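(* For every $\gamma\in(0,1]$, the phase transition locus $\mathcal{PT}(\gamma)$ coincides with the set of potentials $\varphi\in C^{\gamma}(\mathbb{R})$ at which the pressure function $P\colon C^{\gamma}(\mathbb{R})\to\mathbb{R}$ fails to be real-analytic.
   Context: Fix $\alpha\in(0,+\infty)$ and let $f\colon[0,1]\to[0,1]$ be the intermittent map given by $f(x)=x(1+x^{\alpha})$ if $x(1+x^{\alpha})\le 1$, and $f(x)=x(1+x^{\alpha})-1$ otherwise. Let $\mathscr{M}$ be the set of Borel probability measures on $[0,1]$ invariant by $f$; for $\nu\in\mathscr{M}$ let $h_\nu$ be its measure-theoretic entropy. For $\gamma\in(0,1]$, $C^{\gamma}(\mathbb{R})$ (resp. $C^{\gamma}(\mathbb{C})$) is the Banach space of real-valued (resp. complex-valued) $\gamma$-Hölder continuous functions on $[0,1]$ with norm $\|\varphi\|_\gamma=\|\varphi\|+|\varphi|_\gamma$, where $\|\varphi\|=\sup_{[0,1]}|\varphi|$ and $|\varphi|_\gamma=\sup_{x\ne y}|\varphi(x)-\varphi(y)|/|x-y|^\gamma$. For a continuous $\varphi\colon[0,1]\to\mathbb{R}$ (a potential), the pressure is $P(\varphi)=\sup\{h_\nu+\int\varphi\,d\nu:\nu\in\mathscr{M}\}$, and a Gibbs state of $f$ for $\varphi$ is a measure in $\mathscr{M}$ attaining this supremum. $\delta_0$ is the Dirac mass at $0$. A measure $\nu\in\mathscr{M}$ is exponentially mixing if there are $C\in(0,+\infty)$ and $\rho\in(0,1)$ such that for every bounded measurable $\psi\colon[0,1]\to\mathbb{R}$,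 every Lipschitz $\tilde\psi\colon[0,1]\to\mathbb{R}$ and every $n\in\mathbb{N}$, $|\int\psi\circ f^n\cdot\tilde\psi\,d\nu-\int\psi\,d\nu\int\tilde\psi\,d\nu|\le C\|\psi\|\,|\tilde\psi|_1\,\rho^n$. The intermittent phase $\mathcal{I}(\gamma)$ is the set of $\varphi\in C^\gamma(\mathbb{R})$ for which there is an exponentially mixing Gibbs state of strictly positive entropy. The stationary phase $\mathcal{S}(\gamma)$ is the interior in $C^\gamma(\mathbb{R})$ of the set of $\varphi$ for which $\delta_0$ is the unique Gibbs state. The phase transition locus $\mathcal{PT}(\gamma)$ is the common boundary $\partial\mathcal{I}(\gamma)=\partial\mathcal{S}(\gamma)$ in $C^\gamma(\mathbb{R})$ (these two boundaries coincide; when $\alpha<1$ and $\gamma>\alpha$ one has $\mathcal{I}(\gamma)=C^\gamma(\mathbb{R})$, $\mathcal{S}(\gamma)=\emptyset$, and both boundaries are empty). Real-analyticity: for an open $\Delta\subseteq\mathbb{C}$, $H\colon\Delta\to C^\gamma(\mathbb{C})$ is holomorphic if it is complex-differentiable in $\|\cdot\|_\gamma$ at every point. For an open $\mathcal{U}\subseteq C^\gamma(\mathbb{C})$, $h\colon\mathcal{U}\to\mathbb{C}$ is holomorphic if $h\circ H$ is holomorphic for every open $\Delta\subseteq\mathbb{C}$ and every holomorphic $H\colon\Delta\to\mathcal{U}$. A real-valued function on an open subset of $C^\gamma(\mathbb{R})$ is real-analytic if it extends to a complex-valued holomorphic function on an open subset of $C^\gamma(\mathbb{C})$. $P$ fails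 to be real-analytic at $\varphi$ if there is no open neighborhood of $\varphi$ in $C^\gamma(\mathbb{R})$ on which $P$ is real-analytic. *)

(* Defs.v *)
From HB Require Import structures.
From mathcomp Require Import all_boot all_order all_algebra.
From mathcomp Require Import complex.
From mathcomp Require Import all_classical all_reals all_analysis.

Set Implicit Arguments.
Unset Strict Implicit.
Unset Printing Implicit Defensive.

Import Order.TTheory GRing.Theory Num.Theory.
Import numFieldNormedType.Exports.

Local Open Scope classical_set_scope.
Local Open Scope ring_scope.

Definition I01 (R : realType) : Type := `[0 : R, 1 : R]%classic.

Section I01_structure.
Variable R : realType.

HB.instance Definition _ := Choice.on (I01 R).

Lemma I01_itvP (x : I01 R) : 0 <= \val x <= 1.
Proof. by have := valP x; rewrite inE /= in_itv. Qed.

Lemma I01_mem (x : R) : 0 <= x <= 1 -> x \in `[0 : R, 1 : R]%classic.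
Proof. by move=> h; rewrite inE /= in_itv. Qed.

Definition I01_0 : I01 R := exist _ 0 (I01_mem (introT andP (conj (lexx 0) ler01))).
Definition I01_1 : I01 R := exist _ 1 (I01_mem (introT andP (conj ler01 (lexx 1)))).

HB.instance Definition _ := isPointed.Build (I01 R) I01_0.

(* The Borel sigma-algebra of [0, 1]: the traces of the Borel sets of R. *)
Definition I01_val (x : I01 R) : measurableTypeR R := \val x.

HB.instance Definition _ :=
  Measurable.copy (I01 R) (g_sigma_algebra_preimageType I01_val).

End I01_structure.

(* A real-valued absolute value on K; it lets the Hoelder spaces of real- and
   complex-valued functions share one construction although the norm of
   [R[i]] takes its values in [R[i]]. *)
Record modulus (R : realType) (K : numFieldType) := Modulus {
  modulus_emb : {rmorphism R -> K};
  modulus_abs :> K -> R;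
  modulus_absE : forall z, modulus_emb (modulus_abs z) = `|z|;
  modulus_emb_le : {mono modulus_emb : x y / x <= y}
}.

Section modulus_theory.
Variables (R : realType) (K : numFieldType) (m : modulus R K).
Implicit Types z w : K.

Lemma modulus_ge0 z : 0 <= m z.
Proof. by rewrite -(modulus_emb_le m) rmorph0 modulus_absE. Qed.

Lemma modulusD z w : m (z + w) <= m z + m w.
Proof. by rewrite -(modulus_emb_le m) rmorphD !modulus_absE ler_normD. Qed.

Lemma modulusM z w : m (z * w) = m z * m w.
Proof.
apply: (fmorph_inj (modulus_emb m)).
by rewrite rmorphM !modulus_absE normrM.
Qed.

Lemma modulus0 : m 0 = 0.
Proof.
by apply: (fmorph_inj (modulus_emb m)); rewrite modulus_absE rmorph0 normr0.
Qed.

Lemma modulus_eq0 z : m z = 0 -> z = 0.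
Proof.
move=> z0; apply/normr0_eq0; rewrite -(modulus_absE m) z0; exact: rmorph0.
Qed.

End modulus_theory.

Definition real_modulus (R : realType) : modulus R R :=
  @Modulus R R idfun Num.norm (fun=> erefl) (fun _ _ => erefl).

Section complex_modulus.
Variable R : realType.

Lemma complex_absE (z : R[i]) : real_complex R (complex.Re `|z|) = `|z|.
Proof. by rewrite normc_def. Qed.

Lemma real_complex_le : {mono real_complex R : x y / x <= y}.
Proof. by move=> x y; rewrite lecR. Qed.

Definition complex_modulus : modulus R R[i] :=
  @Modulus R R[i] (real_complex R) (fun z => complex.Re `|z|)
    complex_absE real_complex_le.

End complex_modulus.

Section holder_norm.
Variables (R : realType) (K : numFieldType) (m : modulus R K).

Definition sup_norm (phi : I01 R -> K) : R := sup [set m (phi x) | x in setT].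

Definition holder_seminorm (gamma : R) (phi : I01 R -> K) : R :=
  sup [set m (phi p.1 - phi p.2) / `|\val p.1 - \val p.2| `^ gamma
      | p in [set p : I01 R * I01 R | p.1 != p.2]].

Definition holder_norm (gamma : R) (phi : I01 R -> K) : R :=
  sup_norm phi + holder_seminorm gamma phi.

(* For gamma > 0 the first bound follows from the second one; it is there so
   that [holder_norm] is a norm whatever the real number gamma. *)
Definition holder_pred (gamma : R) : {pred I01 R -> K^o} :=
  [pred phi | `[< exists M : R, (forall x, m (phi x) <= M) /\
     forall x y, m (phi x - phi y) <= M * `|\val x - \val y| `^ gamma >]].

End holder_norm.

Record holder (R : realType) (K : numFieldType) (m : modulus R K) (gamma : R) :=
  Holder {
    holder_fun :> I01 R -> K^o;
    holder_funP : holder_fun \in holder_pred m gamma }.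

Section holder_space.
Variables (R : realType) (K : numFieldType) (m : modulus R K) (gamma : R).

Lemma holder_pred_submod : submod_closed (holder_pred m gamma).
Proof.
split=> [|a u v].
  apply/asboolP; exists 0; split=> [x|x y].
    by rewrite [_ x](_ : _ = 0) // modulus0.
  by rewrite mul0r [_ - _](_ : _ = 0) ?modulus0 //= subrr.
move=> /asboolP[M [uM uH]] /asboolP[N [vN vH]]; apply/asboolP.
exists (m a * M + N); split=> [x|x y].
  apply: (le_trans (modulusD _ _ _)); rewrite modulusM lerD //.
  by rewrite ler_wpM2l ?modulus_ge0.
have -> : (a *: u + v) x - (a *: u + v) y = a * (u x - u y) + (v x - v y).
  by rewrite mulrBr opprD addrACA.
apply: (le_trans (modulusD _ _ _)); rewrite modulusM mulrDl lerD //.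
by rewrite -mulrA ler_wpM2l ?modulus_ge0.
Qed.

HB.instance Definition _ :=
  GRing.isSubmodClosed.Build K (I01 R -> K^o) (holder_pred m gamma)
    holder_pred_submod.

HB.instance Definition _ := [isSub for @holder_fun R K m gamma].
HB.instance Definition _ := [Choice of holder m gamma by <:].
HB.instance Definition _ := [SubChoice_isSubLmodule of holder m gamma by <:].

Implicit Types phi psi : holder m gamma.

Lemma sup_image_le (T : Type) (D : set T) (u : T -> R) (c : R) :
  D !=set0 -> (forall t, D t -> u t <= c) -> sup (u @` D) <= c.
Proof.
move=> [t0 Dt0] uc; apply: ge_sup; first by exists (u t0), t0.
by move=> _ [t Dt <-]; exact: uc.
Qed.

Lemma le_sup_image (T : Type) (D : set T) (u : T -> R) (c : R) t :
  (forall t, D t -> u t <= c) -> D t -> u t <= sup (u @` D).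
Proof.
move=> uc Dt; apply: ub_le_sup; last by exists t.
by exists c => _ [s Ds <-]; exact: uc.
Qed.

Lemma I01_neq : [set p : I01 R * I01 R | p.1 != p.2] !=set0.
Proof.
exists (I01_0 R, I01_1 R) => /=; apply/eqP => /(congr1 val) /= /eqP.
by rewrite eq_sym oner_eq0.
Qed.

Lemma holder_ub phi : exists M : R, (forall x, m (phi x) <= M) /\
  forall p : I01 R * I01 R, p.1 != p.2 ->
    m (phi p.1 - phi p.2) / `|\val p.1 - \val p.2| `^ gamma <= M.
Proof.
have /asboolP[M [uM uH]] := holder_funP phi; exists M; split=> // p p12.
rewrite ler_pdivrMr ?uH // powR_gt0 // normr_gt0 subr_eq0.
by apply: contra p12 => /eqP/val_inj ->.
Qed.

Lemma sup_norm_ub phi x : m (phi x) <= sup_norm m phi.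
Proof.
have [M [uM _]] := holder_ub phi.
by apply: (@le_sup_image _ setT (fun x => m (phi x)) M).
Qed.

Lemma holder_seminorm_ub phi (p : I01 R * I01 R) : p.1 != p.2 ->
  m (phi p.1 - phi p.2) / `|\val p.1 - \val p.2| `^ gamma
    <= holder_seminorm m gamma phi.
Proof.
have [M [_ uM]] := holder_ub phi => p12.
by apply: (@le_sup_image _ [set p : I01 R * I01 R | p.1 != p.2]
  (fun p => m (phi p.1 - phi p.2) / `|\val p.1 - \val p.2| `^ gamma) M).
Qed.

Lemma sup_norm_ge0 phi : 0 <= sup_norm m phi.
Proof. exact: le_trans (modulus_ge0 _ _) (sup_norm_ub phi (I01_0 R)). Qed.

Lemma holder_seminorm_ge0 phi : 0 <= holder_seminorm m gamma phi.
Proof.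
have [p p12] := I01_neq; apply: le_trans (holder_seminorm_ub phi p12).
by rewrite divr_ge0 ?modulus_ge0 ?powR_ge0.
Qed.

Lemma holder_normD phi psi :
  holder_norm m gamma (phi + psi) <=
  holder_norm m gamma phi + holder_norm m gamma psi.
Proof.
rewrite /holder_norm addrACA lerD //.
  apply: sup_image_le; first by exists (I01_0 R).
  move=> x _; apply: (le_trans (modulusD _ _ _)).
  by rewrite lerD ?sup_norm_ub.
apply: sup_image_le; first exact: I01_neq.
move=> p p12.
have -> : (phi + psi) p.1 - (phi + psi) p.2
    = (phi p.1 - phi p.2) + (psi p.1 - psi p.2) by rewrite opprD addrACA.
apply: le_trans (lerD (holder_seminorm_ub phi p12) (holder_seminorm_ub psi p12)).
by rewrite -mulrDl ler_wpM2r ?modulusD // invr_ge0 powR_ge0.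
Qed.

Lemma holder_normZ_le (a : K) phi :
  holder_norm m gamma (a *: phi) <= m a * holder_norm m gamma phi.
Proof.
rewrite /holder_norm mulrDr lerD //.
  apply: sup_image_le; first by exists (I01_0 R).
  move=> x _; have -> : (a *: phi) x = a * phi x by [].
  by rewrite modulusM ler_wpM2l ?modulus_ge0 ?sup_norm_ub.
apply: sup_image_le; first exact: I01_neq.
move=> p p12.
have -> : (a *: phi) p.1 - (a *: phi) p.2 = a * (phi p.1 - phi p.2).
  by rewrite mulrBr.
by rewrite modulusM -mulrA ler_wpM2l ?modulus_ge0 ?holder_seminorm_ub.
Qed.

Lemma holder_norm0_eq0 phi : holder_norm m gamma phi = 0 -> phi = 0.
Proof.
move=> /eqP; rewrite paddr_eq0 ?sup_norm_ge0 ?holder_seminorm_ge0 //.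
move=> /andP[/eqP phi0 _]; apply/val_inj/funext => x /=.
apply: (@modulus_eq0 _ _ m); apply/eqP.
by rewrite eq_le modulus_ge0 andbT -phi0 sup_norm_ub.
Qed.

Lemma holder_normZ (a : K) phi :
  holder_norm m gamma (a *: phi) = m a * holder_norm m gamma phi.
Proof.
have [->|a0] := eqVneq a 0.
  apply/eqP; rewrite eq_le holder_normZ_le andTb modulus0 mul0r.
  exact: addr_ge0 (sup_norm_ge0 _) (holder_seminorm_ge0 _).
apply/eqP; rewrite eq_le holder_normZ_le andTb.
have ma0 : 0 < m a.
  by rewrite lt_def modulus_ge0 andbT; apply: contra a0 => /eqP/modulus_eq0 ->.
have mV : m a^-1 = (m a)^-1.
  apply: (mulIf (lt0r_neq0 ma0)); rewrite -modulusM !mulVf //; last exact: lt0r_neq0.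
  by apply: (fmorph_inj (modulus_emb m)); rewrite modulus_absE normr1 rmorph1.
rewrite -ler_pdivlMl // -mV; have := holder_normZ_le a^-1 (a *: phi).
by rewrite scalerA mulVf // scale1r.
Qed.

Definition holder_normK phi : K := modulus_emb m (holder_norm m gamma phi).

Lemma holder_normKD phi psi :
  holder_normK (phi + psi) <= holder_normK phi + holder_normK psi.
Proof. by rewrite -rmorphD modulus_emb_le holder_normD. Qed.

Lemma holder_normKZ (a : K) phi :
  holder_normK (a *: phi) = `|a| * holder_normK phi.
Proof. by rewrite /holder_normK holder_normZ rmorphM modulus_absE. Qed.

Lemma holder_normK0_eq0 phi : holder_normK phi = 0 -> phi = 0.
Proof.
move=> h; apply: holder_norm0_eq0; apply: (fmorph_inj (modulus_emb m)).
by rewrite rmorph0.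
Qed.

HB.instance Definition _ := Lmodule_isNormed.Build K (holder m gamma)
  holder_normKD holder_normKZ holder_normK0_eq0.

End holder_space.

Notation holderR gamma := (holder (real_modulus _) gamma).
Notation holderC gamma := (holder (complex_modulus _) gamma).

Section complexification.
Variables (R : realType) (gamma : R).

Lemma complexify_subproof (phi : holderR gamma) :
  (fun x => (phi x)%:C%C : R[i]^o) \in holder_pred (complex_modulus R) gamma.
Proof.
have /asboolP[M [uM uH]] := holder_funP phi; apply/asboolP.
have absC (x : R) : complex_modulus R x%:C%C = `|x|.
  rewrite -[LHS]/(complex.Re `|x%:C%C|) normc_def /=.
  by rewrite expr0n addr0 sqrtr_sqr.
exists M; split=> [x|x y]; first by rewrite absC; exact: uM.
by rewrite -rmorphB absC; exact: uH.
Qed.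

Definition complexify (phi : holderR gamma) : holderC gamma :=
  Holder (complexify_subproof phi).

End complexification.

Section analyticity.
Variable R : realType.

Definition holomorphic_on (V : normedModType R[i]) (Delta : set R[i]^o)
  (H : R[i]^o -> V) : Prop := forall z, Delta z -> derivable H z 1.

Definition holder_holomorphic_on (gamma : R) (U : set (holderC gamma))
    (h : holderC gamma -> R[i]^o) : Prop :=
  forall (Delta : set R[i]^o) (H : R[i]^o -> holderC gamma),
    open Delta -> (forall z, Delta z -> U (H z)) ->
    holomorphic_on Delta H -> holomorphic_on Delta (h \o H).

Definition real_analytic_on (gamma : R) (U : set (holderR gamma))
    (g : holderR gamma -> R) : Prop :=
  exists (W : set (holderC gamma)) (h : holderC gamma -> R[i]^o),
    [/\ open W, holder_holomorphic_on W h &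
        forall phi, U phi ->
          W (complexify phi) /\ h (complexify phi) = (g phi)%:C%C].

Definition real_analytic_at (gamma : R) (g : holderR gamma -> R)
    (phi : holderR gamma) : Prop :=
  exists U : set (holderR gamma), [/\ open U, U phi & real_analytic_on U g].

End analyticity.

Definition boundary (T : topologicalType) (A : set T) : set T :=
  closure A `\` A^°.

Section entropy.
Context d (T : measurableType d) (R : realType).
Variables (f : T -> T) (nu : probability T R).

Definition invariant_measure : Prop :=
  forall A, measurable A -> nu (f @^-1` A) = nu A.

(* A finite partition is encoded by the map sending a point to the index of its
   cell. *)
Definition measurable_partition (I : finType) (xi : T -> I) : Prop :=
  forall i, measurable (xi @^-1` [set i]).

Definition partition_entropy (I : finType) (xi : T -> I) : R :=
  - \sum_(i : I) (let p := fine (nu (xi @^-1` [set i])) in p * ln p).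

(* The cells of the join of xi, f^-1 xi, ..., f^-(n-1) xi are the level sets of
   the n-step itinerary. *)
Definition itinerary (I : finType) (xi : T -> I) (n : nat) (x : T) :
    {ffun 'I_n -> I} := [ffun i : 'I_n => xi (iter i f x)].

Definition entropy_rate (I : finType) (xi : T -> I) : R :=
  limn (fun n => partition_entropy (itinerary xi n) / n%:R).

Definition measure_entropy : \bar R :=
  ereal_sup [set h | exists (k : nat) (xi : T -> 'I_k),
    measurable_partition xi /\ h = (entropy_rate xi)%:E].

End entropy.

Section intermittent_map.
Variables (R : realType) (alpha : R).

Definition intermittent_formula (x : R) : R :=
  let y := x * (1 + x `^ alpha) in if y <= 1 then y else y - 1.

(* [insubd] only supplies a default value where the formula leaves [0, 1], which
   does not happen when alpha > 0. *)
Definition intermittent (x : I01 R) : I01 R :=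
  insubd x (intermittent_formula (\val x)).

Lemma intermittentE (x : I01 R) : 0 < alpha ->
  \val (intermittent x) = intermittent_formula (\val x).
Proof.
move=> a0; rewrite /intermittent /insubd insubT //; apply: I01_mem.
have /andP[x0 x1] := I01_itvP x; rewrite /intermittent_formula.
have xa1 : (\val x) `^ alpha <= 1.
  have := ge0_ler_powR (ltW a0) x0 ler01 x1; by rewrite powR1.
have y0 : 0 <= \val x * (1 + (\val x) `^ alpha).
  by rewrite mulr_ge0 // addr_ge0 // powR_ge0.
case: ifPn => [->|]; first by rewrite y0.
rewrite -ltNge => y1; rewrite subr_ge0 ltW //= lerBlDr.
by rewrite -[leRHS]mul1r ler_pM ?addr_ge0 ?powR_ge0 // lerD2l.
Qed.

End intermittent_map.

Section thermodynamics.
Variables (R : realType) (alpha : R).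

Local Notation f := (@intermittent R alpha).
Implicit Types (phi : I01 R -> R) (nu : probability (I01 R) R).

Definition free_energy phi nu : \bar R :=
  (measure_entropy f nu + \int[nu]_x (phi x)%:E)%E.

Definition pressure phi : \bar R :=
  ereal_sup [set free_energy phi nu | nu in [set nu | invariant_measure f nu]].

Definition gibbs_state phi nu : Prop :=
  invariant_measure f nu /\ free_energy phi nu = pressure phi.

(* The Lipschitz test functions are the 1-Hoelder functions. *)
Definition exponentially_mixing nu : Prop :=
  exists C rho : R, [/\ 0 < C, 0 < rho < 1 &
    forall (psi : I01 R -> R) (psi' : holderR (1 : R)) (n : nat),
      measurable_fun setT psi -> bounded_fun psi ->
      `| \int[nu]_x (psi (iter n f x) * psi' x)
         - (\int[nu]_x psi x) * (\int[nu]_x psi' x) |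
      <= C * sup_norm (real_modulus R) psi
           * holder_seminorm (real_modulus R) 1 psi' * rho ^+ n].

Definition intermittent_phase (gamma : R) : set (holderR gamma) :=
  [set phi | exists nu : probability (I01 R) R,
    [/\ gibbs_state phi nu, exponentially_mixing nu &
        (0 < measure_entropy f nu)%E]].

(* Two measures are identified when they agree on the measurable sets. *)
Definition unique_gibbs_state_delta0 phi : Prop :=
  gibbs_state phi (\d_(I01_0 R)) /\
  forall nu, gibbs_state phi nu ->
    forall A, measurable A -> nu A = \d_(I01_0 R) A.

Definition stationary_phase (gamma : R) : set (holderR gamma) :=
  [set phi : holderR gamma | unique_gibbs_state_delta0 phi]^°.

(* The boundaries of the two phases are the same set, so this is also
   [boundary (stationary_phase gamma)]. *)
Definition phase_transition_locus (gamma : R) : set (holderR gamma) :=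
  boundary (@intermittent_phase gamma).

(* The pressure is finite: the entropies are at most ln 2, and the Dirac mass
   at the fixed point 0 is invariant. *)
Definition real_pressure (gamma : R) (phi : holderR gamma) : R :=
  fine (pressure phi).

End thermodynamics.

Arguments intermittent_phase {R} alpha gamma.
Arguments stationary_phase {R} alpha gamma.
Arguments phase_transition_locus {R} alpha gamma.
Arguments real_pressure {R} alpha gamma phi.

(* Main.v *)
(* Let A be the set of potentials phi with P phi > phi 0. On A the transfer
   operator L of phi has spectral radius rho > exp (phi 0); near the neutral fixed
   point its weights are smaller than rho, and away from it the inverse branches
   contract, so L satisfies a Lasota-Yorke inequality although f is only
   intermittent. Hence L has a positive Hoelder eigenfunction h, the normalised
   operator u |-> L (h u) / (rho h) contracts Hoelder seminorms, and its stationary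
   measure is an exponentially mixing Gibbs state of positive entropy, with
   P phi = ln rho. Moreover rho is analytic in phi, as the limit of the multipliers
   of the iterates of complex perturbations of the normalised operator. Thus A is
   contained in the intermittent phase and P is analytic on A.

   Off A one has P phi = phi 0. By monotonicity of P, if phi is off A then so is
   every potential at distance less than e from phi - e x^gamma. So the complement
   of A is the closure of its interior; this interior is the stationary phase,
   which does not meet the intermittent phase, and both boundaries equal the set of
   the potentials off A that are not interior points of the complement of A.

   P is analytic on the interior, where it is the evaluation at 0. At a boundary
   point it is not: on a segment joining the interior to A, the function
   P phi - phi 0 would be an analytic function of one variable that vanishes on an
   interval without vanishing just after it. *)
Require Import Defs.
From HB Require Import structures.
From mathcomp Require Import all_boot all_order all_algebra.
From mathcomp Require Import complex ring lra.
From mathcomp Require Import all_classical all_reals all_analysis measurable_realfun.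

Set Implicit Arguments.
Unset Strict Implicit.
Unset Printing Implicit Defensive.

Import Order.TTheory GRing.Theory Num.Theory.
Import numFieldNormedType.Exports.

Local Open Scope classical_set_scope.
Local Open Scope ring_scope.
Import Normc.

(** The pressure meets the spectral radius rho through two bounds. For every Hoelder phi one has P
    phi <= ln rho, by the Gibbs inequality against the weights of L; if rho > exp (phi 0), a Gibbs
    state attains ln rho. With P phi >= phi 0 this turns the condition P phi > phi 0 into rho > exp
    (phi 0), the form that the operator estimates use. Near 0 the cylinders shrink only
    polynomially, so the distortion of Birkhoff sums is controlled up to an error e n only, which
    the entropy rates absorb. Contraction comes from a soft argument: the iterates of the normalised
    operator have equibounded Hoelder constants, their oscillation drops by a definite proportion,
    and the Lasota-Yorke inequality turns a small oscillation into a small constant. Holomorphy on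
    the complex Hoelder space is tested along curves of one complex variable. Hence uniform limits
    and the identity principle in one variable suffice, and both rest on Cauchy's formula on
    rectangles. The multipliers are evaluated at the fixed point 0, which makes each of them a ratio
    of finite sums of products of perturbed weights. *)

Lemma exists_min4 (R : realType) (a b c d : R) : 0 < a -> 0 < b -> 0 < c -> 0 < d ->
  exists t, [/\ 0 < t, t <= a, t <= b, t <= c & t <= d].
Proof.
move=> a0 b0 c0 d0; exists (Num.min (Num.min a b) (Num.min c d)).
by rewrite !lt_min a0 b0 c0 d0 !ge_min !lexx !orbT.
Qed.

(** * Complex differentiability, Cauchy's formula and the identity principle *)

Section normc_facts.
Variable R : realType.
Implicit Types (z w : R[i]) (a b : R).

Lemma normc_ge0 z : 0 <= normc z.
Proof. by case: z => a b /=; exact: sqrtr_ge0. Qed.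

Lemma normcB z w : normc (z - w) = normc (w - z).
Proof. by rewrite -normcN opprB. Qed.

Lemma le_normcB z w : normc (z - w) <= normc z + normc w.
Proof. by rewrite (le_trans (le_normcD _ _))// normcN. Qed.

Lemma normc_sub_le z w : normc z - normc w <= normc (z - w).
Proof. by rewrite lerBlDr (le_trans _ (le_normcD _ _))// subrK. Qed.

Lemma normcX z n : normc (z ^+ n) = normc z ^+ n.
Proof.
elim: n => [|n IH]; first by rewrite !expr0 normc1.
by rewrite !exprS normcM IH.
Qed.

Lemma normc_real a : normc a%:C%C = `|a|.
Proof. by rewrite /= expr0n addr0 sqrtr_sqr. Qed.

Lemma normc_imag a : normc (Complex 0 a) = `|a|.
Proof. by rewrite /= expr0n add0r sqrtr_sqr. Qed.

Lemma normc_i : normc (Complex 0 1 : R[i]) = 1.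
Proof. by rewrite /= expr0n expr1n add0r sqrtr1. Qed.

Lemma normc_eq0 z : (normc z == 0) = (z == 0).
Proof. by apply/eqP/eqP => [/eq0_normc//|->]; rewrite normc0. Qed.

Lemma normc_gt0 z : (0 < normc z) = (z != 0).
Proof. by rewrite lt_neqAle normc_ge0 andbT eq_sym normc_eq0. Qed.

Lemma Re_le_normc z : `|complex.Re z| <= normc z.
Proof.
case: z => a b /=; rewrite -sqrtr_sqr ler_sqrt ?addr_ge0 ?sqr_ge0//.
by rewrite lerDl sqr_ge0.
Qed.

Lemma Im_le_normc z : `|complex.Im z| <= normc z.
Proof.
case: z => a b /=; rewrite -sqrtr_sqr ler_sqrt ?addr_ge0 ?sqr_ge0//.
by rewrite lerDr sqr_ge0.
Qed.

Lemma normc_le_ReIm z : normc z <= `|complex.Re z| + `|complex.Im z|.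
Proof.
case: z => a b /=.
rewrite -[leRHS]ger0_norm ?addr_ge0// -sqrtr_sqr ler_sqrt ?sqr_ge0//.
by rewrite sqrrD !real_normK ?num_real// lerD2r lerDl mulrn_wge0// mulr_ge0.
Qed.

Lemma complex_modulusE z : complex_modulus R z = normc z.
Proof. by rewrite -[LHS]/(complex.Re `|z|) normc_def; case: z. Qed.

End normc_facts.

Arguments Normc.normc {R} x : simpl never.

(** * Integrals of complex-valued functions over a segment *)

Section complex_integral.
Variable R : realType.
Local Notation C := R[i].
Local Notation leb := (@lebesgue_measure R).
Implicit Types (f g : R -> C) (a b c : R).

(** Continuity relative to the segment, in the real-valued norm [normc], so that real and imaginary
    parts can be integrated separately. *)
Definition segcont f a b := forall t, a <= t <= b -> forall e, 0 < e ->
  exists2 d, 0 < d & forall s, a <= s <= b -> `|s - t| < d -> normc (f s - f t) <= e.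

Definition cint f a b : C :=
  Complex (\int[leb]_(t in `[a, b]) complex.Re (f t))
          (\int[leb]_(t in `[a, b]) complex.Im (f t)).

Lemma segcont_within f a b (u : C -> R) :
  (forall z w, `|u z - u w| <= normc (z - w)) -> segcont f a b ->
  leb.-integrable `[a, b] (EFin \o (fun t => u (f t))).
Proof.
move=> ul fc; apply: continuous_compact_integrable; first exact: segment_compact.
apply/subspace_continuousP => t /=; rewrite in_itv/= => tab.
apply/cvgrPdist_le => e e0; have [d d0 fd] := fc t tab e e0.
rewrite near_withinE; exists d => //= s /=; rewrite distrC => sd.
rewrite in_itv/= => sab.
by rewrite (le_trans (ul _ _))// normcB; apply: fd.
Qed.

Lemma segcont_Re f a b : segcont f a b ->
  leb.-integrable `[a, b] (EFin \o (fun t => complex.Re (f t))).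
Proof.
apply: segcont_within => z w.
by rewrite (le_trans _ (Re_le_normc _))//; case: z w => [? ?] [? ?].
Qed.

Lemma segcont_Im f a b : segcont f a b ->
  leb.-integrable `[a, b] (EFin \o (fun t => complex.Im (f t))).
Proof.
apply: segcont_within => z w.
by rewrite (le_trans _ (Im_le_normc _))//; case: z w => [? ?] [? ?].
Qed.

Lemma segcontD f g a b : segcont f a b -> segcont g a b ->
  segcont (fun t => f t + g t) a b.
Proof.
move=> fc gc t tab e e0; have e20 : 0 < e / 2 by rewrite divr_gt0.
have [d d0 fd] := fc t tab _ e20; have [r r0 gr] := gc t tab _ e20.
exists (Num.min d r) => [|s sab]; first by rewrite lt_min d0.
rewrite lt_min => /andP[sd sr]; rewrite opprD addrACA.
by rewrite (le_trans (le_normcD _ _))// (splitr e) lerD ?fd ?gr.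
Qed.

Lemma segcontM f g a b : segcont f a b -> segcont g a b ->
  segcont (fun t => f t * g t) a b.
Proof.
move=> fc gc t tab e e0.
pose K := normc (f t) + normc (g t) + 1.
have K0 : 0 < K by rewrite ltr_wpDl// addr_ge0 ?normc_ge0.
pose e' := Num.min 1 (e / K / 2).
have e'0 : 0 < e' by rewrite lt_min ltr01 !divr_gt0.
have [d d0 fd] := fc t tab _ e'0; have [r r0 gr] := gc t tab _ e'0.
exists (Num.min d r) => [|s sab]; first by rewrite lt_min d0.
rewrite lt_min => /andP[sd sr].
have -> : f s * g s - f t * g t = (f s - f t) * (g s - g t) +
   (f s - f t) * g t + f t * (g s - g t) by ring.
have := fd s sab sd; have := gr s sab sr.
move: (f s - f t) (g s - g t) => u v ve ue.
rewrite (le_trans (le_normcD _ _))// (le_trans (lerD (le_normcD _ _) (lexx _)))//.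
rewrite !normcM.
have h1 : e' <= 1 by rewrite ge_min lexx.
have h2 : e' <= e / K / 2 by rewrite ge_min lexx orbT.
have h3 : e' * K <= e.
  rewrite (le_trans (ler_wpM2r (ltW K0) h2))// mulrAC divfK ?gt_eqF//.
  by rewrite ler_pdivrMr// ler_peMr ?ler1n// ltW.
rewrite (le_trans _ h3)//.
have := normc_ge0 u; have := normc_ge0 v; have := normc_ge0 (f t).
have := normc_ge0 (g t).
rewrite /K; move: (normc u) (normc v) (normc (f t)) (normc (g t)) ue ve => x y p q.
nra.
Qed.

Lemma segcont_cst (k : C) a b : segcont (fun=> k) a b.
Proof. by move=> t _ e e0; exists 1 => // s _ _; rewrite subrr normc0 ltW. Qed.

Lemma cintD f g a b : segcont f a b -> segcont g a b ->
  cint (fun t => f t + g t) a b = cint f a b + cint g a b.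
Proof.
move=> fc gc; rewrite /cint -[RHS]/(Complex _ _); congr Complex.
  rewrite -RintegralD ?segcont_Re//; apply: eq_Rintegral => t _.
  by case: (f t) (g t) => [? ?] [? ?].
rewrite -RintegralD ?segcont_Im//; apply: eq_Rintegral => t _.
by case: (f t) (g t) => [? ?] [? ?].
Qed.

Lemma cintZ f (c : C) a b : segcont f a b ->
  cint (fun t => c * f t) a b = c * cint f a b.
Proof.
move=> fc; case: c => p q; rewrite /cint -[RHS]/(Complex _ _).
have iRe := segcont_Re fc; have iIm := segcont_Im fc.
have iZ (r : R) h : leb.-integrable `[a, b] (EFin \o h) ->
  leb.-integrable `[a, b] (EFin \o (fun t => r * h t)).
  by move=> hi; apply: (@integrableZl _ _ _ leb _ _ r (EFin \o h)) => //; exact: measurable_itv.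
congr Complex.
  rewrite -!RintegralZl// -RintegralB ?iZ//; apply: eq_Rintegral => t _.
  by case: (f t) => [? ?].
rewrite -!RintegralZl// -RintegralD ?iZ//; apply: eq_Rintegral => t _.
by case: (f t) => [? ?] /=; rewrite addrC.
Qed.

Lemma eq_cint f g a b : (forall t, a <= t <= b -> f t = g t) ->
  cint f a b = cint g a b.
Proof.
move=> fg; congr Complex; apply: eq_Rintegral => t; rewrite inE/= in_itv/= => tab;
by rewrite fg.
Qed.

Lemma segcont_eq f g a b : (forall t, a <= t <= b -> f t = g t) ->
  segcont f a b -> segcont g a b.
Proof.
move=> fg fc t tab e e0; have [d d0 fd] := fc t tab e e0.
by exists d => // s sab sd; rewrite -!fg// fd.
Qed.

Lemma cintB f g a b : segcont f a b -> segcont g a b ->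
  cint (fun t => f t - g t) a b = cint f a b - cint g a b.
Proof.
move=> fc gc.
have gN : segcont (fun t => -1 * g t) a b by apply: segcontM => //; exact: segcont_cst.
rewrite -[- cint g a b]mulN1r -cintZ// -cintD//.
by apply: eq_cint => t _; rewrite mulN1r.
Qed.

Lemma cint_cst (c : C) a b : a <= b -> cint (fun=> c) a b = (b - a)%:C%C * c.
Proof.
move=> ab; rewrite /cint !Rintegral_cst//= lebesgue_measure_itv/= lte_fin.
case: c => p q; rewrite -[RHS]/(Complex ((b - a) * p - 0 * q) ((b - a) * q + 0 * p)).
case: ifPn => [_|]; first by rewrite /= !mul0r subr0 addr0 ![_ * (b - a)]mulrC.
rewrite -leNgt => ba; have -> : a = b by apply/eqP; rewrite eq_le ab.
by rewrite subrr /= !mul0r subrr addr0 !mulr0.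
Qed.

Lemma cint_split f a b c : a <= b -> b <= c -> segcont f a c ->
  cint f a c = cint f a b + cint f b c.
Proof.
move=> ab bc fc; rewrite /cint -[RHS]/(Complex _ _).
have h u : leb.-integrable `[a, c] (EFin \o u) ->
  \int[leb]_(t in `[a, c]) u t = \int[leb]_(t in `[a, b]) u t +
    \int[leb]_(t in `[b, c]) u t.
  move=> ui; have := @Rintegral_itvB _ u (BLeft a) (BRight c) b ui.
  rewrite !bnd_simp => /(_ ab bc) e.
  rewrite -(@Rintegral_itv_obnd_cbnd _ b (BRight c)); first by rewrite -e; ring.
  apply: integrableS ui => //= t/=; rewrite !in_itv/= => /andP[bt ->].
  by rewrite (le_trans ab (ltW bt)).
by congr Complex; rewrite h//; [exact: segcont_Re|exact: segcont_Im].
Qed.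

(** The factor 2 is the price of estimating the real and imaginary parts separately; it is the
    source of the constants 4 and 32 in the contour estimates. *)
Lemma cint_le f M a b : a <= b -> segcont f a b ->
  (forall t, a <= t <= b -> normc (f t) <= M) ->
  normc (cint f a b) <= 2 * M * (b - a).
Proof.
move=> ab fc fM.
have h u : leb.-integrable `[a, b] (EFin \o u) ->
   (forall t, a <= t <= b -> `|u t| <= M) ->
   `|\int[leb]_(t in `[a, b]) u t| <= M * (b - a).
  move=> ui uM; rewrite (le_trans (le_normr_Rintegral _ _))//.
  have := cint_cst M%:C%C ab => -[].
  rewrite !mul0r !subr0/= [_ * M]mulrC => <- _; apply: le_Rintegral => //.
  - exact: (integrable_norm ui).
  - by apply/(@segcont_Re (fun=> M%:C%C))/segcont_cst.
rewrite (le_trans (normc_le_ReIm _))//= -mulrA [leRHS]mulr_natl mulr2n lerD//.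
  apply: h => [|t tab]; first exact: segcont_Re.
  by rewrite (le_trans (Re_le_normc _))// fM.
apply: h => [|t tab]; first exact: segcont_Im.
by rewrite (le_trans (Im_le_normc _))// fM.
Qed.

End complex_integral.

(** * Calculus of complex differentiable functions *)

Section complex_differentiability.
Variable R : realType.
Local Notation C := R[i].
Implicit Types (F G : C -> C) (z w : C).

Definition ccont F z := forall e, 0 < e ->
  exists2 d, 0 < d & forall w, normc (w - z) < d -> normc (F w - F z) <= e.

(* Caratheodory's form of complex differentiability. *)
Definition cdiff F z := exists phi : C -> C, ccont phi z /\
  exists2 r, 0 < r & forall w, normc (w - z) < r -> F w = F z + phi w * (w - z).

Lemma ccont_near F G z r : 0 < r -> (forall w, normc (w - z) < r -> F w = G w) ->
  ccont F z -> ccont G z.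
Proof.
move=> r0 FG Fc e e0; have [d d0 Fd] := Fc e e0.
exists (Num.min d r) => [|w]; first by rewrite lt_min d0.
rewrite lt_min => /andP[wd wr]; rewrite -FG// -FG ?Fd//.
by rewrite subrr normc0.
Qed.

Lemma ccont_cst (k : C) z : ccont (fun=> k) z.
Proof. by move=> e e0; exists 1 => // w _; rewrite subrr normc0 ltW. Qed.

Lemma ccont_id z : ccont id z.
Proof. by move=> e e0; exists e => // w /ltW. Qed.

Lemma ccontD F G z : ccont F z -> ccont G z -> ccont (fun w => F w + G w) z.
Proof.
move=> fc gc e e0; have e20 : 0 < e / 2 by rewrite divr_gt0.
have [d d0 fd] := fc _ e20; have [r r0 gr] := gc _ e20.
exists (Num.min d r) => [|s]; first by rewrite lt_min d0.
rewrite lt_min => /andP[sd sr]; rewrite opprD addrACA.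
by rewrite (le_trans (le_normcD _ _))// (splitr e) lerD ?fd ?gr.
Qed.

Lemma ccont_bounded F z : ccont F z ->
  exists2 d, 0 < d & forall w, normc (w - z) < d -> normc (F w) <= normc (F z) + 1.
Proof.
move=> /(_ 1 ltr01)[d d0 Fd]; exists d => // w /Fd h.
by rewrite -lerBlDl (le_trans (normc_sub_le _ _)).
Qed.

Lemma ccontM F G z : ccont F z -> ccont G z -> ccont (fun w => F w * G w) z.
Proof.
move=> fc gc e e0.
pose K := normc (F z) + normc (G z) + 1.
have K0 : 0 < K by rewrite ltr_wpDl// addr_ge0 ?normc_ge0.
have e'0 : 0 < e / K by rewrite divr_gt0.
have [d d0 fd] := fc _ e'0; have [r r0 gr] := gc _ e'0.
have [q q0 fb] := ccont_bounded fc.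
exists (Num.min q (Num.min d r)) => [|s]; first by rewrite !lt_min q0 d0.
rewrite !lt_min => /and3P[sq sd sr].
have -> : F s * G s - F z * G z = F s * (G s - G z) + (F s - F z) * G z by ring.
have := fd s sd; have := gr s sr; have := fb s sq.
move: (F s - F z) (G s - G z) => u v fs ve ue.
rewrite (le_trans (le_normcD _ _))// !normcM.
have -> : e = (normc (F z) + 1) * (e / K) + (e / K) * normc (G z).
  by rewrite /K; field; rewrite -/K gt_eqF.
by rewrite lerD// ler_pM ?normc_ge0.
Qed.

Lemma ccontN F z : ccont F z -> ccont (fun w => - F w) z.
Proof.
move=> Fc e e0; have [d d0 h] := Fc e e0; exists d => // w /h.
by rewrite -opprD normcN.
Qed.

Lemma ccontB F G z : ccont F z -> ccont G z -> ccont (fun w => F w - G w) z.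
Proof. by move=> Fc Gc; apply: ccontD => //; exact: ccontN. Qed.

Lemma ccontV F z : F z != 0 -> ccont F z -> ccont (fun w => (F w)^-1) z.
Proof.
move=> Fz0 Fc e e0; have nz : 0 < normc (F z) by rewrite normc_gt0.
have n20 : 0 < normc (F z) / 2 by rewrite divr_gt0.
have e'0 : 0 < e * normc (F z) ^+ 2 / 2.
  by rewrite !divr_gt0// mulr_gt0// exprn_gt0.
have [d d0 h] := Fc _ n20; have [r r0 k] := Fc _ e'0.
exists (Num.min d r) => [|w]; first by rewrite lt_min d0.
rewrite lt_min => /andP[/h wd /k wr].
have nw : normc (F z) / 2 <= normc (F w).
  have := le_trans (normc_sub_le (F z) (F w)) _; rewrite normcB => /(_ _ wd); lra.
have Fw0 : F w != 0 by rewrite -normc_gt0 (lt_le_trans n20).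
have -> : (F w)^-1 - (F z)^-1 = - (F w - F z) * (F w * F z)^-1.
  by field; rewrite Fw0 Fz0.
rewrite normcM normcN normcV normcM ler_pdivrMr ?mulr_gt0 ?(lt_le_trans n20)//.
rewrite (le_trans wr)//.
have : e * normc (F z) * (normc (F z) / 2) <= e * normc (F z) * normc (F w).
  by rewrite ler_wpM2l// ltW// mulr_gt0.
  lra.
by rewrite ler_pdivrMr// ler_peMr ?ler1n// ltW.
Qed.

Lemma ccont_comp F G z : ccont G z -> ccont F (G z) -> ccont (fun w => F (G w)) z.
Proof.
move=> Gc Fc e e0; have [d d0 h] := Fc e e0.
have d20 : 0 < d / 2 by rewrite divr_gt0.
have [r r0 k] := Gc _ d20; exists r => // w /k wr; apply: h.
by rewrite (le_lt_trans wr)// ltr_pdivrMr// ltr_pMr// ltr1n.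
Qed.

Lemma cdiff_ccont F z : cdiff F z -> ccont F z.
Proof.
move=> [phi [pc [r r0 Fr]]].
apply: (@ccont_near (fun w => F z + phi w * (w - z)) _ _ r) => //.
  by move=> w /Fr.
apply: ccontD; first exact: ccont_cst.
apply: ccontM => //; apply: ccontB; [exact: ccont_id|exact: ccont_cst].
Qed.

Lemma cdiff_near F G z r : 0 < r -> (forall w, normc (w - z) < r -> F w = G w) ->
  cdiff F z -> cdiff G z.
Proof.
move=> r0 FG [phi [pc [q q0 Fq]]]; exists phi; split => //.
exists (Num.min q r) => [|w]; first by rewrite lt_min q0.
rewrite lt_min => /andP[/Fq wd /FG <-]; rewrite wd; congr (_ + _).
by apply: FG; rewrite subrr normc0.
Qed.

Lemma cdiff_cst (k : C) z : cdiff (fun=> k) z.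
Proof.
exists (fun=> 0); split; first exact: ccont_cst.
by exists 1 => // w _; rewrite mul0r addr0.
Qed.

Lemma cdiff_id z : cdiff id z.
Proof.
exists (fun=> 1); split; first exact: ccont_cst.
by exists 1 => // w _; rewrite mul1r addrC subrK.
Qed.

Lemma cdiffD F G z : cdiff F z -> cdiff G z -> cdiff (fun w => F w + G w) z.
Proof.
move=> [phi [pc [r r0 Fr]]] [psi [qc [q q0 Gq]]].
exists (fun w => phi w + psi w); split; first exact: ccontD.
exists (Num.min q r) => [|w]; first by rewrite lt_min q0.
by rewrite lt_min => /andP[wq wr]; rewrite Fr// Gq//; ring.
Qed.

Lemma cdiffM F G z : cdiff F z -> cdiff G z -> cdiff (fun w => F w * G w) z.
Proof.
move=> Fd Gd; have Gc := cdiff_ccont Gd; move: Fd Gd.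
move=> [phi [pc [r r0 Fr]]] [psi [qc [q q0 Gq]]].
exists (fun w => phi w * G w + F z * psi w); split.
  by apply: ccontD; apply: ccontM => //; exact: ccont_cst.
exists (Num.min q r) => [|w]; first by rewrite lt_min q0.
by rewrite lt_min => /andP[wq wr]; rewrite Fr// Gq//; ring.
Qed.

Lemma cdiffN F z : cdiff F z -> cdiff (fun w => - F w) z.
Proof.
move=> Fd; apply: (@cdiff_near (fun w => (-1) * F w) _ _ 1) => //.
  by move=> w _; rewrite mulN1r.
by apply: cdiffM => //; exact: cdiff_cst.
Qed.

Lemma cdiffB F G z : cdiff F z -> cdiff G z -> cdiff (fun w => F w - G w) z.
Proof. by move=> Fc Gc; apply: cdiffD => //; exact: cdiffN. Qed.

Lemma cdiffV F z : F z != 0 -> cdiff F z -> cdiff (fun w => (F w)^-1) z.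
Proof.
move=> Fz0 Fd; have Fc := cdiff_ccont Fd; case: Fd => [phi [pc [r r0 Fr]]].
have n20 : 0 < normc (F z) / 2 by rewrite divr_gt0// normc_gt0.
have [d d0 h] := Fc _ n20.
exists (fun w => - phi w * (F w * F z)^-1); split.
  apply: ccontM; first exact: ccontN.
  apply: ccontV; first by rewrite mulf_neq0.
  by apply: ccontM => //; exact: ccont_cst.
exists (Num.min d r) => [|w]; first by rewrite lt_min d0.
rewrite lt_min => /andP[/h wd wr].
have Fw0 : F w != 0.
  rewrite -normc_gt0; have := le_trans (normc_sub_le (F z) (F w)) _.
  rewrite normcB => /(_ _ wd); lra.
have e : phi w * (w - z) = F w - F z by rewrite Fr//; ring.
rewrite mulrAC mulNr e; by field; rewrite Fw0 Fz0.
Qed.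

Lemma cdiff_comp F G z : cdiff G z -> cdiff F (G z) -> cdiff (fun w => F (G w)) z.
Proof.
move=> Gd; have Gc := cdiff_ccont Gd; case: Gd => [psi [qc [q q0 Gq]]].
move=> [phi [pc [r r0 Fr]]].
have r20 : 0 < r / 2 by rewrite divr_gt0.
have [d d0 h] := Gc _ r20.
exists (fun w => phi (G w) * psi w); split.
  by apply: ccontM => //; exact: ccont_comp.
exists (Num.min q d) => [|w]; first by rewrite lt_min q0.
rewrite lt_min => /andP[wq /h wd]; rewrite Fr.
  have -> : G w - G z = psi w * (w - z) by rewrite (Gq w)//; ring.
  by rewrite mulrA.
  by rewrite (le_lt_trans wd)// ltr_pdivrMr// ltr_pMr// ltr1n.
Qed.

End complex_differentiability.

Arguments cint : simpl never.

(** * Bisection and contour integrals over rectangles *)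

Section rectangles.
Variable R : realType.
Local Notation C := R[i].
Local Notation "''i'" := (Complex 0 1 : C).
Implicit Types (F G : C -> C) (z w : C) (x y : R).

Lemma nested_intervals (W : R) (u : nat -> R) : 0 <= W ->
  (forall n, u n <= u n.+1 /\ u n.+1 + W / 2 ^+ n.+1 <= u n + W / 2 ^+ n) ->
  exists X, forall n, u n <= X <= u n + W / 2 ^+ n.
Proof.
move=> W0 hu.
have W2 n : 0 <= W / 2 ^+ n by rewrite divr_ge0// exprn_ge0.
have um n m : u n <= u (n + m)%N.
  by elim: m => [|m IH]; rewrite ?addn0// addnS (le_trans IH)//; case: (hu (n + m)%N).
have vm n m : u (n + m)%N + W / 2 ^+ (n + m) <= u n + W / 2 ^+ n.
  elim: m => [|m IH]; rewrite ?addn0// addnS (le_trans _ IH)//.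
  by case: (hu (n + m)%N).
have uv n m : u m <= u n + W / 2 ^+ n.
  case: (leqP n m) => nm; rewrite -(subnKC (ltnW nm)) || rewrite -(subnKC nm).
    by rewrite (le_trans _ (vm n (m - n)%N))// lerDl.
  by rewrite (le_trans (um m (n - m)%N))// lerDl.
exists (sup (range u)) => n; apply/andP; split.
  apply: ub_le_sup; last by exists n.
  by exists (u 0%N + W / 2 ^+ 0) => _ [m _ <-]; exact: uv.
apply: ge_sup; first by exists (u 0%N), 0%N.
by move=> _ [m _ <-]; exact: uv.
Qed.

Lemma halfX (W : R) n : W / 2 ^+ n = W / 2 ^+ n.+1 + W / 2 ^+ n.+1.
Proof. by rewrite exprS; field; rewrite expf_neq0. Qed.

(** [Q x y n] speaks of the cell of generation n with lower left corner (x, y). Failure of [Q]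
    passes from a cell to one of its four quarters, and the nested failing cells close in on the
    point (X, Y). *)
Lemma bisection2 (x0 y0 W H : R) (Q : R -> R -> nat -> Prop) :
  0 <= W -> 0 <= H ->
  (forall x y n, x0 <= x -> x + W / 2 ^+ n <= x0 + W ->
     y0 <= y -> y + H / 2 ^+ n <= y0 + H ->
     (forall i j : bool, Q (x + i%:R * (W / 2 ^+ n.+1))
                           (y + j%:R * (H / 2 ^+ n.+1)) n.+1) -> Q x y n) ->
  ~ Q x0 y0 0%N ->
  exists X Y, forall n, exists x y, ~ Q x y n /\
     [/\ x0 <= x, x + W / 2 ^+ n <= x0 + W, y0 <= y & y + H / 2 ^+ n <= y0 + H] /\
     (x <= X <= x + W / 2 ^+ n) /\ (y <= Y <= y + H / 2 ^+ n).
Proof.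
move=> W0 H0 hQ nQ0.
have W2 n : 0 <= W / 2 ^+ n by rewrite divr_ge0// exprn_ge0.
have H2 n : 0 <= H / 2 ^+ n by rewrite divr_ge0// exprn_ge0.
pose inside (p : R * R) n := [/\ x0 <= p.1, p.1 + W / 2 ^+ n <= x0 + W,
   y0 <= p.2 & p.2 + H / 2 ^+ n <= y0 + H].
pose nxt (p : R * R) n (ij : bool * bool) : R * R :=
  (p.1 + ij.1%:R * (W / 2 ^+ n.+1), p.2 + ij.2%:R * (H / 2 ^+ n.+1)).
(* A choice of failing quarter for each cell; off the failing cells of the rectangle its value is
   arbitrary. *)
have /choice [f hf] : forall pn : (R * R) * nat, exists ij : bool * bool,
    inside pn.1 pn.2 -> ~ Q pn.1.1 pn.1.2 pn.2 ->
    ~ Q (nxt pn.1 pn.2 ij).1 (nxt pn.1 pn.2 ij).2 pn.2.+1.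
  move=> [p n] /=; apply: contrapT => hn.
  have [[h1 h2 h3 h4] nQ] : inside p n /\ ~ Q p.1 p.2 n.
    by split; apply: contrapT => h; apply: hn; exists (true, true).
  apply: nQ; apply: hQ => // i j; apply: contrapT => h; apply: hn.
  by exists (i, j).
pose s := fix s n := if n is m.+1 then nxt (s m) m (f (s m, m)) else (x0, y0).
have sS n : s n.+1 = nxt (s n) n (f (s n, n)) by [].
have step (a b c : R) (i : bool) : 0 <= c -> b = c + c ->
   a <= a + i%:R * c /\ a + i%:R * c + c <= a + b.
  by move=> c0 ->; case: i => /=; split; lra.
have sin n : inside (s n) n /\ ~ Q (s n).1 (s n).2 n.
  elim: n => [|n [ins nQ]]; first by split=> //; split=> //=; rewrite expr0 divr1.
  split; last by rewrite sS; exact: (hf (s n, n)).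
  case: ins => h1 h2 h3 h4; rewrite sS /nxt.
  have [a1 a2] := step (s n).1 _ _ (f (s n, n)).1 (W2 n.+1) (halfX W n).
  have [b1 b2] := step (s n).2 _ _ (f (s n, n)).2 (H2 n.+1) (halfX H n).
  split => /=; [exact: le_trans a1|exact: le_trans a2 _|exact: le_trans b1|exact: le_trans b2 _].
have [X hX] := @nested_intervals W (fun n => (s n).1) W0 (fun n =>
  step (s n).1 _ _ (f (s n, n)).1 (W2 n.+1) (halfX W n)).
have [Y hY] := @nested_intervals H (fun n => (s n).2) H0 (fun n =>
  step (s n).2 _ _ (f (s n, n)).2 (H2 n.+1) (halfX H n)).
exists X, Y => n; exists (s n).1, (s n).2.
by have [? ?] := sin n; split.
Qed.

(** Counterclockwise orientation: bottom minus top, plus the right side minus the left side, on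
    which dz = 'i dy. *)
Definition oint F x0 x1 y0 y1 : C :=
  cint (fun x => F (Complex x y0)) x0 x1 - cint (fun x => F (Complex x y1)) x0 x1 +
  'i * (cint (fun y => F (Complex x1 y)) y0 y1 - cint (fun y => F (Complex x0 y)) y0 y1).

Definition boundary_cont F x0 x1 y0 y1 :=
  (forall x, x0 <= x <= x1 -> ccont F (Complex x y0) /\ ccont F (Complex x y1)) /\
  (forall y, y0 <= y <= y1 -> ccont F (Complex x0 y) /\ ccont F (Complex x1 y)).

Lemma segcont_hor F x0 x1 y : (forall x, x0 <= x <= x1 -> ccont F (Complex x y)) ->
  segcont (fun x => F (Complex x y)) x0 x1.
Proof.
move=> Fc t /Fc h e /h[d d0 k]; exists d => // s _ st; apply: k.
by rewrite -[_ - _]/(Complex (s - t) (y - y)) subrr [Complex _ _]complexr0 normc_real.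
Qed.

Lemma segcont_ver F x y0 y1 : (forall y, y0 <= y <= y1 -> ccont F (Complex x y)) ->
  segcont (fun y => F (Complex x y)) y0 y1.
Proof.
move=> Fc t /Fc h e /h[d d0 k]; exists d => // s _ st; apply: k.
by rewrite -[_ - _]/(Complex (x - x) (s - t)) subrr normc_imag.
Qed.

Lemma oint_splitx F x0 xm x1 y0 y1 : x0 <= xm -> xm <= x1 ->
  (forall x, x0 <= x <= x1 -> ccont F (Complex x y0) /\ ccont F (Complex x y1)) ->
  oint F x0 x1 y0 y1 = oint F x0 xm y0 y1 + oint F xm x1 y0 y1.
Proof.
move=> h1 h2 Fc; rewrite /oint.
rewrite (cint_split h1 h2); last by apply: segcont_hor => x /Fc[].
rewrite (@cint_split _ _ _ _ _ h1 h2); last by apply: segcont_hor => x /Fc[].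
ring.
Qed.

Lemma oint_splity F x0 x1 y0 ym y1 : y0 <= ym -> ym <= y1 ->
  (forall y, y0 <= y <= y1 -> ccont F (Complex x0 y) /\ ccont F (Complex x1 y)) ->
  oint F x0 x1 y0 y1 = oint F x0 x1 y0 ym + oint F x0 x1 ym y1.
Proof.
move=> h1 h2 Fc; rewrite /oint.
rewrite (cint_split h1 h2); last by apply: segcont_ver => x /Fc[].
rewrite (@cint_split _ (fun y => F (Complex x0 y)) _ _ _ h1 h2); last by apply: segcont_ver => x /Fc[].
ring.
Qed.

Lemma oint_le F M x0 x1 y0 y1 : x0 <= x1 -> y0 <= y1 ->
  boundary_cont F x0 x1 y0 y1 ->
  (forall x y, x0 <= x <= x1 -> y0 <= y <= y1 -> x = x0 \/ x = x1 \/ y = y0 \/ y = y1 ->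
     normc (F (Complex x y)) <= M) ->
  normc (oint F x0 x1 y0 y1) <= 4 * M * ((x1 - x0) + (y1 - y0)).
Proof.
move=> x01 y01 [Fx Fy] FM; rewrite /oint.
have b1 := cint_le x01 (segcont_hor (fun x xx => (Fx x xx).1)).
have b2 := cint_le x01 (segcont_hor (fun x xx => (Fx x xx).2)).
have b3 := cint_le y01 (segcont_ver (fun x xx => (Fy x xx).1)).
have b4 := cint_le y01 (segcont_ver (fun x xx => (Fy x xx).2)).
have {}b1 := b1 M (fun t tt => FM t y0 tt ltac:(by rewrite lexx) ltac:(tauto)).
have {}b2 := b2 M (fun t tt => FM t y1 tt ltac:(by rewrite lexx andbT) ltac:(tauto)).
have {}b3 := b3 M (fun t tt => FM x0 t ltac:(by rewrite lexx) tt ltac:(tauto)).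
have {}b4 := b4 M (fun t tt => FM x1 t ltac:(by rewrite lexx andbT) tt ltac:(tauto)).
have h1 := le_trans (le_normcB _ _) (lerD b1 b2).
have h2 := le_trans (le_normcB _ _) (lerD b4 b3).
rewrite (le_trans (le_normcD _ _))// normcM normc_i mul1r.
by rewrite (le_trans (lerD h1 h2))//; lra.
Qed.

Lemma ointB F G x0 x1 y0 y1 : boundary_cont F x0 x1 y0 y1 ->
  boundary_cont G x0 x1 y0 y1 ->
  oint (fun z => F z - G z) x0 x1 y0 y1 = oint F x0 x1 y0 y1 - oint G x0 x1 y0 y1.
Proof.
move=> [Fx Fy] [Gx Gy]; rewrite /oint.
have b1 := cintB (segcont_hor (fun x xx => (Fx x xx).1)) (segcont_hor (fun x xx => (Gx x xx).1)).
have b2 := cintB (segcont_hor (fun x xx => (Fx x xx).2)) (segcont_hor (fun x xx => (Gx x xx).2)).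
have b3 := cintB (segcont_ver (fun x xx => (Fy x xx).1)) (segcont_ver (fun x xx => (Gy x xx).1)).
have b4 := cintB (segcont_ver (fun x xx => (Fy x xx).2)) (segcont_ver (fun x xx => (Gy x xx).2)).
by rewrite b1 b2 b3 b4; ring.
Qed.

Lemma ointZ F (c : C) x0 x1 y0 y1 : boundary_cont F x0 x1 y0 y1 ->
  oint (fun z => c * F z) x0 x1 y0 y1 = c * oint F x0 x1 y0 y1.
Proof.
move=> [Fx Fy]; rewrite /oint.
have b1 := cintZ c (segcont_hor (fun x xx => (Fx x xx).1)).
have b2 := cintZ c (segcont_hor (fun x xx => (Fx x xx).2)).
have b3 := cintZ c (segcont_ver (fun x xx => (Fy x xx).1)).
have b4 := cintZ c (segcont_ver (fun x xx => (Fy x xx).2)).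
by rewrite b1 b2 b3 b4; ring.
Qed.

Lemma eq_oint F G x0 x1 y0 y1 : x0 <= x1 -> y0 <= y1 ->
  (forall x y, x0 <= x <= x1 -> y0 <= y <= y1 -> x = x0 \/ x = x1 \/ y = y0 \/ y = y1 ->
     F (Complex x y) = G (Complex x y)) ->
  oint F x0 x1 y0 y1 = oint G x0 x1 y0 y1.
Proof.
move=> x01 y01 FG; rewrite /oint; congr (_ - _ + _ * (_ - _)); apply: eq_cint => t tt;
apply: FG; rewrite ?lexx ?x01 ?y01 //; tauto.
Qed.

(** On opposite sides an affine function differs by a constant, so the horizontal pair contributes -
    'i d (x1 - x0) (y1 - y0) and the vertical pair its opposite. This is the first-order part that
    Goursat's argument subtracts. *)
Lemma oint_affine (c d z0 : C) x0 x1 y0 y1 : x0 <= x1 -> y0 <= y1 ->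
  oint (fun z => c + d * (z - z0)) x0 x1 y0 y1 = 0.
Proof.
move=> x01 y01; rewrite /oint.
have Fc z : ccont (fun z => c + d * (z - z0)) z.
  apply: ccontD; first exact: ccont_cst.
  apply: ccontM; first exact: ccont_cst.
  by apply: ccontB; [exact: ccont_id|exact: ccont_cst].
rewrite -!cintB; try by [apply: (@segcont_hor (fun z => c + d * (z - z0)))|
  apply: (@segcont_ver (fun z => c + d * (z - z0)))].
have E x y x' y' : c + d * (Complex x y - z0) - (c + d * (Complex x' y' - z0)) =
  d * Complex (x - x') (y - y').
  by rewrite -[Complex (x - x') _]/(Complex x y - Complex x' y'); ring.
rewrite (@eq_cint _ _ (fun=> d * Complex 0 (y0 - y1))); last first.
  by move=> t _; rewrite E subrr.
rewrite (@eq_cint _ (fun y => _ + _ * (Complex x1 y - _) - _) (fun=> d * Complex (x1 - x0) 0)); last first.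
  by move=> t _; rewrite E subrr.
rewrite !cint_cst//.
have -> : Complex 0 (y0 - y1) = - 'i * (y1 - y0)%:C%C.
  by rewrite -[RHS]/(Complex (-0 * (y1 - y0) - -1 * 0) (- 0 * 0 + -1 * (y1 - y0))); congr Complex; ring.
rewrite [Complex _ 0]complexr0; ring.
Qed.

End rectangles.

Arguments oint : simpl never.

(** * Goursat's theorem and Cauchy's formula *)

Section cauchy_theory.
Variable R : realType.
Local Notation C := R[i].
Local Notation "''i'" := (Complex 0 1 : C).
Implicit Types (F G : C -> C) (z w : C) (x y : R).

Lemma ltr_halfX (K d : R) : 0 < d -> exists n, K / 2 ^+ n < d.
Proof.
move=> d0; have := archi_boundP (normr_ge0 (K / d)); set n := Num.bound _ => h.
exists n; rewrite ltr_pdivrMr ?exprn_gt0// -ltr_pdivrMl//.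
rewrite mulrC (le_lt_trans (ler_norm _))// (lt_le_trans h)//.
by rewrite -natrX ler_nat ltnW// ltn_expl.
Qed.

Lemma oint_quarters F x y p r e : 0 <= p -> 0 <= r ->
  (forall s t, x <= s <= x + (p + p) -> y <= t <= y + (r + r) ->
     ccont F (Complex s t)) ->
  normc (oint F x (x + p) y (y + r)) <= e ->
  normc (oint F x (x + p) (y + r) (y + r + r)) <= e ->
  normc (oint F (x + p) (x + p + p) y (y + r)) <= e ->
  normc (oint F (x + p) (x + p + p) (y + r) (y + r + r)) <= e ->
  normc (oint F x (x + (p + p)) y (y + (r + r))) <= e *+ 4.
Proof.
move=> p0 r0 Fc q00 q01 q10 q11.
have hx : [/\ x <= x + p, x + p <= x + (p + p), x <= x + (p + p) & x <= x + p <= x + (p + p)].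
  by clear -p0; split; [lra|lra|lra|apply/andP; split; lra].
have hy : [/\ y <= y + r, y + r <= y + (r + r), y <= y + (r + r) & y <= y + r <= y + (r + r)].
  by clear -r0; split; [lra|lra|lra|apply/andP; split; lra].
case: hx hy => x1 x2 x3 x4 [y1 y2 y3 y4].
rewrite (@oint_splitx _ _ _ (x + p))//; last first.
  by move=> s hs; split; apply: Fc; rewrite ?lexx ?y3.
rewrite (@oint_splity _ _ x _ _ (y + r))//; last first.
  by move=> s hs; split; apply: Fc; rewrite ?lexx ?x3 ?x4.
rewrite (@oint_splity _ _ (x + p) _ _ (y + r))//; last first.
  by move=> s hs; split; apply: Fc; rewrite ?lexx ?x3 ?x4.
rewrite !(addrA x) !(addrA y).
have {q00 q01 q10 q11} h := lerD (lerD q00 q01) (lerD q10 q11).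
rewrite (le_trans (le_normcD _ _))// (le_trans (lerD (le_normcD _ _) (lexx _)))//.
rewrite (le_trans (lerD (lexx _) (le_normcD _ _)))// ?(le_trans h)//.
by rewrite !mulrS mulr0n !addrA addr0.
Qed.

Lemma dist_itv_le (x w s t : R) : x <= s -> s <= x + w -> x <= t -> t <= x + w -> `|s - t| <= w.
Proof. by move=> *; rewrite ler_norml; apply/andP; split; lra. Qed.

(** Bisection is applied to the claim that the integral over a cell of generation n is at most eps /
    4^n. Near the limit point F is affine up to an error small with respect to the diameter, and the
    affine part integrates to 0; so the claim holds on a small enough cell, which is a
    contradiction. *)
Lemma goursat F x0 x1 y0 y1 : x0 <= x1 -> y0 <= y1 ->
  (forall x y, x0 <= x <= x1 -> y0 <= y <= y1 -> cdiff F (Complex x y)) ->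
  oint F x0 x1 y0 y1 = 0.
Proof.
move=> x01 y01 Fd; apply: contrapT => /eqP ne.
set I := oint F x0 x1 y0 y1 in ne.
have I0 : 0 < normc I by rewrite normc_gt0.
(* Half of the norm of the integral, so that the claim fails at generation 0. *)
pose W := x1 - x0; pose H := y1 - y0; pose eps := normc I / 2.
have W0 : 0 <= W by rewrite subr_ge0.
have H0 : 0 <= H by rewrite subr_ge0.
have eps0 : 0 < eps by rewrite divr_gt0.
have P2 n : 0 < (2 : R) ^+ n by rewrite exprn_gt0.
have W2 n : 0 <= W / 2 ^+ n by rewrite divr_ge0// ltW.
have H2 n : 0 <= H / 2 ^+ n by rewrite divr_ge0// ltW.
pose Q x y n := normc (oint F x (x + W / 2 ^+ n) y (y + H / 2 ^+ n)) <= eps / 4 ^+ n.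
have sub x y n s t : x0 <= x -> x + W / 2 ^+ n <= x0 + W -> y0 <= y ->
    y + H / 2 ^+ n <= y0 + H -> x <= s <= x + W / 2 ^+ n ->
    y <= t <= y + H / 2 ^+ n -> cdiff F (Complex s t).
  move=> h1 h2 h3 h4 /andP[h5 h6] /andP[h7 h8].
  have eW : x0 + W = x1 by rewrite addrC subrK.
  have eH : y0 + H = y1 by rewrite addrC subrK.
  rewrite eW in h2; rewrite eH in h4; apply: Fd.
    by rewrite (le_trans h1 h5) (le_trans h6 h2).
  by rewrite (le_trans h3 h7) (le_trans h8 h4).
have [] := @bisection2 _ x0 y0 W H Q W0 H0.
- move=> x y n h1 h2 h3 h4 q.
  have Fc s t : x <= s <= x + W / 2 ^+ n -> y <= t <= y + H / 2 ^+ n ->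
     ccont F (Complex s t).
    by move=> hs ht; exact/cdiff_ccont/(sub x y n).
  have q00 := q false false; have q01 := q false true.
  have q10 := q true false; have q11 := q true true.
  move: q00 q01 q10 q11; rewrite /Q/= !mul0r !addr0 !mul1r => q00 q01 q10 q11.
  rewrite (halfX W n) (halfX H n).
  have -> : eps / 4 ^+ n = eps / 4 ^+ n.+1 *+ 4.
    by rewrite exprS -mulr_natr; field; rewrite expf_neq0.
  by apply: oint_quarters => //; rewrite -?halfX.
- rewrite /Q !expr0 !divr1 /W /H ![_ + (_ - _)]addrC !subrK -/I /eps => h.
  by lra.
move=> X [Y XY].
have XYd : cdiff F (Complex X Y).
  have [x [y [_ [[h1 h2 h3 h4] [h5 h6]]]]] := XY 0%N.
  exact: (sub x y 0%N).
case: XYd => phi [pc [r r0 Fr]].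
pose K := W + H.
have K0 : 0 <= K by rewrite addr_ge0.
(* This makes 4 e K^2 <= eps; the shift K + 1 covers the degenerate rectangle K = 0. *)
have e0 : 0 < eps / (4 * (K + 1) ^+ 2).
  by rewrite divr_gt0// mulr_gt0// exprn_gt0// ltr_wpDl.
set e := eps / _ in e0; have [d d0 pd] := pc _ e0.
have [n nd] := @ltr_halfX K (Num.min d r) ltac:(by rewrite lt_min d0).
move: nd; rewrite lt_min => /andP[nd nr].
have [x [y [nQ [[h1 h2 h3 h4] [h5 h6]]]]] := XY n.
apply: nQ; rewrite /Q.
pose A z := F (Complex X Y) + phi (Complex X Y) * (z - Complex X Y).
have Fc s t : x <= s <= x + W / 2 ^+ n -> y <= t <= y + H / 2 ^+ n ->
   ccont F (Complex s t).
  by move=> hs ht; exact/cdiff_ccont/(sub x y n).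
have Ac z : ccont A z.
  apply: ccontD; first exact: ccont_cst.
  apply: ccontM; first exact: ccont_cst.
  by apply: ccontB; [exact: ccont_id|exact: ccont_cst].
have xx : x <= x + W / 2 ^+ n by rewrite lerDl.
have yy : y <= y + H / 2 ^+ n by rewrite lerDl.
have bF : boundary_cont F x (x + W / 2 ^+ n) y (y + H / 2 ^+ n).
  by split=> s hs; split; apply: Fc => //; rewrite lexx ?xx ?yy.
have bA : boundary_cont A x (x + W / 2 ^+ n) y (y + H / 2 ^+ n) by split=> s hs; split.
have bFA : boundary_cont (fun z => F z - A z) x (x + W / 2 ^+ n) y (y + H / 2 ^+ n).
  case: bF => bF1 bF2; split=> s hs; split; apply: ccontB => //.
  - by case: (bF1 s hs). - by case: (bF1 s hs).
  - by case: (bF2 s hs). - by case: (bF2 s hs).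
rewrite -[oint F _ _ _ _]subr0 -(oint_affine (F (Complex X Y)) (phi (Complex X Y)) (Complex X Y) xx yy).
rewrite -ointB// (le_trans (oint_le (M := e * (K / 2 ^+ n)) xx yy bFA _))//.
  move=> s t hs ht _.
  have dist : normc (Complex s t - Complex X Y) <= K / 2 ^+ n.
    rewrite (le_trans (normc_le_ReIm _))//= /K mulrDl.
    move: hs ht h5 h6 => /andP[s1 s2] /andP[t1 t2] /andP[? ?] /andP[? ?].
    by rewrite lerD//; [exact: dist_itv_le s1 s2 _ _|exact: dist_itv_le t1 t2 _ _].
  rewrite Fr ?(le_lt_trans dist)//.
  rewrite [X in normc X](_ : _ = (phi (Complex s t) - phi (Complex X Y)) *
    (Complex s t - Complex X Y)); last by rewrite /A; ring.
  rewrite normcM ler_pM ?normc_ge0//.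
  by rewrite pd// (le_lt_trans dist).
rewrite [x + _ - x]addrC addKr [y + _ - y]addrC addKr -mulrDl -/K.
have -> : 4 * (e * (K / 2 ^+ n)) * (K / 2 ^+ n) = (4 * e * K ^+ 2) / 4 ^+ n.
  have -> : (4 : R) ^+ n = 2 ^+ n * 2 ^+ n by rewrite -exprMn -natrM.
  by field; rewrite expf_neq0.
rewrite ler_pM2r ?invr_gt0 ?exprn_gt0// /e.
have K1 : 0 < K + 1 by rewrite ltr_wpDl.
have -> : 4 * (eps / (4 * (K + 1) ^+ 2)) * K ^+ 2 = eps * (K / (K + 1)) ^+ 2.
  by field; rewrite gt_eqF.
rewrite ler_piMr ?(ltW eps0)// expr_le1// ?divr_ge0// ?(ltW K1)//.
by rewrite ler_pdivrMr// mul1r lerDl.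
Qed.

(** Cutting along x = a0 and x = a1, then the middle strip along y = b0 and y = b1, leaves four
    rectangles on which Goursat's theorem applies. *)
Lemma oint_deform G x0 x1 y0 y1 a0 a1 b0 b1 :
  x0 <= a0 -> a0 <= a1 -> a1 <= x1 -> y0 <= b0 -> b0 <= b1 -> b1 <= y1 ->
  (forall x y, x0 <= x <= x1 -> y0 <= y <= y1 -> ~ (a0 < x < a1 /\ b0 < y < b1) ->
    cdiff G (Complex x y)) ->
  oint G x0 x1 y0 y1 = oint G a0 a1 b0 b1.
Proof.
move=> h1 h2 h3 h4 h5 h6 Gd.
have k1 := le_trans h2 h3; have k2 := le_trans h1 h2.
have k3 := le_trans h5 h6; have k4 := le_trans h4 h5.
have y01 := le_trans h4 k3.
have outx x y : x0 <= x <= x1 -> y0 <= y <= y1 -> x <= a0 \/ a1 <= x ->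
    cdiff G (Complex x y).
  move=> hx hy hh; apply: Gd => // -[/andP[e1 e2] _].
  by case: hh; rewrite leNgt ?e1 ?e2.
have outy x y : x0 <= x <= x1 -> y0 <= y <= y1 -> y <= b0 \/ b1 <= y ->
    cdiff G (Complex x y).
  move=> hx hy hh; apply: Gd => // -[_ /andP[e1 e2]].
  by case: hh; rewrite leNgt ?e1 ?e2.
rewrite (@oint_splitx _ _ _ a0)//; last first.
  by move=> x xx; split; apply/cdiff_ccont/outy; rewrite ?lexx ?y01//; [left|right].
rewrite (@oint_splitx _ _ a0 a1 x1)//; last first.
  move=> x /andP[xx xx']; split; apply/cdiff_ccont/outy;
    rewrite ?lexx ?y01// ?xx' ?(le_trans h1)//; [by left|by right].
rewrite (@oint_splity _ _ a0 a1 y0 b0)//; last first.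
  move=> y yy; split; apply/cdiff_ccont/outx; rewrite ?h1 ?h3 ?k1 ?k2//; [by left|by right].
rewrite (@oint_splity _ _ a0 a1 b0 b1)//; last first.
  move=> y /andP[yy yy']; split; apply/cdiff_ccont/outx;
    rewrite ?h1 ?h3 ?k1 ?k2// ?yy' ?(le_trans h4)//; [by left|by right].
rewrite (@goursat G x0 a0)//; last first.
  move=> x y /andP[e1 e2] yy; apply: outx => //; last by left.
  by rewrite e1 (le_trans e2).
rewrite (@goursat G a1 x1)//; last first.
  move=> x y /andP[e1 e2] yy; apply: outx => //; last by right.
  by rewrite e2 (le_trans k2).
rewrite (@goursat G a0 a1 y0 b0)//; last first.
  move=> x y /andP[e1 e2] /andP[e3 e4]; apply: outy; last by left.
    by rewrite (le_trans h1 e1) (le_trans e2).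
  by rewrite e3 (le_trans e4).
rewrite (@goursat G a0 a1 b1 y1)//; last first.
  move=> x y /andP[e1 e2] /andP[e3 e4]; apply: outy; last by right.
    by rewrite (le_trans h1 e1) (le_trans e2).
  by rewrite e4 (le_trans k4).
by rewrite !add0r !addr0.
Qed.

Lemma invcE (a b : R) : (Complex a b)^-1 =
  Complex (a / (a ^+ 2 + b ^+ 2)) (- (b / (a ^+ 2 + b ^+ 2))) :> C.
Proof. by []. Qed.

Lemma cint_Re_ge (f : R -> C) (m a b : R) : a <= b -> segcont f a b ->
  (forall t, a <= t <= b -> m <= complex.Re (f t)) -> m * (b - a) <= complex.Re (cint f a b).
Proof.
move=> ab fc fm; have := cint_cst m%:C%C ab => -[].
rewrite !mul0r !subr0/= [_ * m]mulrC => <- _; apply: le_Rintegral => //.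
- by apply/(@segcont_Re _ (fun=> m%:C%C))/segcont_cst.
- exact: segcont_Re.
Qed.

Lemma cint_Im_ge (f : R -> C) (m a b : R) : a <= b -> segcont f a b ->
  (forall t, a <= t <= b -> m <= complex.Im (f t)) -> m * (b - a) <= complex.Im (cint f a b).
Proof.
move=> ab fc fm; have := cint_cst m%:C%C ab => -[].
rewrite !mul0r !subr0/= [_ * m]mulrC => <- _; apply: le_Rintegral => //.
- by apply/(@segcont_Re _ (fun=> m%:C%C))/segcont_cst.
- exact: segcont_Im.
Qed.

Lemma kernel_cdiff w z : z != w -> cdiff (fun z => (z - w)^-1) z.
Proof.
move=> zw; apply: (@cdiffV _ (fun z => z - w)); first by rewrite subr_eq0.
by apply: cdiffB; [exact: cdiff_id|exact: cdiff_cst].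
Qed.

(* A lower bound for the winding integral makes its exact value 2 pi i unnecessary. *)
Lemma winding_ge a b t : 0 < t ->
  4 <= normc (oint (fun z => (z - Complex a b)^-1) (a - t) (a + t) (b - t) (b + t)).
Proof.
move=> t0.
have ta : a - t <= a + t by lra.
have tb : b - t <= b + t by lra.
have E x y : (Complex x y - Complex a b)^-1 = (Complex (x - a) (y - b))^-1 :> C by [].
have ne x y : (x != a) || (y != b) -> ccont (fun z => (z - Complex a b)^-1) (Complex x y).
  move=> h; apply/cdiff_ccont/kernel_cdiff; apply: contraL h => /eqP[-> ->].
  by rewrite !eqxx.
have hor s : s != b -> segcont (fun x => (Complex x s - Complex a b)^-1) (a - t) (a + t).
  by move=> sb; apply: (@segcont_hor _ (fun z => (z - Complex a b)^-1)) => x _; apply: ne; rewrite sb orbT.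
have ver s : s != a -> segcont (fun y => (Complex s y - Complex a b)^-1) (b - t) (b + t).
  by move=> sb; apply: (@segcont_ver _ (fun z => (z - Complex a b)^-1)) => x _; apply: ne; rewrite sb.
have s1 := hor (b - t) ltac:(by rewrite -subr_eq0; lra).
have s2 := hor (b + t) ltac:(by rewrite -subr_eq0; lra).
have s3 := ver (a + t) ltac:(by rewrite -subr_eq0; lra).
have s4 := ver (a - t) ltac:(by rewrite -subr_eq0; lra).
have cB (f g : R -> C) (u v : R) : segcont f u v -> segcont g u v -> segcont (fun t => f t - g t) u v.
  move=> fc gc; apply: segcontD => //; apply: (@segcont_eq _ (fun t => -1 * g t)).
    by move=> *; rewrite mulN1r.
  by apply: segcontM => //; exact: segcont_cst.
(* Opposite sides, taken together, have the integrand 2 t / (s^2 + t^2), which is at least 1 / t.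
   Over a length 2 t each pair contributes at least 2, hence 4 in all. *)
have key s : - t <= s <= t -> t^-1 <= 2 * t / (s ^+ 2 + t ^+ 2).
  move=> /andP[h1 h2]; have p : 0 < s ^+ 2 + t ^+ 2 by rewrite ltr_wpDl ?sqr_ge0 ?exprn_gt0.
  rewrite ler_pdivlMr// -ler_pdivlMl ?invr_gt0// invrK; nra.
rewrite /oint -!cintB//.
rewrite (le_trans _ (Im_le_normc _))// (le_trans _ (ler_norm _))//.
have A := @cint_Im_ge _ t^-1 _ _ ta (cB _ _ _ _ s1 s2).
have B := @cint_Re_ge _ t^-1 _ _ tb (cB _ _ _ _ s3 s4).
set I1 := cint _ _ _ in A *; set I2 := cint _ _ _ in B *.
have -> : complex.Im (I1 + 'i * I2) = complex.Im I1 + complex.Re I2.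
  by case: I1 {A} => ? ?; case: I2 {B} => ? ? /=; rewrite mul0r mul1r add0r.
have t1 : t^-1 * (a + t - (a - t)) = 2 by field; rewrite gt_eqF.
have t2 : t^-1 * (b + t - (b - t)) = 2 by field; rewrite gt_eqF.
rewrite t1 t2 in A B.
suff : 2 <= complex.Im I1 /\ 2 <= complex.Re I2 by move=> []; lra.
split.
  apply: A => x /andP[h1 h2]; rewrite !E !invcE/= (le_trans (key (x - a) _))//.
    by apply/andP; split; lra.
  rewrite [b - t - b]addrAC [b + t - b]addrAC subrr !sub0r add0r sqrrN.
  by rewrite mulNr opprK -mulrDl; have -> : 2 * t = t + t by ring.
apply: B => y /andP[h1 h2]; rewrite !E !invcE/= (le_trans (key (y - b) _))//.
  by apply/andP; split; lra.
rewrite [a - t - a]addrAC [a + t - a]addrAC subrr !sub0r add0r sqrrN.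
by rewrite mulNr opprK -mulrDl addrC; have -> : 2 * t = t + t by ring.
Qed.

(** The quotient (F z - F w) / (z - w) is bounded near w. Deformation to a square of half-side t
    bounds its contour integral by 16 M t for all small t, so the integral is 0. The winding
    integral stays as a factor, known only to be far from 0. *)
Lemma cauchy_formula F x0 x1 y0 y1 a b : x0 < a -> a < x1 -> y0 < b -> b < y1 ->
  (forall x y, x0 <= x <= x1 -> y0 <= y <= y1 -> cdiff F (Complex x y)) ->
  oint (fun z => F z * (z - Complex a b)^-1) x0 x1 y0 y1 =
    F (Complex a b) * oint (fun z => (z - Complex a b)^-1) x0 x1 y0 y1 /\
  4 <= normc (oint (fun z => (z - Complex a b)^-1) x0 x1 y0 y1).
Proof.
move=> xa ax yb b_y Fd; set w := Complex a b.
have [t0 [t00 ha1 ha2 hb1 hb2]] : exists t, [/\ 0 < t, t <= a - x0, t <= x1 - a,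
    t <= b - y0 & t <= y1 - b] by apply: exists_min4; rewrite subr_gt0.
have deform G t : 0 < t -> t <= t0 -> (forall x y, x0 <= x <= x1 -> y0 <= y <= y1 ->
    Complex x y != w -> cdiff G (Complex x y)) ->
    oint G x0 x1 y0 y1 = oint G (a - t) (a + t) (b - t) (b + t).
  move=> tp tt Gd.
  apply: oint_deform; try (by clear -tp tt ha1 ha2 hb1 hb2; lra).
  move=> x y hx hy h; apply: Gd => //; apply/eqP => -[e1 e2]; apply: h; rewrite e1 e2.
  by clear -tp; split; apply/andP; split; lra.
have kd x y : x0 <= x <= x1 -> y0 <= y <= y1 -> Complex x y != w ->
    cdiff (fun z => (z - w)^-1) (Complex x y) by move=> _ _; exact: kernel_cdiff.
split; last by rewrite (deform _ t0)//; exact: winding_ge.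
have x01 := ltW (lt_trans xa ax); have y01 := ltW (lt_trans yb b_y).
have bneq x y : x = x0 \/ x = x1 \/ y = y0 \/ y = y1 -> Complex x y != w.
  by move=> h; apply/eqP => -[e1 e2]; rewrite e1 e2 in h; clear -h xa ax yb b_y; lra.
have bk : boundary_cont (fun z => (z - w)^-1) x0 x1 y0 y1.
  split=> s hs; split; apply/cdiff_ccont/kd; rewrite ?lexx ?x01 ?y01//; apply: bneq; tauto.
have bF : boundary_cont F x0 x1 y0 y1.
  split=> s hs; split; apply/cdiff_ccont/Fd; rewrite ?lexx ?x01 ?y01//.
have bFk : boundary_cont (fun z => F z * (z - w)^-1) x0 x1 y0 y1.
  case: bF bk => A B [A' B']; split=> s hs; split; apply: ccontM;
  first [by case: (A s hs)|by case: (A' s hs)|by case: (B s hs)|by case: (B' s hs)].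
have bck : boundary_cont (fun z => F w * (z - w)^-1) x0 x1 y0 y1.
  case: bk => A' B'; split=> s hs; split; apply: ccontM; try exact: ccont_cst;
  first [by case: (A' s hs)|by case: (B' s hs)].
apply/eqP; rewrite -subr_eq0 -ointZ// -ointB//; set G := (fun z => _ - _).
have Gd x y : x0 <= x <= x1 -> y0 <= y <= y1 -> Complex x y != w -> cdiff G (Complex x y).
  move=> hx hy h; apply: cdiffB; apply: cdiffM; try exact: cdiff_cst; try exact: kd.
  exact: Fd.
have [phi [pc [r r0 Fr]]] : cdiff F w by apply: Fd; rewrite ?ltW.
have [d d0 pd] := ccont_bounded pc.
pose M := normc (phi w) + 1.
have M0 : 0 < M by rewrite ltr_wpDl// normc_ge0.
rewrite -normc_eq0; apply/negPn/negP => ne.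
have n0 : 0 < normc (oint G x0 x1 y0 y1) by rewrite lt_neqAle eq_sym ne normc_ge0.
set N := normc _ in n0.
(* With t <= N / (32 M) the bound 16 M t is at most N / 2, which contradicts N > 0. *)
have [t [tp tle tN td tr]] : exists t, [/\ 0 < t, t <= t0, t <= N / (32 * M),
    t <= d / 4 & t <= r / 4] by apply: exists_min4; rewrite ?divr_gt0// mulr_gt0.
suff : N <= 4 * M * (2 * t + 2 * t).
  by have : t * (32 * M) <= N; [rewrite -ler_pdivlMr// mulr_gt0|nra].
have ta : a - t <= a + t by clear -tp; lra.
have tb : b - t <= b + t by clear -tp; lra.
have sub x y : a - t <= x <= a + t -> b - t <= y <= b + t -> x0 <= x <= x1 /\ y0 <= y <= y1.
  move=> /andP[h1 h2] /andP[h3 h4]; clear -h1 h2 h3 h4 tle ha1 ha2 hb1 hb2.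
  by split; apply/andP; split; lra.
have bneq' x y : x = a - t \/ x = a + t \/ y = b - t \/ y = b + t -> Complex x y != w.
  by move=> h; apply/eqP => -[e1 e2]; rewrite e1 e2 in h; clear -h tp; lra.
have Gc x y : a - t <= x <= a + t -> b - t <= y <= b + t ->
    x = a - t \/ x = a + t \/ y = b - t \/ y = b + t -> ccont G (Complex x y).
  by move=> hx hy /bneq' ?; case: (sub x y) => // ? ?; apply/cdiff_ccont/Gd.
have bG : boundary_cont G (a - t) (a + t) (b - t) (b + t).
  by split=> s hs; split; apply: Gc; rewrite ?lexx ?ta ?tb//; tauto.
rewrite /N (deform G t)//.
have -> : 2 * t + 2 * t = (a + t - (a - t)) + (b + t - (b - t)) by clear; ring.
apply: oint_le => // x y hx hy hb.
have zw := bneq' _ _ hb; set z := Complex x y in zw *.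
have dist : normc (z - w) <= 2 * t.
  rewrite (le_trans (normc_le_ReIm _))//=.
  have -> : 2 * t = t + t by ring.
  move: hx hy => /andP[h1 h2] /andP[h3 h4]; clear -h1 h2 h3 h4.
  by rewrite lerD// ler_norml; apply/andP; split; lra.
have -> : G z = phi z.
  rewrite /G -mulrBl Fr; last by apply: le_lt_trans dist _; clear -td tr tp; lra.
  by rewrite addrC addKr mulfK// subr_eq0.
by apply: pd; apply: le_lt_trans dist _; clear -td tr tp; lra.
Qed.

End cauchy_theory.

(** * Uniform limits of holomorphic functions *)

Section weierstrass.
Variable R : realType.
Local Notation C := R[i].
Local Notation "''i'" := (Complex 0 1 : C).
Implicit Types (F G : C -> C) (z w : C) (x y : R).

Lemma segcont_bounded (f : R -> C) a b : a <= b -> segcont f a b ->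
  exists2 M, 0 <= M & forall t, a <= t <= b -> normc (f t) <= M.
Proof.
move=> ab fc.
have cf : {within `[a, b], continuous (fun t => normc (f t))}.
  apply/subspace_continuousP => t /=; rewrite in_itv/= => tab.
  apply/cvgrPdist_le => e e0; have [d d0 fd] := fc t tab e e0.
  rewrite near_withinE; exists d => //= s /=; rewrite distrC => sd.
  rewrite in_itv/= => sab.
  have := fd s sab sd; change (normc (f s - f t) <= e -> `|normc (f t) - normc (f s)| <= e).
  rewrite ler_norml; have := normc_sub_le (f s) (f t).
  have := normc_sub_le (f t) (f s); rewrite normcB; lra.
have [c _ fM] := EVT_max ab cf; exists (normc (f c)); first exact: normc_ge0.
by move=> t tab; apply: fM; rewrite in_itv.
Qed.

Lemma segcontV (f : R -> C) rho a b : 0 < rho -> segcont f a b ->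
  (forall t, a <= t <= b -> rho <= normc (f t)) -> segcont (fun t => (f t)^-1) a b.
Proof.
move=> rho0 fc fr t tab e e0.
have [d d0 fd] := fc t tab (e * rho ^+ 2) ltac:(by rewrite mulr_gt0// exprn_gt0).
exists d => // s sab sd.
have fs := fr s sab; have ft := fr t tab.
have ns : f s != 0 by rewrite -normc_gt0 (lt_le_trans rho0).
have nt : f t != 0 by rewrite -normc_gt0 (lt_le_trans rho0).
have -> : (f s)^-1 - (f t)^-1 = - (f s - f t) * (f s * f t)^-1.
  by field; rewrite ns nt.
rewrite normcM normcN normcV normcM ler_pdivrMr ?mulr_gt0 ?normc_gt0//.
rewrite (le_trans (fd s sab sd))// ler_wpM2l ?(ltW e0)// expr2.
by rewrite ler_pM// ltW.
Qed.

(** The identity 1/(zeta - v) - 1/(zeta - w) = (v - w) / ((zeta - v) (zeta - w)) displays the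
    Caratheodory slope as an integral. Its continuity at w follows from the uniform bound (2 /
    rho)^3 on products of three kernels. *)
Lemma cint_kernel_cdiff (g zeta : R -> C) rho a b w : a <= b -> 0 < rho ->
  segcont g a b -> segcont zeta a b ->
  (forall t, a <= t <= b -> rho <= normc (zeta t - w)) ->
  cdiff (fun w => cint (fun t => g t * (zeta t - w)^-1) a b) w.
Proof.
move=> ab rho0 gc zc far.
have [M M0 gM] := segcont_bounded ab gc.
have r20 : 0 < rho / 2 by rewrite divr_gt0.
have far' v : normc (v - w) < rho / 2 -> forall t, a <= t <= b ->
    rho / 2 <= normc (zeta t - v).
  move=> vw t /far h; have := normc_sub_le (zeta t - w) (v - w).
  by rewrite opprB addrA subrK => h'; clear -vw h h'; lra.
have zcv v : segcont (fun t => zeta t - v) a b.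
  by apply: segcontD => //; exact: segcont_cst.
have kc v : normc (v - w) < rho / 2 -> segcont (fun t => (zeta t - v)^-1) a b.
  by move=> vw; apply: (segcontV r20) => //; exact: far'.
have ww : normc (w - w) < rho / 2 by rewrite subrr normc0.
have nz v t : normc (v - w) < rho / 2 -> a <= t <= b -> zeta t - v != 0.
  by move=> vw tab; rewrite -normc_gt0 (lt_le_trans r20)// far'.
pose phi v := cint (fun t => g t * ((zeta t - w)^-1 * (zeta t - v)^-1)) a b.
have phic v : normc (v - w) < rho / 2 ->
   segcont (fun t => g t * ((zeta t - w)^-1 * (zeta t - v)^-1)) a b.
  by move=> vw; apply: segcontM => //; apply: segcontM; exact: kc.
exists phi; split; last first.
  exists (rho / 2) => // v vw; apply/eqP; rewrite addrC -subr_eq; apply/eqP.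
  rewrite [RHS]mulrC -[RHS]cintZ; last exact: phic.
  have gk u : normc (u - w) < rho / 2 -> segcont (fun t => g t * (zeta t - u)^-1) a b.
    by move=> uw; apply: segcontM => //; exact: kc.
  rewrite -(cintB (gk v vw) (gk w ww)).
  by apply: eq_cint => t tab; field; rewrite !nz.
move=> e e0.
pose B := M * ((rho / 2)^-1 ^+ 3) * (b - a) + 1.
have B0 : 0 < B by rewrite ltr_wpDl// !mulr_ge0 ?subr_ge0// ?exprn_ge0// ?invr_ge0 ltW.
have [d [d0 d1 d2 _ _]] := @exists_min4 R (rho / 2) (e / (2 * B)) 1 1 r20
  ltac:(by rewrite divr_gt0// mulr_gt0) ltr01 ltr01.
exists d => // v vd; have vw := lt_le_trans vd d1.
rewrite /phi -(cintB (phic v vw) (phic w ww)).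
rewrite (le_trans (cint_le (M := M * ((rho / 2)^-1 ^+ 3) * normc (v - w)) ab _ _))//.
- apply: segcontD; first exact: phic.
  apply: (@segcont_eq _ (fun t => -1 * (g t * ((zeta t - w)^-1 * (zeta t - w)^-1)))).
    by move=> *; rewrite mulN1r.
  by apply: segcontM; [exact: segcont_cst|exact: phic].
- move=> t tab.
  have -> : g t * ((zeta t - w)^-1 * (zeta t - v)^-1) -
    g t * ((zeta t - w)^-1 * (zeta t - w)^-1) =
    g t * ((zeta t - w)^-1 * (zeta t - w)^-1 * (zeta t - v)^-1) * (v - w).
    by field; rewrite !nz.
  rewrite normcM ler_wpM2r ?normc_ge0// normcM ler_pM ?normc_ge0//; first exact: gM.
  rewrite !normcM !normcV !exprSr expr0 mul1r.
  by rewrite !ler_pM// ?mulr_ge0 ?invr_ge0 ?normc_ge0// lef_pV2 ?posrE ?far'// (lt_le_trans r20)// far'.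
have : normc (v - w) * (2 * B) <= e.
  by rewrite -ler_pdivlMr ?mulr_gt0// ltW// (lt_le_trans vd).
apply: le_trans.
have -> : 2 * (M * (rho / 2)^-1 ^+ 3 * normc (v - w)) * (b - a) =
  normc (v - w) * (2 * (M * (rho / 2)^-1 ^+ 3 * (b - a))) by ring.
by rewrite ler_wpM2l ?normc_ge0// ler_wpM2l// lerDl.
Qed.

Lemma oint_kernel_cdiff F rho x0 x1 y0 y1 w : x0 <= x1 -> y0 <= y1 -> 0 < rho ->
  boundary_cont F x0 x1 y0 y1 ->
  (forall x y, x0 <= x <= x1 -> y0 <= y <= y1 -> x = x0 \/ x = x1 \/ y = y0 \/ y = y1 ->
     rho <= normc (Complex x y - w)) ->
  cdiff (fun w => oint (fun z => F z * (z - w)^-1) x0 x1 y0 y1) w.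
Proof.
move=> x01 y01 rho0 [Fx Fy] far; rewrite /oint.
have idh y a b : segcont (fun x : R => Complex x y : C) a b.
  by apply: (@segcont_hor _ id) => x _; exact: ccont_id.
have idv x a b : segcont (fun y : R => Complex x y : C) a b.
  by apply: (@segcont_ver _ id) => y _; exact: ccont_id.
apply: cdiffD; last apply: cdiffM; try apply: cdiffB; try exact: cdiff_cst;
 apply: (@cint_kernel_cdiff _ _ rho) => //.
- by apply: segcont_hor => x /Fx[].
- by move=> t tt; apply: far; rewrite ?lexx//; tauto.
- by apply: segcont_hor => x /Fx[].
- by move=> t tt; apply: far; rewrite ?lexx ?y01//; tauto.
- by apply: segcont_ver => x /Fy[].
- by move=> t tt; apply: far; rewrite ?lexx ?x01//; tauto.
- by apply: segcont_ver => x /Fy[].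
- by move=> t tt; apply: far; rewrite ?lexx//; tauto.
Qed.

(** Cauchy's formula passes to the limit on a small square: near z0, F w is the contour integral of
    F z / (z - w) divided by that of 1 / (z - w). Both depend differentiably on w, and the divisor
    has norm at least 4. *)
Lemma uniform_limit_cdiff (Fn : nat -> C -> C) F z0 r : 0 < r ->
  (forall n z, normc (z - z0) < r -> cdiff (Fn n) z) ->
  (forall e, 0 < e -> exists n, forall z, normc (z - z0) < r -> normc (Fn n z - F z) <= e) ->
  cdiff F z0.
Proof.
move=> r0 Fd FF.
have Fc z : normc (z - z0) < r -> ccont F z.
  move=> zr e e0; have e30 : 0 < e / 3 by rewrite divr_gt0.
  have [n Fn3] := FF _ e30; have [d d0 Fnc] := cdiff_ccont (Fd n z zr) e30.
  have rz0 : 0 < r - normc (z - z0) by rewrite subr_gt0.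
  exists (Num.min d (r - normc (z - z0))) => [|w]; first by rewrite lt_min d0.
  rewrite lt_min => /andP[wd wz].
  have wr : normc (w - z0) < r.
    have -> : w - z0 = (w - z) + (z - z0) by ring.
    by rewrite (le_lt_trans (le_normcD _ _))// -ltrBrDr.
  have -> : F w - F z = - (Fn n w - F w) + (Fn n w - Fn n z) + (Fn n z - F z) by ring.
  rewrite (le_trans (le_normcD _ _))// (le_trans (lerD (le_normcD _ _) (lexx _)))//.
  rewrite normcN; have := Fn3 _ wr; have := Fn3 _ zr; have := Fnc _ wd.
  by clear; lra.
case: z0 r0 Fd FF Fc => p q; set z0 := Complex p q => r0 Fd FF Fc.
(* The square of half-side a then lies in the disc of radius r, and the points at distance less than
   a / 2 from the centre are at distance at least a / 2 from its boundary. *)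
pose a := r / 4; have a0 : 0 < a by rewrite divr_gt0.
have er : r = 4 * a by rewrite /a mulrC divfK.
clearbody a; subst r.
have xx : p - a <= p + a by clear -a0; lra.
have yy : q - a <= q + a by clear -a0; lra.
have rect x y : p - a <= x <= p + a -> q - a <= y <= q + a ->
    normc (Complex x y - z0) < 4 * a.
  move=> /andP[h1 h2] /andP[h3 h4].
  rewrite (le_lt_trans (normc_le_ReIm _))//=.
  have : `|x - p| <= a by rewrite ler_norml; apply/andP; clear -h1 h2; split; lra.
  have : `|y - q| <= a by rewrite ler_norml; apply/andP; clear -h3 h4; split; lra.
  by clear -a0; lra.
have bF G : (forall z, normc (z - z0) < 4 * a -> ccont G z) ->
    boundary_cont G (p - a) (p + a) (q - a) (q + a).
  by move=> Gc; split=> s hs; split; apply: Gc; apply: rect; rewrite ?lexx ?xx ?yy.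
have a20 : 0 < a / 2 by rewrite divr_gt0.
have far w x y : normc (w - z0) < a / 2 ->
    x = p - a \/ x = p + a \/ y = q - a \/ y = q + a ->
    a / 2 <= normc (Complex x y - w).
  move=> wa h; have := normc_sub_le (Complex x y - z0) (w - z0).
  rewrite opprB addrA subrK => h'.
  suff : a <= normc (Complex x y - z0) by clear -wa h'; lra.
  have hx := Re_le_normc (Complex x y - z0); have hy := Im_le_normc (Complex x y - z0).
  rewrite /= in hx hy; move: h => [e|[e|[e|e]]]; subst.
  - by rewrite (le_trans _ hx)// addrAC subrr sub0r normrN ler_norm.
  - by rewrite (le_trans _ hx)// addrAC subrr add0r ler_norm.
  - by rewrite (le_trans _ hy)// addrAC subrr sub0r normrN ler_norm.
  - by rewrite (le_trans _ hy)// addrAC subrr add0r ler_norm.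
have kcont w x y : normc (w - z0) < a / 2 ->
    x = p - a \/ x = p + a \/ y = q - a \/ y = q + a ->
    ccont (fun z => (z - w)^-1) (Complex x y).
  move=> wa h; apply/cdiff_ccont/kernel_cdiff.
  by rewrite -subr_eq0 -normc_gt0 (lt_le_trans a20)// far.
have bK G w : normc (w - z0) < a / 2 ->
    boundary_cont G (p - a) (p + a) (q - a) (q + a) ->
    boundary_cont (fun z => G z * (z - w)^-1) (p - a) (p + a) (q - a) (q + a).
  move=> wa [Gx Gy]; split=> s hs; split; apply: ccontM;
   try (by apply: kcont => //; tauto);
   first [by case: (Gx s hs)|by case: (Gy s hs)].
have key w : normc (w - z0) < a / 2 ->
   oint (fun z => F z * (z - w)^-1) (p - a) (p + a) (q - a) (q + a) =
    F w * oint (fun z => (z - w)^-1) (p - a) (p + a) (q - a) (q + a) /\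
   4 <= normc (oint (fun z => (z - w)^-1) (p - a) (p + a) (q - a) (q + a)).
  move=> wa.
  have [w1 w2 w3 w4] : [/\ p - a < complex.Re w, complex.Re w < p + a,
      q - a < complex.Im w & complex.Im w < q + a].
    have := le_lt_trans (Re_le_normc _) wa; have := le_lt_trans (Im_le_normc _) wa.
    case: (w) => u v /=; rewrite !ltr_norml => /andP[h1 h2] /andP[h3 h4].
    by clear -h1 h2 h3 h4 a0; split; lra.
  have cf n := cauchy_formula w1 w2 w3 w4 (fun x y hx hy => Fd n _ (rect x y hx hy)).
  rewrite -[Complex _ _](_ : w = _) in cf; last by case: (w).
  split; last exact: (cf 0%N).2.
  set K := oint (fun z => (z - w)^-1) _ _ _ _.
  apply/eqP; rewrite -subr_eq0 -normc_eq0; apply/negPn/negP => ne.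
  have N0 : 0 < normc (oint (fun z => F z * (z - w)^-1) (p - a) (p + a) (q - a) (q + a) - F w * K).
    by rewrite lt_neqAle eq_sym ne normc_ge0.
  set N := normc _ in N0.
  (* The integral of (F - Fn) / (z - w) is at most 32 e: the constant 4 of [oint_le], the kernel
     bound 2 / a, and width plus height 4 a. The term (Fn w - F w) K adds e |K|. *)
  have K0 : 0 < 32 + normc K + 1 by rewrite ltr_wpDl// addr_ge0 ?normc_ge0.
  have e0 : 0 < N / (32 + normc K + 1) by rewrite divr_gt0.
  set e := _ / _ in e0; have [n Fe] := FF _ e0.
  have Nle : N <= e * (32 + normc K).
    have bFn := bF _ (fun z hz => cdiff_ccont (Fd n z hz)).
    have -> : N = normc (oint (fun z => (F z - Fn n z) * (z - w)^-1) (p - a) (p + a) (q - a) (q + a)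
       + (Fn n w - F w) * K).
      rewrite /N; congr normc.
      rewrite (_ : (fun z => (F z - Fn n z) * _) = (fun z => F z * (z - w)^-1 - Fn n z * (z - w)^-1)); last first.
        by apply/funext => z; rewrite mulrBl.
      rewrite ointB; [|exact: bK (bF _ Fc)|exact: bK bFn].
      by rewrite (cf n).1 -/K; ring.
    rewrite (le_trans (le_normcD _ _))// [leRHS]mulrDr lerD//.
      have bD : boundary_cont (fun z => F z - Fn n z) (p - a) (p + a) (q - a) (q + a).
        by apply: bF => z hz; apply: ccontB; [exact: Fc|exact/cdiff_ccont/Fd].
      rewrite (le_trans (oint_le (M := e * (a / 2)^-1) _ _ (bK _ _ wa bD) _))//.
        move=> x y hx hy hb; rewrite normcM normcV ler_pM ?invr_ge0 ?normc_ge0//.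
          by rewrite normcB Fe// rect.
        have fr := far w x y wa hb.
        by rewrite lef_pV2 ?posrE// (lt_le_trans a20).
      have -> : p + a - (p - a) + (q + a - (q - a)) = 4 * a by clear; ring.
      have -> : 4 * (e * (a / 2)^-1) * (4 * a) = e * 32 by field; rewrite gt_eqF.
      by [].
    rewrite normcM ler_wpM2r ?normc_ge0// Fe//.
    by rewrite (lt_trans wa)//; clear -a0; lra.
  have : N = e * (32 + normc K + 1) by rewrite /e divfK// gt_eqF.
  by clear -Nle e0; rewrite mulrDr mulr1; lra.
pose Kf w := oint (fun z => 1 * (z - w)^-1) (p - a) (p + a) (q - a) (q + a).
have Ke w : Kf w = oint (fun z => (z - w)^-1) (p - a) (p + a) (q - a) (q + a).
  rewrite /Kf (_ : (fun z => 1 * (z - w)^-1) = (fun z => (z - w)^-1))//.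
  by apply/funext => z; rewrite mul1r.
apply: (@cdiff_near _ (fun w => oint (fun z => F z * (z - w)^-1) (p - a) (p + a) (q - a) (q + a) * (Kf w)^-1) _ _ (a / 2)) => //.
  move=> w wa; have [-> K4] := key w wa; rewrite Ke mulfK//.
  by rewrite -normc_gt0 (lt_le_trans _ K4).
have zz : normc (z0 - z0) < a / 2 by rewrite subrr normc0.
have kd G : (forall z, normc (z - z0) < 4 * a -> ccont G z) ->
    cdiff (fun w => oint (fun z => G z * (z - w)^-1) (p - a) (p + a) (q - a) (q + a)) z0.
  by move=> Gc; apply: (@oint_kernel_cdiff _ (a / 2)) => // [|x y hx hy hb]; [exact: bF|exact: far].
apply: cdiffM; first exact: kd Fc.
apply: cdiffV; first by rewrite Ke -normc_gt0 (lt_le_trans _ (key z0 zz).2).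
by apply: kd => z _; exact: ccont_cst.
Qed.

End weierstrass.

(** * Identity principle along the real axis *)

Section identity_principle.
Variable R : realType.
Local Notation C := R[i].
Local Notation "''i'" := (Complex 0 1 : C).
Implicit Types (F G : C -> C) (z w : C) (x y : R).

(* A function that vanishes on the real axis stays holomorphic when it is
   replaced by 0 on the lower half-plane: on the real axis its derivative is
   already 0 along the real direction. *)
Lemma half_cut_cdiff F r : (forall z, normc z < r -> cdiff F z) ->
  (forall x, `|x| < r -> F x%:C%C = 0) ->
  forall z, normc z < r ->
  cdiff (fun w => if 0 <= complex.Im w then F w else 0) z.
Proof.
move=> Fd F0 z zr.
have [z0|z0|z0] := ltgtP 0 (complex.Im z).
- apply: (@cdiff_near _ F _ _ (complex.Im z)) => //; last exact: Fd.
  move=> w wz; rewrite ifT//.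
  have := le_lt_trans (Im_le_normc _) wz.
  by case: (w) (z) {wz} => ? ? [? ?] /=; rewrite ltr_norml => /andP[]; clear; lra.
- apply: (@cdiff_near _ (fun=> 0) _ _ (- complex.Im z)) => //; [by rewrite oppr_gt0| |exact: cdiff_cst].
  move=> w wz; rewrite ifF//; apply/negbTE; rewrite -ltNge.
  have := le_lt_trans (Im_le_normc _) wz.
  by case: (w) (z) {wz} => ? ? [? ?] /=; rewrite ltr_norml => /andP[]; clear; lra.
have zE : z = (complex.Re z)%:C%C by case: (z) z0 => u v /= <-.
have Fz0 : F z = 0.
  by rewrite zE F0// (le_lt_trans (Re_le_normc _)).
have [phi [pc [d d0 Fr]]] := Fd z zr.
have phi0 : phi z = 0.
  apply/eqP; rewrite -normc_eq0; apply/negPn/negP => ne.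
  have n0 : 0 < normc (phi z) by rewrite lt_neqAle eq_sym ne normc_ge0.
  have [e e0 pe] := pc (normc (phi z) / 2) ltac:(by rewrite divr_gt0).
  have rz : 0 < r - normc z by rewrite subr_gt0.
  have [t [t0 t1 t2 t3 _]] := @exists_min4 R (d / 2) (e / 2) ((r - normc z) / 2) 1
    ltac:(by rewrite divr_gt0) ltac:(by rewrite divr_gt0) ltac:(by rewrite divr_gt0) ltr01.
  have wz : z + t%:C%C - z = t%:C%C by rewrite addrC addKr.
  have nt : normc (z + t%:C%C - z) = t by rewrite wz normc_real gtr0_norm.
  have Fw : F (z + t%:C%C) = 0.
    rewrite zE -rmorphD F0//.
    have /= := Re_le_normc (z + t%:C%C); rewrite raddfD/= => h.
    rewrite (le_lt_trans h)// (le_lt_trans (le_normcD _ _))// normc_real gtr0_norm//.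
    by clear -t0 t3 rz; lra.
  have := Fr (z + t%:C%C); rewrite nt Fw Fz0 add0r => /(_ ltac:(by clear -t0 t1 d0; lra))/esym/eqP.
  rewrite mulf_eq0 => /orP[/eqP p0|]; last by rewrite -normc_eq0 nt gt_eqF.
  have := pe (z + t%:C%C); rewrite nt p0 sub0r normcN => /(_ ltac:(by clear -t0 t2 e0; lra)).
  by clear -n0; lra.
exists (fun w => if 0 <= complex.Im w then phi w else 0); split; last first.
  exists d => // w wd; rewrite -z0 lexx Fz0; case: ifPn => h; last by rewrite mul0r addr0.
  by rewrite Fr// Fz0.
move=> e e0; have [q q0 pq] := pc e e0; exists q => // w wq.
rewrite -z0 lexx; case: ifPn => h; first exact: pq.
by rewrite phi0 subrr normc0 ltW.
Qed.

(* K z = F (- z^2) vanishes on the real axis, so its restriction Kt to the upper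
   half-plane, extended by 0, is holomorphic. For c = 'i y, each side of the
   square of half-side 2 y is carried into the lower half-plane by one of the
   maps z |-> c + 'i^k z, so the product of the four Kt (c + 'i^k z) vanishes on
   the boundary, hence at the centre, where it is F (y^2)^4. *)
Lemma cdiff_vanish F r : 0 < r -> (forall z, normc z < r -> cdiff F z) ->
  (forall x, - r < x <= 0 -> F x%:C%C = 0) ->
  exists2 d, 0 < d & forall x, 0 <= x < d -> F x%:C%C = 0.
Proof.
move=> r0 Fd F0.
have [s [s0 s1 s2 _ _]] := @exists_min4 R 1 r 1 1 ltr01 r0 ltr01 ltr01.
pose K z := F (- z ^+ 2).
have zs z : normc z < s -> normc (- z ^+ 2) < r.
  move=> zs; rewrite normcN normcX expr2 (lt_le_trans _ s2)//.
  rewrite (le_lt_trans _ zs)// ler_piMr ?normc_ge0// (le_trans (ltW zs))//.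
have Kd z : normc z < s -> cdiff K z.
  move=> h; apply: (@cdiff_comp _ F (fun z => - z ^+ 2)); last exact/Fd/zs.
  apply: cdiffN; apply: (@cdiff_near _ (fun w => w * w) _ _ 1) => //.
  by apply: cdiffM; exact: cdiff_id.
have K0 x : `|x| < s -> K x%:C%C = 0.
  move=> xs; rewrite /K -rmorphXn -rmorphN F0//.
  have := zs x%:C%C; rewrite normcN normcX normc_real => /(_ xs).
  by rewrite real_normK ?num_real// => h; rewrite ltrNl opprK h oppr_le0 sqr_ge0.
pose Kt w := if 0 <= complex.Im w then K w else 0.
have Ktd := half_cut_cdiff Kd K0.
(* For x = y^2 with y < s / 8, the points of the square have norm at most 4 y, so the four arguments
   c + 'i^k z have norm at most 5 y < s. *)
exists ((s / 8) ^+ 2); first by rewrite exprn_gt0// divr_gt0.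
move=> X /andP[X0 Xs].
pose y := Num.sqrt X.
have [->|Xn] := eqVneq X 0; first by rewrite F0// lexx oppr_lt0 r0.
have y0 : 0 < y by rewrite sqrtr_gt0 lt_neqAle eq_sym Xn.
have yX : y ^+ 2 = X by rewrite sqr_sqrtr.
have ys : y < s / 8.
  by rewrite -(@ltr_pXn2r _ 2)// ?nnegrE ?ltW// ?yX// divr_gt0.
have s8 : 8 * y < s by rewrite mulrC -ltr_pdivlMr.
pose c : C := Complex 0 y.
pose G z := (Kt (c + z) * Kt (c + 'i * z)) * (Kt (c - z) * Kt (c - 'i * z)).
have nc : normc c = y by rewrite normc_imag gtr0_norm.
have rect u v : - (2 * y) <= u <= 2 * y -> - (2 * y) <= v <= 2 * y ->
   normc (Complex u v) <= 4 * y.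
  move=> hu hv; rewrite (le_trans (normc_le_ReIm _))//=.
  have : `|u| <= 2 * y by rewrite ler_norml.
  have : `|v| <= 2 * y by rewrite ler_norml.
  by clear; lra.
have Gd u v : - (2 * y) <= u <= 2 * y -> - (2 * y) <= v <= 2 * y ->
   cdiff G (Complex u v).
  move=> hu hv; set z := Complex u v; have zy := rect u v hu hv; rewrite -/z in zy.
  have lin (k : C) : normc k = 1 -> cdiff (fun z => Kt (c + k * z)) z.
    move=> k1; apply: (@cdiff_comp _ Kt (fun z => c + k * z)).
      apply: cdiffD; [exact: cdiff_cst|apply: cdiffM; [exact: cdiff_cst|exact: cdiff_id]].
    apply: Ktd; rewrite (le_lt_trans (le_normcD _ _))// normcM k1 mul1r nc.
    by clear -zy s8 y0; lra.
  have l1 := lin 1 (@normc1 R); have l2 := lin 'i (@normc_i R).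
  have l3 := lin (-1) ltac:(by rewrite normcN normc1).
  have l4 := lin (- 'i) ltac:(by rewrite normcN normc_i).
  apply: cdiffM; apply: cdiffM => //.
  - by apply: cdiff_near l1 => // w _; rewrite mul1r.
  - by apply: (cdiff_near ltr01) l3 => w _; rewrite mulN1r.
  - by apply: (cdiff_near ltr01) l4 => w _; rewrite mulNr.
have y2 : 0 < 2 * y by rewrite mulr_gt0.
have y2N : - (2 * y) < 0 by rewrite oppr_lt0.
have [E1 E2] := cauchy_formula y2N y2 y2N y2 Gd.
have Gb u v : - (2 * y) <= u <= 2 * y -> - (2 * y) <= v <= 2 * y ->
   u = - (2 * y) \/ u = 2 * y \/ v = - (2 * y) \/ v = 2 * y ->
   G (Complex u v) = 0.
  move=> _ _ hb; rewrite /G /Kt.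
  have -> : complex.Im (c + Complex u v) = y + v by [].
  have -> : complex.Im (c - Complex u v) = y - v by [].
  have -> : complex.Im (c + 'i * Complex u v) = y + u by rewrite /= mul0r mul1r add0r.
  have -> : complex.Im (c - 'i * Complex u v) = y - u by rewrite /= mul0r mul1r add0r.
  have neg : 0 <= - y = false by rewrite oppr_ge0 leNgt y0.
  have e1 : y - 2 * y = - y by clear; ring.
  by case: hb => [->|[->|[->|->]]]; rewrite e1 neg !(mul0r, mulr0).
rewrite (@eq_oint _ _ (fun=> 0 * 0)) in E1; [|exact: ltW (lt_trans y2N y2)..|]; last first.
  by move=> u v hu hv hb; rewrite Gb// !mul0r.
rewrite (@ointZ _ (fun=> 0) 0) ?mul0r in E1; last by split=> s' _; split; exact: ccont_cst.
have := E1 => /esym/eqP; rewrite mulf_eq0 -[X in _ || X]normc_eq0 [X in _ || X]gt_eqF ?orbF//; last exact: lt_le_trans E2.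
have -> : Complex 0 0 = 0 :> C by [].
rewrite /G !mulr0 !addr0 !subr0 -expr2 -expr2 expf_eq0 expf_eq0 /= => /eqP.
rewrite /Kt /= (ltW y0) /K.
by have -> : - c ^+ 2 = X%:C%C; first by
  rewrite -yX expr2 /c; apply/eqP; rewrite eq_complex /= !mul0r !mulr0 addr0 sub0r opprK expr2 eqxx oppr0 eqxx.
Qed.

End identity_principle.

(** * The complex exponential and logarithm *)

Lemma derive_expansion (R : realType) (f : R -> R) (a c : R) : is_derive a 1 f c ->
  forall e, 0 < e -> exists2 d, 0 < d & forall t, `|t| < d -> `|f (t + a) - f a - c * t| <= e * `|t|.
Proof.
move=> fc e e0.
have cv : h^-1 *: (f (h *: 1 + a) - f a) @[h --> 0^'] --> c.
  by rewrite -(@derive_val _ _ _ _ _ _ _ fc); exact: (@ex_derive _ _ _ _ _ _ _ fc).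
have /cvgrPdist_le/(_ _ e0)[d /= d0 hd] := cv; exists d => // t td.
have [->|t0] := eqVneq t 0; first by rewrite add0r subrr mulr0 subr0 normr0 mulr0.
have := hd t; rewrite /ball_ /= sub0r normrN => /(_ td t0).
rewrite distrC [t *: 1]mulr1 => h.
have -> : f (t + a) - f a - c * t = (t^-1 *: (f (t + a) - f a) - c) * t.
  by rewrite mulrBl -[t^-1 *: _]/(t^-1 * _) mulrAC mulVf// mul1r.
by rewrite normrM ler_wpM2r.
Qed.

Section complex_exponential.
Variable R : realType.
Local Notation C := R[i].
Implicit Types (z w h : C) (a b : R).

Definition cexp z : C := Complex (expR (complex.Re z) * cos (complex.Im z))
  (expR (complex.Re z) * sin (complex.Im z)).

Lemma cexpD z w : cexp (z + w) = cexp z * cexp w.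
Proof.
case: z w => [a b] [c d]; rewrite /cexp /= cosD sinD expRD.
by apply/eqP; rewrite eq_complex /=; apply/andP; split; apply/eqP; ring.
Qed.

Lemma cexp_real a : cexp a%:C%C = (expR a)%:C%C.
Proof. by rewrite /cexp /= cos0 sin0 mulr1 mulr0. Qed.

Lemma cexp0 : cexp 0 = 1.
Proof. by rewrite (cexp_real 0) expR0. Qed.

Lemma cexpN z : cexp z * cexp (- z) = 1.
Proof. by rewrite -cexpD subrr cexp0. Qed.

Lemma cexp_neq0 z : cexp z != 0.
Proof.
by apply/eqP => h; have := cexpN z; rewrite h mul0r => /esym/eqP; rewrite oner_eq0.
Qed.

Lemma cexp_near e : 0 < e -> exists2 d, 0 < d &
  forall h, normc h < d -> normc (cexp h - 1 - h) <= e * normc h.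
Proof.
move=> e0.
(* 8 = 1 + 2 + 5, the coefficients of the bounds [r1] and [r2] on the real and imaginary parts. *)
have [e8 [e80 h8 hl1 _ _]] := @exists_min4 R (e / 8) 1 1 1 ltac:(by rewrite divr_gt0) ltr01 ltr01 ltr01.
have [d1 d10 hexp] := derive_expansion (is_derive_expR (0 : R)) e80.
have [d2 d20 hcos] := derive_expansion (is_derive_cos (0 : R)) e80.
have [d3 d30 hsin] := derive_expansion (is_derive_sin (0 : R)) e80.
have [d [d0 dd1 dd2 dd3 dd4]] := exists_min4 d10 d20 d30 e80.
exists d => // -[a b] hn.
have ha : `|a| < d := le_lt_trans (Re_le_normc (Complex a b)) hn.
have hb : `|b| < d := le_lt_trans (Im_le_normc (Complex a b)) hn.
have := hexp a (lt_le_trans ha dd1); rewrite addr0 expR0 mul1r => ea.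
have := hcos b (lt_le_trans hb dd2); rewrite addr0 cos0 sin0 oppr0 mul0r subr0 => cb.
have := hsin b (lt_le_trans hb dd3); rewrite addr0 sin0 cos0 mul1r subr0 => sb.
have an := Re_le_normc (Complex a b); have bn := Im_le_normc (Complex a b).
rewrite /= in an bn.
have -> : cexp (Complex a b) - 1 - Complex a b =
    Complex (expR a * cos b - 1 - a) (expR a * sin b - b).
  by apply/eqP; rewrite eq_complex /= subr0 !eqxx.
rewrite (le_trans (normc_le_ReIm _))//=.
have c1 : `|cos b| <= 1 by rewrite ler_norml cos_geN1 cos_le1.
have r1 : `|expR a * cos b - 1 - a| <= e8 * `|a| + 2 * (e8 * `|b|).
  have -> : expR a * cos b - 1 - a = (expR a - 1 - a) * cos b + (1 + a) * (cos b - 1) by ring.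
  rewrite (le_trans (ler_normD _ _))// !normrM lerD//.
    by rewrite -[leRHS]mulr1 ler_pM.
  rewrite ler_pM//.
  by rewrite (le_trans (ler_normD _ _))// normr1; lra.
have r2 : `|expR a * sin b - b| <= 5 * (e8 * `|b|).
  have -> : expR a * sin b - b = (expR a - 1) * sin b + (sin b - b) by ring.
  have q1 : `|expR a - 1| <= 2 * e8.
    have -> : expR a - 1 = (expR a - 1 - a) + a by ring.
    rewrite (le_trans (ler_normD _ _))//.
    have h1 : e8 * `|a| <= 1 * `|a| by rewrite ler_wpM2r.
    by have h2 := le_trans (ltW ha) dd4; clear -ea h1 h2; lra.
  have q2 : `|sin b| <= 2 * `|b|.
    have -> : sin b = (sin b - b) + b by ring.
    rewrite (le_trans (ler_normD _ _))//.
    have h1 : e8 * `|b| <= 1 * `|b| by rewrite ler_wpM2r.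
    by clear -sb h1; lra.
  have h := ler_pM (normr_ge0 _) (normr_ge0 _) q1 q2.
  have e2 : 2 * e8 * (2 * `|b|) = 4 * (e8 * `|b|) by ring.
  rewrite e2 in h.
  by rewrite (le_trans (ler_normD _ _))// normrM (le_trans (lerD h sb))//; clear; lra.
have n0 := normc_ge0 (Complex a b).
have k1 : e8 * `|a| <= e8 * normc (Complex a b) by rewrite ler_wpM2l// ltW.
have k2 : e8 * `|b| <= e8 * normc (Complex a b) by rewrite ler_wpM2l// ltW.
have k3 : e8 * normc (Complex a b) <= e / 8 * normc (Complex a b) by rewrite ler_wpM2r.
rewrite (le_trans (lerD r1 r2))//; clear -k1 k2 k3; lra.
Qed.

Definition cexp_slope z w : C :=
  cexp z * (if w == z then 1 else (cexp (w - z) - 1) / (w - z)).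

Lemma cexp_slopeE z w : cexp w = cexp z + cexp_slope z w * (w - z).
Proof.
rewrite /cexp_slope; case: eqVneq => [->|wz]; first by rewrite subrr mulr0 addr0.
rewrite -mulrA divfK ?subr_eq0// mulrBr mulr1 -cexpD addrC.
by rewrite [_ + (w - z)]addrC !subrK.
Qed.

Lemma cexp_slope_cont z : ccont (cexp_slope z) z.
Proof.
apply: ccontM; first exact: ccont_cst.
move=> e e0; have [d d0 hd] := cexp_near e0; exists d => // w wz; rewrite eqxx.
case: (eqVneq w z) => [_|wz']; first by rewrite subrr normc0 ltW.
have wz0 : w - z != 0 by rewrite subr_eq0.
have -> : (cexp (w - z) - 1) / (w - z) - 1 = (cexp (w - z) - 1 - (w - z)) / (w - z).
  by rewrite [RHS]mulrBl mulfV.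
by rewrite normcM normcV ler_pdivrMr ?normc_gt0// hd.
Qed.

Lemma cexp_cdiff z : cdiff cexp z.
Proof.
exists (cexp_slope z); split; first exact: cexp_slope_cont.
by exists 1 => // w _; exact: cexp_slopeE.
Qed.

(** A continuous local right inverse is differentiable, its slope being the reciprocal of the slope
    of F. *)
Lemma cdiff_inverse (F g phi : C -> C) z r : 0 < r ->
  (forall w, normc (w - z) < r -> F (g w) = w) -> ccont g z -> ccont phi (g z) ->
  phi (g z) != 0 -> (forall u, F u = F (g z) + phi u * (u - g z)) -> cdiff g z.
Proof.
move=> r0 Fg gc pc p0 FE; exists (fun w => (phi (g w))^-1); split.
  by apply: ccontV => //; exact: ccont_comp.
have n20 : 0 < normc (phi (g z)) / 2 by rewrite divr_gt0// normc_gt0.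
have [d d0 hd] := ccont_comp gc pc n20.
exists (Num.min r d) => [|w]; first by rewrite lt_min r0.
rewrite lt_min => /andP[wr /hd wd].
have pw : phi (g w) != 0.
  rewrite -normc_gt0; have := normc_sub_le (phi (g z)) (phi (g w)); rewrite normcB; lra.
have := FE (g w); rewrite !Fg// ?subrr ?normc0// => e.
have -> : w - z = phi (g w) * (g w - g z) by rewrite {1}e addrC addKr.
by rewrite mulKf// addrC subrK.
Qed.

(** The principal branch on the half-plane Re > 0, where atan (Im / Re) is the argument; the leading
    multiplier lies in that half-plane. *)
Definition clog z : C := Complex (ln (normc z)) (atan (complex.Im z / complex.Re z)).

Lemma clog_real a : 0 < a -> clog a%:C%C = (ln a)%:C%C.
Proof. by move=> a0; rewrite /clog normc_real gtr0_norm//= mul0r atan0. Qed.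

Lemma clogK z : 0 < complex.Re z -> cexp (clog z) = z.
Proof.
case: z => a b /= a0; have n0 : 0 < normc (Complex a b).
  by rewrite (lt_le_trans a0)// (le_trans _ (Re_le_normc _))//= ler_norm.
rewrite /cexp /clog /= lnK ?posrE//.
set t := b / a.
have st : sin (atan t) = t * cos (atan t).
  have := atanK t; rewrite /tan => {2}<-; rewrite divfK// cos_atan invr_eq0.
  by rewrite gt_eqF// sqrtr_gt0 ltr_wpDr// sqr_ge0.
rewrite st cos_atan /t.
have -> : normc (Complex a b) = a * Num.sqrt (1 + (b / a) ^+ 2).
  rewrite -{2}(ger0_norm (ltW a0)) -sqrtr_sqr -sqrtrM ?sqr_ge0//.
  by congr Num.sqrt; rewrite mulrDr mulr1 -exprMn mulrCA mulfV ?gt_eqF// mulr1.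
have s0 : Num.sqrt (1 + (b / a) ^+ 2) != 0.
  by rewrite gt_eqF// sqrtr_gt0 ltr_wpDr// sqr_ge0.
by apply/eqP; rewrite eq_complex /=; apply/andP; split; apply/eqP; field; rewrite s0 ?gt_eqF.
Qed.

Definition rcont (u : C -> R) z := forall e, 0 < e ->
  exists2 d, 0 < d & forall w, normc (w - z) < d -> `|u w - u z| <= e.

Lemma rcont_comp (f : R -> R) (u : C -> R) z : {for u z, continuous f} -> rcont u z ->
  rcont (fun w => f (u w)) z.
Proof.
move=> fc uc e e0; have /cvgrPdist_le/(_ _ e0)[d /= d0 hd] := fc.
have d20 : 0 < d / 2 by rewrite divr_gt0.
have [r r0 hr] := uc _ d20; exists r => // w /hr wr.
rewrite distrC; apply: hd; rewrite /ball_ /= distrC (le_lt_trans wr)//.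
by rewrite ltr_pdivrMr// ltr_pMr// ltr1n.
Qed.

Lemma rcont_Complex (u v : C -> R) z : rcont u z -> rcont v z ->
  ccont (fun w => Complex (u w) (v w)) z.
Proof.
move=> uc vc e e0; have e20 : 0 < e / 2 by rewrite divr_gt0.
have [d d0 hd] := uc _ e20; have [r r0 hr] := vc _ e20.
exists (Num.min d r) => [|w]; first by rewrite lt_min d0.
rewrite lt_min => /andP[/hd wd /hr wr].
rewrite (le_trans (normc_le_ReIm _))//= (splitr e); exact: lerD.
Qed.

Lemma rcont_Re F z : ccont F z -> rcont (fun w => complex.Re (F w)) z.
Proof.
move=> Fc e e0; have [d d0 hd] := Fc e e0; exists d => // w /hd; apply: le_trans.
have := Re_le_normc (F w - F z); by case: (F w) (F z) => [? ?] [? ?].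
Qed.

Lemma rcont_Im F z : ccont F z -> rcont (fun w => complex.Im (F w)) z.
Proof.
move=> Fc e e0; have [d d0 hd] := Fc e e0; exists d => // w /hd; apply: le_trans.
have := Im_le_normc (F w - F z); by case: (F w) (F z) => [? ?] [? ?].
Qed.

Lemma clog_cont z : 0 < complex.Re z -> ccont clog z.
Proof.
move=> z0; have cstC (k : R) : rcont (fun=> k) z by move=> e e0; exists 1 => // w _; rewrite subrr normr0 ltW.
have n0 : 0 < normc z by rewrite (lt_le_trans z0)// (le_trans _ (Re_le_normc _))// ler_norm.
apply: rcont_Complex; apply: rcont_comp.
- exact: continuous_ln.
- move=> e e0; exists e => // w h; rewrite ler_norml; apply/andP; split.
    by have := normc_sub_le z w; rewrite normcB; move: h; lra.
  by have := normc_sub_le w z; move: h; lra.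
- exact: continuous_atan.
- have cRe : ccont (fun w : C => (complex.Re w)%:C%C) z.
    by apply: rcont_Complex => //; apply: rcont_Re; exact: ccont_id.
  have cIm : ccont (fun w : C => (complex.Im w)%:C%C) z.
    by apply: rcont_Complex => //; apply: rcont_Im; exact: ccont_id.
  have re0 : (complex.Re z)%:C%C != 0 :> C.
    by rewrite -normc_gt0 normc_real normr_gt0 gt_eqF.
  have := rcont_Re (ccontM cIm (ccontV re0 cRe)).
  have e (w : C) : complex.Re ((complex.Im w)%:C%C * ((complex.Re w)%:C%C)^-1) =
      complex.Im w / complex.Re w.
    by rewrite -fmorphV -rmorphM.
  by move=> h e' e0'; have [d d0 hd] := h e' e0'; exists d => // w /hd; rewrite !e.
Qed.

Lemma clog_cdiff z : 0 < complex.Re z -> cdiff clog z.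
Proof.
move=> z0; apply: (@cdiff_inverse cexp clog (cexp_slope (clog z)) z (complex.Re z)) => //.
- move=> w wz; apply: clogK; have := le_lt_trans (Re_le_normc (w - z)) wz.
  rewrite ltr_norml; case: w z {z0 wz} => [a b] [c d] /= /andP[h _]; lra.
- exact: clog_cont.
- exact: cexp_slope_cont.
- by rewrite /cexp_slope eqxx mulr1 cexp_neq0.
- by move=> u; exact: cexp_slopeE.
Qed.

End complex_exponential.

(** * Inverse branches of the intermittent map *)

Definition pt (R : realType) (x : I01 R) : R := \val x.
Arguments pt : simpl never.

Lemma pt_inj (R : realType) : injective (@pt R).
Proof. exact: val_inj. Qed.

Section branches.
Variables (R : realType) (alpha : R).
Hypothesis alpha_gt0 : 0 < alpha.
Local Notation X := (I01 R).
Implicit Types (x y : X) (s t : R) (b : bool) (w : seq bool).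

(** The intermittent map before reduction modulo 1, an increasing bijection from [0, 1] onto
    [0, 2]. *)
Definition lift s : R := s * (1 + s `^ alpha).

Lemma le_powR s t : 0 <= s -> s <= t -> s `^ alpha <= t `^ alpha.
Proof. by move=> s0 st; apply: ge0_ler_powR; rewrite ?nnegrE ?(ltW alpha_gt0)// (le_trans s0). Qed.

(** The difference is (1 + t^alpha) (t - s) + s (t^alpha - s^alpha), so the rate of expansion can be
    taken at the larger point. *)
Lemma lift_expand s t : 0 <= s -> s <= t ->
  (1 + t `^ alpha) * (t - s) <= lift t - lift s.
Proof.
move=> s0 st; have := le_powR s0 st; rewrite /lift.
have := powR_ge0 s alpha; move: (s `^ alpha) (t `^ alpha) => p q; nra.
Qed.

Lemma lift0 : lift 0 = 0. Proof. by rewrite /lift mul0r. Qed.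

Lemma lift1 : lift 1 = 2. Proof. by rewrite /lift powR1 mul1r. Qed.

Lemma lift_inj s t : 0 <= s -> 0 <= t -> lift s = lift t -> s = t.
Proof.
wlog st : s t / s <= t.
  move=> h s0 t0 e; have [/h|/ltW/h h'] := leP s t; first exact.
  by apply/esym/h'.
move=> s0 t0 e; have := lift_expand s0 st; rewrite e subrr => h.
apply/eqP; rewrite eq_le st -subr_le0 -(@pmulr_rle0 _ (1 + t `^ alpha))//.
by rewrite ltr_wpDr// powR_ge0.
Qed.

Lemma powR_continuous_gt0 t : 0 < t -> {for t, continuous (fun s => s `^ alpha)}.
Proof.
move=> t0.
have h : {for t, continuous (fun s => expR (alpha * ln s))}.
  apply: continuous_comp; last exact: continuous_expR.
  by apply: continuousM; [exact: cvg_cst|exact: continuous_ln].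
rewrite /prop_for /continuous_at {2}/powR gt_eqF//.
apply: cvg_trans h; apply: near_eq_cvg; rewrite /powR.
by near=> s; rewrite gt_eqF//; near: s; exact: lt_nbhsr.
Unshelve. all: by end_near.
Qed.

Lemma lift_continuous : {within `[0, 1], continuous lift}.
Proof.
have lc t : 0 < t -> {for t, continuous lift}.
  move=> t0; apply: continuousM; first exact: cvg_id.
  by apply: cvgD; [exact: cvg_cst|exact: powR_continuous_gt0].
apply/continuous_within_itvP => //; split.
- by move=> t; rewrite in_itv/= => /andP[t0 _]; exact: lc.
- rewrite lift0 [X in _ --> X](_ : 0 = 0 * (1 + 0)); last by rewrite mul0r.
  apply: cvgM; first exact: cvg_at_right_filter cvg_id.
  by apply: cvgD; [exact: cvg_cst|exact: powR_cvg0].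
- by apply: cvg_at_left_filter; exact: lc.
Qed.

Lemma lift_surj s : 0 <= s <= 2 -> exists2 x : X, lift (pt x) = s & true.
Proof.
move=> s02; have [||c] := @IVT _ lift 0 1 s ler01.
- exact: lift_continuous.
- by rewrite lift0 lift1 min_l// max_r.
by rewrite in_itv/= => c01 <-; exists (exist _ c (I01_mem c01)).
Qed.

(* [branch true 0] is the discontinuity of the map; by [lift_surj] the default
   value of [xget] is never used. *)
Definition branch b x : X := xget (I01_0 R) [set y : X | lift (pt y) = pt x + b%:R].

Lemma I01_ge0 x : 0 <= pt x. Proof. by have /andP[] := I01_itvP x. Qed.
Lemma I01_le1 x : pt x <= 1. Proof. by have /andP[] := I01_itvP x. Qed.
Lemma pt0 : pt (I01_0 R) = 0. Proof. by []. Qed.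
Hint Resolve I01_ge0 I01_le1 : core.

Lemma branchE b x : lift (pt (branch b x)) = pt x + b%:R.
Proof.
rewrite /branch; case: xgetP => [y _ //|] h.
have [|y yE _] := @lift_surj (pt x + b%:R).
  by have := I01_ge0 x; have := I01_le1 x; case: b {h} => /=; lra.
by have := h y.
Qed.

(** [lift_expand] gives the rate at the larger of the two preimages, which dominates the rate at
    [branch b x]. The rate degenerates to 1 at the neutral fixed point only. *)
Lemma branch_contract b x y :
  `|pt (branch b x) - pt (branch b y)| * (1 + (pt (branch b x)) `^ alpha)
    <= `|pt x - pt y|.
Proof.
have key (u v : X) : pt u <= pt v -> lift (pt v) - lift (pt u) = pt y - pt x \/
   lift (pt v) - lift (pt u) = pt x - pt y ->
   (1 + (pt v) `^ alpha) * (pt v - pt u) <= `|pt x - pt y|.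
  move=> uv h; rewrite (le_trans (lift_expand (I01_ge0 u) uv))//.
  by case: h => ->; [rewrite distrC|]; exact: ler_norm.
have [h|/ltW h] := leP (pt (branch b x)) (pt (branch b y)).
  rewrite distrC ger0_norm ?subr_ge0//.
  rewrite (le_trans _ (key _ _ h _))//; last by left; rewrite !branchE; ring.
  by rewrite mulrC ler_wpM2r ?subr_ge0// lerD2l le_powR.
rewrite ger0_norm ?subr_ge0// mulrC.
by apply: key => //; right; rewrite !branchE; ring.
Qed.

Lemma branch_le_dist b x y :
  `|pt (branch b x) - pt (branch b y)| <= `|pt x - pt y|.
Proof.
apply: le_trans (branch_contract b x y).
by rewrite ler_peMr// lerDl powR_ge0.
Qed.

Lemma branch_gt0 b x : 0 < pt x + b%:R -> 0 < pt (branch b x).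
Proof.
rewrite -branchE => h; rewrite lt_neqAle I01_ge0 andbT; apply: contraTneq h => <-.
by rewrite lift0 ltxx.
Qed.

Lemma branch_true_ge x : pt (branch true (I01_0 R)) <= pt (branch true x).
Proof.
rewrite leNgt; apply/negP => h.
have := lift_expand (I01_ge0 _) (ltW h); rewrite !branchE pt0 add0r.
have := I01_ge0 x => x0.
have : 0 < (1 + (pt (branch true (I01_0 R))) `^ alpha) *
   (pt (branch true (I01_0 R)) - pt (branch true x)).
  by rewrite mulr_gt0 ?subr_gt0// ltr_wpDr// powR_ge0.
lra.
Qed.

Lemma branch_false0 : branch false (I01_0 R) = I01_0 R.
Proof. by apply/pt_inj/lift_inj => //; rewrite branchE pt0 addr0 lift0. Qed.

Local Notation f := (@intermittent R alpha).

Definition digit x := 1 < lift (pt x).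

Lemma intermittent_lift x : pt (f x) = lift (pt x) - (digit x)%:R.
Proof.
have -> : pt (f x) = intermittent_formula alpha (pt x) := intermittentE x alpha_gt0.
rewrite /intermittent_formula -/(lift _) /digit leNgt.
by case: ifP => [/negbTE->|/negbFE ->]; rewrite ?subr0.
Qed.

Lemma branch_intermittent x : branch (digit x) (f x) = x.
Proof.
by apply/pt_inj/lift_inj => //; rewrite branchE intermittent_lift subrK.
Qed.

(** For x = 0 and b = true this fails: the discontinuity has lift 1, hence digit false and image 1.
    Identities along inverse branches thus hold off 0, which is harmless for a measure without atom
    at 0. *)
Lemma digit_branch b x : 0 < pt x -> digit (branch b x) = b.
Proof.
move=> x0; rewrite /digit branchE; case: b => /=; first by rewrite ltrDr.
by rewrite addr0 ltNge I01_le1.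
Qed.

Lemma intermittent_branch b x : 0 < pt x -> f (branch b x) = x.
Proof.
move=> x0; apply/pt_inj; rewrite intermittent_lift digit_branch// branchE.
by rewrite addrK.
Qed.

Lemma intermittent0 : f (I01_0 R) = I01_0 R.
Proof.
apply/pt_inj; rewrite intermittent_lift /digit pt0 lift0.
by rewrite ltNge ler01 subr0.
Qed.

Definition wbranch w x : X := foldr branch x w.

Definition word n x : seq bool := [seq digit (iter i f x) | i <- iota 0 n].

Lemma wordS n x : word n.+1 x = digit x :: word n (f x).
Proof.
rewrite /word /= -[1%N]addn0 iotaDl -map_comp; congr (_ :: _).
by apply: eq_map => i /=; rewrite add0n -iterSr.
Qed.

Lemma size_word n x : size (word n x) = n.
Proof. by rewrite size_map size_iota. Qed.

Lemma wbranch_word n x : wbranch (word n x) (iter n f x) = x.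
Proof.
elim: n x => [//|n IH] x.
by rewrite wordS iterSr /= IH branch_intermittent.
Qed.

Lemma wbranch_gt0 w x : 0 < pt x -> 0 < pt (wbranch w x).
Proof.
by move=> x0; elim: w => //= b w IH; apply: branch_gt0; rewrite ltr_wpDr// ler0n.
Qed.

Lemma word_wbranch w x : 0 < pt x -> word (size w) (wbranch w x) = w.
Proof.
move=> x0; elim: w => //= b w IH.
by rewrite wordS intermittent_branch ?wbranch_gt0// IH digit_branch ?wbranch_gt0.
Qed.

(* At distance more than e from each other, two points cannot both lie in
   [0, e], so that each inverse step contracts by the factor 1 + e^alpha. *)
Lemma wbranch_far e w x y : 0 < e ->
  e < `|pt (wbranch w x) - pt (wbranch w y)| ->
  `|pt (wbranch w x) - pt (wbranch w y)| * (1 + e `^ alpha) ^+ size w <= 1.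
Proof.
move=> e0; elim: w => /= [|b w IH] far.
  by rewrite mulr1 ler_norml; have := I01_ge0 x; have := I01_ge0 y; have := I01_le1 x; have := I01_le1 y; lra.
have far' := lt_le_trans far (branch_le_dist _ _ _).
apply: le_trans (IH far'); rewrite exprS mulrA ler_wpM2r//.
  by rewrite exprn_ge0// addr_ge0// powR_ge0.
have cxy := branch_contract b (wbranch w x) (wbranch w y).
have cyx := branch_contract b (wbranch w y) (wbranch w x).
rewrite distrC [leRHS]distrC in cyx.
have [h|h] : e <= pt (branch b (wbranch w x)) \/ e <= pt (branch b (wbranch w y)).
  have [?|h1] := leP e (pt (branch b (wbranch w x))); first by left.
  have [?|h2] := leP e (pt (branch b (wbranch w y))); first by right.
  have : `|pt (branch b (wbranch w x)) - pt (branch b (wbranch w y))| < e.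
    rewrite ltr_norml; have := I01_ge0 (branch b (wbranch w x)).
    have := I01_ge0 (branch b (wbranch w y)); lra.
  by move/(lt_trans far); rewrite ltxx.
- by apply: le_trans cxy; rewrite ler_wpM2l// lerD2l le_powR// ltW.
- by apply: le_trans cyx; rewrite ler_wpM2l// lerD2l le_powR// ltW.
Qed.

(** By Bernoulli's inequality (1 + e^alpha)^n exceeds 1 / e for large n, which contradicts
    [wbranch_far]. The cylinders shrink uniformly, but no rate is claimed. *)
Lemma wbranch_diam e : 0 < e -> exists n, forall w x y, (n <= size w)%N ->
  `|pt (wbranch w x) - pt (wbranch w y)| <= e.
Proof.
move=> e0; have p0 : 0 < e `^ alpha by rewrite powR_gt0.
pose n := Num.bound (e * e `^ alpha)^-1.
have hn : (e * e `^ alpha)^-1 < n%:R by apply: archi_boundP; rewrite invr_ge0 mulr_ge0 ?ltW.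
exists n => w x y nw; rewrite leNgt; apply/negP => far.
have := wbranch_far e0 far.
suff : 1 < `|pt (wbranch w x) - pt (wbranch w y)| * (1 + e `^ alpha) ^+ size w by lra.
have hb : 1 + n%:R * e `^ alpha <= (1 + e `^ alpha) ^+ size w.
  have bern m : 1 + m%:R * e `^ alpha <= (1 + e `^ alpha) ^+ m.
    elim: m => [|m IH]; first by rewrite mul0r addr0.
    rewrite exprS; have := ler_wpM2l (ltW (addr_gt0 ltr01 p0)) IH.
    rewrite -natr1; have := sqr_ge0 (e `^ alpha); have : 0 <= (m%:R : R) by [].
    move: (m%:R : R) (e `^ alpha) p0 => k p ? ? ?; nra.
  by rewrite (le_trans _ (bern _))// lerD2l (ler_wpM2r (ltW p0))// ler_nat.
have h1 : 1 < e * (n%:R * e `^ alpha).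
  by rewrite mulrCA mulrC -ltr_pdivrMl ?mulr1// mulr_gt0.
rewrite (lt_le_trans h1)// ler_pM ?(ltW e0) ?(ltW far) ?mulr_ge0 ?(ltW p0)//.
by apply: le_trans hb; rewrite lerDr.
Qed.

End branches.

(** * Transfer operators *)

Lemma exists_small_geom (R : realType) (C q e : R) : 0 <= C -> 0 <= q -> q < 1 -> 0 < e ->
  exists2 n, (0 < n)%N & C * q ^+ n <= e.
Proof.
move=> C0 q0 q1 e0.
have cv : (fun n => C * q ^+ n) @ \oo --> (0 : R).
  rewrite -[X in _ --> X](mulr0 C); apply: cvgM; first exact: cvg_cst.
  by apply: cvg_expr; rewrite ger0_norm.
have := cvgr0_norm_le _ cv _ e0 => -[N _ hN].
exists N.+1 => //; apply: le_trans (ler_norm _) _; apply: hN => /=; exact: leqnSn.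
Qed.

Section transfer.
Variables (R : realType) (alpha : R).
Hypothesis alpha_gt0 : 0 < alpha.
Local Notation X := (I01 R).
Local Notation branch := (@branch R alpha).
Local Notation wbranch := (@wbranch R alpha).

Section generic.
Variable K : numFieldType.
Implicit Types (W V : bool -> X -> K) (u v : X -> K).

Definition transfer W u : X -> K := fun x =>
  W false x * u (branch false x) + W true x * u (branch true x).

Lemma transferE W u x : transfer W u x =
  W false x * u (branch false x) + W true x * u (branch true x).
Proof. by []. Qed.

Fixpoint words n : seq (seq bool) := if n is m.+1 then
  [seq false :: w | w <- words m] ++ [seq true :: w | w <- words m] else [:: [::]].

Lemma mem_words n w : (w \in words n) = (size w == n).
Proof.
elim: n w => [|n IH] w; first by rewrite inE; case: w.
rewrite /= mem_cat; case: w => [|b w] /=.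
  by apply/negbTE; rewrite negb_or; apply/andP; split; apply/mapP => -[].
rewrite eqSS -IH; apply/orP/idP => [[/mapP[v vn [_ ->]]//|/mapP[v vn [_ ->]]//]|wn].
by case: b; [right|left]; apply/mapP; exists w.
Qed.

Fixpoint weight W w x : K := if w is b :: v then W b (wbranch v x) * weight W v x else 1.

Lemma iter_transferE W n u x : iter n (transfer W) u x =
  \sum_(w <- words n) weight W w x * u (wbranch w x).
Proof.
elim: n u => [|n IH] u; first by rewrite big_seq1 mul1r.
rewrite iterSr IH [words n.+1]/= big_cat !big_map -[RHS]big_split /=; apply: eq_bigr => w _.
by rewrite /transfer mulrDr; congr (_ + _); rewrite mulrCA mulrA.
Qed.

Lemma iter_transferD W n u v x :
  iter n (transfer W) (fun x => u x + v x) x =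
  iter n (transfer W) u x + iter n (transfer W) v x.
Proof.
by rewrite !iter_transferE -big_split; apply: eq_bigr => w _; rewrite mulrDr.
Qed.

Lemma iter_transferZ W n u (c : K) x :
  iter n (transfer W) (fun x => c * u x) x = c * iter n (transfer W) u x.
Proof.
by rewrite !iter_transferE mulr_sumr; apply: eq_bigr => w _; rewrite mulrCA.
Qed.

Lemma iter_transferB W n u v x :
  iter n (transfer W) (fun x => u x - v x) x =
  iter n (transfer W) u x - iter n (transfer W) v x.
Proof.
rewrite !iter_transferE -sumrB.
by apply: eq_bigr => w _; rewrite mulrBr.
Qed.

End generic.

Implicit Types (W V : bool -> X -> R) (u v : X -> R) (x y : X).

Lemma iter_transfer_le W V n u v : (forall b x, 0 <= W b x <= V b x) ->
  (forall x, 0 <= u x <= v x) ->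
  forall x, 0 <= iter n (transfer W) u x <= iter n (transfer V) v x.
Proof.
move=> WV uv; elim: n => [//|n IH] x; rewrite !iterS /transfer.
have := IH (branch false x); have := IH (branch true x).
have /andP[a1 a2] := WV false x; have /andP[b1 b2] := WV true x.
move=> /andP[c1 c2] /andP[d1 d2].
by rewrite addr_ge0 ?mulr_ge0// lerD// ler_pM.
Qed.

Lemma iter_transfer_ge0 W n u : (forall b x, 0 <= W b x) -> (forall x, 0 <= u x) ->
  forall x, 0 <= iter n (transfer W) u x.
Proof.
move=> W0 u0 x; have := @iter_transfer_le W W n u u _ _ x.
by case/(_ _ _)/andP => // *; rewrite ?W0 ?u0 lexx.
Qed.

Lemma iter_transfer_mono W n u v : (forall b x, 0 <= W b x) -> (forall x, u x <= v x) ->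
  forall x, iter n (transfer W) u x <= iter n (transfer W) v x.
Proof.
move=> W0 uv x; rewrite -subr_ge0.
have := @iter_transfer_ge0 W n (fun x => v x - u x) W0 _ x.
by rewrite iter_transferB; apply => y; rewrite subr_ge0.
Qed.

Lemma iter_transfer_norm W n u : (forall b x, 0 <= W b x) ->
  forall x, `|iter n (transfer W) u x| <= iter n (transfer W) (fun x => `|u x|) x.
Proof.
move=> W0 x; rewrite ler_norml -mulN1r -iter_transferZ.
apply/andP; split; apply: iter_transfer_mono => // y; last exact: ler_norm.
by rewrite mulN1r lerNl -normrN ler_norm.
Qed.

Lemma iter_transfer_super W n u (c : R) : (forall b x, 0 <= W b x) -> 0 <= c ->
  (forall x, transfer W u x <= c * u x) ->
  forall x, iter n (transfer W) u x <= c ^+ n * u x.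
Proof.
move=> W0 c0 h; elim: n => [|n IH] x; first by rewrite expr0 mul1r.
rewrite iterSr (le_trans (iter_transfer_mono n W0 h x))// iter_transferZ.
by rewrite exprS -mulrA ler_wpM2l.
Qed.

Lemma weight_le_iter W w u x : (forall b x, 0 <= W b x) -> (forall x, 0 <= u x) ->
  weight W w x * u (wbranch w x) <= iter (size w) (transfer W) u x.
Proof.
move=> W0 u0; elim: w u u0 => [|b w IH] u u0; first by rewrite mul1r.
rewrite [size _]/= iterSr; apply: le_trans (IH (transfer W u) _); last first.
  by move=> y; rewrite addr_ge0// mulr_ge0.
have w0 : 0 <= weight W w x by elim: (w) => //= c v IHv; rewrite mulr_ge0.
rewrite /= [leLHS](_ : _ = weight W w x * (W b (wbranch w x) * u (branch b (wbranch w x)))); last by rewrite mulrAC mulrC mulrA.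
by rewrite ler_wpM2l// /transfer; case: b; rewrite ?lerDr ?lerDl mulr_ge0.
Qed.

(** * Hoelder classes and the Lasota-Yorke inequality *)

Section holder_classes.
Variable gamma : R.
Hypothesis gamma_gt0 : 0 < gamma.

Definition dist x y := `|pt x - pt y| `^ gamma.

Definition hol (c : R) u := forall x y, `|u x - u y| <= c * dist x y.

Lemma dist_ge0 x y : 0 <= dist x y. Proof. exact: powR_ge0. Qed.
Hint Resolve dist_ge0 : core.

Lemma dist_le1 x y : dist x y <= 1.
Proof.
have h : `|pt x - pt y| <= 1.
  have := I01_ge0 x; have := I01_ge0 y; have := I01_le1 x; have := I01_le1 y.
  by rewrite ler_norml; lra.
by have := ge0_ler_powR (ltW gamma_gt0) (normr_ge0 _) ler01 h; rewrite powR1.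
Qed.

Lemma distC x y : dist x y = dist y x. Proof. by rewrite /dist distrC. Qed.

Lemma distxx x : dist x x = 0.
Proof. by rewrite /dist subrr normr0 powR0// gt_eqF. Qed.

Lemma dist0r x : dist x (I01_0 R) = pt x `^ gamma.
Proof. by rewrite /dist pt0 subr0 (ger0_norm (I01_ge0 x)). Qed.

Lemma hol_ge0 c u : hol c u -> 0 <= c.
Proof.
move=> h; have := h (I01_1 R) (I01_0 R).
rewrite /dist /pt /= subr0 normr1 powR1 mulr1; exact: le_trans.
Qed.

Lemma hol_osc c u : hol c u -> forall x y, `|u x - u y| <= c.
Proof.
by move=> h x y; rewrite (le_trans (h x y))// ler_piMr ?(hol_ge0 h) ?dist_le1.
Qed.

Lemma hol_le c d u : c <= d -> hol c u -> hol d u.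
Proof. by move=> cd h x y; rewrite (le_trans (h x y))// ler_wpM2r. Qed.

Lemma holD c d u v : hol c u -> hol d v -> hol (c + d) (fun x => u x + v x).
Proof.
by move=> hu hv x y; rewrite opprD addrACA (le_trans (ler_normD _ _))// mulrDl lerD.
Qed.

Lemma holZ c k u : hol c u -> hol (`|k| * c) (fun x => k * u x).
Proof. by move=> h x y; rewrite -mulrBr normrM -mulrA ler_wpM2l. Qed.

Lemma hol_cst k : hol 0 (fun=> k).
Proof. by move=> x y; rewrite subrr normr0 mul0r. Qed.

Lemma holB c u k : hol c u -> hol c (fun x => u x - k).
Proof. by move=> h x y; rewrite opprB addrA subrK; exact: h. Qed.

Lemma holM c d A B u v : hol c u -> hol d v -> (forall x, `|u x| <= A) ->
  (forall x, `|v x| <= B) -> hol (A * d + c * B) (fun x => u x * v x).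
Proof.
move=> hu hv uA vB x y.
have -> : u x * v x - u y * v y = u x * (v x - v y) + (u x - u y) * v y by ring.
rewrite (le_trans (ler_normD _ _))// !normrM mulrDl lerD//.
  by rewrite -mulrA ler_pM.
by rewrite mulrAC ler_pM.
Qed.

Lemma holV c k u : 0 < k -> (forall x, k <= u x) -> hol c u ->
  hol (c / k ^+ 2) (fun x => (u x)^-1).
Proof.
move=> k0 uk h x y; have ux := lt_le_trans k0 (uk x); have uy := lt_le_trans k0 (uk y).
have -> : (u x)^-1 - (u y)^-1 = (u y - u x) / (u x * u y).
  by field; rewrite !gt_eqF.
rewrite normrM distrC normfV (gtr0_norm (mulr_gt0 ux uy)).
rewrite mulrAC ler_pM// ?invr_ge0 ?(ltW (mulr_gt0 ux uy))//.
by rewrite lef_pV2 ?posrE ?mulr_gt0 ?exprn_gt0// expr2 ler_pM// ltW.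
Qed.

Lemma dist_branch b x y :
  dist (branch b x) (branch b y) <= (1 + (pt (branch b x)) `^ alpha) `^ (- gamma) * dist x y.
Proof.
have p1 : 0 < 1 + (pt (branch b x)) `^ alpha by rewrite ltr_wpDr// powR_ge0.
rewrite powRN mulrC ler_pdivlMr ?powR_gt0// /dist -powRM ?(ltW p1)//.
apply: ge0_ler_powR; rewrite ?nnegrE ?(ltW gamma_gt0)//.
  by rewrite mulr_ge0// ltW.
exact: branch_contract.
Qed.

Lemma hol_branch c u b : hol c u -> hol c (fun x => u (branch b x)).
Proof.
move=> h x y; rewrite (le_trans (h _ _))// ler_wpM2l ?(hol_ge0 h)//.
by apply: ge0_ler_powR; rewrite ?nnegrE ?(ltW gamma_gt0)// branch_le_dist.
Qed.

(* The weights of the two-point cocycle: they record, along inverse orbits, the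
   contraction of the gamma-th power of the distance. *)
Definition damped W b x := W b x * (1 + (pt (branch b x)) `^ alpha) `^ (- gamma).

Lemma damped_ge0 W : (forall b x, 0 <= W b x) -> forall b x, 0 <= damped W b x.
Proof. by move=> W0 b x; rewrite mulr_ge0// powR_ge0. Qed.

(** In W u - W' u' the increment of u is transported by the damped weights, and the increment of W
    sees only the sup norm of u. The coefficient of s is the iterate of the damped operator itself,
    so that it can be compared with rho^n. *)
Lemma lasota_yorke W A B n : (forall b x, 0 <= W b x <= A) -> (forall b, hol B (W b)) ->
  exists2 C, 0 <= C & forall u s M, hol s u -> (forall x, `|u x| <= M) ->
    forall x y, `|iter n (transfer W) u x - iter n (transfer W) u y| <=
      (s * iter n (transfer (damped W)) (fun=> 1) x + C * M) * dist x y.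
Proof.
move=> W0 WB.
have Wp b x : 0 <= W b x by case/andP: (W0 b x).
have WA b x : W b x <= A by case/andP: (W0 b x).
have A0 : 0 <= A := le_trans (Wp true (I01_0 R)) (WA _ _).
have B0 := hol_ge0 (WB true).
have itb m u M : (forall x, `|u x| <= M) -> forall x, `|iter m (transfer W) u x| <= (2 * A) ^+ m * M.
  move=> uM x; have M0 : 0 <= M := le_trans (normr_ge0 _) (uM x).
  rewrite (le_trans (iter_transfer_norm _ _ _ _))//.
  rewrite (le_trans (@iter_transfer_mono W m _ (fun=> M) Wp uM x))//.
  apply: (@iter_transfer_super W m (fun=> M)) => // [|y]; first by rewrite mulr_ge0.
  by rewrite /transfer mulrDl mul1r mulrDl lerD// ler_wpM2r.
have alg (s' p q A' C' B' k M' l : R) : (s' * p + (A' * C' + B' * k) * M') * l +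
   (s' * q + (A' * C' + B' * k) * M') * l = (s' * (p + q) + (2 * A' * C' + 2 * B' * k) * M') * l.
  by ring.
elim: n => [|n [C C0 IH]].
  exists 0 => // u s M us uM x y; rewrite mulr1 mul0r addr0; exact: us.
exists (2 * A * C + 2 * B * (2 * A) ^+ n).
  by rewrite addr_ge0 ?mulr_ge0// exprn_ge0// mulr_ge0.
move=> u s M us uM x y; rewrite !iterS.
have M0 : 0 <= M := le_trans (normr_ge0 _) (uM x).
have s0 := hol_ge0 us.
set v := iter n (transfer W) u; set D := iter n (transfer (damped W)) (fun=> 1).
have D0 z : 0 <= D z by apply: iter_transfer_ge0 => //; exact: damped_ge0.
have one b : `|W b x * v (branch b x) - W b y * v (branch b y)| <=
   (s * (damped W b x * D (branch b x)) + (A * C + B * (2 * A) ^+ n) * M) * dist x y.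
  have -> : W b x * v (branch b x) - W b y * v (branch b y) =
    W b x * (v (branch b x) - v (branch b y)) + (W b x - W b y) * v (branch b y) by ring.
  rewrite (le_trans (ler_normD _ _))// !normrM (ger0_norm (Wp b x)).
  have h1 := IH u s M us uM (branch b x) (branch b y).
  have h2 := WB b x y; have h3 := itb n u M uM (branch b y).
  have h4 : W b x * `|v (branch b x) - v (branch b y)| <=
     (s * (damped W b x * D (branch b x)) + A * C * M) * dist x y.
    rewrite (le_trans (ler_wpM2l (Wp b x) h1))//.
    have q0 : 0 <= s * D (branch b x) + C * M by rewrite addr_ge0// mulr_ge0.
    rewrite (le_trans (ler_wpM2l (Wp b x) (ler_wpM2l q0 (dist_branch b x y))))//.
    rewrite [leLHS](_ : _ = (s * (damped W b x * D (branch b x)) + damped W b x * C * M) * dist x y); last by rewrite /damped -/D; ring.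
    rewrite ler_wpM2r// lerD2l ler_wpM2r// ler_wpM2r//.
    rewrite (le_trans _ (WA b x))// ler_piMr// powRN invf_le1 ?powR_gt0//; last first.
      by rewrite ltr_wpDr ?powR_ge0.
    have p1 : 1 <= 1 + (pt (branch b x)) `^ alpha by rewrite lerDl powR_ge0.
    have := ge0_ler_powR (ltW gamma_gt0) ler01 (le_trans ler01 p1) p1.
    by rewrite powR1.
  have h5 := ler_pM (normr_ge0 _) (normr_ge0 _) h2 h3.
  rewrite (le_trans (lerD h4 h5))//.
  by rewrite le_eqVlt; apply/orP; left; apply/eqP; ring.
rewrite /transfer opprD addrACA (le_trans (ler_normD _ _))//.
rewrite (le_trans (lerD (one false) (one true)))//.
by rewrite -/D /transfer alg.
Qed.

(* Discounting by c the visits to ]r, 1] costs at most the larger of a fraction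
   exp (- c * a) of the full sum (at least a visits) and the sum over the orbits
   with few visits, which are penalised by a larger s. *)
Definition discount W (r c : R) b x := W b x * expR (- c * (r < pt (branch b x))%R%:R).

Lemma discount_interp W r c s n (a : R) x : (forall b x, 0 <= W b x) ->
  0 <= c -> 0 <= s ->
  iter n (transfer (discount W r c)) (fun=> 1) x <=
  expR (- c * a) * iter n (transfer W) (fun=> 1) x +
  expR (s * a) * iter n (transfer (discount W r s)) (fun=> 1) x.
Proof.
have alg (e1 e2 w0 w1 d0 d1 p q p' q' : R) : (e1 * (w0 * p) + e2 * (d0 * p')) +
   (e1 * (w1 * q) + e2 * (d1 * q')) = e1 * (w0 * p + w1 * q) + e2 * (d0 * p' + d1 * q').
  by ring.
move=> W0 c0 s0; elim: n a x => [|n IH] a x.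
  rewrite /= !mulr1; have [a0|a0] := leP 0 a.
    apply: (@le_trans _ _ (expR (s * a))); last by rewrite lerDr expR_ge0.
    by rewrite -[leLHS]expR0 ler_expR mulr_ge0.
  apply: (@le_trans _ _ (expR (- c * a))); last by rewrite lerDl expR_ge0.
  by rewrite -[leLHS]expR0 ler_expR mulNr oppr_ge0 mulr_ge0_le0// ltW.
have one b : discount W r c b x * iter n (transfer (discount W r c)) (fun=> 1) (branch b x) <=
  expR (- c * a) * (W b x * iter n (transfer W) (fun=> 1) (branch b x)) +
  expR (s * a) * (discount W r s b x * iter n (transfer (discount W r s)) (fun=> 1) (branch b x)).
  (* The induction runs over the number of visits still allowed: a visit lowers a by 1. Once a is
     negative, the first term alone is at least 1. *)
  set k := ((r < pt (branch b x))%R%:R : R).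
  have dp : 0 <= discount W r c b x by rewrite mulr_ge0// expR_ge0.
  rewrite (le_trans (ler_wpM2l dp (IH (a - k) (branch b x))))//.
  rewrite mulrDr /discount -/k; apply: lerD.
    rewrite le_eqVlt; apply/orP; left; apply/eqP.
    have -> : - c * (a - k) = - c * a + c * k by ring.
    have e1 : expR (- c * k) * expR (c * k) = 1 by rewrite -expRD mulNr addNr expR0.
    rewrite expRD; rewrite [LHS](_ : _ = (expR (- c * k) * expR (c * k)) *
      (expR (- c * a) * (W b x * iter n (transfer W) (fun=> 1) (branch b x)))); last by ring.
    by rewrite e1 mul1r.
  have -> : s * (a - k) = s * a + - s * k by ring.
  rewrite expRD.
  set T := iter _ _ _ _.
  have T0 : 0 <= T.
    by apply: iter_transfer_ge0 => // b' y; rewrite mulr_ge0// expR_ge0.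
  rewrite [leLHS](_ : _ = expR (- c * k) * (expR (s * a) * (W b x * expR (- s * k) * T))); last by ring.
  rewrite ler_piMl ?mulr_ge0 ?expR_ge0//.
  by rewrite -expR0 ler_expR mulNr oppr_le0 mulr_ge0// /k.
rewrite !iterS [leLHS]/transfer (le_trans (lerD (one false) (one true)))//.
by rewrite /transfer alg.
Qed.

End holder_classes.
End transfer.

Lemma ultra_fmap (T U : Type) (f : T -> U) (G : set_system T) :
  UltraFilter G -> UltraFilter (f @ G).
Proof.
move=> UG; split; first exact: fmap_proper_filter.
move=> F' PF' sub; rewrite eqEsubset; split=> // A F'A.
have [//|GN] := in_ultra_setVsetC (f @^-1` A) UG.
have /filter_ex[u [Au /(_ Au)]//] : F' (A `&` ~` A).
by apply: filterI => //; apply: sub.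
Qed.

Lemma powR_small (R : realType) (gamma H e : R) : 0 < gamma -> 0 <= H -> 0 < e ->
  exists2 r, 0 < r & forall t, 0 <= t -> t <= r -> H * t `^ gamma <= e.
Proof.
move=> g0 H0 e0; have H1 : 0 < H + 1 by rewrite ltr_wpDl.
have q0 : 0 < e / (H + 1) by rewrite divr_gt0.
exists ((e / (H + 1)) `^ gamma^-1); first by rewrite powR_gt0.
move=> t t0 tr; have := ge0_ler_powR (ltW g0) t0 (powR_ge0 _ _) tr.
rewrite -powRrM mulVf ?gt_eqF// powRr1 ?(ltW q0)// => h.
rewrite (le_trans (ler_wpM2l H0 h))// mulrCA ler_piMr ?(ltW e0)//.
by rewrite ler_pdivrMr// mul1r lerDl.
Qed.

(** * Spectral radius and decay of the damped operator *)

Section ruelle_operator.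
Variables (R : realType) (alpha : R).
Hypothesis alpha_gt0 : 0 < alpha.
Local Notation X := (I01 R).
Local Notation branch := (@branch R alpha).
Local Notation wbranch := (@wbranch R alpha).
Local Notation transfer := (@transfer R alpha R).
Local Notation one := (fun _ : X => 1 : R).
Implicit Types (phi u v : X -> R) (x y : X).

Definition ruelle phi b x : R := expR (phi (branch b x)).

Lemma ruelle_ge0 phi b x : 0 <= ruelle phi b x. Proof. exact: expR_ge0. Qed.
Hint Resolve ruelle_ge0 : core.

Definition growth phi : set R := [set s | 0 < s /\
  exists C, forall n x, iter n (transfer (ruelle phi)) one x <= C * s ^+ n].

(* The spectral radius of the transfer operator on continuous functions. *)
Definition srad phi := inf (growth phi).

Lemma growth_C_ge1 phi s C : (forall n x, iter n (transfer (ruelle phi)) one x <= C * s ^+ n) ->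
  1 <= C.
Proof. by move=> /(_ 0%N (I01_0 R)) /=; rewrite expr0 mulr1. Qed.

Lemma growth_up phi s t : s <= t -> growth phi s -> growth phi t.
Proof.
move=> st [s0 [C hC]]; split; first exact: lt_le_trans st.
exists C => n x; rewrite (le_trans (hC n x))// ler_wpM2l//.
  by rewrite (le_trans ler01 (growth_C_ge1 hC)).
by rewrite lerXn2r// nnegrE ltW// (lt_le_trans s0).
Qed.

Lemma ruelle_bound phi B b x : (forall x, `|phi x| <= B) -> ruelle phi b x <= expR B.
Proof. by move=> h; rewrite ler_expR (le_trans (ler_norm _)). Qed.

Lemma growth_nonempty phi B : (forall x, `|phi x| <= B) -> growth phi (2 * expR B).
Proof.
move=> phiB; split; first by rewrite mulr_gt0// expR_gt0.
exists 1 => n x; rewrite mulrC.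
apply: (@iter_transfer_super R alpha (ruelle phi) n one) => // y.
by rewrite /transfer !mulr1 mulrDl mul1r lerD// ruelle_bound.
Qed.

Lemma growth_lb phi : lbound (growth phi) 0.
Proof. by move=> s [/ltW]. Qed.

Lemma srad_le phi s : growth phi s -> srad phi <= s.
Proof. by move=> h; apply: ge_inf => //; exists 0; exact: growth_lb. Qed.

Lemma srad_growth phi s B : (forall x, `|phi x| <= B) -> srad phi < s -> growth phi s.
Proof.
move=> phiB ss.
have hi : has_inf (growth phi).
  split; last by exists 0; exact: growth_lb.
  by exists (2 * expR B); exact: growth_nonempty.
have := inf_adherent (eps := s - srad phi); rewrite subr_gt0 => /(_ _ ss hi)[t gt].
by rewrite addrC subrK => /ltW ts; exact: growth_up gt.
Qed.

Section holder_potential.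
Variable gamma : R.
Hypothesis gamma_gt0 : 0 < gamma.
Local Notation hol := (@hol R gamma).
Local Notation dist := (@dist R gamma).
Variables (phi : X -> R) (H B : R).
Hypothesis phiH : hol H phi.
Hypothesis phiB : forall x, `|phi x| <= B.
Local Notation L := (transfer (ruelle phi)).
Local Notation rho := (srad phi).

Lemma expR_lip (a b M : R) : a <= M -> b <= M -> `|expR a - expR b| <= expR M * `|a - b|.
Proof.
wlog ab : a b / a <= b.
  move=> h aM bM; have [/h|/ltW/h] := leP a b; first exact.
  by rewrite distrC [X in _ -> _ <= _ * X]distrC; exact.
move=> aM bM; rewrite distrC ger0_norm ?subr_ge0 ?ler_expR//.
rewrite distrC ger0_norm ?subr_ge0//.
have := expR_ge1Dx (a - b) => h.
have -> : expR b - expR a = expR b * (1 - expR (a - b)).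
  by rewrite mulrBr mulr1 -expRD addrCA subrr addr0.
rewrite ler_pM ?expR_ge0 ?ler_expR//; last by lra.
by rewrite subr_ge0 -expR0 ler_expR subr_le0.
Qed.

Lemma hol_ruelle b : hol (expR B * H) (ruelle phi b).
Proof.
move=> x y; rewrite -mulrA.
rewrite (le_trans (@expR_lip _ _ B _ _))//.
- by rewrite (le_trans (ler_norm _)).
- by rewrite (le_trans (ler_norm _)).
by rewrite ler_wpM2l ?expR_ge0//; exact: (hol_branch alpha_gt0 gamma_gt0 b phiH).
Qed.

Hypothesis gap : expR (phi (I01_0 R)) < rho.

Lemma rho_gt0 : 0 < rho. Proof. exact: lt_trans (expR_gt0 _) gap. Qed.

Lemma damped_le_discount W r b y : 0 < r -> 0 <= W b y ->
  damped alpha gamma W b y <= discount alpha W r (gamma * ln (1 + r `^ alpha)) b y.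
Proof.
move=> r0 W0; apply: ler_wpM2l => //.
have pos (z : R) : 0 < 1 + z `^ alpha by rewrite ltr_wpDr ?powR_ge0.
have [h|h] := leP (pt (branch b y)) r.
  rewrite mulr0 expR0 powRN invf_le1 ?powR_gt0//.
  have p1 : 1 <= 1 + (pt (branch b y)) `^ alpha by rewrite lerDl powR_ge0.
  by have := ge0_ler_powR (ltW gamma_gt0) ler01 (le_trans ler01 p1) p1; rewrite powR1.
rewrite [X in expR X](_ : _ = ln (1 + r `^ alpha) * - gamma); last first.
  by rewrite [LHS]mulr1 mulrN mulrC.
rewrite expRM lnK; last by rewrite posrE.
have le : (1 + r `^ alpha) `^ gamma <= (1 + pt (branch b y) `^ alpha) `^ gamma.
  apply: (ge0_ler_powR (ltW gamma_gt0) (ltW (pos _)) (ltW (pos _))).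
  by rewrite lerD2l; apply: le_powR => //; exact: ltW.
rewrite !powRN lef_pV2; [exact: le| |]; by rewrite posrE powR_gt0.
Qed.

(* Near the fixed point the weights are close to exp (phi 0) < rho, and each
   visit away from it is damped by a fixed factor: [discount_interp] trades the
   two effects against each other. *)
Lemma damped_small e : 0 < e -> exists2 n, (0 < n)%N &
  forall x, iter n (transfer (damped alpha gamma (ruelle phi))) one x <= e * rho ^+ n.
Proof.
move=> e0; have rho0 := rho_gt0.
have Er := gap; set E := expR (phi (I01_0 R)) in Er *.
have E0 : 0 < E by exact: expR_gt0.
(* When visits are discounted by s, the branch near 0 weighs at most e1 + D and the other one at
   most D, with e1 + 2 D = beta, halfway between E and rho. *)
pose e1 := (3 * E + rho) / 4; pose beta := (E + rho) / 2.
have Ee1 : E < e1 by rewrite /e1; lra.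
have e10 : 0 < e1 := lt_trans E0 Ee1.
have beta0 : 0 < beta by rewrite /beta; lra.
have br : beta < rho by rewrite /beta; lra.
pose eps := ln e1 - phi (I01_0 R).
have eps0 : 0 < eps.
  rewrite subr_gt0 -ltr_expR lnK ?posrE//.
have [r0 r00 hr0] := powR_small gamma_gt0 (hol_ge0 phiH) eps0.
pose xm := pt (branch true (I01_0 R)).
have xm0 : 0 < xm by apply: branch_gt0 => //; rewrite pt0 add0r ltr01.
(* [xm] is the leftmost point of the right branch; r < xm makes every passage through that branch a
   visit. *)
have [r [rp r1 r2 _ _]] := @exists_min4 R r0 (xm / 2) 1 1 r00 ltac:(by rewrite divr_gt0) ltr01 ltr01.
have near0 x : pt x <= r -> expR (phi x) <= e1.
  move=> xr; rewrite -[leRHS]lnK ?posrE// ler_expR.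
  have := phiH x (I01_0 R); rewrite dist0r.
  move=> /(fun h => le_trans h (hr0 _ (I01_ge0 x) (le_trans xr r1))).
  by rewrite ler_norml /eps => /andP[_]; lra.
pose D := (rho - E) / 8.
have D0 : 0 < D by rewrite divr_gt0// subr_gt0.
pose s := Num.max 0 (B - ln D).
have s0 : 0 <= s by rewrite le_max lexx.
have sD : expR (B - s) <= D.
  rewrite -[leRHS]lnK ?posrE// ler_expR.
  have : B - ln D <= s by rewrite le_max lexx orbT.
  lra.
pose c := gamma * ln (1 + r `^ alpha).
have c0 : 0 < c by rewrite mulr_gt0// ln_gt0// ltrDl powR_gt0.
have sumE : e1 + D + D <= beta by rewrite /e1 /D /beta; lra.
have discs n x : iter n (transfer (discount alpha (ruelle phi) r s)) one x <= beta ^+ n.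
  rewrite -[leRHS]mulr1.
  have W0 b y : 0 <= discount alpha (ruelle phi) r s b y by rewrite mulr_ge0// expR_ge0.
  apply: (@iter_transfer_super R alpha _ n one) => // [|y]; first exact: ltW.
  rewrite /transfer !mulr1.
  have far b z : r < pt (branch b z) -> discount alpha (ruelle phi) r s b z <= D.
    move=> rb; rewrite /discount rb mulr1 -expRD (le_trans _ sD)// ler_expR.
    by rewrite lerD2r (le_trans (ler_norm _)).
  have h1 : discount alpha (ruelle phi) r s true y <= D.
    apply: far; apply: lt_le_trans (branch_true_ge alpha_gt0 y).
    by apply: le_lt_trans r2 _; rewrite ltr_pdivrMr// ltr_pMr// ltr1n.
  have h2 : discount alpha (ruelle phi) r s false y <= e1 + D.
    have [h|h] := leP (pt (branch false y)) r; last first.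
      by rewrite (le_trans (far _ _ h))// lerDr ltW.
    rewrite /discount ltNge h /= mulr0 expR0 mulr1 (le_trans (near0 _ h))//.
    by rewrite lerDl ltW.
  by rewrite (le_trans (lerD h2 h1)).
pose q0 := rho / beta.
have q01 : 1 < q0 by rewrite ltr_pdivlMr// mul1r.
(* The threshold is del n visits. Orbits with fewer are bounded by (exp (s del) beta)^n, and s del <
   ln (rho / beta). For the others the factor exp (- c del n) outweighs the growth (rho exp (c del /
   2))^n. *)
pose del := ln q0 / (2 * (s + 1)).
have s1 : 0 < s + 1 by rewrite ltr_wpDl.
have del0 : 0 < del by rewrite divr_gt0 ?ln_gt0// mulr_gt0.
pose q1 := expR (s * del) / q0; pose q2 := expR (- (c * del / 2)).
have q10 : 0 <= q1 by rewrite divr_ge0 ?expR_ge0// ltW// (lt_trans ltr01).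
have q1lt : q1 < 1.
  rewrite ltr_pdivrMr ?(lt_trans ltr01)// mul1r -[ltRHS]lnK ?posrE ?(lt_trans ltr01)//.
  rewrite ltr_expR /del mulrCA gtr_pMr ?ln_gt0//.
  by rewrite ltr_pdivrMr ?mulr_gt0// mul1r; lra.
have q20 : 0 <= q2 := expR_ge0 _.
have q2lt : q2 < 1 by rewrite -expR0 ltr_expR oppr_lt0 divr_gt0// mulr_gt0.
pose t := rho * expR (c * del / 2).
have [t0 [C hC]] : growth phi t.
  apply: (srad_growth phiB); rewrite ltr_pMr// -expR0 ltr_expR divr_gt0// mulr_gt0//.
have C0 : 0 <= C := le_trans ler01 (growth_C_ge1 hC).
pose q := Num.max q1 q2.
have q00 : 0 <= q by rewrite le_max q10.
have qlt : q < 1 by rewrite gt_max q1lt.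
have [n n0 hn] := exists_small_geom (addr_ge0 C0 ler01) q00 qlt e0.
exists n => // x.
have damp : iter n (transfer (damped alpha gamma (ruelle phi))) one x <=
   iter n (transfer (discount alpha (ruelle phi) r c)) one x.
  have := @iter_transfer_le R alpha (damped alpha gamma (ruelle phi))
     (discount alpha (ruelle phi) r c) n one one _ _ x.
  case/(_ _ _)/andP => // [b y|y]; last by rewrite ler01 lexx.
  by rewrite damped_ge0//= damped_le_discount.
rewrite (le_trans damp)//.
have := @discount_interp R alpha (ruelle phi) r c s n (del * n%:R) x (ruelle_ge0 phi) (ltW c0) s0.
move=> /le_trans; apply.
have exn (a : R) : expR (a * n%:R) = expR a ^+ n.
  by rewrite mulrC mulr_natl; elim: (n) => [|m IH]; rewrite ?expR0// mulrS expRD IH exprS.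
have h1 : expR (- c * (del * n%:R)) * iter n (transfer (ruelle phi)) one x <= rho ^+ n * (C * q ^+ n).
  rewrite mulrA exn (le_trans (ler_wpM2l (exprn_ge0 _ (expR_ge0 _)) (hC n x)))//.
  rewrite mulrCA -exprMn [leRHS]mulrCA ler_wpM2l// -exprMn.
  apply: lerXn2r; rewrite ?nnegrE ?mulr_ge0 ?expR_ge0 ?(ltW rho0)//.
  rewrite /t mulrCA ler_pM2l// -expRD.
  have -> : - c * del + c * del / 2 = - (c * del / 2) by field.
  by rewrite -/q2 le_max lexx orbT.
have h2 : expR (s * (del * n%:R)) * iter n (transfer (discount alpha (ruelle phi) r s)) one x <=
    rho ^+ n * q ^+ n.
  rewrite mulrA exn (le_trans (ler_wpM2l (exprn_ge0 _ (expR_ge0 _)) (discs n x)))//.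
  have bq : expR (s * del) * beta <= rho * q.
    have -> : expR (s * del) * beta = rho * q1.
      by rewrite /q1 /q0; field; rewrite !gt_eqF.
    by rewrite ler_pM2l// le_max lexx.
  rewrite -!exprMn; apply: lerXn2r; rewrite ?nnegrE//.
    by apply: mulr_ge0; [exact: expR_ge0|exact: ltW].
  by apply: mulr_ge0 => //; exact: ltW.
rewrite (le_trans (lerD h1 h2))// -mulrDr -[X in _ + X]mul1r -mulrDl mulrC.
by rewrite ler_wpM2r// exprn_ge0// ltW.
Qed.

End holder_potential.
End ruelle_operator.

(** * The eigenfunction *)

Lemma lerXV (R : realFieldType) (a b : R) n : 0 < a -> a <= b -> b^-1 ^+ n <= a^-1 ^+ n.
Proof.
move=> a0 ab; have b0 := lt_le_trans a0 ab.
by apply: lerXn2r; rewrite ?nnegrE ?invr_ge0 ?(ltW a0) ?(ltW b0)// lef_pV2.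
Qed.

Section eigenfunction.
Variables (R : realType) (alpha : R).
Hypothesis alpha_gt0 : 0 < alpha.
Local Notation X := (I01 R).
Local Notation branch := (@branch R alpha).
Local Notation wbranch := (@wbranch R alpha).
Local Notation transfer := (@transfer R alpha R).
Local Notation one := (fun _ : X => 1 : R).
Implicit Types (u v : X -> R) (x y : X).
Variable gamma : R.
Hypothesis gamma_gt0 : 0 < gamma.
Local Notation hol := (@hol R gamma).
Local Notation dist := (@dist R gamma).
Variables (phi : X -> R) (H B : R).
Hypothesis phiH : hol H phi.
Hypothesis phiB : forall x, `|phi x| <= B.
Local Notation L := (transfer (ruelle alpha phi)).
Local Notation rho := (srad alpha phi).
Hypothesis gap : expR (phi (I01_0 R)) < rho.

Let rho0 : 0 < rho := rho_gt0 gap.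
Let Lp b x : 0 <= ruelle alpha phi b x := ruelle_ge0 alpha phi b x.
Let LB b x : 0 <= ruelle alpha phi b x <= expR B.
Proof. by rewrite Lp ruelle_bound. Qed.
Let LH b : hol (expR B * H) (ruelle alpha phi b) := hol_ruelle alpha_gt0 gamma_gt0 phiH phiB b.

(** The sum of s^-k L^k 1 over k < m, in Horner form. *)
Definition psum s m : X -> R := iter m (fun v x => 1 + s^-1 * L v x) (fun=> 0).

Lemma psum_add s m n x :
  psum s (n + m) x = psum s n x + s^-1 ^+ n * iter n L (psum s m) x.
Proof.
elim: n x => [|n IH] x; first by rewrite add0n /= expr0 mul1r add0r.
rewrite addSn /psum /= -/(psum s (n + m)) -/(psum s n).
by rewrite !transferE !IH exprS; ring.
Qed.

Lemma psum1 s x : psum s 1 x = 1.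
Proof. by rewrite /psum /= transferE !mulr0 addr0 mulr0 addr0. Qed.

Lemma psumS s m x : psum s m.+1 x = psum s m x + s^-1 ^+ m * iter m L one x.
Proof.
rewrite -addn1 psum_add (_ : psum s 1 = one)//.
by apply/funext => y; rewrite psum1.
Qed.

Lemma psum_le s m n x : 0 < s -> (m <= n)%N -> psum s m x <= psum s n x.
Proof.
move=> s0 mn; rewrite -(subnKC mn); elim: (n - m)%N => [|k IH]; first by rewrite addn0.
rewrite addnS psumS (le_trans IH)// lerDl mulr_ge0//.
  by rewrite exprn_ge0// invr_ge0 ltW.
exact: iter_transfer_ge0.
Qed.

Lemma iter_one_hol m : exists2 C, 0 <= C & hol C (iter m L one).
Proof.
have [C C0 LY] := lasota_yorke alpha_gt0 gamma_gt0 m LB LH.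
exists C => // x y; have := LY one 0 1 (@hol_cst R gamma 1) _ x y.
by rewrite mul0r add0r mulr1; apply => z; rewrite normr1.
Qed.

(** The base of the induction by blocks of n0 steps in [resolvent]; uniformity in s is what lets s
    tend to rho. *)
Lemma psum_hol n0 : exists2 K, 0 <= K &
  forall s, rho <= s -> forall m, (m <= n0)%N -> hol K (psum s m).
Proof.
elim: n0 => [|n [K K0 IH]].
  exists 0 => // s _ m; rewrite leqn0 => /eqP ->; exact: hol_cst.
have [C C0 hC] := iter_one_hol n.
have r0 : 0 <= rho^-1 ^+ n by rewrite exprn_ge0// invr_ge0 ltW.
exists (K + rho^-1 ^+ n * C); first by rewrite addr_ge0// mulr_ge0.
move=> s rs m; rewrite leq_eqVlt => /orP[/eqP ->|]; last first.
  by rewrite ltnS => /(IH s rs); apply: hol_le; rewrite lerDl mulr_ge0.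
have s0 : 0 < s := lt_le_trans rho0 rs.
rewrite [psum s n.+1](_ : _ = fun x => psum s n x + s^-1 ^+ n * iter n L one x); last first.
  by apply/funext => x; rewrite psumS.
apply: holD; first exact: IH.
apply: hol_le (holZ (s^-1 ^+ n) hC).
rewrite ger0_norm ?exprn_ge0 ?invr_ge0 ?(ltW s0)// ler_wpM2r//.
exact: lerXV.
Qed.

(* h is S / sup S for S = \sum_n s^-n L^n 1; the supremum of S is at least
   s / (s - rho), and the Lasota-Yorke inequality bounds the Hoelder constant of
   S by a multiple of that supremum. *)
Lemma resolvent : exists2 K, 0 <= K & forall s, rho < s -> exists h : X -> R,
  [/\ forall x, 0 <= h x <= 1, hol K h, exists p, 1 / 2 <= h p &
      forall x, 0 <= s * h x - L h x <= s - rho].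
Proof.
have [n0 n0p ds] := damped_small alpha_gt0 gamma_gt0 phiH phiB gap
  (ltac:(by []) : (0 : R) < 1 / 4).
have [C C0 LY] := lasota_yorke alpha_gt0 gamma_gt0 n0 LB LH.
have [K1 K10 init] := psum_hol n0.
have r0 : 0 <= rho^-1 ^+ n0 by rewrite exprn_ge0// invr_ge0 ltW.
have CR0 : 0 <= C * rho^-1 ^+ n0 by rewrite mulr_ge0.
(* This constant K2 satisfies K1 + K2 D / 4 + C rho^-n0 D <= K2 D for every D >= 1, which closes the
   induction below. *)
exists (2 * (K1 + C * rho^-1 ^+ n0)); first by rewrite mulr_ge0// addr_ge0.
set K2 := 2 * _; move=> s rs.
have s0 : 0 < s := lt_trans rho0 rs.
have [Bd hBd] : exists Bd, forall m x, psum s m x <= Bd.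
  have [t0 [C' hC']] : growth alpha phi ((rho + s) / 2).
    by apply: (srad_growth phiB); lra.
  have C'0 : 0 <= C' := le_trans ler01 (growth_C_ge1 hC').
  pose q := (rho + s) / 2 / s.
  have q0 : 0 <= q by rewrite divr_ge0 ?ltW.
  have q1 : q < 1 by rewrite ltr_pdivrMr// mul1r; lra.
  have q10 : 0 < 1 - q by rewrite subr_gt0.
  exists (C' / (1 - q)) => m x.
  suff : psum s m x <= C' / (1 - q) * (1 - q ^+ m).
    move/le_trans; apply; rewrite ler_piMr ?divr_ge0 ?(ltW q10)//.
    by rewrite lerBlDr lerDl exprn_ge0.
  elim: m => [|m IH]; first by rewrite expr0 subrr mulr0.
  rewrite psumS.
  have h1 : s^-1 ^+ m * iter m L one x <= C' * q ^+ m.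
    rewrite (le_trans (ler_wpM2l _ (hC' m x)))//.
      by rewrite exprn_ge0// invr_ge0 ltW.
    by rewrite mulrCA -exprMn mulrC [s^-1 * _]mulrC mulrC.
  rewrite (le_trans (lerD IH h1))// le_eqVlt; apply/orP; left; apply/eqP.
  by rewrite exprS; field; rewrite gt_eqF.
pose S x := sup (range (fun m => psum s m x)).
have ubS x : has_ubound (range (fun m => psum s m x)).
  by exists Bd => _ [m _ <-].
have cv x : psum s m x @[m --> \oo] --> S x.
  by apply: nondecreasing_cvgn => // m n mn; exact: psum_le.
have Sle m x : psum s m x <= S x by apply: ub_le_sup => //; exists m.
have SB x : S x <= Bd.
  by apply: ge_sup => [|_ [m _ <-]//]; exists (psum s 0 x), 0%N.
have S1 x : 1 <= S x by rewrite -(psum1 s x).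
pose D := sup (range S).
have SD x : S x <= D by apply: ub_le_sup; [exists Bd => _ [y _ <-]|exists x].
have D1 : 1 <= D := le_trans (S1 (I01_0 R)) (SD _).
have D0 : 0 < D := lt_le_trans ltr01 D1.
have K20 : 0 <= K2 by rewrite mulr_ge0// addr_ge0.
have psum0 m x : 0 <= psum s m x by have := @psum_le s 0 m x s0 (leq0n m).
have holS m : hol (K2 * D) (psum s m).
  have [k] := ubnP m; elim: k m => // k IH m; rewrite ltnS => mk.
  have K1D : K1 <= K2 * D.
    rewrite (@le_trans _ _ K2)//; first by rewrite /K2; lra.
    by rewrite ler_peMr.
  have [mn|nm] := leqP m n0; first by apply: hol_le K1D (init s (ltW rs) m mn).
  rewrite -(subnKC (ltnW nm)); set j := (m - n0)%N.
  have jk : (j < k)%N by rewrite (leq_trans _ mk)// -subn_gt0 subKn ?(ltnW nm).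
  rewrite [psum s _](_ : _ = fun x => psum s n0 x + s^-1 ^+ n0 * iter n0 L (psum s j) x); last first.
    by apply/funext => x; rewrite psum_add.
  have hj : hol (K2 * D * (1 / 4 * rho ^+ n0) + C * D) (iter n0 L (psum s j)).
    move=> x y; rewrite (le_trans (LY _ _ D (IH j jk) _ x y))//.
      by move=> z; rewrite ger0_norm// (le_trans (Sle _ _)).
    rewrite ler_wpM2r ?dist_ge0// lerD2r ler_wpM2l//.
    by rewrite mulr_ge0// ltW.
  apply: hol_le (holD (init s (ltW rs) n0 (leqnn _)) (holZ (s^-1 ^+ n0) hj)).
  rewrite ger0_norm ?exprn_ge0 ?invr_ge0 ?(ltW s0)//.
  have le1 : s^-1 ^+ n0 <= rho^-1 ^+ n0.
    by apply: lerXV => //; exact: ltW.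
  have q0 : 0 <= K2 * D * (1 / 4 * rho ^+ n0) + C * D.
    apply: addr_ge0; last by rewrite mulr_ge0// ltW.
    apply: mulr_ge0; first by rewrite mulr_ge0// ltW.
    by apply: mulr_ge0 => //; rewrite exprn_ge0// ltW.
  rewrite (le_trans (lerD (lexx _) (ler_wpM2r q0 le1)))//.
  have -> : rho^-1 ^+ n0 * (K2 * D * (1 / 4 * rho ^+ n0) + C * D) =
    K2 * D / 4 + C * rho^-1 ^+ n0 * D.
    have e1 : rho^-1 ^+ n0 * rho ^+ n0 = 1 by rewrite -exprMn mulVf ?expr1n// gt_eqF.
    rewrite mulrDr; congr (_ + _); last by rewrite mulrA [_ * C]mulrC.
    transitivity (K2 * D / 4 * (rho^-1 ^+ n0 * rho ^+ n0)); last by rewrite e1 mulr1.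
    by move: (rho^-1 ^+ n0) (rho ^+ n0) => a b; field.
  have : K1 <= K1 * D by rewrite ler_peMr.
  have : 0 <= K1 * D by rewrite mulr_ge0// ltW.
  have : 0 <= C * rho^-1 ^+ n0 * D by rewrite mulr_ge0// ltW.
  rewrite /K2; move: (C * rho^-1 ^+ n0) => c.
  by move=> ? ? ?; lra.
have holinf : hol (K2 * D) S.
  move=> x y; apply: (@ler_cvg_to nat \oo _ R (fun m => `|psum s m x - psum s m y|)
      (fun=> K2 * D * dist x y)).
  - by apply: cvg_norm; apply: cvgB; exact: cv.
  - exact: cvg_cst.
  - by apply: nearW => m; exact: holS.
have LS x : L S x = s * (S x - 1).
  have c1 : psum s m.+1 x @[m --> \oo] --> 1 + s^-1 * L S x.
    apply: cvgD; first exact: cvg_cst.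
    apply: cvgM; first exact: cvg_cst.
    by apply: cvgD; apply: cvgM; try exact: cvg_cst; exact: cv.
  have c2 : psum s m.+1 x @[m --> \oo] --> S x.
    by have := cv x; rewrite -(cvg_shiftS (fun m => psum s m x)).
  have e : 1 + s^-1 * L S x = S x by apply: cvg_unique c1 c2.
  by rewrite -e; field; rewrite gt_eqF.
(* From L S = s (S - 1) and S <= D one gets L S <= s (1 - 1 / D) S. Since S >= 1, the iterates L^n 1
   grow at most at the rate s (1 - 1 / D), so rho is at most that rate. *)
have sD : s / D <= s - rho.
  pose c := s * (1 - D^-1).
  have c0 : 0 <= c by rewrite mulr_ge0 ?(ltW s0)// subr_ge0 invf_le1.
  have LSc x : L S x <= c * S x.
    rewrite LS /c -mulrA ler_wpM2l ?(ltW s0)// mulrBl mul1r lerD2l lerN2 mulrC.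
    by rewrite ler_pdivrMr// mul1r.
  (* Elements of [growth] are positive whereas c may vanish; the alternative rho <= rho / 2 is
     absurd. *)
  suff : rho <= Num.max c (rho / 2).
    rewrite le_max => /orP[|]; rewrite /c; last by have := rho0; lra.
    by rewrite mulrBr mulr1; lra.
  apply: srad_le; split; first by rewrite lt_max (_ : 0 < rho / 2) ?orbT// divr_gt0.
  exists D => n x; rewrite (le_trans (@iter_transfer_mono R alpha _ n _ _ Lp S1 x))//.
  rewrite (le_trans (@iter_transfer_super R alpha _ n S c Lp c0 LSc x))// mulrC.
  apply: ler_pM => //; [exact: le_trans (S1 x)|exact: exprn_ge0|].
  by apply: lerXn2r; rewrite ?nnegrE ?le_max ?c0// lexx.
exists (fun x => S x / D); split.
- by move=> x; rewrite divr_ge0 ?(ltW D0) ?(le_trans ler01)//= ler_pdivrMr// mul1r.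
- move=> x y; rewrite -mulrBl normrM [X in _ * X]ger0_norm ?invr_ge0 ?(ltW D0)//.
  by rewrite ler_pdivrMr// (le_trans (holinf x y))// mulrAC.
- have : D / 2 < D by rewrite ltr_pdivrMr// ltr_pMr// ltr1n.
  move=> /sup_gt; case; first by exists (S (I01_0 R)), (I01_0 R).
  by move=> _ [p _ <-] pD; exists p; rewrite ler_pdivlMr//; lra.
- move=> x; have -> : L (fun x => S x / D) x = L S x / D.
    by rewrite !transferE !mulrA -mulrDl.
  by rewrite LS mulrA -mulrBl mulrBr mulr1 subKr sD divr_ge0 ?ltW.
Qed.

Lemma weight_ge w x : expR (- B) ^+ size w <= weight alpha (ruelle alpha phi) w x.
Proof.
elim: w => [|b w IH]; first by rewrite /= expr0.
rewrite [size _]/= exprS /= ler_pM ?expR_ge0 ?exprn_ge0 ?expR_ge0//.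
by rewrite ler_expR lerNl (le_trans _ (phiB (branch b (wbranch w x))))// -normrN ler_norm.
Qed.

(** The point p lies in its own cylinder of order m, whose diameter is small uniformly in p; m
    depends on K and e but not on the function. *)
Lemma hol_ball K e (h : X -> R) : 0 <= K -> 0 < e -> exists m, forall h : X -> R, hol K h ->
  forall p x, h p - e <= h (wbranch (word alpha m p) x).
Proof.
move=> K0 e0; have [r r0 hr] := powR_small gamma_gt0 K0 e0.
have [m hm] := wbranch_diam alpha_gt0 r0.
exists m => g gK p x.
have := gK p (wbranch (word alpha m p) x).
have d := hm (word alpha m p) (iter m (intermittent alpha) p) x.
rewrite size_word leqnn wbranch_word// in d.
have := hr _ (normr_ge0 _) (d isT); rewrite -/(dist _ _) => h1 /le_trans/(_ h1).
by rewrite ler_norml => /andP[_]; lra.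
Qed.

(** A pointwise limit, along an ultrafilter, of the functions of [resolvent] for s = rho + 1 / (k +
    1); the common Hoelder constant passes to the limit. Positivity: each function is at least 1/4
    on some cylinder of order m, and s^m h >= L^m h carries this to every point. *)
Lemma eigenfunction : exists h c K, [/\ 0 < c, forall x, c <= h x <= 1, hol K h &
  forall x, L h x = rho * h x].
Proof.
have [K K0 res] := resolvent.
pose s (k : nat) := rho + k.+1%:R^-1.
have sr k : rho < s k by rewrite ltrDl invr_gt0.
have /choice[hk hhk] k := res (s k) (sr k).
have [m hm] := hol_ball one K0 (ltac:(by []) : (0 : R) < 1 / 4).
(* The least weight of a word of length m, times the value 1/4, divided by an upper bound of s^m. *)
pose c := expR (- B) ^+ m / 4 / (rho + 1) ^+ m.
have r1 : 0 < rho + 1 by rewrite addr_gt0.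
have c0 : 0 < c by rewrite !divr_gt0 ?exprn_gt0 ?expR_gt0.
have hc k x : c <= hk k x.
  have [h01 hK [p hp] hL] := hhk k.
  have sk0 : 0 <= s k by rewrite ltW// (lt_trans rho0).
  have Lsk y : L (hk k) y <= s k * hk k y by have /andP[] := hL y; rewrite subr_ge0.
  have h0 y : 0 <= hk k y by case/andP: (h01 y).
  have it := @iter_transfer_super R alpha _ m _ _ Lp sk0 Lsk x.
  have := @weight_le_iter R alpha _ (word alpha m p) _ x Lp h0; rewrite size_word => wt.
  have q : 1 / 4 <= hk k (wbranch (word alpha m p) x).
    by have := hm _ hK p x; move: hp; lra.
  have := weight_ge (word alpha m p) x; rewrite size_word => wg.
  have e0 : 0 <= expR (- B) ^+ m by rewrite exprn_ge0// expR_ge0.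
  have := ler_pM e0 (ltac:(by []) : (0 : R) <= 1 / 4) wg q.
  move=> /le_trans/(_ wt)/le_trans/(_ it) key.
  rewrite /c ler_pdivrMr ?exprn_gt0//.
  move: key; rewrite div1r => /le_trans; apply; rewrite mulrC ler_wpM2l//.
  apply: lerXn2r; rewrite ?nnegrE ?(ltW r1)// lerD2l invf_le1//.
  by rewrite ler1n.
have [G [UG subG]] := @ultraFilterLemma nat \oo _.
have PG : ProperFilter G by exact: ultra_proper.
have cvx : forall x, exists l : R, hk k x @[k --> G] --> l.
  move=> x; have UhG := ultra_fmap (fun k => hk k x) UG.
  have := @segment_compact R 0 1; rewrite compact_ultra => /(_ _ UhG)[|l [_ hl]].
    by apply: subG; exists 0%N => // k _ /=; rewrite in_itv/=; case: (hhk k) => ->.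
  by exists l.
have [h hh] := choice cvx.
have cvG (u : nat -> R) l : u k @[k --> \oo] --> l -> u k @[k --> G] --> l.
  by move=> ul A nA; apply: subG; exact: ul.
have s_cv : s k @[k --> G] --> rho.
  apply: cvG; rewrite -[X in _ --> X]addr0; apply: cvgD; first exact: cvg_cst.
  exact: cvg_harmonic.
have Lcv x : L (hk k) x @[k --> G] --> L h x.
  by apply: cvgD; apply: cvgM; try exact: cvg_cst; exact: hh.
exists h, c, K; split => //.
- move=> x; apply/andP; split.
    apply: (@ler_cvg_to nat G PG R (fun=> c) (fun k => hk k x)) => //; first exact: cvg_cst.
    by apply: nearW => k.
  apply: (@ler_cvg_to nat G PG R (fun k => hk k x) (fun=> 1)) => //; first exact: cvg_cst.
  by apply: nearW => k; case: (hhk k) => /(_ x)/andP[].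
- move=> x y; apply: (@ler_cvg_to nat G PG R (fun k => `|hk k x - hk k y|)
      (fun=> K * dist x y)).
  + by apply: cvg_norm; apply: cvgB; exact: hh.
  + exact: cvg_cst.
  + by apply: nearW => k; case: (hhk k).
- move=> x; apply/eqP; rewrite eq_le; apply/andP; split.
    apply: (@ler_cvg_to nat G PG R (fun k => L (hk k) x) (fun k => s k * hk k x)) => //.
      by apply: cvgM.
    by apply: nearW => k; case: (hhk k) => _ _ _ /(_ x)/andP[]; rewrite subr_ge0.
  apply: (@ler_cvg_to nat G PG R (fun k => s k * hk k x) (fun k => L (hk k) x + (s k - rho))).
  + exact: cvgM.
  + rewrite -[X in _ --> X]addr0 -(subrr rho); apply: cvgD => //.
    by apply: cvgB => //; exact: cvg_cst.
  + by apply: nearW => k; case: (hhk k) => _ _ _ /(_ x)/andP[_]; rewrite lerBlDl.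
Qed.

End eigenfunction.

(** * Contraction of the normalised operator *)

Section markov_operator.
Variables (R : realType) (alpha : R).
Hypothesis alpha_gt0 : 0 < alpha.
Local Notation X := (I01 R).
Local Notation branch := (@branch R alpha).
Local Notation wbranch := (@wbranch R alpha).
Local Notation transfer := (@transfer R alpha R).
Local Notation one := (fun _ : X => 1 : R).
Implicit Types (u v : X -> R) (x y : X).
Variable gamma : R.
Hypothesis gamma_gt0 : 0 < gamma.
Local Notation hol := (@hol R gamma).
Local Notation dist := (@dist R gamma).
Variables (p : bool -> X -> R) (c0 Bp : R) (n0 : nat).
Hypothesis c0_gt0 : 0 < c0.
Hypothesis p_ge : forall b x, c0 <= p b x.
Hypothesis p_sum : forall x, p false x + p true x = 1.
Hypothesis p_hol : forall b, hol Bp (p b).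
Hypothesis n0_gt0 : (0 < n0)%N.
Hypothesis p_damped : forall x, iter n0 (transfer (damped alpha gamma p)) one x <= 1 / 4.
Local Notation M := (transfer p).

Let p0 b x : 0 <= p b x. Proof. exact: le_trans (ltW c0_gt0) (p_ge b x). Qed.
Let p1 b x : 0 <= p b x <= 1.
Proof.
rewrite p0 /= -(p_sum x); case: b; first by rewrite lerDr.
by rewrite lerDl.
Qed.

Lemma markov_cst n a x : iter n M (fun=> a) x = a.
Proof.
elim: n x => //= n IH x; by rewrite transferE !IH -mulrDl p_sum mul1r.
Qed.

Lemma markov_range n u a b : (forall x, a <= u x <= b) -> forall x, a <= iter n M u x <= b.
Proof.
move=> ab x; apply/andP; split.
  by rewrite -[leLHS](markov_cst n a x) iter_transfer_mono// => y; case/andP: (ab y).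
by rewrite -[leRHS](markov_cst n b x) iter_transfer_mono// => y; case/andP: (ab y).
Qed.

Lemma markov_damped_le1 n x : 0 <= iter n (transfer (damped alpha gamma p)) one x <= 1.
Proof.
have := @iter_transfer_le R alpha (damped alpha gamma p) p n one one _ _ x.
rewrite markov_cst; apply => [b y|y]; last by rewrite ler01 lexx.
rewrite damped_ge0//= ler_piMr// powRN invf_le1 ?powR_gt0//; last by rewrite ltr_wpDr ?powR_ge0.
have q1 : 1 <= 1 + (pt (branch b y)) `^ alpha by rewrite lerDl powR_ge0.
by have := ge0_ler_powR (ltW gamma_gt0) ler01 (le_trans ler01 q1) q1; rewrite powR1.
Qed.

(** M fixes the constants, so u can be replaced by u - a and the sup norm by the length d of the
    range. *)
Lemma markov_lasota_yorke n : exists2 C, 0 <= C & forall u s a d, hol s u ->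
  (forall x, a <= u x <= a + d) -> forall x y,
  `|iter n M u x - iter n M u y| <=
    (s * iter n (transfer (damped alpha gamma p)) one x + C * d) * dist x y.
Proof.
have [C C0 LY] := lasota_yorke alpha_gt0 gamma_gt0 n p1 p_hol.
exists C => // u s a d us ua x y.
have := LY (fun x => u x - a) s d (holB a us) _ x y.
rewrite !iter_transferB !markov_cst opprB addrA subrK; apply => z.
by have /andP[h1 h2] := ua z; rewrite ger0_norm ?subr_ge0// lerBlDl.
Qed.

Lemma hol_range u s x0 : hol s u -> forall x, u x0 - s <= u x <= (u x0 - s) + 2 * s.
Proof.
move=> us x; have := hol_osc gamma_gt0 us x x0; rewrite ler_norml => /andP[? ?].
by apply/andP; split; lra.
Qed.

Lemma markov_step : exists2 C, 0 <= C & forall u s a d, hol s u ->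
  (forall x, a <= u x <= a + d) -> hol (s / 4 + C * d) (iter n0 M u).
Proof.
have [C C0 LY] := markov_lasota_yorke n0; exists C => // u s a d us ua x y.
rewrite (le_trans (LY u s a d us ua x y))// ler_wpM2r ?dist_ge0// lerD2r.
by rewrite -div1r ler_wpM2l ?(hol_ge0 us).
Qed.

Lemma markov_growth m : exists2 C, 1 <= C & forall j, (j <= m)%N -> forall u s, hol s u ->
  hol (C * s) (iter j M u).
Proof.
elim: m => [|m [C C1 IH]].
  by exists 1 => // j; rewrite leqn0 => /eqP -> u s us; rewrite mul1r.
have [K K0 LY] := markov_lasota_yorke m.+1.
exists (C + (1 + K * 2)); first by rewrite (le_trans C1)// lerDl addr_ge0// mulr_ge0.
move=> j jm u s us; have s0 := hol_ge0 us.
move: jm; rewrite leq_eqVlt => /orP[/eqP ->|]; last first.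
  rewrite ltnS => jm; apply: hol_le (IH j jm u s us).
  by rewrite ler_wpM2r// lerDl addr_ge0// mulr_ge0.
move=> x y; rewrite (le_trans (LY u s _ _ us (hol_range (I01_0 R) us) x y))//.
rewrite ler_wpM2r ?dist_ge0//.
have /andP[d0 d1] := markov_damped_le1 m.+1 x.
have h1 : s * iter m.+1 (transfer (damped alpha gamma p)) one x <= s by rewrite ler_piMr.
have h2 : 0 <= C * s by rewrite mulr_ge0// (le_trans ler01).
lra.
Qed.

Lemma markov_uniform : exists2 K, 0 <= K & forall u, hol 1 u -> forall n, hol K (iter n M u).
Proof.
have [C C0 step] := markov_step; have [K0 K01 gr] := markov_growth n0.
have K00 : 0 <= K0 := le_trans ler01 K01.
(* The range of u has length at most 2, and K = K0 + 4 C satisfies K / 4 + 2 C <= K. *)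
exists (K0 + 4 * C); first by rewrite addr_ge0// mulr_ge0.
move=> u u1 n; have [k] := ubnP n; elim: k n => // k IH n; rewrite ltnS => nk.
have [le|lt] := leqP n n0.
  by apply: hol_le (gr n le u 1 u1); rewrite mulr1 lerDl mulr_ge0.
rewrite -(subnKC (ltnW lt)) iterD.
have rg := markov_range (n - n0) (hol_range (I01_0 R) u1).
have jk : (n - n0 < k)%N by rewrite (leq_trans _ nk)// -subn_gt0 subKn ?(ltnW lt).
apply: hol_le (step _ _ _ _ (IH _ jk) rg).
lra.
Qed.

Lemma p_weight_ge w x : c0 ^+ size w <= weight alpha p w x.
Proof.
elim: w => [|b w IH]; first by rewrite expr0.
by rewrite [size _]/= exprS /= ler_pM ?exprn_ge0 ?(ltW c0_gt0).
Qed.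

Lemma c0_le : c0 <= 1 / 2.
Proof.
have := p_sum (I01_0 R); have := p_ge true (I01_0 R); have := p_ge false (I01_0 R); lra.
Qed.

(* Either u takes a value in the upper half of its range, and then all averages
   of u of large order see a definite proportion of that value, or it does not,
   and then its range is already halved. *)
Lemma osc_step K e : 0 <= K -> 0 < e -> exists m c, 0 < c <= 1 / 4 /\
  forall u a d, hol K u -> e <= d -> (forall x, a <= u x <= a + d) ->
  exists a', forall x, a' <= iter m M u x <= a' + (1 - c) * d.
Proof.
move=> K0 e0; have e4 : 0 < e / 4 by rewrite divr_gt0.
have [m hm] := hol_ball alpha_gt0 gamma_gt0 one K0 e4.
have c1 : c0 <= 1 by have := c0_le; lra.
have cm0 : 0 < c0 ^+ m by rewrite exprn_gt0.
have cm1 : c0 ^+ m <= 1 by rewrite exprn_ile1// ltW.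
exists m, (c0 ^+ m / 4); split; first by rewrite divr_gt0//= ler_pM2r ?invr_gt0.
move=> u a d uK ed ua; have d0 : 0 <= d by rewrite (le_trans _ ed)// ltW.
have rg := markov_range m ua.
case: (pselect (exists q, a + d / 2 <= u q)) => [[q hq]|nq].
  (* On the cylinder of q, u is at least a + d / 2 - e / 4 >= a + d / 4, and every point gives this
     cylinder weight at least c0^m. *)
  exists (a + c0 ^+ m / 4 * d) => x; apply/andP; split; last first.
    have /andP[_ h] := rg x; rewrite (le_trans h)//; lra.
  have u0 y : 0 <= u y - a by have /andP[] := ua y; rewrite subr_ge0.
  have := @weight_le_iter R alpha p (word alpha m q) (fun y => u y - a) x p0 u0.
  rewrite size_word iter_transferB markov_cst.
  have := hm u uK q x; have := p_weight_ge (word alpha m q) x; rewrite size_word.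
  move: (weight _ _ _ _) (u (wbranch _ x)) (iter _ _ _ _) => w v z cw uv wz.
  have h : c0 ^+ m * (d / 4) <= w * (v - a).
    apply: ler_pM => //; [exact: ltW|by rewrite divr_ge0|lra].
  lra.
have ua' x : a <= u x <= a + d / 2.
  have /andP[-> _] := ua x; rewrite /= leNgt; apply/negP => h; apply: nq.
  by exists x; exact: ltW.
exists a => x; have /andP[-> h] := markov_range m ua' x; rewrite /= (le_trans h)// lerD2l.
rewrite mulrC ler_wpM2r//; lra.
Qed.

Lemma osc_small e : 0 < e -> exists n, forall u, hol 1 u -> exists a,
  forall x, a <= iter n M u x <= a + e.
Proof.
move=> e0; have [K K0 un] := markov_uniform.
have [m [c [/andP[cp c4] step]]] := osc_step K0 e0.
have [j _ hj] := @exists_small_geom R 2 (1 - c) e ltac:(lra) ltac:(lra) ltac:(lra) e0.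
exists (m * j)%N => u u1.
suff [a [d [dm ha]]] : exists a d, d <= Num.max e (2 * (1 - c) ^+ j) /\
    forall x, a <= iter (m * j) M u x <= a + d.
  exists a => x; have /andP[-> h] := ha x; rewrite /= (le_trans h)// lerD2l.
  by rewrite (le_trans dm)// ge_max lexx hj.
elim: j {hj} => [|j [a [d [dm ha]]]].
  exists (u (I01_0 R) - 1), (2 * 1); rewrite muln0 expr0; split; last exact: hol_range.
  by rewrite le_max lexx orbT.
rewrite mulnS iterD; have [de|ed] := leP d e.
  exists a, d; split; first by rewrite le_max de.
  exact: markov_range.
have [a' ha'] := step _ a d (un u u1 (m * j)%N) (ltW ed) ha.
exists a', ((1 - c) * d); split => //.
move: dm; rewrite le_max leNgt ed /= => dm.
by rewrite le_max exprS mulrCA ler_wpM2l ?orbT//; lra.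
Qed.

(** Small oscillation precedes small Hoelder constant: once the range has length at most e', each
    block of n0 steps divides the constant by 4 up to the error C e'. *)
Lemma markov_contract1 e : 0 < e -> exists2 n, (0 < n)%N &
  forall u, hol 1 u -> hol e (iter n M u).
Proof.
move=> e0; have [K K0 un] := markov_uniform; have [C C0 step] := markov_step.
pose e' := e / (4 * (C + 1)).
have C1 : 0 < 4 * (C + 1) by lra.
have e'0 : 0 < e' by rewrite divr_gt0.
have [n hn] := osc_small e'0.
have [k k0 hk] := @exists_small_geom R K (1 / 4) (e / 2) K0 ltac:(lra) ltac:(lra) ltac:(lra).
exists (n0 * k + n)%N; first by rewrite addn_gt0 muln_gt0 n0_gt0 k0.
move=> u u1; have [a ha] := hn u u1.
have Ce : 2 * (C * e') <= e / 2.
  have : e' * (4 * (C + 1)) = e by rewrite /e' divfK// gt_eqF.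
  nra.
suff h : hol (K * (1 / 4) ^+ k + 2 * (C * e')) (iter (n0 * k + n) M u).
  by apply: hol_le h; lra.
elim: k {hk k0} => [|k IH].
  rewrite muln0 add0n expr0 mulr1; apply: hol_le (un u u1 n).
  by rewrite lerDl mulr_ge0// mulr_ge0// ltW.
rewrite mulnS -addnA iterD.
have rg x : a <= iter (n0 * k + n) M u x <= a + e' by rewrite iterD; exact: markov_range.
apply: hol_le (step _ _ _ _ IH rg).
have : 0 <= C * e' by rewrite mulr_ge0// ltW.
by rewrite exprS; lra.
Qed.

Lemma markov_contract e : 0 < e -> exists2 n, (0 < n)%N &
  forall u s, hol s u -> hol (e * s) (iter n M u).
Proof.
move=> e0; have [n n0' hn] := markov_contract1 e0; exists n => // u s us.
have [s0|s0] := eqVneq s 0.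
  have [C _ gr] := markov_growth n.
  by have := gr n (leqnn n) u s us; rewrite s0 !mulr0.
have sp : 0 < s by rewrite lt_neqAle eq_sym s0 (hol_ge0 us).
have u1 : hol 1 (fun x => s^-1 * u x).
  by have := holZ s^-1 us; rewrite ger0_norm ?invr_ge0 ?(ltW sp)// mulVf.
have := holZ s (hn _ u1); rewrite (ger0_norm (ltW sp)) mulrC.
congr (hol _ _); apply/funext => x.
by rewrite iter_transferZ mulrA mulfV// mul1r.
Qed.

Lemma markov_contract_exp : exists C th, [/\ 0 <= C, 0 < th < 1 &
  forall n u s, hol s u -> hol (C * th ^+ n * s) (iter n M u)].
Proof.
have [N N0 hN] := markov_contract (ltac:(by []) : (0 : R) < 1 / 2).
have [C C1 gr] := markov_growth N.
have N0r : (0 : R) < N%:R by rewrite ltr0n.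
(* By Bernoulli's inequality th^N >= 1/2, so th^n dominates one halving every N steps. *)
pose th : R := 1 - (2 * N%:R)^-1.
have N2 : 0 < (2 * N%:R)^-1 :> R by rewrite invr_gt0 mulr_gt0.
have N2' : (2 * N%:R)^-1 <= 1 / 2 :> R.
  by rewrite div1r lef_pV2 ?posrE ?mulr_gt0// ler_peMr// ler1n.
have th0 : 0 < th by rewrite /th; lra.
have th1 : th < 1 by rewrite /th; lra.
have thN : 1 / 2 <= th ^+ N.
  have bern k : 1 - k%:R * (2 * N%:R)^-1 <= th ^+ k.
    elim: k => [|k IH]; first by rewrite mul0r subr0.
    rewrite exprS -natr1; have := ler_wpM2l (ltW th0) IH; rewrite /th.
    have : 0 <= k%:R * (2 * N%:R)^-1 * (2 * N%:R)^-1 :> R by rewrite !mulr_ge0// ltW.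
    move: (k%:R : R) (2 * N%:R)^-1 => a b; nra.
  apply: le_trans (bern N).
  by rewrite invfM mulrCA mulfV ?gt_eqF// mulr1; lra.
(* C bounds the remainder of n modulo N, and the factor 2 compensates for th^(n mod N) >= 1/2. *)
exists (2 * C), th; split; [by lra|by rewrite th0|].
move=> n u s us; have s0 := hol_ge0 us.
have C0 : 0 <= C := le_trans ler01 C1.
have hq q : hol ((1 / 2) ^+ q * s) (iter (N * q) M u).
  elim: q => [|q IH]; first by rewrite muln0 expr0 mul1r.
  by rewrite mulnS iterD exprS -mulrA; apply: hN.
rewrite {2}(divn_eq n N) addnC mulnC iterD.
have rN : (n %% N <= N)%N by rewrite ltnW// ltn_pmod.
apply: hol_le (gr _ rN _ _ (hq _)).
have nE : th ^+ n = th ^+ N ^+ (n %/ N) * th ^+ (n %% N).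
  by rewrite {1}(divn_eq n N) exprD mulnC exprM.
rewrite nE.
have t1 : (1 / 2) ^+ (n %/ N) <= th ^+ N ^+ (n %/ N).
  by apply: lerXn2r; rewrite ?nnegrE ?exprn_ge0 ?(ltW th0)//; lra.
have t2 : 1 / 2 <= th ^+ (n %% N).
  have e : N = (n %% N + (N - n %% N))%N by rewrite subnKC.
  apply: le_trans thN _; rewrite [X in th ^+ X <= _]e exprD ler_piMr ?exprn_ge0 ?(ltW th0)//.
  by rewrite exprn_ile1 ?(ltW th0) ?(ltW th1).
have t3 : 0 <= (1 / 2 : R) ^+ (n %/ N) by rewrite exprn_ge0.
have h12 : (0 : R) <= 1 / 2 by lra.
have := ler_wpM2l (mulr_ge0 C0 s0) (ler_pM h12 t3 t2 t1); lra.
Qed.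

End markov_operator.

(** * Birkhoff sums along inverse branches *)

Section distortion.
Variables (R : realType) (alpha : R).
Hypothesis alpha_gt0 : 0 < alpha.
Local Notation X := (I01 R).
Local Notation branch := (@branch R alpha).
Local Notation wbranch := (@wbranch R alpha).
Local Notation transfer := (@transfer R alpha R).
Local Notation one := (fun _ : X => 1 : R).
Implicit Types (phi u v : X -> R) (x y : X).

Fixpoint bsum phi w x : R :=
  if w is b :: v then phi (branch b (wbranch v x)) + bsum phi v x else 0.

Lemma weight_ruelle phi w x : weight alpha (ruelle alpha phi) w x = expR (bsum phi w x).
Proof. by elim: w => [|b w IH] /=; rewrite ?expR0// IH expRD. Qed.

Lemma bsum_word phi n x :
  bsum phi (word alpha n x) (iter n (intermittent alpha) x) =
  \sum_(i < n) phi (iter i (intermittent alpha) x).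
Proof.
elim: n x => [|n IH] x; first by rewrite big_ord0.
rewrite wordS iterSr /= IH wbranch_word// branch_intermittent// big_ord_recl; congr (_ + _).
by apply: eq_bigr => i _; rewrite -iterSr.
Qed.

Variable gamma : R.
Hypothesis gamma_gt0 : 0 < gamma.
Local Notation hol := (@hol R gamma).
Local Notation dist := (@dist R gamma).

(** After n0 inverse steps the two orbits are so close that each further term differs by at most e;
    the first n0 terms differ by at most H each. *)
Lemma distortion phi H e : hol H phi -> 0 < e -> exists2 C, 0 <= C &
  forall w x y, `|bsum phi w x - bsum phi w y| <= C + e * (size w)%:R.
Proof.
move=> phiH e0; have H0 := hol_ge0 phiH.
have [r r0 hr] := powR_small gamma_gt0 H0 e0.
have [n0 hn] := wbranch_diam alpha_gt0 r0.
exists (H * n0%:R) => [|w x y]; first by rewrite mulr_ge0.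
suff : `|bsum phi w x - bsum phi w y| <= H * (minn (size w) n0)%:R + e * (size w)%:R.
  move/le_trans; apply; rewrite lerD2r ler_wpM2l// ler_nat; exact: geq_minr.
elim: w => [|b w IH]; first by rewrite min0n /= subrr normr0 !mulr0 addr0.
rewrite /= opprD addrACA (le_trans (ler_normD _ _))//.
have ph := phiH (branch b (wbranch w x)) (branch b (wbranch w y)).
have e0' := ltW e0.
rewrite -[(size w).+1%:R]natr1 mulrDr mulr1.
have [h|h] := leqP n0 (size w).+1.
  have : `|phi (branch b (wbranch w x)) - phi (branch b (wbranch w y))| <= e.
    by rewrite (le_trans ph)// /dist hr// (hn (b :: w)).
  have : H * (minn (size w) n0)%:R <= H * n0%:R.
    by rewrite ler_wpM2l// ler_nat geq_minr.
  lra.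
have : `|phi (branch b (wbranch w x)) - phi (branch b (wbranch w y))| <= H.
  by rewrite (le_trans ph)// ler_piMr ?dist_le1.
move: IH; rewrite (minn_idPl (ltnW (ltnW h))) -[(size w).+1%:R]natr1; lra.
Qed.

End distortion.

(** * Conjugation by the eigenfunction *)

Section normalized_operator.
Variables (R : realType) (alpha : R).
Hypothesis alpha_gt0 : 0 < alpha.
Local Notation X := (I01 R).
Local Notation branch := (@branch R alpha).
Local Notation wbranch := (@wbranch R alpha).
Local Notation transfer := (@transfer R alpha R).
Local Notation one := (fun _ : X => 1 : R).
Implicit Types (phi u v : X -> R) (x y : X) (W : bool -> X -> R).

(** The weights of the conjugated operator u |-> k L (h u) / h. *)
Definition conjw (k : R) (h : X -> R) W b x : R := k * W b x * h (branch b x) / h x.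

Lemma conjw_weight k h W w x : (forall x, h x != 0) ->
  weight alpha (conjw k h W) w x =
  k ^+ size w * weight alpha W w x * h (wbranch w x) / h x.
Proof.
move=> h0; elim: w => [|b w IH] /=; first by rewrite expr0 !mul1r mulfV.
rewrite IH /conjw exprS; field.
by rewrite !h0.
Qed.

Lemma iter_conjw k h W n u x : (forall x, h x != 0) ->
  iter n (transfer (conjw k h W)) u x =
  k ^+ n * iter n (transfer W) (fun x => h x * u x) x / h x.
Proof.
move=> h0; rewrite !iter_transferE mulr_sumr mulr_suml !big_seq.
apply: eq_bigr => w; rewrite mem_words => /eqP sw.
by rewrite conjw_weight// sw; field.
Qed.

Variable gamma : R.
Hypothesis gamma_gt0 : 0 < gamma.
Local Notation hol := (@hol R gamma).
Local Notation dist := (@dist R gamma).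
Variables (phi : X -> R) (H B : R).
Hypothesis phiH : hol H phi.
Hypothesis phiB : forall x, `|phi x| <= B.
Local Notation L := (transfer (ruelle alpha phi)).
Local Notation rho := (srad alpha phi).
Hypothesis gap : expR (phi (I01_0 R)) < rho.
Variables (h : X -> R) (c K : R).
Hypothesis c_gt0 : 0 < c.
Hypothesis h_range : forall x, c <= h x <= 1.
Hypothesis h_hol : hol K h.
Hypothesis h_eigen : forall x, L h x = rho * h x.

Let rho0 : 0 < rho := rho_gt0 gap.
Let h0 x : h x != 0.
Proof. by rewrite gt_eqF// (lt_le_trans c_gt0)//; case/andP: (h_range x). Qed.
Let hp x : 0 < h x.
Proof. by rewrite (lt_le_trans c_gt0)//; case/andP: (h_range x). Qed.
Let cle1 : c <= 1. Proof. by have /andP[/le_trans] := h_range (I01_0 R); apply. Qed.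

Definition normal := conjw rho^-1 h (ruelle alpha phi).

Lemma normal_ge b x : rho^-1 * expR (- B) * c <= normal b x.
Proof.
have /andP[hc h1] := h_range (branch b x); have /andP[_ hx] := h_range x.
have r0 : 0 <= rho^-1 by rewrite invr_ge0 ltW.
rewrite /normal /conjw ler_pdivlMr// (le_trans (ler_piMr _ hx))//.
  by rewrite !mulr_ge0 ?expR_ge0// ltW.
apply: ler_pM => //; [by rewrite mulr_ge0 ?expR_ge0|exact: ltW|].
rewrite ler_wpM2l// ler_expR.
by have := phiB (branch b x); rewrite ler_norml => /andP[].
Qed.

Lemma normal_sum x : normal false x + normal true x = 1.
Proof.
have := h_eigen x; rewrite transferE => e.
have -> : normal false x + normal true x = rho^-1 * (ruelle alpha phi false x * h (branch false x) +
   ruelle alpha phi true x * h (branch true x)) / h x.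
  by rewrite /normal /conjw; ring.
by rewrite e mulKf ?mulfV// gt_eqF.
Qed.

Lemma normal_hol : exists Bp, forall b, hol Bp (normal b).
Proof.
have hb x : `|h x| <= 1 by have /andP[_] := h_range x; rewrite gtr0_norm.
have hv x : `|(h x)^-1| <= c^-1.
  by rewrite gtr0_norm ?invr_gt0// lef_pV2 ?posrE//; case/andP: (h_range x).
have hc x : c <= h x by case/andP: (h_range x).
pose E := expR B; have E0 : 0 < E := expR_gt0 _.
have rb b x : `|ruelle alpha phi b x| <= E by rewrite ger0_norm ?ruelle_ge0// ruelle_bound.
exists (`|rho^-1| * ((E * 1) * (K / c ^+ 2) + (E * K + E * H * 1) * c^-1)) => b.
have h1 := hol_ruelle alpha_gt0 gamma_gt0 phiH phiB b.
have h2 := hol_branch alpha_gt0 gamma_gt0 b h_hol.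
have h3 := holM h1 h2 (rb b) (fun x => hb _).
have h4 := holV c_gt0 hc h_hol.
have bb x : `|ruelle alpha phi b x * h (branch b x)| <= E * 1 by rewrite normrM ler_pM.
have := holZ rho^-1 (holM h3 h4 bb hv).
congr (hol _ _); apply/funext => x; rewrite /normal /conjw; ring.
Qed.

(** Damping commutes with conjugation, and conjugation costs at most a factor 1 / c; this is why the
    damped iterates of L are first brought below c / 4. *)
Lemma normal_damped : exists2 n, (0 < n)%N &
  forall x, iter n (transfer (damped alpha gamma normal)) one x <= 1 / 4.
Proof.
have [n n0 hn] := damped_small alpha_gt0 gamma_gt0 phiH phiB gap
  (ltac:(by rewrite divr_gt0) : 0 < c / 4).
exists n => // x.
have -> : damped alpha gamma normal = conjw rho^-1 h (damped alpha gamma (ruelle alpha phi)).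
  by apply/funext => b; apply/funext => y; rewrite /damped /normal /conjw; ring.
rewrite iter_conjw//.
have hd b y : 0 <= damped alpha gamma (ruelle alpha phi) b y by rewrite damped_ge0// => *; exact: ruelle_ge0.
have h1 : iter n (transfer (damped alpha gamma (ruelle alpha phi))) (fun x => h x * 1) x <= c / 4 * rho ^+ n.
  apply: le_trans (hn x); apply: iter_transfer_mono => // y.
  by rewrite mulr1; case/andP: (h_range y).
have rn : 0 < rho^-1 ^+ n by rewrite exprn_gt0// invr_gt0.
rewrite ler_pdivrMr// (le_trans (ler_wpM2l (ltW rn) h1))//.
rewrite mulrCA -exprMn mulVf ?gt_eqF// expr1n mulr1 mulrC div1r ler_wpM2l//.
by case/andP: (h_range x).
Qed.

(** The pointwise form of the Gibbs property: the quotient of two values of h lies in [c, 1 / c]. *)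
Lemma normal_weight w x :
  c * (rho^-1 ^+ size w * expR (bsum alpha phi w x)) <= weight alpha normal w x
   <= c^-1 * (rho^-1 ^+ size w * expR (bsum alpha phi w x)).
Proof.
rewrite conjw_weight// weight_ruelle; set q := rho^-1 ^+ size w * _.
have q0 : 0 <= q by rewrite mulr_ge0 ?expR_ge0// exprn_ge0// invr_ge0 ltW.
clearbody q; have /andP[a1 a2] := h_range (wbranch w x); have /andP[b1 b2] := h_range x.
rewrite ler_pdivlMr// ler_pdivrMr//; apply/andP; split.
  rewrite mulrAC mulrC ler_wpM2l//.
  by apply: le_trans a1; rewrite ler_piMr// ltW.
rewrite [leRHS](_ : _ = q * (h x / c)); last by rewrite mulrAC mulrC [c^-1 * _]mulrC.
rewrite ler_wpM2l// (le_trans a2)//.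
by rewrite ler_pdivlMr// mul1r.
Qed.

End normalized_operator.

(** * Complex perturbations of the normalised operator *)

Section complex_operator.
Variables (R : realType) (alpha : R).
Hypothesis alpha_gt0 : 0 < alpha.
Local Notation X := (I01 R).
Local Notation C := R[i].
Local Notation branch := (@branch R alpha).
Local Notation rtransfer := (@transfer R alpha R).
Local Notation ctransfer := (@transfer R alpha C).
Variable gamma : R.
Hypothesis gamma_gt0 : 0 < gamma.
Local Notation hol := (@hol R gamma).
Local Notation dist := (@dist R gamma).
Implicit Types (u v : X -> C) (x y : X) (V W E : bool -> X -> C).

Definition chol (s : R) u := forall x y, normc (u x - u y) <= s * dist x y.

Lemma chol_ge0 s u : chol s u -> 0 <= s.
Proof.
move=> h; have := h (I01_1 R) (I01_0 R).
rewrite /dist /pt /= subr0 normr1 powR1 mulr1; apply: le_trans; exact: normc_ge0.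
Qed.

Lemma chol_le s t u : s <= t -> chol s u -> chol t u.
Proof. by move=> st h x y; rewrite (le_trans (h x y))// ler_wpM2r ?dist_ge0. Qed.

Lemma chol_osc s u : chol s u -> forall x y, normc (u x - u y) <= s.
Proof.
by move=> h x y; rewrite (le_trans (h x y))// ler_piMr ?(chol_ge0 h) ?dist_le1.
Qed.

Lemma cholD s t u v : chol s u -> chol t v -> chol (s + t) (fun x => u x + v x).
Proof.
by move=> hu hv x y; rewrite opprD addrACA (le_trans (le_normcD _ _))// mulrDl lerD.
Qed.

Lemma cholZ s (k : C) u : chol s u -> chol (normc k * s) (fun x => k * u x).
Proof. by move=> h x y; rewrite -mulrBr normcM -mulrA ler_wpM2l// normc_ge0. Qed.

Lemma chol_Re s u : chol s u -> hol s (fun x => complex.Re (u x)).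
Proof.
move=> h x y; apply: le_trans (h x y); apply: le_trans (Re_le_normc _).
by case: (u x) (u y) => [? ?] [? ?].
Qed.

Lemma chol_Im s u : chol s u -> hol s (fun x => complex.Im (u x)).
Proof.
move=> h x y; apply: le_trans (h x y); apply: le_trans (Im_le_normc _).
by case: (u x) (u y) => [? ?] [? ?].
Qed.

Lemma chol_ReIm s u : hol s (fun x => complex.Re (u x)) -> hol s (fun x => complex.Im (u x)) ->
  chol (2 * s) u.
Proof.
move=> hR hI x y; apply: le_trans (normc_le_ReIm _) _.
have -> : 2 * s * dist x y = s * dist x y + s * dist x y by ring.
have := hR x y; have := hI x y.
by case: (u x) (u y) => [? ?] [? ?] /= h1 h2; apply: lerD.
Qed.

(** Sup norm and Hoelder constant bounded by the same number, which stands for the Hoelder norm. *)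
Definition cnb (A : R) u := (forall x, normc (u x) <= A) /\ chol A u.

Lemma cnb_ge0 A u : cnb A u -> 0 <= A.
Proof. by case=> _ /chol_ge0. Qed.

Lemma cnb_le A B u : A <= B -> cnb A u -> cnb B u.
Proof. by move=> AB [h1 h2]; split; [move=> x; exact: le_trans AB|exact: chol_le h2]. Qed.

Lemma cnbD A B u v : cnb A u -> cnb B v -> cnb (A + B) (fun x => u x + v x).
Proof.
move=> [u1 u2] [v1 v2]; split; last exact: cholD.
by move=> x; rewrite (le_trans (le_normcD _ _))// lerD.
Qed.

Lemma cnbM A B u v : cnb A u -> cnb B v -> cnb (2 * A * B) (fun x => u x * v x).
Proof.
move=> hu hv; have A0 := cnb_ge0 hu; have B0 := cnb_ge0 hv; case: hu hv => [u1 u2] [v1 v2].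
split=> [x|x y].
  rewrite normcM (le_trans (ler_pM (normc_ge0 _) (normc_ge0 _) (u1 x) (v1 x)))//.
  by rewrite -mulrA mulr2n mulrDl !mul1r lerDl mulr_ge0.
have -> : u x * v x - u y * v y = u x * (v x - v y) + (u x - u y) * v y by ring.
rewrite (le_trans (le_normcD _ _))// !normcM.
have h1 := ler_pM (normc_ge0 _) (normc_ge0 _) (u1 x) (v2 x y).
have h2 := ler_pM (normc_ge0 _) (normc_ge0 _) (u2 x y) (v1 y).
rewrite (le_trans (lerD h1 h2))// le_eqVlt; apply/orP; left; apply/eqP; ring.
Qed.

Lemma cnb_branch A u b : cnb A u -> cnb A (fun x => u (branch b x)).
Proof.
move=> hu; have A0 := cnb_ge0 hu; case: hu => [u1 u2]; split => // x y.
rewrite (le_trans (u2 _ _))// ler_wpM2l//.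
by apply: ge0_ler_powR; rewrite ?nnegrE ?(ltW gamma_gt0)// branch_le_dist.
Qed.

Lemma cnb_transfer A B V u : (forall b, cnb A (V b)) -> cnb B u -> cnb (4 * A * B) (ctransfer V u).
Proof.
move=> hV hu; have -> : 4 * A * B = 2 * A * B + 2 * A * B by ring.
by apply: cnbD; apply: cnbM => //; exact: cnb_branch.
Qed.

(** With W = V + E, W^(n+1) - V^(n+1) = W (W^n - V^n) + E V^n. The bound is linear in the size d of
    E because d <= 1 keeps W bounded. *)
Lemma iter_perturb A V n : (forall b, cnb A (V b)) -> exists2 K, 0 <= K &
  forall E d u B, 0 <= d <= 1 -> (forall b, cnb d (E b)) -> cnb B u ->
  cnb (K * d * B) (fun x => iter n (ctransfer (fun b x => V b x + E b x)) u x - iter n (ctransfer V) u x).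
Proof.
move=> hV; have A0 := cnb_ge0 (hV true).
have itV m u B : cnb B u -> cnb ((4 * A) ^+ m * B) (iter m (ctransfer V) u).
  move=> hu; elim: m => [|m IH]; first by rewrite expr0 mul1r.
  by rewrite exprS -[4 * A * _ * B]mulrA; exact: cnb_transfer.
elim: n => [|n [K K0 IH]].
  exists 0 => // E d u B _ _ hu; rewrite !mul0r.
  rewrite (_ : (fun x => _) = fun=> 0); last by apply/funext => x; rewrite subrr.
  by split => [x|x y]; rewrite ?subrr normc0 ?mul0r.
exists (4 * (A + 1) * K + 4 * (4 * A) ^+ n).
  by rewrite addr_ge0// ?mulr_ge0 ?exprn_ge0 ?mulr_ge0// addr_ge0.
move=> E d u B /andP[d0 d1] hE hu; have B0 := cnb_ge0 hu.
pose W b x := V b x + E b x.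
have hW b : cnb (A + 1) (W b) by apply: cnb_le (cnbD (hV b) (hE b)); rewrite lerD2l.
rewrite (_ : (fun x => _) = fun x => ctransfer W (fun y => iter n (ctransfer W) u y - iter n (ctransfer V) u y) x
    + ctransfer E (iter n (ctransfer V) u) x); last first.
  by apply/funext => x; rewrite /= !transferE /W; ring.
have h1 := cnb_transfer hW (IH E d u B (introT andP (conj d0 d1)) hE hu).
have h2 := cnb_transfer hE (itV n u B hu).
by apply: cnb_le (cnbD h1 h2); rewrite le_eqVlt; apply/orP; left; apply/eqP; ring.
Qed.

Section real_weights.
Variables (p : bool -> X -> R).
Hypothesis p_ge0 : forall b x, 0 <= p b x.
Hypothesis p_sum : forall x, p false x + p true x = 1.
Let pC b x : C := (p b x)%:C%C.

Lemma Re_iter_transfer n u x :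
  complex.Re (iter n (ctransfer pC) u x) = iter n (rtransfer p) (fun y => complex.Re (u y)) x.
Proof.
elim: n x => //= n IH x; rewrite !transferE -!IH /pC.
by case: (iter _ _ _ _) (iter _ _ _ _) => [a b] [c d] /=; ring.
Qed.

Lemma Im_iter_transfer n u x :
  complex.Im (iter n (ctransfer pC) u x) = iter n (rtransfer p) (fun y => complex.Im (u y)) x.
Proof.
elim: n x => //= n IH x; rewrite !transferE -!IH /pC.
by case: (iter _ _ _ _) (iter _ _ _ _) => [a b] [c d] /=; ring.
Qed.

Lemma normc_iter_transfer n u (m : R) : (forall x, normc (u x) <= m) ->
  forall x, normc (iter n (ctransfer pC) u x) <= m.
Proof.
move=> hu; elim: n => // n IH x; rewrite iterS transferE (le_trans (le_normcD _ _))// !normcM.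
have pn b : normc (pC b x) = p b x by rewrite normc_real ger0_norm.
rewrite !pn.
have h1 := ler_wpM2l (p_ge0 false x) (IH (branch false x)).
have h2 := ler_wpM2l (p_ge0 true x) (IH (branch true x)).
by rewrite (le_trans (lerD h1 h2))// -mulrDl p_sum mul1r.
Qed.

End real_weights.

(* An operator close to a strongly contracting Markov operator: the multipliers
   of its normalised iterates form a Cauchy sequence with explicit rate, whose
   limit plays the part of the leading eigenvalue. *)
Section contraction.
Variable L : (X -> C) -> X -> C.
Hypothesis LB : forall u v x, L (fun y => u y - v y) x = L u x - L v x.
Hypothesis L_close : forall u s, u (I01_0 R) = 1 -> chol s u -> s <= 1 / 4 ->
  normc (L u (I01_0 R) - 1) <= 1 / 2 /\ chol (1 / 32) (L u).
Hypothesis L_contract : forall u s, u (I01_0 R) = 0 -> chol s u ->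
  normc (L u (I01_0 R)) <= 2 * s /\ chol (s / 16) (L u).

Fixpoint normalized_iter k : X -> C := if k is j.+1 then
  fun x => L (normalized_iter j) x / L (normalized_iter j) (I01_0 R) else fun=> 1.

Definition multiplier k := L (normalized_iter k) (I01_0 R).

Lemma multiplier_ge (z : C) : normc (z - 1) <= 1 / 2 -> 1 / 2 <= normc z.
Proof.
by move=> h; have := normc_sub_le 1 z; rewrite normcB normc1 => h'; move: (le_trans h' h); lra.
Qed.

(** The multiplier has norm at least 1/2, so normalisation at most doubles the constant 1/32
    supplied by [L_close]. *)
Lemma normalized_iterP k : normalized_iter k (I01_0 R) = 1 /\ chol (1 / 4) (normalized_iter k).
Proof.
elim: k => [|k [u0 uh]].
  by split => // x y; rewrite subrr normc0 mulr_ge0 ?dist_ge0.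
have [l1 l2] := L_close u0 uh (lexx _).
have n2 := multiplier_ge l1.
have nz : L (normalized_iter k) (I01_0 R) != 0 by rewrite -normc_gt0 (lt_le_trans _ n2).
split; first by rewrite /= mulfV.
rewrite (_ : normalized_iter k.+1 = fun x => (L (normalized_iter k) (I01_0 R))^-1 * L (normalized_iter k) x); last first.
  by apply/funext => x /=; rewrite mulrC.
apply: chol_le (cholZ _ l2); rewrite normcV ler_pdivrMl ?(lt_le_trans _ n2)//; lra.
Qed.

Lemma multiplier_near k : normc (multiplier k - 1) <= 1 / 2.
Proof. by have [u0 uh] := normalized_iterP k; case: (L_close u0 uh (lexx _)). Qed.

Lemma normalized_iter_step k :
  chol ((1 / 2) ^+ k) (fun x => normalized_iter k.+1 x - normalized_iter k x).
Proof.
elim: k => [|k IH].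
  rewrite expr0; have [_ h] := normalized_iterP 1; apply: chol_le (_ : chol (1 / 4) _); first lra.
  by move=> x y; rewrite [normalized_iter 0 _]/= opprB addrA subrK; exact: h.
set u := normalized_iter k.+1 in IH *; set v := normalized_iter k in IH *.
have [u0 uh] := normalized_iterP k.+1; have [v0 vh] := normalized_iterP k.
have w0 : u (I01_0 R) - v (I01_0 R) = 0 by rewrite /u /v u0 v0 subrr.
have [Lw0 Lwh] := L_contract w0 IH.
rewrite LB in Lw0.
have [lu _] := L_close u0 uh (lexx _); have [lv Lvh] := L_close v0 vh (lexx _).
have nu2 := multiplier_ge lu; have nv2 := multiplier_ge lv.
set a := L u (I01_0 R) in Lw0 lu nu2 *; set b := L v (I01_0 R) in Lw0 lv nv2 *.
have a0 : a != 0 by rewrite -normc_gt0 (lt_le_trans _ nu2).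
have b0 : b != 0 by rewrite -normc_gt0 (lt_le_trans _ nv2).
(* The difference of two quotients splits into the contracted difference and a correction of the
   multiplier. With q = 2^-k these cost 2 q / 16 and (2 q) 4 / 32, hence 3 q / 8 <= q / 2 in all. *)
rewrite (_ : (fun x => _) = fun x => a^-1 * L (fun y => u y - v y) x + ((b - a) / (a * b)) * L v x); last first.
  apply/funext => x; rewrite LB -/(normalized_iter k.+2).
  have -> : normalized_iter k.+2 x = L u x / a by [].
  have -> : u x = L v x / b by [].
  by field; rewrite a0 b0.
apply: chol_le (cholD (cholZ _ Lwh) (cholZ _ Lvh)).
rewrite !normcM !normcV normcB; set q := (1 / 2) ^+ k in Lw0 *.
have q0 : 0 <= q by rewrite exprn_ge0.
have na : (normc a)^-1 <= 2.
  by rewrite -[leRHS]invrK lef_pV2 ?posrE ?(lt_le_trans _ nu2)//; lra.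
have nb : (normc b)^-1 <= 2.
  by rewrite -[leRHS]invrK lef_pV2 ?posrE ?(lt_le_trans _ nv2)//; lra.
have ai : 0 <= (normc a)^-1 by rewrite invr_ge0 normc_ge0.
have bi : 0 <= (normc b)^-1 by rewrite invr_ge0 normc_ge0.
rewrite normcM invfM.
have h1 : (normc a)^-1 * (q / 16) <= 2 * (q / 16) by rewrite ler_wpM2r// divr_ge0.
have h2 : normc (a - b) * ((normc a)^-1 * (normc b)^-1) * (1 / 32) <= 2 * q * (2 * 2) * (1 / 32).
  rewrite ler_wpM2r//; apply: ler_pM => //; [exact: normc_ge0|exact: mulr_ge0|exact: ler_pM].
rewrite (le_trans (lerD h1 h2))// exprS -/q; move: q q0 {Lw0 h1 h2} => q q0; lra.
Qed.

Lemma multiplier_step k : normc (multiplier k.+1 - multiplier k) <= 2 * (1 / 2) ^+ k.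
Proof.
rewrite /multiplier -LB.
have [u0 _] := normalized_iterP k.+1; have [v0 _] := normalized_iterP k.
have w0 : normalized_iter k.+1 (I01_0 R) - normalized_iter k (I01_0 R) = 0.
  by rewrite u0 v0 subrr.
by have [] := L_contract w0 (@normalized_iter_step k).
Qed.

Lemma multiplier_tail k j : normc (multiplier (k + j) - multiplier k) <= 4 * (1 / 2) ^+ k - 4 * (1 / 2) ^+ (k + j).
Proof.
elim: j => [|j IH]; first by rewrite addn0 !subrr normc0.
rewrite addnS -[multiplier _ - _](subrKA (multiplier (k + j))).
rewrite (le_trans (le_normcD _ _))// exprS.
have := multiplier_step (k + j); have := IH; lra.
Qed.

Definition leading_multiplier : C :=
  Complex (limn (fun k => complex.Re (multiplier k))) (limn (fun k => complex.Im (multiplier k))).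

Lemma leading_multiplierP k : normc (multiplier k - leading_multiplier) <= 8 * (1 / 2) ^+ k.
Proof.
have key (P : C -> R) : (forall z w, `|P z - P w| <= normc (z - w)) ->
    `|P (multiplier k) - limn (fun k => P (multiplier k))| <= 4 * (1 / 2) ^+ k.
  move=> Pl; have tail m j : `|P (multiplier (j + m)) - P (multiplier m)| <= 4 * (1 / 2) ^+ m.
    rewrite (le_trans (Pl _ _))// addnC (le_trans (multiplier_tail _ _))//.
    by rewrite gerBl mulr_ge0// exprn_ge0.
  have cv : cvgn (fun k => P (multiplier k)).
    apply: cauchy_cvg; apply: cauchy_exP => e e0.
    have [n _ hn] := @exists_small_geom R 4 (1 / 2) (e / 2) ltac:(by []) ltac:(lra) ltac:(lra) ltac:(by rewrite divr_gt0).
    exists (P (multiplier n)); exists n => // m /= nm.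
    rewrite /ball /= distrC -(subnK nm) (le_lt_trans (tail _ _))// (le_lt_trans hn)//; lra.
  rewrite distrC; apply: (@ler_cvg_to nat \oo _ R
    (fun j => `|P (multiplier (j + k)) - P (multiplier k)|) (fun=> 4 * (1 / 2) ^+ k)).
  - apply: cvg_norm; apply: cvgB; last exact: cvg_cst.
    by rewrite (cvg_shiftn k (fun j => P (multiplier j))).
  - exact: cvg_cst.
  - by apply: nearW => j; exact: tail.
rewrite (le_trans (normc_le_ReIm _))//.
have -> : 8 * (1 / 2) ^+ k = 4 * (1 / 2) ^+ k + 4 * (1 / 2 : R) ^+ k by ring.
have h1 := key (@complex.Re R) _; have h2 := key (@complex.Im R) _.
rewrite /leading_multiplier; case: (multiplier k) h1 h2 => a b /= h1 h2.
apply: lerD; [apply: h1|apply: h2] => z w.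
  by apply: le_trans (Re_le_normc _); case: z w => [? ?] [? ?].
by apply: le_trans (Im_le_normc _); case: z w => [? ?] [? ?].
Qed.

Lemma leading_multiplier_Re : 1 / 2 <= complex.Re leading_multiplier.
Proof.
apply/ler_addgt0Pr => e e0.
have [n _ hn] := @exists_small_geom R 8 (1 / 2) e ltac:(by []) ltac:(lra) ltac:(lra) e0.
have h1 := leading_multiplierP n; have h2 := multiplier_near n.
have h3 := le_trans (Re_le_normc _) (le_trans h1 hn).
have h4 := le_trans (Re_le_normc _) h2.
case: (multiplier n) (leading_multiplier) h3 h4 => [a b] [c d] /=.
rewrite !ler_norml => /andP[_ h5] /andP[h6 _]; lra.
Qed.

End contraction.

(** * Stability of the contraction under complex perturbations *)

Section perturbation.
Variables (p : bool -> X -> R) (Bp : R) (N : nat).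
Hypothesis p_ge0 : forall b x, 0 <= p b x.
Hypothesis p_sum : forall x, p false x + p true x = 1.
Hypothesis p_hol : forall b, hol Bp (p b).
Hypothesis p_contract : forall (u : X -> R) s, hol s u -> hol (1 / 64 * s) (iter N (rtransfer p) u).
Let pC b x : C := (p b x)%:C%C.

Lemma pC_cnb : exists A, forall b, cnb A (pC b).
Proof.
have Bp0 := hol_ge0 (p_hol true).
exists (1 + Bp) => b; split=> [x|x y].
  rewrite normc_real ger0_norm// (@le_trans _ _ 1)//; last by rewrite lerDl.
  by rewrite -(p_sum x); case: b; rewrite ?lerDr ?lerDl.
by rewrite -rmorphB normc_real (le_trans (p_hol b x y))// ler_wpM2r ?dist_ge0// lerDr ler01.
Qed.

Lemma pC_contract u s : chol s u -> chol (s / 32) (iter N (ctransfer pC) u).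
Proof.
move=> hu; have -> : s / 32 = 2 * (1 / 64 * s) by field.
apply: chol_ReIm => x y.
  by rewrite !Re_iter_transfer; apply: p_contract; exact: chol_Re.
by rewrite !Im_iter_transfer; apply: p_contract; exact: chol_Im.
Qed.

Lemma perturbed_contraction : exists2 d, 0 < d & forall E, (forall b, cnb d (E b)) ->
  (forall u s, u (I01_0 R) = 1 -> chol s u -> s <= 1 / 4 ->
    normc (iter N (ctransfer (fun b x => pC b x + E b x)) u (I01_0 R) - 1) <= 1 / 2 /\
    chol (1 / 32) (iter N (ctransfer (fun b x => pC b x + E b x)) u)) /\
  (forall u s, u (I01_0 R) = 0 -> chol s u ->
    normc (iter N (ctransfer (fun b x => pC b x + E b x)) u (I01_0 R)) <= 2 * s /\
    chol (s / 16) (iter N (ctransfer (fun b x => pC b x + E b x)) u)).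
Proof.
have [A hA] := pC_cnb; have [K K0 pert] := iter_perturb N hA.
(* Then K d <= 1/128. For u of constant at most 1/4 and norm bound 2 this leaves 1/128 + 2/128 <=
   1/32; for u of constant s vanishing at 0, s / 32 + s / 128 <= s / 16. *)
pose d := (128 * (K + 1))^-1.
have K1 : 0 < 128 * (K + 1) by rewrite mulr_gt0// ltr_wpDl.
have d0 : 0 < d by rewrite invr_gt0.
have d1 : d <= 1 by rewrite invf_le1//; lra.
have Kd : K * d <= 1 / 128.
  by rewrite /d ler_pdivrMr//; lra.
exists d => // E hE; set W := fun b x => pC b x + E b x.
have hd : 0 <= d <= 1 by rewrite ltW.
have Kd0 : 0 <= K * d by rewrite mulr_ge0// ltW.
have split_ u x : iter N (ctransfer W) u x = iter N (ctransfer pC) u x +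
    (iter N (ctransfer W) u x - iter N (ctransfer pC) u x) by rewrite addrC subrK.
have cholW u s B : chol s u -> cnb B u -> chol (s / 32 + K * d * B) (iter N (ctransfer W) u).
  move=> hu bu; have [_ h] := pert E d u B hd hE bu.
  rewrite (_ : iter N (ctransfer W) u = fun x => iter N (ctransfer pC) u x +
    (iter N (ctransfer W) u x - iter N (ctransfer pC) u x)); last by apply/funext => x.
  by apply: cholD => //; exact: pC_contract.
split=> u s u0 hu => [s4|].
  have s0 := chol_ge0 hu.
  have near1 x : normc (u x - 1) <= 1 / 4 by rewrite -u0 (le_trans (chol_osc hu _ _)).
  have bu : cnb 2 u.
    split=> [x|]; last by apply: chol_le hu; lra.
    have := normc_sub_le (u x) 1; rewrite normc1; have := near1 x; lra.
  split; last by apply: chol_le (cholW u s 2 hu bu); lra.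
  have [h _] := pert E d u 2 hd hE bu.
  rewrite split_ addrAC (le_trans (le_normcD _ _))//.
  have h1 : normc (iter N (ctransfer pC) u (I01_0 R) - 1) <= 1 / 4.
    have e : iter N (ctransfer pC) u (I01_0 R) - 1 = iter N (ctransfer pC) (fun x => u x - 1) (I01_0 R).
      rewrite iter_transferB; congr (_ - _).
      elim: N (I01_0 R) => //= n IH x.
      by rewrite transferE -!IH !mulr1 -rmorphD p_sum.
    by rewrite e; apply: normc_iter_transfer.
  by have := h (I01_0 R); lra.
have s0 := chol_ge0 hu.
have bu : cnb s u.
  split=> // x; have := chol_osc hu x (I01_0 R); by rewrite u0 subr0.
have sK : K * d * s <= 1 / 128 * s by rewrite ler_wpM2r.
split; last by apply: chol_le (cholW u s s hu bu); lra.
have [h _] := pert E d u s hd hE bu.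
rewrite split_ (le_trans (le_normcD _ _))//.
have h1 : normc (iter N (ctransfer pC) u (I01_0 R)) <= s.
  by apply: normc_iter_transfer => //; case: bu.
by have := h (I01_0 R); lra.
Qed.

End perturbation.
End complex_operator.

(** If the ratios tended to a limit other than th, then from some index on [a] would grow or decay
    like q^k with q strictly between th and the limit, against the two-sided bound by multiples of
    th^k. *)
Lemma ratio_limit (R : realType) (a l : nat -> R) (Lam th c C : R) :
  (forall k, a k.+1 = l k * a k) -> 0 < th -> 0 < c ->
  (forall k, c * th ^+ k <= a k <= C * th ^+ k) -> l k @[k --> \oo] --> Lam -> Lam = th.
Proof.
move=> al th0 c0 ath lc.
have thk k : 0 < th ^+ k by rewrite exprn_gt0.
have a0 k : 0 < a k by apply: (@lt_le_trans _ _ (c * th ^+ k)); [rewrite mulr_gt0|case/andP: (ath k)].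
have l0 k : 0 < l k by have := a0 k.+1; rewrite al pmulr_lgt0.
have C0 : 0 < C.
  by have := lt_le_trans (a0 0%N) (proj2 (andP (ath 0%N))); rewrite expr0 mulr1.
have Lam0 : 0 <= Lam.
  apply: (@ler_cvg_to nat \oo _ R (fun=> 0) l) => //; first exact: cvg_cst.
  by apply: nearW => k; exact: ltW.
apply/eqP; rewrite eq_le; apply/andP; split; rewrite leNgt; apply/negP => h.
  pose q := (Lam + th) / 2; have q1 : th < q by rewrite /q; lra.
  have q2 : 0 < Lam - q by rewrite /q; lra.
  have q0 : 0 < q := lt_trans th0 q1.
  have /cvgrPdist_le/(_ _ q2)[K _ hK] := lc.
  have grow j : a K * q ^+ j <= a (K + j)%N.
    elim: j => [|j IH]; first by rewrite expr0 mulr1 addn0.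
    rewrite addnS al exprS mulrCA; apply: ler_pM => //; [exact: ltW|by rewrite mulr_ge0 ?exprn_ge0 ?ltW|].
    by have := hK (K + j)%N (leq_addr _ _); rewrite /= ler_norml => /andP[_]; lra.
  have tq0 : 0 <= th / q by rewrite divr_ge0 ?ltW.
  have tq1 : th / q < 1 by rewrite ltr_pdivrMr// mul1r.
  have Ck0 : 0 <= C * th ^+ K by rewrite mulr_ge0 ?ltW.
  have [j _ hj] := exists_small_geom Ck0 tq0 tq1 (ltac:(by rewrite divr_gt0) : 0 < a K / 2).
  have h1 : a K <= C * th ^+ K * (th / q) ^+ j.
    rewrite expr_div_n mulrA ler_pdivlMr ?exprn_gt0// -mulrA -exprD.
    exact: le_trans (grow j) (proj2 (andP (ath (K + j)%N))).
  by have := le_trans h1 hj; have := a0 K; lra.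
pose q := (Lam + th) / 2; have q1 : q < th by rewrite /q; lra.
have q2 : 0 < q - Lam by rewrite /q; lra.
have q0 : 0 < q by rewrite /q; lra.
have /cvgrPdist_le/(_ _ q2)[K _ hK] := lc.
have decay j : a (K + j)%N <= a K * q ^+ j.
  elim: j => [|j IH]; first by rewrite expr0 mulr1 addn0.
  rewrite addnS al exprS mulrCA; apply: ler_pM => //; [exact: ltW|exact: ltW|].
  by have := hK (K + j)%N (leq_addr _ _); rewrite /= ler_norml => /andP[h' _]; lra.
have tq0 : 0 <= q / th by rewrite divr_ge0 ?ltW.
have tq1 : q / th < 1 by rewrite ltr_pdivrMr// mul1r.
have [j _ hj] := exists_small_geom (ltW (a0 K)) tq0 tq1 (ltac:(by rewrite divr_gt0// mulr_gt0) : 0 < c * th ^+ K / 2).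
have h1 : c * th ^+ K <= a K * (q / th) ^+ j.
  rewrite expr_div_n mulrA ler_pdivlMr ?exprn_gt0// -mulrA -exprD.
  exact: le_trans (proj1 (andP (ath (K + j)%N))) (decay j).
have h2 := le_trans h1 hj; have h3 : 0 < c * th ^+ K by rewrite mulr_gt0.
by move: (c * th ^+ K) h2 h3 => t; lra.
Qed.

Section cexp_estimate.
Variables (R : realType) (gamma : R).
Hypothesis gamma_gt0 : 0 < gamma.
Local Notation X := (I01 R).

(** exp (u x) - exp (u y) = exp (u y) (exp (u x - u y) - 1), so the sup bound and the Hoelder bound
    both follow from |exp h - 1| <= 2 |h| near 0. *)
Lemma cexp_cnb d : 0 < d -> exists2 r, 0 < r & forall u : X -> R[i], cnb gamma r u ->
  cnb gamma d (fun x => cexp (u x) - 1).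
Proof.
move=> d0; have [q q0 hq] := cexp_near (ltr01 : (0 : R) < 1).
have e1 (h : R[i]) : normc h < q -> normc (cexp h - 1) <= 2 * normc h.
  move=> hn; have -> : cexp h - 1 = (cexp h - 1 - h) + h by rewrite subrK.
  rewrite (le_trans (le_normcD _ _))//; have := hq h hn; lra.
have [r [r0 rq rd r1 _]] := @exists_min4 R (q / 2) (d / 4) (1 / 2) 1 ltac:(by rewrite divr_gt0) ltac:(by rewrite divr_gt0) ltac:(by rewrite divr_gt0) ltr01.
have rq' : r < q by lra.
exists r => // u [u1 u2].
have u3 x : normc (cexp (u x) - 1) <= 2 * r.
  by have := e1 (u x) (le_lt_trans (u1 x) rq'); have := u1 x; lra.
split=> [x|x y]; first by have := u3 x; lra.
have uxy : normc (u x - u y) < q.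
  by rewrite (le_lt_trans _ rq')// (chol_osc gamma_gt0 u2).
have -> : cexp (u x) - 1 - (cexp (u y) - 1) = cexp (u y) * (cexp (u x - u y) - 1).
  rewrite mulrBr mulr1 -cexpD [u y + _]addrC subrK; ring.
rewrite normcM; have n2 : normc (cexp (u y)) <= 2.
  have -> : cexp (u y) = (cexp (u y) - 1) + 1 by rewrite subrK.
  by rewrite (le_trans (le_normcD _ _))// normc1; have := u3 y; lra.
have h2 : normc (cexp (u x - u y) - 1) <= 2 * (r * dist gamma x y).
  by rewrite (le_trans (e1 _ uxy))// ler_wpM2l.
rewrite (le_trans (ler_pM (normc_ge0 _) (normc_ge0 _) n2 h2))//.
by rewrite !mulrA ler_wpM2r ?dist_ge0//; lra.
Qed.

End cexp_estimate.

Lemma half_geom_small (R : realType) (e : R) : 0 < e ->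
  exists n, forall k, (n <= k)%N -> 8 * (1 / 2) ^+ k <= e.
Proof.
move=> e0; have [n _ hn] := @exists_small_geom R 8 (1 / 2) e ltac:(by []) ltac:(lra) ltac:(lra) e0.
exists n => k nk; rewrite (le_trans _ hn)// ler_wpM2l// ler_wiXn2l//; lra.
Qed.

(** * Local holomorphic extension of ln rho *)

Section local_pressure.
Variables (R : realType) (alpha : R).
Hypothesis alpha_gt0 : 0 < alpha.
Local Notation X := (I01 R).
Local Notation C := R[i].
Local Notation rtransfer := (@transfer R alpha R).
Local Notation ctransfer := (@transfer R alpha C).
Variable gamma : R.
Hypothesis gamma_gt0 : 0 < gamma.
Local Notation hol := (@hol R gamma).
Local Notation cnb := (@cnb R gamma).
Local Notation one := (fun _ : X => 1 : C).

Section iterates.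
Variable L : (X -> C) -> X -> C.
Hypothesis LZ : forall (k : C) u x, L (fun y => k * u y) x = k * L u x.
Hypothesis mult0 : forall k, multiplier L k != 0.

Lemma iter_normalized k x : iter k L one x = iter k L one (I01_0 R) * normalized_iter L k x.
Proof.
elim: k x => [|k IH] x; first by rewrite mulr1.
have e : iter k L one = fun x => iter k L one (I01_0 R) * normalized_iter L k x.
  by apply/funext => y; exact: IH.
rewrite !iterS e !LZ /= -mulrA; congr (_ * _); rewrite mulrCA mulfV ?mulr1//.
exact: mult0.
Qed.

Lemma iter_multiplier k : iter k.+1 L one (I01_0 R) = multiplier L k * iter k L one (I01_0 R).
Proof.
have e : iter k L one = fun x => iter k L one (I01_0 R) * normalized_iter L k x.
  by apply/funext => y; exact: iter_normalized.
by rewrite iterS {1}e LZ mulrC.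
Qed.

End iterates.

Lemma iter_ctransfer_real (w : bool -> X -> R) n x :
  iter n (ctransfer (fun b x => (w b x)%:C%C)) one x = (iter n (rtransfer w) (fun=> 1) x)%:C%C.
Proof.
have h0 : iter n (rtransfer w) (fun=> 0) x = 0.
  by rewrite iter_transferE big1// => v _; rewrite mulr0.
have hR := Re_iter_transfer alpha w n one x; have hI := Im_iter_transfer alpha w n one x.
rewrite /= h0 in hI; rewrite /= in hR.
by move: hR hI; case: (iter n _ one x) => a b /= -> ->.
Qed.

(** h0 and the eigenfunction h1 of phi are comparable, so L^n h0 is comparable with L^n h1 = rh^n
    h1, with constants that do not depend on n. *)
Lemma iter_conjw_growth phi (h0 h1 : X -> R) (c c' rho rh : R) n x : 0 < c -> 0 < c' ->
  0 < rho -> 0 < rh -> (forall x, c <= h0 x <= 1) -> (forall x, c' <= h1 x <= 1) ->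
  (forall x, rtransfer (ruelle alpha phi) h1 x = rh * h1 x) ->
  c * c' * (rh / rho) ^+ n <=
    iter n (rtransfer (conjw alpha rho^-1 h0 (ruelle alpha phi))) (fun=> 1) x <=
    (c' * c)^-1 * (rh / rho) ^+ n.
Proof.
move=> c0 c'0 rho0 rh0 hr hr' hL'; have Lp b y : 0 <= ruelle alpha phi b y by exact: ruelle_ge0.
have it m y : iter m (rtransfer (ruelle alpha phi)) h1 y = rh ^+ m * h1 y.
  elim: m y => [|m IH] y; first by rewrite expr0 mul1r.
  have -> : iter m.+1 (rtransfer (ruelle alpha phi)) h1 y =
     rtransfer (ruelle alpha phi) (fun z => rh ^+ m * h1 z) y.
    by rewrite iterS; congr (rtransfer _ _ _); apply/funext => z.
  transitivity (rh ^+ m * rtransfer (ruelle alpha phi) h1 y); first by rewrite !transferE; ring.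
  by rewrite hL' exprSr mulrA.
have lo : c * (rh ^+ n * h1 x) <= iter n (rtransfer (ruelle alpha phi)) (fun y => h0 y * 1) x.
  rewrite -it -iter_transferZ; apply: iter_transfer_mono => // y.
  rewrite mulr1; have /andP[x1 x2] := hr y; have /andP[y1 y2] := hr' y.
  by rewrite (le_trans _ x1)// ler_piMr// ltW.
have hi : iter n (rtransfer (ruelle alpha phi)) (fun y => h0 y * 1) x <= c'^-1 * (rh ^+ n * h1 x).
  rewrite -it -iter_transferZ; apply: iter_transfer_mono => // y.
  rewrite mulr1; have /andP[x1 x2] := hr y; have /andP[y1 y2] := hr' y.
  by rewrite (le_trans x2)// mulrC ler_pdivlMr// mul1r.
have /andP[x1 x2] := hr x; have /andP[y1 y2] := hr' x.
have x0 := lt_le_trans c0 x1; have y0 := lt_le_trans c'0 y1.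
rewrite iter_conjw => [|y]; last by rewrite gt_eqF// (lt_le_trans c0)//; case/andP: (hr y).
rewrite expr_div_n -exprVn; move: (iter _ _ _ _) lo hi => T lo hi.
have rn0 : 0 < rh ^+ n := exprn_gt0 n rh0.
have rV : 0 < rho^-1 ^+ n by rewrite exprn_gt0// invr_gt0.
move: (rh ^+ n) (rho^-1 ^+ n) rn0 rV lo hi => r s r0 s0 lo hi; apply/andP; split.
  rewrite ler_pdivlMr// (le_trans _ (ler_wpM2l (ltW s0) lo))//.
  rewrite [leLHS](_ : _ = s * r * c * (c' * h0 x)); last by ring.
  rewrite [leRHS](_ : _ = s * r * c * h1 x); last by ring.
  apply: ler_wpM2l; first by rewrite !mulr_ge0 ?ltW.
  by rewrite (le_trans _ y1)// ler_piMr// ltW.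
rewrite ler_pdivrMr// (le_trans (ler_wpM2l (ltW s0) hi))// invfM.
rewrite [leLHS](_ : _ = s * r * c'^-1 * h1 x); last by ring.
rewrite [leRHS](_ : _ = s * r * c'^-1 * (h0 x / c)); last by ring.
apply: ler_wpM2l; first by rewrite !mulr_ge0 ?invr_ge0 ?ltW.
by rewrite (le_trans y2)// ler_pdivlMr// mul1r.
Qed.

Variables (phi0 : X -> R) (H0 B0 : R).
Hypothesis phi0H : hol H0 phi0.
Hypothesis phi0B : forall x, `|phi0 x| <= B0.
Hypothesis gap0 : expR (phi0 (I01_0 R)) < srad alpha phi0.

Let wt (p : bool -> X -> R) (eta : X -> C) b x : C :=
  (p b x)%:C%C * cexp (eta (@branch R alpha b x)).

Lemma cdiff_iter_transfer (W : C -> bool -> X -> C) (u : C -> X -> C) n z :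
  (forall b x, cdiff (fun s => W s b x) z) -> (forall x, cdiff (fun s => u s x) z) ->
  forall x, cdiff (fun s => iter n (ctransfer (W s)) (u s) x) z.
Proof.
move=> Wd ud; elim: n => [//|n IH] x.
by apply: cdiffD; apply: cdiffM => //; exact: IH.
Qed.

(* The multiplier is that of the N-th iterate of the normalised operator of phi0
   perturbed by the factor exp (psi - phi0); for real psi its value is read off
   the growth of the iterates. *)
Lemma local_pressure : exists2 r, 0 < r & exists h : (X -> C) -> C,
  (forall phi H B, hol H phi -> (forall x, `|phi x| <= B) ->
     expR (phi (I01_0 R)) < srad alpha phi ->
     cnb r (fun x => (phi x)%:C%C - (phi0 x)%:C%C) ->
     h (fun x => (phi x)%:C%C) = (ln (srad alpha phi))%:C%C) /\
  (forall (F : C -> X -> C) z0 q, 0 < q ->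
     (forall z, normc (z - z0) < q -> cnb r (fun x => F z x - (phi0 x)%:C%C)) ->
     (forall z x, normc (z - z0) < q -> cdiff (fun s => F s x) z) ->
     cdiff (fun z => h (F z)) z0).
Proof.
have [h0 [c [K [c0 hr hK hL]]]] := eigenfunction alpha_gt0 gamma_gt0 phi0H phi0B gap0.
have rho0 := rho_gt0 gap0; set rho := srad alpha phi0 in rho0 hL.
pose p := normal alpha phi0 h0.
pose c1 := rho^-1 * expR (- B0) * c.
have c10 : 0 < c1 by rewrite !mulr_gt0 ?invr_gt0 ?expR_gt0.
have p_ge b x : c1 <= p b x := normal_ge phi0B gap0 c0 hr b x.
have p_sum x : p false x + p true x = 1 := normal_sum gap0 c0 hr hL x.
have [Bp p_hol] := normal_hol alpha_gt0 gamma_gt0 phi0H phi0B c0 hr hK.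
have [n0 n00 p_damp] := normal_damped alpha_gt0 gamma_gt0 phi0H phi0B gap0 c0 hr.
have p0 b x : 0 <= p b x := le_trans (ltW c10) (p_ge b x).
(* The ratio 1/64 for real functions becomes 1/32 for complex ones, the real and imaginary parts
   being contracted separately. *)
have [N N0 contr] := markov_contract alpha_gt0 gamma_gt0 c10 p_ge p_sum p_hol n00 p_damp
  (ltac:(by []) : (0 : R) < 1 / 64).
have [d d0 pert] := perturbed_contraction alpha_gt0 gamma_gt0 p0 p_sum p_hol contr.
have [A hA] := pC_cnb p0 p_sum p_hol.
have A0 := cnb_ge0 (hA true).
(* The product estimate [cnbM] multiplies the size of exp (eta) - 1 by 2 A. *)
have d'0 : 0 < d / (2 * (A + 1)) by rewrite divr_gt0// mulr_gt0// ltr_wpDl.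
have [r r0 hexp] := cexp_cnb gamma_gt0 d'0.
pose L (eta : X -> C) := iter N (ctransfer (wt p eta)).
have LB eta (u v : X -> C) x : L eta (fun y => u y - v y) x = L eta u x - L eta v x.
  exact: iter_transferB.
have LZ eta (k : C) u x : L eta (fun y => k * u y) x = k * L eta u x.
  exact: iter_transferZ.
have LP eta : cnb r eta ->
    (forall u s, u (I01_0 R) = 1 -> chol gamma s u -> s <= 1 / 4 ->
       normc (L eta u (I01_0 R) - 1) <= 1 / 2 /\ chol gamma (1 / 32) (L eta u)) /\
    (forall u s, u (I01_0 R) = 0 -> chol gamma s u ->
       normc (L eta u (I01_0 R)) <= 2 * s /\ chol gamma (s / 16) (L eta u)).
  move=> he; have := pert (fun b x => (p b x)%:C%C * (cexp (eta (@branch R alpha b x)) - 1)) _.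
  have -> : (fun b x => (p b x)%:C%C + (p b x)%:C%C * (cexp (eta (@branch R alpha b x)) - 1)) = wt p eta.
    by apply/funext => b; apply/funext => x; rewrite /wt mulrBr mulr1 addrC subrK.
  apply => b.
  have h2 := cnb_branch alpha_gt0 gamma_gt0 b (hexp eta he).
  apply: cnb_le (cnbM (hA b) h2).
  have A1 : 0 < A + 1 by rewrite ltr_wpDl.
  rewrite [leLHS](_ : _ = d * (A / (A + 1))); last by field; rewrite gt_eqF.
  by rewrite ler_piMr ?(ltW d0)// ler_pdivrMr// mul1r lerDl.
have mult0 eta k : cnb r eta -> multiplier (L eta) k != 0.
  move=> he; have [l1 l2] := LP eta he; have := multiplier_near l1 k.
  by move=> /multiplier_ge h; rewrite -normc_gt0 (lt_le_trans _ h).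
have N0r : (0 : R) < N%:R by rewrite ltr0n.
pose eta_ (psi : X -> C) x := psi x - (phi0 x)%:C%C.
(* The leading multiplier belongs to the N-th iterate of an operator already divided by rho: for
   real psi it equals (srad psi / rho)^N. *)
pose h (psi : X -> C) : C := (ln rho)%:C%C + (N%:R^-1)%:C%C * clog (leading_multiplier (L (eta_ psi))).
exists r => //; exists h; split.
  move=> phi H B phiH phiB gap he; pose psi x : C := (phi x)%:C%C.
  have [l1 l2] := LP _ he.
  have [h1 [c' [K' [c'0 hr' hK' hL']]]] := eigenfunction alpha_gt0 gamma_gt0 phiH phiB gap.
  have rho1 := rho_gt0 gap; set rh := srad alpha phi in rho1 hL' *.
  pose w := conjw alpha rho^-1 h0 (ruelle alpha phi).
  have wtE : wt p (eta_ psi) = fun b x => (w b x)%:C%C.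
    apply/funext => b; apply/funext => x; rewrite /wt /eta_ /psi -rmorphB cexp_real -rmorphM.
    congr (_%:C%C); rewrite /p /normal /w /conjw /ruelle expRB.
    move: (expR_gt0 (phi0 (@branch R alpha b x))); move: (expR (phi0 _)) => E /gt_eqF E0.
    by rewrite -[RHS](mulfK (negbT E0)); ring.
  pose a k := iter (k * N) (rtransfer w) (fun=> 1) (I01_0 R).
  have aE k : iter k (L (eta_ psi)) one (I01_0 R) = (a k)%:C%C.
    by rewrite /a -iter_ctransfer_real -wtE iterM.
  pose l k := complex.Re (multiplier (L (eta_ psi)) k).
  have th0 : 0 < (rh / rho) ^+ N := exprn_gt0 N (divr_gt0 rho1 rho0).
  have abd k : c * c' * ((rh / rho) ^+ N) ^+ k <= a k <= (c' * c)^-1 * ((rh / rho) ^+ N) ^+ k.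
    by rewrite -exprM mulnC; exact: (iter_conjw_growth _ _ c0 c'0 rho0 rho1 hr hr' hL').
  have a0 k : 0 < a k.
    apply: lt_le_trans (proj1 (andP (abd k))).
    by apply: mulr_gt0; [exact: mulr_gt0|rewrite exprn_gt0].
  have multE k : multiplier (L (eta_ psi)) k = (l k)%:C%C /\ a k.+1 = l k * a k.
    have := iter_multiplier (LZ (eta_ psi)) (fun k => mult0 _ k he) k.
    rewrite !aE /l; case: (multiplier _ k) => x y; rewrite -[LHS]/(Complex (a k.+1) 0).
    move=> /eqP; rewrite eq_complex /= !mulr0 subr0 add0r => /andP[/eqP -> /eqP/esym/eqP].
    by rewrite mulf_eq0 (gt_eqF (a0 k)) orbF => /eqP ->.
  pose Lam := leading_multiplier (L (eta_ psi)).
  have lamP k : normc ((l k)%:C%C - Lam) <= 8 * (1 / 2) ^+ k.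
    have hk := leading_multiplierP (LB (eta_ psi)) l1 l2 k.
    by have [e _] := multE k; rewrite -e.
  have ImL : complex.Im Lam = 0.
    apply/eqP; rewrite -normr_le0; apply/ler_addgt0Pl => e e0; rewrite addr0.
    have [n hn] := half_geom_small e0; have := le_trans (Im_le_normc _) (le_trans (lamP n) (hn n (leqnn n))).
    by case: (Lam) => x y /=; rewrite sub0r normrN.
  have ReL : complex.Re Lam = (rh / rho) ^+ N.
    apply: (ratio_limit (a := a) (l := l) _ th0 (mulr_gt0 c0 c'0) abd); first by move=> k; case: (multE k).
    apply/cvgrPdist_le => e e0; have [n hn] := half_geom_small e0; exists n => // k /= nk.
    have := le_trans (Re_le_normc _) (le_trans (lamP k) (hn k nk)).
    by rewrite distrC; case: (Lam) => x y.
  have LamE : Lam = ((rh / rho) ^+ N)%:C%C by move: ImL ReL; case: (Lam) => x y /= -> ->.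
  rewrite /h -/psi -/Lam LamE (clog_real th0) (lnXn _ (divr_gt0 rho1 rho0)) (ln_div (rho1 : rh \in Num.pos) (rho0 : rho \in Num.pos)).
  rewrite -rmorphM -rmorphD; congr (_%:C%C).
  by rewrite -[X in _ * X]mulr_natl mulKf ?gt_eqF// addrC subrK.
move=> F z0 q q0 Fr Fd.
have z00 : normc (z0 - z0) < q by rewrite subrr normc0.
have Wd z b x : normc (z - z0) < q -> cdiff (fun s => wt p (eta_ (F s)) b x) z.
  move=> zq; apply: cdiffM; first exact: cdiff_cst.
  apply: (@cdiff_comp R (@cexp R) (fun s => eta_ (F s) (@branch R alpha b x))).
    by apply: cdiffB; [exact: Fd|exact: cdiff_cst].
  exact: cexp_cdiff.
have ud k z x : normc (z - z0) < q -> cdiff (fun s => normalized_iter (L (eta_ (F s))) k x) z.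
  move=> zq; elim: k x => [|k IH] x; first exact: cdiff_cst.
  have Ld y : cdiff (fun s => L (eta_ (F s)) (normalized_iter (L (eta_ (F s))) k) y) z.
    by apply: cdiff_iter_transfer => // b y'; exact: Wd.
  apply: cdiffM => //; apply: cdiffV => //.
  by have := mult0 _ k (Fr z zq).
have lamd : cdiff (fun z => leading_multiplier (L (eta_ (F z)))) z0.
  apply: (@uniform_limit_cdiff R (fun k z => multiplier (L (eta_ (F z))) k) _ z0 q q0).
    move=> k z zq; apply: cdiff_iter_transfer => [b x|x]; [exact: Wd|exact: ud].
  move=> e e0; have [n hn] := half_geom_small e0.
  exists n => z zq; have [l1 l2] := LP _ (Fr z zq).
  exact: le_trans (leading_multiplierP (LB _) l1 l2 n) (hn n (leqnn n)).
apply: cdiffD; first exact: cdiff_cst.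
apply: cdiffM; first exact: cdiff_cst.
apply: (@cdiff_comp R (@clog R)) => //; apply: clog_cdiff.
have [l1 l2] := LP _ (Fr z0 z00).
by apply: lt_le_trans (leading_multiplier_Re (LB _) l1 l2).
Qed.

End local_pressure.

(** * Bounded measurable functions and states *)

Section expectation.
Context d (T : measurableType d) (R : realType).
Implicit Types (nu : probability T R) (u v : T -> R).

Definition bm u := measurable_fun setT u /\ exists M : R, forall x, `|u x| <= M.

Definition ev nu u : R := \int[nu]_x u x.

Definition pr nu (A : set T) : R := fine (nu A).

Lemma bm_cst (k : R) : bm (fun=> k).
Proof. by split; [exact: measurable_cst|exists `|k|]. Qed.

Lemma bmD u v : bm u -> bm v -> bm (fun x => u x + v x).
Proof.
move=> [mu [M hM]] [mv [N hN]]; split; first exact: measurable_funD.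
by exists (M + N) => x; rewrite (le_trans (ler_normD _ _))// lerD.
Qed.

Lemma bmM u v : bm u -> bm v -> bm (fun x => u x * v x).
Proof.
move=> [mu [M hM]] [mv [N hN]]; split; first exact: measurable_funM.
by exists (M * N) => x; rewrite normrM ler_pM.
Qed.

Lemma bmZ k u : bm u -> bm (fun x => k * u x).
Proof. exact/bmM/bm_cst. Qed.

Lemma bmB u v : bm u -> bm v -> bm (fun x => u x - v x).
Proof.
move=> hu hv; rewrite (_ : (fun x => _) = fun x => u x + -1 * v x).
  by apply: bmD => //; exact: bmZ.
by apply/funext => x; rewrite mulN1r.
Qed.

Lemma bm_indic (A : set T) : measurable A -> bm (\1_A : T -> R).
Proof.
move=> mA; split; first exact: measurable_indic.
by exists 1 => x; rewrite indicE; case: (_ \in _); rewrite ?normr0 ?normr1.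
Qed.

Lemma bm_sum (I : Type) (r : seq I) (F : I -> T -> R) : (forall i, bm (F i)) ->
  bm (fun x => \sum_(i <- r) F i x).
Proof.
move=> hF; elim: r => [|i r IH].
  by rewrite (_ : (fun x => _) = fun=> 0); [exact: bm_cst|apply/funext => x; rewrite big_nil].
rewrite (_ : (fun x => _) = fun x => F i x + \sum_(i <- r) F i x); first exact: bmD.
by apply/funext => x; rewrite big_cons.
Qed.

Lemma bm_comp (g : T -> T) u : measurable_fun setT g -> bm u -> bm (fun x => u (g x)).
Proof.
move=> mg [mu [M hM]]; split; first exact: (measurableT_comp mu mg).
by exists M => x.
Qed.

Variable nu : probability T R.

Lemma bm_integrable u : bm u -> nu.-integrable setT (EFin \o u).
Proof.
move=> [mu [M hM]]; apply: measurable_bounded_integrable => //.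
  exact: le_lt_trans (probability_le1 nu measurableT) (ltry 1).
exists M; split; first exact: num_real.
by move=> N MN x _ /=; rewrite (le_trans (hM x))// ltW.
Qed.

Lemma evE u : bm u -> (ev nu u)%:E = (\int[nu]_x (u x)%:E)%E.
Proof. by move=> hu; rewrite /ev /Rintegral fineK//; apply: integrable_fin_num => //; exact: bm_integrable. Qed.

Lemma evD u v : bm u -> bm v -> ev nu (fun x => u x + v x) = ev nu u + ev nu v.
Proof. by move=> hu hv; apply: RintegralD => //; exact: bm_integrable. Qed.

Lemma evB u v : bm u -> bm v -> ev nu (fun x => u x - v x) = ev nu u - ev nu v.
Proof. by move=> hu hv; apply: RintegralB => //; exact: bm_integrable. Qed.

Lemma evZ k u : bm u -> ev nu (fun x => k * u x) = k * ev nu u.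
Proof. by move=> hu; apply: RintegralZl => //; exact: bm_integrable. Qed.

Lemma ev_le u v : bm u -> bm v -> (forall x, u x <= v x) -> ev nu u <= ev nu v.
Proof. by move=> hu hv uv; apply: le_Rintegral => //; exact: bm_integrable. Qed.

Lemma ev_cst k : ev nu (fun=> k) = k.
Proof.
rewrite /ev Rintegral_cst// (_ : fine _ = 1) ?mulr1//.
exact: (congr1 fine (probability_setT nu)).
Qed.

Lemma ev_ge0 u : (forall x, 0 <= u x) -> 0 <= ev nu u.
Proof. by move=> u0; apply: Rintegral_ge0. Qed.

Lemma ev_sum (I : Type) (r : seq I) (F : I -> T -> R) : (forall i, bm (F i)) ->
  ev nu (fun x => \sum_(i <- r) F i x) = \sum_(i <- r) ev nu (F i).
Proof.
move=> hF; elim: r => [|i r IH].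
  rewrite big_nil -[RHS]ev_cst; congr (ev nu _); apply/funext => x; exact: big_nil.
rewrite big_cons -IH -evD//; last exact: bm_sum.
by congr (ev nu _); apply/funext => x; rewrite big_cons.
Qed.

Lemma ev_indic (A : set T) : measurable A -> ev nu \1_A = pr nu A.
Proof.
by move=> mA; rewrite /ev /pr /Rintegral integral_indic// setIT.
Qed.

Lemma prE (A : set T) : measurable A -> (pr nu A)%:E = nu A.
Proof. by move=> mA; rewrite /pr fineK// fin_num_measure. Qed.

Lemma pr_ge0 (A : set T) : 0 <= pr nu A.
Proof. by rewrite fine_ge0. Qed.

Lemma pr_le (A B : set T) : measurable A -> measurable B -> A `<=` B -> pr nu A <= pr nu B.
Proof. by move=> mA mB AB; rewrite -lee_fin !prE// le_measure ?inE. Qed.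

Section finite_valued.
Variables (I : finType) (xi : T -> I).
Hypothesis mxi : measurable_partition xi.

Lemma partition_sum (G : I -> R) x : G (xi x) = \sum_i G i * \1_(xi @^-1` [set i]) x.
Proof.
rewrite (bigD1 (xi x))//= indicE mem_set// mulr1 big1 ?addr0// => i ix.
by rewrite indicE memNset ?mulr0// => /esym/eqP; rewrite (negbTE ix).
Qed.

Lemma bm_partition (G : I -> R) : bm (fun x => G (xi x)).
Proof.
rewrite (_ : (fun x => _) = fun x => \sum_i G i * \1_(xi @^-1` [set i]) x).
  by apply: bm_sum => i; apply: bmZ; exact: bm_indic.
by apply/funext => x; exact: partition_sum.
Qed.

Lemma ev_partition (G : I -> R) :
  ev nu (fun x => G (xi x)) = \sum_i G i * pr nu (xi @^-1` [set i]).
Proof.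
transitivity (ev nu (fun x => \sum_i G i * \1_(xi @^-1` [set i]) x)).
  by congr (ev nu _); apply/funext => x; exact: partition_sum.
rewrite ev_sum => [|i]; last by apply: bmZ; exact: bm_indic.
by apply: eq_bigr => i _; rewrite evZ ?ev_indic//; exact: bm_indic.
Qed.

Lemma pr_partition : \sum_i pr nu (xi @^-1` [set i]) = 1.
Proof.
rewrite -(ev_cst 1) (ev_partition (fun=> 1)).
by apply: eq_bigr => i _; rewrite mul1r.
Qed.

End finite_valued.

(* If u takes its values in [0, 1], so does u' = 2u - 1_{u >= 1/2}, and the
   discrepancy of the two functionals at u is half of that at u'. *)
Lemma functional_eq (Phi Psi : (T -> R) -> R) :
  (forall u v, bm u -> bm v -> Phi (fun x => u x + v x) = Phi u + Phi v) ->
  (forall k u, bm u -> Phi (fun x => k * u x) = k * Phi u) ->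
  (forall u v, bm u -> bm v -> (forall x, u x <= v x) -> Phi u <= Phi v) ->
  (forall u v, bm u -> bm v -> Psi (fun x => u x + v x) = Psi u + Psi v) ->
  (forall k u, bm u -> Psi (fun x => k * u x) = k * Psi u) ->
  (forall u v, bm u -> bm v -> (forall x, u x <= v x) -> Psi u <= Psi v) ->
  (forall A, measurable A -> Phi \1_A = Psi \1_A) ->
  forall u, bm u -> Phi u = Psi u.
Proof.
move=> PhiD PhiZ Phile PsiD PsiZ Psile ind.
have cst k : Phi (fun=> k) = Psi (fun=> k).
  have -> : (fun=> k) = (fun x => k * (\1_(setT : set T) x : R)).
    by apply/funext => x; rewrite indicE in_setT mulr1.
  by rewrite PhiZ ?PsiZ ?ind//; exact: bm_indic.
have zero (Xi : (T -> R) -> R) : (forall k u, bm u -> Xi (fun x => k * u x) = k * Xi u) ->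
    Xi (fun=> 0) = 0.
  move=> XZ; rewrite -[RHS](mul0r (Xi (fun=> 0))) -XZ; last exact: bm_cst.
  by congr Xi; apply/funext => x; rewrite mul0r.
have bnd n u : bm u -> (forall x, 0 <= u x <= 1) ->
    `|Phi u - Psi u| <= (Phi (fun=> 1) + Psi (fun=> 1)) * (1 / 2) ^+ n.
  elim: n u => [|n IH] u hu u01.
    have h (Xi : (T -> R) -> R) :
      (forall k u, bm u -> Xi (fun x => k * u x) = k * Xi u) ->
      (forall u v, bm u -> bm v -> (forall x, u x <= v x) -> Xi u <= Xi v) ->
      0 <= Xi u <= Xi (fun=> 1).
      move=> XZ Xle; rewrite -{1}(zero Xi XZ); apply/andP.
      by split; apply: Xle => //; try exact: bm_cst; move=> x; case/andP: (u01 x).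
    have /andP[a1 a2] := h _ PhiZ Phile; have /andP[b1 b2] := h _ PsiZ Psile.
    by rewrite expr0 mulr1 ler_norml; apply/andP; split; lra.
  have mA : measurable (u @^-1` `[1 / 2, +oo[%classic).
    by have := hu.1 measurableT _ (measurable_itv `[1 / 2, +oo[%R); rewrite setTI.
  set A := _ @^-1` _ in mA.
  have hA : bm (\1_A : T -> R) := bm_indic mA.
  pose v x := 2 * u x + -1 * \1_A x.
  have h2u : bm (fun x => 2 * u x) by exact: bmZ.
  have hnA : bm (fun x => -1 * \1_A x) by exact: bmZ.
  have hv : bm v by exact: bmD.
  have v01 x : 0 <= v x <= 1.
    rewrite /v indicE; have /andP[u0 u1] := u01 x.
    case: (boolP (x \in A)) => [|] xA; apply/andP.
      by move: xA; rewrite inE /A /= in_itv /= andbT => h; split=> /=; lra.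
    have : ~ A x by move=> h; move: xA; rewrite mem_set.
    by rewrite /A /= in_itv /= andbT => /negP; rewrite -ltNge => h; split=> /=; lra.
  have := IH v hv v01.
  rewrite /v PhiD// PsiD// !PhiZ// !PsiZ// ind// exprS.
  have -> : 2 * Phi u + -1 * Psi \1_A - (2 * Psi u + -1 * Psi \1_A) = 2 * (Phi u - Psi u) by ring.
  by rewrite normrM (ger0_norm (ltac:(by []) : (0 : R) <= 2)); lra.
have unit u : bm u -> (forall x, 0 <= u x <= 1) -> Phi u = Psi u.
  move=> hu u01; apply/eqP; rewrite -subr_eq0 -normr_le0; apply/ler_addgt0Pl => e e0.
  rewrite addr0.
  have C0 : 0 <= Phi (fun=> 1) + Psi (fun=> 1).
    by have := bnd 0%N u hu u01; rewrite expr0 mulr1; apply: le_trans.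
  have [n _ hn] := @exists_small_geom R _ (1 / 2) e C0 ltac:(lra) ltac:(lra) e0.
  exact: le_trans (bnd n u hu u01) hn.
move=> u hu; have [_ [M hM]] := hu.
have M0 : 0 <= M by apply: le_trans (hM point).
have k0 : 0 < 2 * M + 1 by lra.
pose v x := (2 * M + 1)^-1 * (u x + M).
have hv : bm v by apply: bmZ; apply: bmD => //; exact: bm_cst.
have v01 x : 0 <= v x <= 1.
  have := hM x; rewrite ler_norml => /andP[a b].
  by rewrite /v mulrC ler_pdivrMr// ler_pdivlMr//; apply/andP; split; lra.
have e : u = fun x => (2 * M + 1) * v x + - M.
  by apply/funext => x; rewrite /v mulrA mulfV ?mul1r ?addrK// gt_eqF.
have hcst : bm (fun=> - M : R) := bm_cst _.
have hkv : bm (fun x => (2 * M + 1) * v x) by exact: bmZ.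
by rewrite e PhiD// PsiD// PhiZ// PsiZ// (unit v)// cst.
Qed.

End expectation.

Lemma measurable_iter d (T : measurableType d) (f : T -> T) n :
  measurable_fun setT f -> measurable_fun setT (iter n f).
Proof.
by move=> mf; elim: n => [|n IH]; [exact: measurable_id|exact: measurableT_comp mf IH].
Qed.

(** * Borel structure of the interval and of the map *)

Section I01_measurable.
Variable R : realType.
Local Notation X := (I01 R).
Implicit Types (x y : X) (s t : R) (u v : X -> R).

Lemma measurable_pt : measurable_fun setT (@pt R).
Proof. by move=> _ B mB; rewrite setTI; exists B => //; rewrite setTI. Qed.

Lemma measurable_I01 d (T : measurableType d) (g : T -> X) :
  measurable_fun setT (fun z => pt (g z)) -> measurable_fun setT g.
Proof.
move=> mg _ A [B mB <-]; rewrite !setTI -comp_preimage.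
by have := mg measurableT B mB; rewrite setTI.
Qed.

Lemma clamp_subproof s : 0 <= Num.max 0 (Num.min s 1) <= 1.
Proof. by rewrite le_max lexx ge_max ler01 ge_min lexx orbT. Qed.

(** The Lipschitz retraction of the line onto [0, 1]; through it, functions on [I01 R] inherit
    continuity and measurability from the real line. *)
Definition clamp s : X :=
  exist _ (Num.max 0 (Num.min s 1)) (I01_mem (clamp_subproof s)).

Lemma clampK x : clamp (pt x) = x.
Proof.
by apply/pt_inj; rewrite /pt /= min_l ?I01_le1// max_r// I01_ge0.
Qed.

Lemma clamp_lip s t : `|pt (clamp s) - pt (clamp t)| <= `|s - t|.
Proof.
have max_lip (a u v : R) : `|Num.max a u - Num.max a v| <= `|u - v|.
  have key (p q : R) : Num.max a p <= Num.max a q + `|p - q|.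
    rewrite ge_max; apply/andP; split; first by rewrite ler_wpDr// le_max lexx.
    by rewrite -lerBlDr (le_trans _ (_ : q <= _))// ?le_max ?lexx ?orbT// lerBlDr -lerBlDl ler_norm.
  rewrite ler_norml; have := key u v; have := key v u; rewrite distrC.
  by move: (Num.max a u) (Num.max a v) => p q h1 h2; apply/andP; split; lra.
have minE (u : R) : Num.min u 1 = - Num.max (- 1) (- u) by rewrite oppr_max !opprK minC.
rewrite /pt /= (le_trans (max_lip _ _ _))// !minE -opprD normrN.
by rewrite (le_trans (max_lip _ _ _))// -opprD normrN.
Qed.

Lemma clamp_id s : 0 <= s <= 1 -> pt (clamp s) = s.
Proof. by move=> /andP[s0 s1]; rewrite /pt /= min_l// max_r. Qed.

Section holder_exponent.
Variable gamma : R.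
Hypothesis gamma_gt0 : 0 < gamma.

Lemma hol_continuous c u : hol gamma c u -> continuous (fun s => u (clamp s)).
Proof.
move=> hu s; apply/cvgrPdist_le => e e0.
have [r r0 hr] := powR_small gamma_gt0 (hol_ge0 hu) e0.
apply: filterS (nbhsx_ballx s r r0) => t st.
by rewrite (le_trans (hu _ _))// hr// (le_trans (clamp_lip _ _))// ltW.
Qed.

Lemma hol_bm c u : hol gamma c u -> bm u.
Proof.
move=> hu; split.
  rewrite (_ : u = (fun s => u (clamp s)) \o @pt R).
    by apply: measurableT_comp; [apply: continuous_measurable_fun; exact: (hol_continuous hu)|exact: measurable_pt].
  by apply/funext => x /=; rewrite clampK.
exists (`|u (I01_0 R)| + c) => x.
rewrite -[u x](subrK (u (I01_0 R))) addrC (le_trans (ler_normD _ _))// lerD2l.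
exact: (hol_osc gamma_gt0 hu).
Qed.

End holder_exponent.

Lemma pt_hol1 : hol 1 1 (@pt R).
Proof. by move=> x y; rewrite mul1r /dist powRr1. Qed.

Definition upper_rays : set (set X) := range (fun t => [set x | t < pt x]).

Lemma upper_rays_setI : setI_closed upper_rays.
Proof.
move=> _ _ [s _ <-] [t _ <-]; exists (Num.max s t) => //.
by apply/seteqP; split => x /=; rewrite gt_max => /andP.
Qed.

Lemma measurable_upper_rays : @measurable _ X = <<s upper_rays >>.
Proof.
transitivity (preimage_set_system setT (@pt R) (@RGenOInfty.G R).-sigma.-measurable).
  by rewrite -RGenOInfty.measurableE.
rewrite -g_sigma_preimageE; congr (<<s _ >>).
apply/seteqP; split => A.
  move=> [_ [t ->] <-]; exists t => //; rewrite setTI; apply/seteqP.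
  by split => x /=; rewrite in_itv/= andbT.
move=> [t _ <-]; exists (`]t, +oo[%classic); first by exists t.
by rewrite setTI; apply/seteqP; split => x /=; rewrite in_itv/= andbT.
Qed.

Lemma measurable_ray t : measurable [set x : X | t < pt x].
Proof. by rewrite measurable_upper_rays; apply: sub_gen_smallest; exists t. Qed.

Lemma measurable_rayC t : measurable [set x : X | pt x <= t].
Proof.
rewrite (_ : [set x | _] = ~` [set x : X | t < pt x]).
  exact/measurableC/measurable_ray.
by apply/seteqP; split => x /=; rewrite leNgt => /negP.
Qed.

Lemma measurable_I01_set1 x : measurable [set x].
Proof.
have := measurable_pt measurableT (measurable_set1 (pt x)); rewrite setTI.
by congr measurable; apply/seteqP; split => y /= => [/pt_inj|->].
Qed.

Variable alpha : R.
Hypothesis alpha_gt0 : 0 < alpha.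

Lemma measurable_branch b : measurable_fun setT (@branch R alpha b).
Proof.
apply: measurable_I01; apply: (proj1 (@hol_bm 1 ltr01 1 _ _)) => x y.
by rewrite mul1r /dist powRr1//; exact: branch_le_dist.
Qed.

Lemma measurable_lift : measurable_fun setT (fun x : X => lift alpha (pt x)).
Proof.
have m1 := measurable_pt.
have m2 : measurable_fun setT (fun x : X => (pt x) `^ alpha).
  by apply: (measurableT_comp (@measurable_powR R alpha)).
apply: measurable_funM => //; apply: measurable_funD => //; exact: measurable_cst.
Qed.

Lemma measurable_digit : measurable_fun setT (@digit R alpha).
Proof.
apply: measurable_fun_ltr; [exact: measurable_cst|exact: measurable_lift].
Qed.

Lemma measurable_intermittent : measurable_fun setT (@intermittent R alpha).
Proof.
apply: measurable_I01.
rewrite (_ : (fun x => _) = fun x => lift alpha (pt x) - (digit alpha x)%:R).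
  apply: measurable_funB; first exact: measurable_lift.
  exact: (measurableT_comp (f := fun b : bool => b%:R : R)) measurable_digit.
by apply/funext => x; rewrite intermittent_lift.
Qed.

End I01_measurable.

(** * Representation of states by probability measures *)

Section states.
Variables (R : realType) (gamma : R).
Hypothesis gamma_gt0 : 0 < gamma.
Hypothesis gamma_le1 : gamma <= 1.
Local Notation X := (I01 R).
Local Notation hol := (@hol R gamma).
Local Notation dist := (@dist R gamma).
Implicit Types (u v : X -> R) (x y : X) (s t : R).

Definition isholder u := exists c, hol c u.

Lemma isholderD u v : isholder u -> isholder v -> isholder (fun x => u x + v x).
Proof. by move=> [c hc] [d hd]; exists (c + d); exact: holD. Qed.

Lemma isholderZ k u : isholder u -> isholder (fun x => k * u x).
Proof. by move=> [c hc]; exists (`|k| * c); exact: holZ. Qed.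

Lemma isholder_cst k : isholder (fun=> k).
Proof. by exists 0; exact: hol_cst. Qed.

(** Positive normalised linear functionals on the Hoelder functions. *)
Definition state (Phi : (X -> R) -> R) := [/\
  forall u v, isholder u -> isholder v -> Phi (fun x => u x + v x) = Phi u + Phi v,
  forall k u, isholder u -> Phi (fun x => k * u x) = k * Phi u,
  forall u v, isholder u -> isholder v -> (forall x, u x <= v x) -> Phi u <= Phi v &
  Phi (fun=> 1) = 1].

Lemma state_cst Phi k : state Phi -> Phi (fun=> k) = k.
Proof.
case=> _ PZ _ P1; rewrite -[RHS]mulr1 -P1 -PZ; last exact: isholder_cst.
by congr Phi; apply/funext => x; rewrite mulr1.
Qed.

Lemma state_close Phi u v e : state Phi -> isholder u -> isholder v ->
  (forall x, `|u x - v x| <= e) -> `|Phi u - Phi v| <= e.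
Proof.
move=> hP hu hv uv; have [PD _ Ple _] := hP.
have le (u' v' : X -> R) : isholder u' -> isholder v' -> (forall x, `|u' x - v' x| <= e) -> Phi u' <= Phi v' + e.
  move=> hu' hv' uv'; rewrite -(state_cst e hP) -PD//; last exact: isholder_cst.
  apply: Ple => //; first by apply: isholderD => //; exact: isholder_cst.
  by move=> x; have := uv' x; rewrite ler_norml => /andP[_]; lra.
have h1 := le u v hu hv uv.
have h2 : Phi v <= Phi u + e by apply: le => // x; rewrite distrC.
by rewrite ler_norml; apply/andP; split; lra.
Qed.

Lemma ev_state (nu : probability X R) : state (ev nu).
Proof.
have bmh u : isholder u -> bm u by case=> c; exact: hol_bm.
split.
- by move=> u v /bmh hu /bmh hv; exact: evD.
- by move=> k u /bmh hu; exact: evZ.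
- by move=> u v /bmh hu /bmh hv; exact: ev_le.
- exact: ev_cst.
Qed.

(** A Lipschitz majorant of the indicator of [0, t] that vanishes from t + 1 / (n + 1) on and
    decreases to the indicator as n grows. *)
Definition ramp n t x : R := pt (clamp (1 - n.+1%:R * (pt x - t))).

Lemma ramp_range n t x : 0 <= ramp n t x <= 1.
Proof. by rewrite I01_ge0 I01_le1. Qed.

Lemma ramp_holder n t : isholder (ramp n t).
Proof.
exists n.+1%:R => x y; rewrite (le_trans (clamp_lip _ _))//.
have -> : 1 - n.+1%:R * (pt x - t) - (1 - n.+1%:R * (pt y - t)) = n.+1%:R * (pt y - pt x) by ring.
rewrite normrM ger0_norm// ler_wpM2l// distrC /dist.
have [->|xy] := eqVneq (pt x) (pt y); first by rewrite subrr normr0 powR_ge0.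
apply: ger1_powR => //; rewrite normr_gt0 subr_eq0 xy /=.
by rewrite ler_norml; have := I01_ge0 x; have := I01_ge0 y; have := I01_le1 x; have := I01_le1 y; lra.
Qed.

Lemma ramp1 n t x : pt x <= t -> ramp n t x = 1.
Proof.
move=> xt; rewrite /ramp /pt /= min_r ?max_r//.
by rewrite lerBrDl gerDr mulr_ge0_le0// subr_le0.
Qed.

Lemma ramp0 n t x : t + n.+1%:R^-1 <= pt x -> ramp n t x = 0.
Proof.
move=> tx; rewrite /ramp /pt /= max_l// ge_min; apply/orP; left.
rewrite subr_le0 -[leLHS](@mulfV _ n.+1%:R) ?pnatr_eq0// ler_wpM2l//.
by rewrite lerBrDl.
Qed.

Lemma ramp_le m n s t x : (m <= n)%N -> s <= t -> ramp n s x <= ramp m t x.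
Proof.
move=> mn st; have [h|h] := leP (pt x) t.
  by rewrite [leRHS]ramp1//; case/andP: (ramp_range n s x).
rewrite /ramp /pt /= ge_max le_max lexx /= le_max; apply/orP; right.
rewrite le_min [X in _ && X]ge_min lexx orbT andbT ge_min; apply/orP; left.
rewrite lerD2l lerN2; apply: ler_pM => //.
- by rewrite subr_ge0 ltW.
- by rewrite ler_nat ltnS.
- by rewrite lerD2l lerN2.
Qed.

Section uniqueness.
Variables (u : X -> R) (c e r : R) (N : nat).
Hypothesis hu : hol c u.
Hypothesis hr : forall t, 0 <= t -> t <= r -> c * t `^ gamma <= e.
Let t_ (k : nat) : R := k%:R / N.+1%:R.

(* u is compared with a combination of the differences of consecutive ramps,
   which form a partition of unity. *)
Fixpoint pwl n k : X -> R := if k is j.+1 then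
  fun x => pwl n j x + u (clamp (t_ j.+1)) * (ramp n (t_ j.+1) x + -1 * ramp n (t_ j) x)
  else fun x => u (clamp (t_ 0)) * ramp n (t_ 0) x.

Lemma pwl_holder n k : isholder (pwl n k).
Proof.
elim: k => [|k IH] /=; first by apply: isholderZ; exact: ramp_holder.
by apply: isholderD => //; apply: isholderZ; apply: isholderD; [|apply: isholderZ]; exact: ramp_holder.
Qed.

Let N0 : (0 : R) < N.+1%:R. Proof. by rewrite ltr0n. Qed.

(** Where two consecutive ramps differ, x is within r of the node, so the error is at most e times
    their difference; these errors telescope to e times the last ramp. *)
Lemma pwl_close n k x : N.+1%:R^-1 <= r -> n.+1%:R^-1 <= r -> (k <= N.+1)%N ->
  `|u x * ramp n (t_ k) x - pwl n k x| <= e * ramp n (t_ k) x.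
Proof.
move=> Nr nr.
have t01 j : (j <= N.+1)%N -> 0 <= t_ j <= 1.
  by move=> jN; rewrite divr_ge0//= ler_pdivrMr// mul1r ler_nat.
have close j : (j <= N.+1)%N -> `|pt x - t_ j| <= r -> `|u x - u (clamp (t_ j))| <= e.
  move=> jN xr; rewrite (le_trans (hu _ _))// hr// clamp_id//; exact: t01.
have n0 : (0 : R) < n.+1%:R^-1 by rewrite invr_gt0 ltr0n.
have N1 : (0 : R) < N.+1%:R^-1 by rewrite invr_gt0.
elim: k => [_|k IH kN] /=.
  have /andP[r0 _] := ramp_range n (t_ 0) x.
  rewrite -mulrBl normrM (ger0_norm r0).
  have [h|h] := leP (t_ 0 + n.+1%:R^-1) (pt x); first by rewrite ramp0 ?mulr0.
  rewrite ler_wpM2r// close// ler_norml.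
  have x0 := I01_ge0 x; have t00 : t_ 0 = 0 by rewrite /t_ mul0r.
  by move: h; rewrite t00 add0r subr0 => h; move: (n.+1%:R^-1) h nr => a h nr; apply/andP; split; lra.
have := IH (ltnW kN).
set a := ramp n (t_ k.+1) x; set b := ramp n (t_ k) x.
have ts : t_ k.+1 = t_ k + N.+1%:R^-1 by rewrite /t_ -natr1 mulrDl mul1r.
have ab : b <= a by apply: ramp_le => //; rewrite ts lerDl ltW.
have term : `|(u x - u (clamp (t_ k.+1))) * (a - b)| <= e * (a - b).
  rewrite normrM [X in _ * X]ger0_norm ?subr_ge0//.
  have [h1|h1] := leP (t_ k.+1 + n.+1%:R^-1) (pt x).
    rewrite ts in h1; rewrite /a /b !ramp0 ?ts// ?subrr ?mulr0//.
    by apply: le_trans h1; rewrite lerD2r lerDl ltW.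
  have [h2|h2] := leP (pt x) (t_ k).
    by rewrite /a /b !ramp1 ?subrr ?mulr0// ts (le_trans h2)// lerDl ltW.
  rewrite ler_wpM2r ?subr_ge0// close// ler_norml.
  rewrite ts in h1 *; move: (n.+1%:R^-1) (N.+1%:R^-1) (t_ k) nr Nr h1 h2 => p q w nr' Nr' h1 h2.
  by apply/andP; split; lra.
have alg (ux w A B p : R) : ux * A - (p + w * (A + -1 * B)) = (ux * B - p) + (ux - w) * (A - B).
  by ring.
rewrite alg => h; rewrite (le_trans (ler_normD _ _))// (le_trans (lerD h term))//.
by rewrite mulrBr addrC subrK.
Qed.

(** [pwl] is a combination of ramps whose coefficients do not depend on the state, so the limit S is
    common to all states with the same F. *)
Lemma pwl_cvg (F : R -> R) k : exists S : R, forall Phi, state Phi ->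
  (forall t, Phi (ramp n t) @[n --> \oo] --> F t) -> Phi (pwl n k) @[n --> \oo] --> S.
Proof.
elim: k => [|k [S hS]].
  exists (u (clamp (t_ 0)) * F (t_ 0)) => Phi [_ PZ _ _] hF.
  rewrite (_ : (fun n => _) = fun n => u (clamp (t_ 0)) * Phi (ramp n (t_ 0))).
    by apply: cvgM; [exact: cvg_cst|exact: hF].
  by apply/funext => n; rewrite /= PZ//; exact: ramp_holder.
exists (S + u (clamp (t_ k.+1)) * (F (t_ k.+1) + -1 * F (t_ k))) => Phi sP hF.
have [PD PZ _ _] := sP.
rewrite (_ : (fun n => _) = fun n => Phi (pwl n k) +
   u (clamp (t_ k.+1)) * (Phi (ramp n (t_ k.+1)) + -1 * Phi (ramp n (t_ k)))).
  apply: cvgD; first exact: hS.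
  by apply: cvgM; [exact: cvg_cst|apply: cvgD => //; apply: cvgM; [exact: cvg_cst|exact: hF]].
have hz n t : isholder (fun x => -1 * ramp n t x) by apply: isholderZ; exact: ramp_holder.
have hd n s t : isholder (fun x => ramp n s x + -1 * ramp n t x).
  by apply: isholderD => //; exact: ramp_holder.
apply/funext => n; rewrite /= PD ?PZ ?PD ?PZ//; try exact: ramp_holder.
  exact: pwl_holder.
exact: isholderZ.
Qed.

End uniqueness.

Lemma state_unique Phi Psi (F : R -> R) : state Phi -> state Psi ->
  (forall t, Phi (ramp n t) @[n --> \oo] --> F t) ->
  (forall t, Psi (ramp n t) @[n --> \oo] --> F t) ->
  forall u, isholder u -> Phi u = Psi u.
Proof.
move=> sP sQ PF QF u hu'; have [c hu] := hu'.
apply/eqP; rewrite -subr_eq0 -normr_le0; apply/ler_addgt0Pl => e0 e00; rewrite addr0.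
pose e := e0 / 2; have e_gt0 : 0 < e by rewrite divr_gt0.
have [r r0 hr] := powR_small gamma_gt0 (hol_ge0 hu) e_gt0.
have [N hN] : exists N : nat, forall n, (N <= n)%N -> n.+1%:R^-1 <= r.
  exists (Num.bound r^-1) => n nN; rewrite -[leRHS]invrK lef_pV2 ?posrE ?invr_gt0 ?ltr0n//.
  rewrite (le_trans (ltW (archi_boundP (ltW _))))//.
  by rewrite ?invr_gt0 ?ler_nat// ltnW.
  by rewrite ler_nat (leq_trans nN).
have [S hS] := pwl_cvg u N F N.+1.
have key Xi : state Xi -> (forall t, Xi (ramp n t) @[n --> \oo] --> F t) -> `|Xi u - S| <= e.
  move=> sX XF; apply: (@ler_cvg_to nat \oo _ R
    (fun n => `|Xi u - Xi (pwl u N n N.+1)|) (fun=> e)).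
  - by apply: cvg_norm; apply: cvgB; [exact: cvg_cst|exact: hS].
  - exact: cvg_cst.
  exists N => // n /= nN; apply: (state_close sX hu' (pwl_holder u N n N.+1)).
  move=> x; have := @pwl_close u c e r N hu hr n N.+1 x (hN _ (leqnn N)) (hN _ nN) (leqnn _).
  by rewrite mulfV ?pnatr_eq0// ramp1 ?I01_le1// !mulr1.
have h1 := key _ sP PF; have h2 := key _ sQ QF.
have -> : Phi u - Psi u = (Phi u - S) - (Psi u - S) by rewrite opprB addrA subrK.
by rewrite (le_trans (ler_normB _ _))// (le_trans (lerD h1 h2))// /e; lra.
Qed.

Section representation.
Variable Phi : (X -> R) -> R.
Hypothesis sP : state Phi.

Definition state_cdf t : R := inf (range (fun n => Phi (ramp n t))).

Lemma state_ramp_le m n s t : (m <= n)%N -> s <= t -> Phi (ramp n s) <= Phi (ramp m t).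
Proof.
move=> mn st; have [_ _ Ple _] := sP.
by apply: Ple; try exact: ramp_holder; move=> x; exact: ramp_le.
Qed.

Lemma state_ramp_ge0 n t : 0 <= Phi (ramp n t).
Proof.
have [_ _ Ple _] := sP; rewrite -[leLHS](state_cst 0 sP).
apply: Ple; [exact: isholder_cst|exact: ramp_holder|move=> x].
by case/andP: (ramp_range n t x).
Qed.

Let hlb t : has_lbound (range (fun n => Phi (ramp n t))).
Proof. by exists 0 => _ [n _ <-]; exact: state_ramp_ge0. Qed.

Lemma state_cdf_cvg t : Phi (ramp n t) @[n --> \oo] --> state_cdf t.
Proof. by apply: nonincreasing_cvgn => // m n mn; exact: state_ramp_le. Qed.

Lemma state_cdf_le n t : state_cdf t <= Phi (ramp n t).
Proof. by apply: ge_inf => //; exists n. Qed.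

Lemma state_cdf_lb a t : (forall n, a <= Phi (ramp n t)) -> a <= state_cdf t.
Proof.
by move=> h; apply: lb_le_inf; [exists (Phi (ramp 0 t)), 0%N|move=> _ [n _ <-]].
Qed.

Lemma state_cdf_nd : nondecreasing state_cdf.
Proof.
move=> s t st; apply: state_cdf_lb => n.
exact: le_trans (state_cdf_le n s) (state_ramp_le (leqnn n) st).
Qed.

(** For a fixed n the value of the state on [ramp n s] is continuous in s. It bounds the
    distribution function at s from above and, for large n, is close to it at t. *)
Lemma state_cdf_rc : right_continuous state_cdf.
Proof.
move=> t; apply/cvgrPdist_le => e e0.
have e2 : 0 < e / 2 by rewrite divr_gt0.
have /cvgrPdist_le/(_ _ e2)[n _ /(_ n (leqnn n)) hn] := @state_cdf_cvg t.
have n0 : (0 : R) < n.+1%:R by rewrite ltr0n.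
near=> s.
have ts : t < s by near: s; exact: nbhs_right_gt.
have st : s <= t + e / 2 / n.+1%:R.
  by near: s; apply: nbhs_right_le; rewrite ltrDl divr_gt0.
have close : `|Phi (ramp n s) - Phi (ramp n t)| <= e / 2.
  apply: state_close => //; try exact: ramp_holder.
  move=> x; rewrite (le_trans (clamp_lip _ _))//.
  have -> : 1 - n.+1%:R * (pt x - s) - (1 - n.+1%:R * (pt x - t)) = (s - t) * n.+1%:R by ring.
  by rewrite ger0_norm ?mulr_ge0 ?subr_ge0 ?(ltW ts)// -ler_pdivlMr// lerBlDl.
rewrite distrC ger0_norm ?subr_ge0; last by apply: state_cdf_nd; exact: ltW.
have := state_cdf_le n s; move: close hn; rewrite !ler_norml => /andP[_ h1] /andP[h2 _].
by lra.
Unshelve. all: by end_near.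
Qed.

Lemma state_cdf_lt0 t : t < 0 -> state_cdf t = 0.
Proof.
move=> t0; apply/eqP; rewrite eq_le; apply/andP; split; last first.
  by apply: state_cdf_lb => n; exact: state_ramp_ge0.
have t0' : 0 < (- t)^-1 by rewrite invr_gt0 oppr_gt0.
have hn := archi_boundP (ltW t0'); set n := Num.bound _ in hn.
apply: le_trans (state_cdf_le n t) _; rewrite (_ : ramp n t = fun=> 0) ?state_cst//.
apply/funext => x; apply: ramp0; rewrite (le_trans _ (I01_ge0 x))//.
rewrite -lerBrDl sub0r -[leRHS]invrK lef_pV2 ?posrE ?ltr0n//.
by rewrite (le_trans (ltW hn))// ler_nat.
Qed.

Lemma state_cdf_ge1 t : 1 <= t -> state_cdf t = 1.
Proof.
move=> t1.
have r1 n : ramp n t = fun=> 1.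
  by apply/funext => x; rewrite ramp1// (le_trans (I01_le1 x)).
apply/eqP; rewrite eq_le; apply/andP; split.
  by rewrite (le_trans (state_cdf_le 0 t))// r1 state_cst.
by apply: state_cdf_lb => n; rewrite r1 state_cst.
Qed.

Lemma state_cdf_Ny : state_cdf @ -oo --> (0 : R).
Proof.
apply: cvg_near_cst; exists (-1); split; first exact: num_real.
by move=> s s1; rewrite state_cdf_lt0// (lt_trans s1)// ltrN10.
Qed.

Lemma state_cdf_y : state_cdf @ +oo --> (1 : R).
Proof.
apply: cvg_near_cst; exists 1; split; first exact: num_real.
by move=> s s1; rewrite state_cdf_ge1// ltW.
Qed.

Definition clampR : measurableTypeR R -> X := @clamp R.

Lemma measurable_clamp : measurable_fun setT clampR.
Proof.
apply: measurable_I01; apply: (@continuous_measurable_fun R).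
exact: (hol_continuous ltr01 (@pt_hol1 R)).
Qed.

(** The Riesz representation on an interval: the Lebesgue-Stieltjes measure of the distribution
    function of the state, pushed to [0, 1] by [clamp]. Its values on ramps are squeezed between F t
    and F (t + 1 / (n + 1)), and [state_unique] concludes. *)
Lemma state_measure : exists nu : probability X R, forall u, isholder u -> ev nu u = Phi u.
Proof.
pose F0 := isCumulative.Build R _ R state_cdf state_cdf_nd state_cdf_rc.
pose F1 := isCumulativeBounded.Build R 0 1 state_cdf state_cdf_Ny state_cdf_y.
pose F : cumulativeBounded (0 : R) (1 : R) := HB.pack state_cdf F0 F1.
pose g0 := isMeasurableFun.Build _ _ _ _ clampR measurable_clamp.
pose g : {mfun measurableTypeR R >-> X} := HB.pack clampR g0.
pose mu : probability (measurableTypeR R) R := lebesgue_stieltjes_measure F.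
pose nu : probability X R := distribution mu g.
have nuF t : pr nu [set x | pt x <= t] = state_cdf t.
  have muF s : mu `]-oo, s]%classic = (state_cdf s)%:E.
    exact: (cdf_lebesgue_stieltjes_id F s).
  have e : nu [set x | pt x <= t] = mu (clampR @^-1` [set x | pt x <= t]) by [].
  (* [clamp] collapses the half-lines outside [0, 1], so t >= 1 and t < 0 are treated apart. *)
  rewrite /pr e; have [t1|t1] := leP 1 t.
    rewrite state_cdf_ge1// (_ : _ @^-1` _ = setT) ?probability_setT//.
    by apply/seteqP; split => // s _ /=; rewrite (le_trans (I01_le1 _)).
  have [t0|t0] := leP 0 t; last first.
    rewrite state_cdf_lt0// (_ : _ @^-1` _ = set0) ?measure0//.
    apply/seteqP; split => // s /= h; have := le_lt_trans h t0.
    by rewrite ltNge I01_ge0.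
  rewrite (_ : _ @^-1` _ = `]-oo, t]%classic) ?muF//.
  apply/seteqP; split => s /=; rewrite in_itv /=.
    by rewrite /pt /= ge_max ge_min t0 /= => /orP[//|]; rewrite leNgt t1.
  by move=> st; rewrite /pt /= ge_max ge_min t0 st.
exists nu; apply: (state_unique (F := state_cdf)) => //; first exact: ev_state.
  2: exact: state_cdf_cvg.
have bmh u : isholder u -> bm u by case=> c; exact: hol_bm.
have lo n t : state_cdf t <= ev nu (ramp n t).
  have mA := @measurable_rayC R t.
  rewrite -nuF -ev_indic//; apply: ev_le; [exact: bm_indic|exact/bmh/ramp_holder|].
  move=> x; rewrite indicE; case: (boolP (x \in _)); last by case/andP: (ramp_range n t x).
  by rewrite inE /= => h; rewrite ramp1.
have hi n t : ev nu (ramp n t) <= state_cdf (t + n.+1%:R^-1).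
  have mA := @measurable_rayC R (t + n.+1%:R^-1).
  rewrite -nuF -ev_indic//; apply: ev_le; [exact/bmh/ramp_holder|exact: bm_indic|].
  move=> x; rewrite indicE; case: (boolP (x \in _)); first by case/andP: (ramp_range n t x).
  by move=> h; rewrite ramp0// leNgt; apply/negP => /ltW h'; move: h; rewrite mem_set.
move=> t; apply: (@squeeze_cvgr _ _ _ _ (fun=> state_cdf t) (fun n => state_cdf (t + n.+1%:R^-1))).
- by apply: nearW => n; rewrite lo hi.
- exact: cvg_cst.
- apply/cvgrPdist_le => e e0.
  have /cvgrPdist_le/(_ _ e0)[d /= d0 hd] := @state_cdf_rc t.
  have d0' : 0 < d^-1 by rewrite invr_gt0.
  exists (Num.bound d^-1) => // n /= nb; apply: hd; last by rewrite ltrDl invr_gt0.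
  rewrite /= opprD addrA subrr sub0r normrN ger0_norm ?invr_ge0//.
  rewrite -[ltRHS]invrK ltf_pV2 ?posrE ?ltr0n//.
  by rewrite (lt_le_trans (archi_boundP (ltW d0')))// ler_nat ltnW.
Qed.

End representation.
End states.

(** * The stationary measure *)

Section probability_unique.
Variables (R : realType) (gamma : R).
Hypothesis gamma_gt0 : 0 < gamma.
Hypothesis gamma_le1 : gamma <= 1.
Local Notation X := (I01 R).
Implicit Types (nu : probability X R) (t : R).

Lemma pr_setC nu (A : set X) : measurable A -> pr nu (~` A) = 1 - pr nu A.
Proof.
move=> mA; apply: EFin_inj; rewrite EFinB !prE//; last exact: measurableC.
exact: probability_setC.
Qed.

Lemma ev_ramp_cvg nu t : ev nu (ramp n t) @[n --> \oo] --> pr nu [set x | pt x <= t].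
Proof.
have bmr n s : bm (ramp n s : X -> R).
  by have [c] := ramp_holder gamma_le1 n s; exact: hol_bm.
pose A n := [set x : X | pt x <= t + n.+1%:R^-1].
have mA n : measurable (A n) by exact: measurable_rayC.
have capA : \bigcap_n A n = [set x | pt x <= t].
  apply/seteqP; split => x /= h; last first.
    by move=> n _; rewrite /A /= (le_trans h)// lerDl invr_ge0.
  apply/ler_addgt0Pl => e e0; rewrite addrC.
  have e0' : 0 < e^-1 by rewrite invr_gt0.
  rewrite (le_trans (h (Num.bound e^-1) I))// lerD2l.
  rewrite -[leRHS]invrK lef_pV2 ?posrE ?ltr0n//.
  by rewrite (le_trans (ltW (archi_boundP (ltW e0'))))// ler_nat.
have cvA : pr nu (A n) @[n --> \oo] --> pr nu [set x | pt x <= t].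
  rewrite -capA; apply: fine_cvg; rewrite prE; last exact: bigcapT_measurable.
  apply: nonincreasing_cvg_mu => //.
  - exact: le_lt_trans (probability_le1 nu (mA 0%N)) (ltry 1).
  - exact: bigcapT_measurable.
  - move=> m n mn; apply/subsetPset => x /= /le_trans; apply.
    by rewrite lerD2l lef_pV2 ?posrE ?ltr0n// ler_nat ltnS.
apply: (@squeeze_cvgr _ _ _ _ (fun=> pr nu [set x | pt x <= t]) (fun n => pr nu (A n))) => //.
  2: exact: cvg_cst.
apply: nearW => n; rewrite -!ev_indic//; last exact: measurable_rayC.
apply/andP; split; apply: ev_le => //; try exact/bm_indic/measurable_rayC.
- move=> x; rewrite indicE; case: (boolP (x \in _)); last by case/andP: (ramp_range n t x).
  by rewrite inE /= => h; rewrite ramp1.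
- move=> x; rewrite indicE; case: (boolP (x \in _)); first by case/andP: (ramp_range n t x).
  by move=> h; rewrite ramp0// leNgt; apply/negP => /ltW h'; move: h; rewrite mem_set.
Qed.

Lemma probability_unique nu mu : (forall u, isholder gamma u -> ev nu u = ev mu u) ->
  forall A, measurable A -> nu A = mu A.
Proof.
move=> h; apply: (measure_unique (@upper_rays R) (fun=> setT)).
- exact: measurable_upper_rays.
- exact: upper_rays_setI.
- move=> _; exists (-1) => //; apply/seteqP; split => // x _ /=.
  by rewrite (lt_le_trans _ (I01_ge0 x))// ltrN10.
- by rewrite bigcup_const//; exists 0%N.
- move=> _ [t _ <-].
  have -> : [set x : X | t < pt x] = ~` [set x | pt x <= t].
    by apply/seteqP; split => x /=; rewrite ltNge => /negP.
  have mt := @measurable_rayC R t.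
  have prC (m : probability X R) : m (~` [set x | pt x <= t]) = (1 - pr m [set x | pt x <= t])%:E.
    by rewrite -pr_setC// prE//; exact: measurableC.
  transitivity ((1 - pr nu [set x | pt x <= t])%:E); first exact: prC.
  transitivity ((1 - pr mu [set x | pt x <= t])%:E); last exact/esym/prC.
  congr (1 - _)%:E.
  have c1 := @ev_ramp_cvg nu t; have c2 := @ev_ramp_cvg mu t.
  have e : (fun n => ev nu (ramp n t)) = (fun n => ev mu (ramp n t)).
    by apply/funext => n; rewrite h//; exact: ramp_holder.
  by rewrite e in c1; apply: cvg_unique c1 c2.
- by move=> _; exact: le_lt_trans (probability_le1 nu measurableT) (ltry 1).
Qed.

End probability_unique.

(** * Dual measures and stationarity *)

Section stationary_measure.
Variables (R : realType) (alpha : R).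
Hypothesis alpha_gt0 : 0 < alpha.
Local Notation X := (I01 R).
Local Notation branch := (@branch R alpha).
Local Notation wbranch := (@wbranch R alpha).
Local Notation transfer := (@transfer R alpha R).
Local Notation f := (@intermittent R alpha).
Local Notation one := (fun _ : X => 1 : R).
Implicit Types (u v : X -> R) (x y : X).
Variable gamma : R.
Hypothesis gamma_gt0 : 0 < gamma.
Hypothesis gamma_le1 : gamma <= 1.
Local Notation hol := (@hol R gamma).
Local Notation dist := (@dist R gamma).
Local Notation isholder := (@isholder R gamma).
Variables (p : bool -> X -> R) (c0 Bp : R).
Hypothesis c0_gt0 : 0 < c0.
Hypothesis p_ge : forall b x, c0 <= p b x.
Hypothesis p_sum : forall x, p false x + p true x = 1.
Hypothesis p_hol : forall b, hol Bp (p b).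
Local Notation M := (transfer p).

Let p0 b x : 0 <= p b x. Proof. exact: le_trans (ltW c0_gt0) (p_ge b x). Qed.
Let p1 b x : p b x <= 1.
Proof. by rewrite -(p_sum x); case: b; rewrite ?lerDr ?lerDl. Qed.

Lemma bm_p b : bm (p b). Proof. exact: (hol_bm gamma_gt0 (p_hol b)). Qed.

Lemma bm_markov u : bm u -> bm (M u).
Proof.
move=> hu; have hb b : bm (fun x => u (branch b x)).
  by apply: bm_comp => //; exact: measurable_branch.
by apply: bmD; apply: bmM => //; exact: bm_p.
Qed.

Lemma bm_iter_markov n u : bm u -> bm (iter n M u).
Proof. by move=> hu; elim: n => //= n IH; exact: bm_markov. Qed.

Lemma holder_markov u : isholder u -> isholder (M u).
Proof.
move=> [s hu]; have q01 b x : 0 <= p b x <= 1 by rewrite p0 p1.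
have [C C0 LY] := lasota_yorke alpha_gt0 gamma_gt0 1 q01 p_hol.
exists (s + C * (`|u (I01_0 R)| + s)) => x y.
have := LY u s (`|u (I01_0 R)| + s) hu _ x y => /=.
move=> /(_ _)/le_trans; apply.
  move=> z; rewrite -[u z](subrK (u (I01_0 R))) addrC (le_trans (ler_normD _ _))// lerD2l.
  exact: (hol_osc gamma_gt0 hu).
rewrite ler_wpM2r ?dist_ge0// lerD2r ler_piMr ?(hol_ge0 hu)//.
apply: (@le_trans _ _ (p false x + p true x)); last by rewrite p_sum.
rewrite transferE.
have le1 b z : damped alpha gamma p b z <= p b z.
  rewrite /damped ler_piMr// powRN invf_le1 ?powR_gt0//; last by rewrite ltr_wpDr ?powR_ge0.
  have q1 : 1 <= 1 + (pt (branch b z)) `^ alpha by rewrite lerDl powR_ge0.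
  by have := ge0_ler_powR (ltW gamma_gt0) ler01 (le_trans ler01 q1) q1; rewrite powR1.
by apply: lerD; rewrite mulr1.
Qed.

Section dual_measure.
Variable nu : probability X R.

(** The part of the dual measure of nu under M that is carried by the image of branch b. *)
Definition branch_part b (A : set X) : \bar R :=
  (\int[nu]_(x in branch b @^-1` A) (p b x)%:E)%E.

Let bp0 b : branch_part b set0 = 0%E.
Proof. by rewrite /branch_part preimage_set0 integral_set0. Qed.

Let bp_ge0 b A : (0 <= branch_part b A)%E.
Proof. by apply: integral_ge0 => x _; rewrite lee_fin. Qed.

Let mbranch b (A : set X) : measurable A -> measurable (branch b @^-1` A).
Proof. by move=> mA; rewrite -[X in measurable X]setTI; exact: measurable_branch. Qed.

Let bp_sigma b : semi_sigma_additive (branch_part b).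
Proof.
move=> /= A mA tA mUA; rewrite /branch_part preimage_bigcup ge0_integral_bigcup//=.
- apply: is_cvg_ereal_nneg_natsum_cond => n _ _.
  by apply: integral_ge0 => /= x _; rewrite lee_fin.
- by move=> k; exact: mbranch.
- apply: measurable_funTS; apply/measurable_EFinP; exact: (bm_p b).1.
- by move=> x _; rewrite lee_fin.
- by move=> i j _ _ [x [h1 h2]]; apply: (tA i j) => //; exists (branch b x).
Qed.

HB.instance Definition _ b := isMeasure.Build _ _ _ (branch_part b)
  (bp0 b) (bp_ge0 b) (@bp_sigma b).

Definition dual_measure := measure_add (branch_part false) (branch_part true).

Lemma branch_partE b A : measurable A ->
  branch_part b A = (ev nu (fun x => p b x * \1_A (branch b x)))%:E.
Proof.
move=> mA; have hA : bm (fun x => \1_A (branch b x) : R).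
  by apply: bm_comp; [exact: measurable_branch|exact: bm_indic].
rewrite evE; last by apply: bmM => //; exact: bm_p.
rewrite /branch_part integral_mkcond; apply: eq_integral => x _.
rewrite patchE indicE; case: ifPn => h.
  by rewrite mem_set ?mulr1//; move: h; rewrite inE.
by rewrite memNset ?mulr0// => hx; move: h; rewrite mem_set.
Qed.

Lemma dual_measureE A : measurable A -> dual_measure A = (ev nu (M \1_A))%:E.
Proof.
move=> mA; transitivity (branch_part false A + branch_part true A)%E; first exact: measure_addE.
rewrite !branch_partE// -EFinD -evD//.
all: apply: bmM; first exact: bm_p.
all: by apply: bm_comp; [exact: measurable_branch|exact: bm_indic].
Qed.

Lemma dual_measureT : dual_measure setT = 1%E.
Proof.
rewrite dual_measureE// (_ : M \1_setT = fun=> 1) ?ev_cst//.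
by apply/funext => x; rewrite transferE !indicE !in_setT !mulr1 p_sum.
Qed.

HB.instance Definition _ := Measure.on dual_measure.
HB.instance Definition _ := Measure_isProbability.Build _ _ _ dual_measure dual_measureT.

Lemma markovD u v : M (fun x => u x + v x) = fun x => M u x + M v x.
Proof. by apply/funext => x; rewrite !transferE; ring. Qed.

Lemma markovZ k u : M (fun x => k * u x) = fun x => k * M u x.
Proof. by apply/funext => x; rewrite !transferE; ring. Qed.

Lemma markov_le u v : (forall x, u x <= v x) -> forall x, M u x <= M v x.
Proof. by move=> uv x; rewrite !transferE lerD// ler_wpM2l. Qed.

Lemma ev_dual u : bm u -> ev dual_measure u = ev nu (M u).
Proof.
move=> hu; apply: (functional_eq (Phi := ev dual_measure) (Psi := fun u => ev nu (M u))) hu.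
- by move=> v w hv hw; exact: evD.
- by move=> k v hv; exact: evZ.
- by move=> v w hv hw; exact: ev_le.
- by move=> v w hv hw; rewrite markovD evD//; exact: bm_markov.
- by move=> k v hv; rewrite markovZ evZ//; exact: bm_markov.
- by move=> v w hv hw vw; apply: ev_le; [exact: bm_markov|exact: bm_markov|exact: markov_le].
- by move=> A mA; rewrite ev_indic// /pr [fine _](congr1 fine (dual_measureE mA)).
Qed.

End dual_measure.

Variable nu : probability X R.
Hypothesis nu_markov : forall u, isholder u -> ev nu (M u) = ev nu u.

(** Stationarity on Hoelder functions says that nu and its dual measure have the same Hoelder
    integrals. Hence they are the same measure, and stationarity extends to bounded measurable
    functions. *)
Lemma ev_markov u : bm u -> ev nu (M u) = ev nu u.
Proof.
have bmh v : isholder v -> bm v by case=> c; exact: hol_bm.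
have e : forall A, measurable A -> dual_measure nu A = nu A.
  apply: (probability_unique gamma_gt0 gamma_le1) => v hv.
  by rewrite ev_dual ?nu_markov//; exact: bmh.
move=> hu; rewrite -ev_dual//; congr fine.
by apply: eq_measure_integral => A mA _; exact: e.
Qed.

(** The only inverse branch that reaches 0 is the left one, and only from 0 itself. So M maps the
    indicator of 0 to [p false] at 0 times itself, and that factor is less than 1. *)
Lemma stationary_no_atom : pr nu [set I01_0 R] = 0.
Proof.
have m0 := measurable_I01_set1 (I01_0 R).
have h0 : bm (\1_[set I01_0 R] : X -> R) by exact: bm_indic.
have := ev_markov h0; rewrite (_ : M _ = fun x => p false (I01_0 R) * \1_[set I01_0 R] x).
  rewrite evZ// ev_indic// => e.
  have : (1 - p false (I01_0 R)) * pr nu [set I01_0 R] = 0 by rewrite mulrBl e mul1r subrr.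
  have -> : 1 - p false (I01_0 R) = p true (I01_0 R) by rewrite -(p_sum (I01_0 R)) addrC addKr.
  by move=> /eqP; rewrite mulf_eq0 gt_eqF ?(lt_le_trans c0_gt0)//= => /eqP.
apply/funext => x; rewrite transferE !indicE.
have -> : branch true x \in [set I01_0 R] = false.
  apply/negbTE; rewrite notin_setE /= => /(congr1 (@pt R)) /eqP.
  by rewrite pt0 gt_eqF// branch_gt0// ltr_wpDl ?I01_ge0.
have -> : branch false x \in [set I01_0 R] = (x \in [set I01_0 R]).
  apply/idP/idP; rewrite !inE /=; [move=> h|by move=> ->; exact: branch_false0].
  apply/pt_inj; rewrite pt0; apply/eqP; rewrite eq_le I01_ge0 andbT leNgt; apply/negP => x0.
  by have := branch_gt0 alpha_gt0 (b := false) (x := x); rewrite addr0 h pt0 ltxx => /(_ x0).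
case: (boolP (x \in _)) => [|_]; last by rewrite !mulr0 addr0.
by rewrite inE /= => ->; rewrite mulr0 addr0.
Qed.

Lemma ev_eq_off0 u v : bm u -> bm v -> (forall x, 0 < pt x -> u x = v x) -> ev nu u = ev nu v.
Proof.
move=> hu hv uv; have m0 := measurable_I01_set1 (I01_0 R).
have h0 : bm (\1_[set I01_0 R] : X -> R) by exact: bm_indic.
apply/eqP; rewrite -subr_eq0 -evB//.
rewrite (_ : (fun x => _) = fun x => (u (I01_0 R) - v (I01_0 R)) * \1_[set I01_0 R] x).
  by rewrite evZ// ev_indic// stationary_no_atom mulr0.
apply/funext => x; rewrite indicE; case: (boolP (x \in _)).
  by rewrite inE /= => ->; rewrite mulr1.
move=> h; rewrite mulr0; apply/eqP; rewrite subr_eq0; apply/eqP/uv.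
rewrite lt_neqAle I01_ge0 andbT; apply: contraNneq h => e.
by rewrite inE /=; apply/pt_inj; rewrite pt0.
Qed.

(** Off 0, f undoes the branches, so that M ((psi o f) v) = psi (M v) there; 0 has mass 0. *)
Lemma ev_koopman n psi v : bm psi -> bm v ->
  ev nu (fun x => psi (iter n f x) * v x) = ev nu (fun x => psi x * iter n M v x).
Proof.
move=> hpsi; elim: n v => [//|n IH] v hv.
have mf n' := measurable_iter n' (measurable_intermittent alpha_gt0).
have hpf k : bm (fun x => psi (iter k f x)) by exact: bm_comp.
rewrite -ev_markov; last exact: bmM.
rewrite iterSr -IH; last exact: bm_markov.
apply: ev_eq_off0.
- exact/bm_markov/bmM.
- by apply: bmM => //; exact: bm_markov.
- move=> x x0; rewrite !transferE !iterSr !intermittent_branch//; ring.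
Qed.

Lemma stationary_invariant : invariant_measure f nu.
Proof.
move=> A mA.
have mfA : measurable (f @^-1` A).
  by rewrite -[X in measurable X]setTI; exact: measurable_intermittent.
rewrite -!prE//; congr EFin.
have := @ev_koopman 1 \1_A one (bm_indic R mA) (bm_cst _ 1).
have -> : (fun x => \1_A x * iter 1 M one x) = \1_A.
  by apply/funext => x; rewrite /= transferE !mulr1 p_sum mulr1.
rewrite (_ : (fun x => _) = \1_(f @^-1` A)).
  by rewrite !ev_indic.
by apply/funext => x; rewrite mulr1 /= !indicE; congr (_ _); apply/idP/idP; rewrite !inE.
Qed.

(** Off 0, the iterate of M of order [size w] applied to the indicator of the cylinder retains the
    single term of the word w. *)
Lemma pr_cylinder w : pr nu [set x | word alpha (size w) x = w] = ev nu (weight alpha p w).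
Proof.
have mW n (v : seq bool) : measurable [set x | word alpha n x = v].
  elim: n v => [|n IH] v.
    case: v => [|b v]; last by rewrite (_ : [set _ | _] = set0)//; apply/seteqP; split.
    by rewrite (_ : [set _ | _] = setT)//; apply/seteqP; split.
  case: v => [|b v]; first by rewrite (_ : [set _ | _] = set0)//; apply/seteqP; split.
  rewrite (_ : [set _ | _] = @digit R alpha @^-1` [set b] `&` f @^-1` [set x | word alpha n x = v]).
    apply: measurableI.
      by rewrite -[X in measurable X]setTI; exact: measurable_digit.
    by rewrite -[X in measurable X]setTI; apply: measurable_intermittent.
  apply/seteqP; split => x /=; rewrite wordS; first by case.
  by case=> -> ->.
have bmw (v : seq bool) : bm (weight alpha p v).
  elim: v => [|b v IH] /=; first exact: bm_cst.
  apply: bmM => //; apply: (bm_comp (g := wbranch v)); last exact: bm_p.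
  elim: v {IH} => [|b' v IH] /=; first exact: measurable_id.
  by apply: measurableT_comp => //; exact: measurable_branch.
set A := [set x | _]; have mA : measurable A by exact: mW.
rewrite -ev_indic//.
have hA : bm (\1_A : X -> R) by exact: bm_indic.
have it n : ev nu (\1_A : X -> R) = ev nu (iter n M \1_A).
  by elim: n => // n ->; rewrite iterS ev_markov//; exact: bm_iter_markov.
rewrite (it (size w)); apply: ev_eq_off0 => //; first exact: bm_iter_markov.
move=> x x0; rewrite iter_transferE.
have uw n : uniq (words n).
  elim: n => //= n IH; rewrite cat_uniq !map_inj_uniq ?IH//=; try by move=> ? ? [].
  by rewrite andbT; apply/hasPn => _ /mapP[v _ ->]; apply/mapP => -[].
rewrite (bigD1_seq w) ?mem_words//= big_seq_cond big1 => [|v /andP[]].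
  by rewrite addr0 indicE mem_set ?mulr1//= /A /= word_wbranch.
rewrite mem_words => /eqP sv vw; rewrite indicE memNset ?mulr0// /A /= -sv word_wbranch//.
exact/eqP.
Qed.

End stationary_measure.

(** * Exponential mixing of the stationary measure *)

Section equilibrium.
Variables (R : realType) (alpha : R).
Hypothesis alpha_gt0 : 0 < alpha.
Local Notation X := (I01 R).
Local Notation transfer := (@transfer R alpha R).
Local Notation one := (fun _ : X => 1 : R).
Implicit Types (u v : X -> R) (x y : X).
Variable gamma : R.
Hypothesis gamma_gt0 : 0 < gamma.
Hypothesis gamma_le1 : gamma <= 1.
Local Notation hol := (@hol R gamma).
Local Notation isholder := (@isholder R gamma).
Variables (p : bool -> X -> R) (c0 Bp : R) (n0 : nat).
Hypothesis c0_gt0 : 0 < c0.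
Hypothesis p_ge : forall b x, c0 <= p b x.
Hypothesis p_sum : forall x, p false x + p true x = 1.
Hypothesis p_hol : forall b, hol Bp (p b).
Hypothesis n0_gt0 : (0 < n0)%N.
Hypothesis p_damped : forall x, iter n0 (transfer (damped alpha gamma p)) one x <= 1 / 4.
Local Notation M := (transfer p).

(** The ranges of the iterates M^n u are nested and shrink like th^n, so the iterates converge
    uniformly to a constant, which is the value of the state. *)
Lemma markov_limit : exists Phi C th, [/\ state gamma Phi,
  forall u, isholder u -> Phi (M u) = Phi u, 0 <= C, 0 < th < 1 &
  forall s u n x, hol s u -> `|iter n M u x - Phi u| <= C * th ^+ n * s].
Proof.
have [C [th [C0 /andP[th0 th1] contr]]] :=
  markov_contract_exp alpha_gt0 gamma_gt0 c0_gt0 p_ge p_sum p_hol n0_gt0 p_damped.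
pose Phi u : R := lim (iter n M u (I01_0 R) @[n --> \oo]).
have close s u n m x y : hol s u -> `|iter (m + n) M u x - iter n M u y| <= C * th ^+ n * s.
  move=> hu; have hn := contr n u s hu; rewrite iterD.
  have rg z : iter n M u y - C * th ^+ n * s <= iter n M u z <= iter n M u y + C * th ^+ n * s.
    have := hol_osc gamma_gt0 hn z y; rewrite ler_norml.
    by move=> /andP[h1 h2]; apply/andP; split; lra.
  have := markov_range alpha c0_gt0 p_ge p_sum m rg x.
  by move=> /andP[h1 h2]; rewrite ler_norml; apply/andP; split; lra.
have cv u : isholder u -> iter n M u (I01_0 R) @[n --> \oo] --> Phi u.
  move=> [s hu]; apply: cauchy_cvg; apply: cauchy_exP => e e0.
  have Cs : 0 <= C * s by rewrite mulr_ge0// (hol_ge0 hu).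
  have [N _ hN] := exists_small_geom Cs (ltW th0) th1 (ltac:(by rewrite divr_gt0) : 0 < e / 2).
  exists (iter N M u (I01_0 R)); exists N => // n /= Nn.
  rewrite /ball /= distrC -(subnK Nn).
  have := close s u N (n - N)%N (I01_0 R) (I01_0 R) hu.
  by rewrite mulrAC => h; rewrite (le_lt_trans h)// (le_lt_trans hN)//; lra.
have lim_close s u n x : hol s u -> `|iter n M u x - Phi u| <= C * th ^+ n * s.
  move=> hu; rewrite distrC; apply: (@ler_cvg_to nat \oo _ R
    (fun m => `|iter (m + n) M u (I01_0 R) - iter n M u x|) (fun=> C * th ^+ n * s)).
  - apply: cvg_norm; apply: cvgB; last exact: cvg_cst.
    by have := cv u (ex_intro _ s hu); rewrite -(cvg_shiftn n).
  - exact: cvg_cst.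
  - by apply: nearW => m; exact: close.
exists Phi, C, th; split => //; last by rewrite th0.
- split.
  + move=> u v hu hv.
    have h := cv _ (isholderD hu hv).
    have e : (fun n => iter n M (fun x => u x + v x) (I01_0 R)) =
        (fun n => iter n M u (I01_0 R) + iter n M v (I01_0 R)).
      by apply/funext => n; rewrite iter_transferD.
    by rewrite e in h; apply: cvg_unique h _ => //; apply: cvgD; exact: cv.
  + move=> k u hu; have h := cv _ (isholderZ k hu).
    have e : (fun n => iter n M (fun x => k * u x) (I01_0 R)) =
        (fun n => k * iter n M u (I01_0 R)).
      by apply/funext => n; rewrite iter_transferZ.
    rewrite e in h; apply: cvg_unique h _ => //.
    by apply: cvgM; [exact: cvg_cst|exact: cv].
  + move=> u v hu hv uv; apply: ler_cvg_to (cv u hu) (cv v hv) _.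
    apply: nearW => n; apply: iter_transfer_mono => // b y.
    exact: le_trans (ltW c0_gt0) (p_ge b y).
  + have h := cv _ (isholder_cst gamma 1).
    have e : (fun n => iter n M one (I01_0 R)) = fun=> 1.
      by apply/funext => n; rewrite (markov_cst alpha p_sum).
    by rewrite e in h; apply: cvg_unique h _ => //; exact: cvg_cst.
- move=> u hu; have hMu := holder_markov alpha_gt0 gamma_gt0 c0_gt0 p_ge p_sum p_hol hu.
  have h := cv _ hu; rewrite -(cvg_shiftS (fun n => iter n M u (I01_0 R))) in h.
  have e : (fun n => iter n.+1 M u (I01_0 R)) = fun n => iter n M (M u) (I01_0 R).
    by apply/funext => n; rewrite iterSr.
  by move: h => /=; rewrite e => h; apply: cvg_unique (cv _ hMu) h.
Qed.

(** Distances in [0, 1] are at most 1 and gamma <= 1, so |x - y| <= |x - y|^gamma. *)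
Lemma lipschitz_hol (v : holderR (1 : R)) : hol (holder_seminorm (real_modulus R) 1 v) v.
Proof.
move=> x y; have [->|xy] := eqVneq x y; first by rewrite subrr normr0 distxx ?mulr0.
have xy' : 0 < `|pt x - pt y|.
  by rewrite normr_gt0 subr_eq0; apply: contra xy => /eqP/pt_inj ->.
have := holder_seminorm_ub v (p := (x, y)) xy.
rewrite ler_pdivrMr ?powR_gt0// powRr1; last exact: normr_ge0.
move=> /le_trans; apply; rewrite ler_wpM2l ?holder_seminorm_ge0// /dist.
apply: ger1_powR => //; rewrite xy' andTb -/(pt x) -/(pt y).
by rewrite ler_norml; have := I01_ge0 x; have := I01_ge0 y; have := I01_le1 x; have := I01_le1 y; lra.
Qed.

Lemma equilibrium : exists nu : probability X R,
  (forall u, isholder u -> ev nu (M u) = ev nu u) /\ exponentially_mixing alpha nu.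
Proof.
have [Phi [C [th [sP PM C0 th01 close]]]] := markov_limit.
have [nu nuE] := state_measure gamma_gt0 gamma_le1 sP.
have nuM u : isholder u -> ev nu (M u) = ev nu u.
  move=> hu; rewrite !nuE ?PM//.
  exact: (holder_markov alpha_gt0 gamma_gt0 c0_gt0 p_ge p_sum p_hol hu).
exists nu; split => //.
(* C may be 0 whereas the mixing constant has to be positive. *)
exists (C + 1), th; split => //; first by rewrite ltr_wpDl.
move=> psi v n mpsi bpsi; have hv := lipschitz_hol v.
set s := holder_seminorm _ _ _ in hv *.
have hvh : isholder v by exists s.
have bv : bm (v : X -> R) by apply: (hol_bm gamma_gt0 hv).
have [M0 hM0] : exists M0, forall x, `|psi x| <= M0.
  have [N [_ hN]] := bpsi; exists (N + 1) => x; apply: hN => //; rewrite ltrDl//.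
have bpsi' : bm psi by split => //; exists M0.
have psi_le x : `|psi x| <= sup_norm (real_modulus R) psi.
  by apply: (@le_sup_image _ _ setT (fun x => `|psi x|) M0).
set S := sup_norm _ _ in psi_le *.
have S0 : 0 <= S := le_trans (normr_ge0 _) (psi_le (I01_0 R)).
have s0 : 0 <= s := hol_ge0 hv.
rewrite -!/(ev nu _).
rewrite (@ev_koopman R alpha alpha_gt0 gamma gamma_gt0 gamma_le1 p c0 Bp)//.
have bMv : bm (iter n M v) by apply: (bm_iter_markov alpha_gt0 gamma_gt0 p_hol).
rewrite mulrC -evZ// -evB; [|exact: bmM|exact: bmZ].
have key x : `|psi x * iter n M v x - ev nu v * psi x| <= (C + 1) * S * s * th ^+ n.
  have -> : psi x * iter n M v x - ev nu v * psi x = psi x * (iter n M v x - ev nu v) by ring.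
  rewrite normrM nuE//.
  have tn : 0 <= th ^+ n * s by rewrite mulr_ge0// exprn_ge0// ltW//; case/andP: th01.
  have := ler_pM (normr_ge0 _) (normr_ge0 _) (psi_le x) (close s v n x hv).
  move=> /le_trans; apply.
  have -> : (C + 1) * S * s * th ^+ n = S * (C * th ^+ n * s) + S * (th ^+ n * s) by ring.
  by rewrite lerDl mulr_ge0.
have bd : bm (fun x => psi x * iter n M v x - ev nu v * psi x).
  by apply: bmB; [exact: bmM|exact: bmZ].
rewrite ler_norml -[X in X <= _ <= _](ev_cst nu) -[X in _ <= _ <= X](ev_cst nu).
by rewrite !ev_le//; try exact: bm_cst; move=> x; have := key x; rewrite ler_norml => /andP[].
Qed.

End equilibrium.

(** * Entropy bounds *)

(** Termwise, q ln (r / q) <= r - q; r need only be a subprobability. *)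
Lemma gibbs_inequality (R : realType) (I : finType) (q r : I -> R) :
  (forall i, 0 <= q i) -> (forall i, 0 < r i) -> \sum_i q i = 1 -> \sum_i r i <= 1 ->
  - \sum_i q i * ln (q i) <= \sum_i q i * - ln (r i).
Proof.
move=> q0 r0 q1 r1.
have key i : - (q i * ln (q i)) <= q i * - ln (r i) + (r i - q i).
  have [->|qi] := eqVneq (q i) 0; first by rewrite !mul0r !oppr0 add0r addr0 ltW.
  have qp : 0 < q i by rewrite lt_def qi q0.
  have h : ln (r i / q i) <= r i / q i - 1.
    have y0 : 0 < r i / q i by rewrite divr_gt0.
    have y1 : -1 < r i / q i - 1 by rewrite ltrBDr addNr.
    by have := le_ln1Dx y1; rewrite addrC subrK.
  rewrite ln_div ?posrE// in h.
  have := ler_wpM2l (q0 i) h; rewrite mulrBr mulrBr mulr1 mulrCA mulfV// mulr1; lra.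
rewrite -sumrN (le_trans (ler_sum _ (fun i _ => key i)))//.
rewrite big_split /= sumrB q1 gerDl; lra.
Qed.

(** * Entropy of finite partitions under an invariant measure *)

Section invariant_entropy.
Context d (T : measurableType d) (R : realType).
Variables (f : T -> T) (nu : probability T R).
Hypothesis mf : measurable_fun setT f.

Lemma ev_indic_comp A : measurable A -> ev nu (fun x => \1_A (f x)) = pr nu (f @^-1` A).
Proof.
move=> mA; rewrite -ev_indic; last by rewrite -[X in measurable X]setTI; exact: mf.
by congr (ev nu _); apply/funext => x; rewrite !indicE; congr (_ _); apply/idP/idP; rewrite !inE.
Qed.

Hypothesis inv : invariant_measure f nu.

Lemma ev_invariant u : bm u -> ev nu (fun x => u (f x)) = ev nu u.
Proof.
move=> hu; have hc v : bm v -> bm (fun x => v (f x)) by exact: bm_comp.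
apply: (functional_eq (Phi := fun u => ev nu (fun x => u (f x))) (Psi := ev nu)) hu.
- by move=> v w hv hw; apply: evD; exact: hc.
- by move=> k v hv; apply: evZ; exact: hc.
- by move=> v w hv hw vw; apply: ev_le => //; exact: hc.
- by move=> v w hv hw; exact: evD.
- by move=> k v hv; exact: evZ.
- by move=> v w hv hw; exact: ev_le.
- by move=> A mA; rewrite ev_indic_comp// ev_indic// /pr inv.
Qed.

Lemma ev_invariant_iter n u : bm u -> ev nu (fun x => u (iter n f x)) = ev nu u.
Proof.
move=> hu; elim: n => // n IH; rewrite -IH.
rewrite -(ev_invariant (u := fun x => u (iter n f x))); last exact: bm_comp (measurable_iter n mf) hu.
by congr (ev nu _); apply/funext => x; rewrite iterSr.
Qed.

Lemma ev_birkhoff n u : bm u -> ev nu (fun x => \sum_(i < n) u (iter i f x)) = n%:R * ev nu u.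
Proof.
move=> hu; rewrite ev_sum; last by move=> i; exact: bm_comp (measurable_iter i mf) hu.
under eq_bigr do rewrite ev_invariant_iter//.
by rewrite sumr_const card_ord mulr_natl.
Qed.

Lemma measurable_itinerary (I : finType) (xi : T -> I) n : measurable_partition xi ->
  measurable_partition (itinerary f xi n).
Proof.
move=> mxi a.
rewrite (_ : _ @^-1` _ = \bigcap_(i in [set: 'I_n]) (iter i f) @^-1` (xi @^-1` [set a i])).
  apply: fin_bigcap_measurable => // i _; rewrite -[X in measurable X]setTI.
  exact: measurable_iter.
apply/seteqP; split => x /=.
  by move=> <- i _ /=; rewrite ffunE.
by move=> h; apply/ffunP => i; rewrite ffunE; exact: h.
Qed.

Lemma partition_entropyE (I : finType) (xi : T -> I) :
  partition_entropy nu xi = - \sum_i pr nu (xi @^-1` [set i]) * ln (pr nu (xi @^-1` [set i])).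
Proof. by []. Qed.

Lemma partition_entropy_ev (I : finType) (xi : T -> I) : measurable_partition xi ->
  partition_entropy nu xi = ev nu (fun x => - ln (pr nu (xi @^-1` [set xi x]))).
Proof.
move=> mxi; rewrite partition_entropyE (ev_partition nu mxi (fun i => - ln (pr nu (xi @^-1` [set i])))).
by rewrite -sumrN; apply: eq_bigr => i _; rewrite mulrC mulNr.
Qed.

Lemma partition_entropy_le (I : finType) (xi : T -> I) (r : I -> R) (U : T -> R) :
  measurable_partition xi -> (forall i, 0 < r i) -> \sum_i r i <= 1 -> bm U ->
  (forall x, - ln (r (xi x)) <= U x) -> partition_entropy nu xi <= ev nu U.
Proof.
move=> mxi r0 r1 bU rU; rewrite partition_entropyE.
apply: le_trans (gibbs_inequality _ r0 _ r1) _.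
- by move=> i; exact: pr_ge0.
- exact: pr_partition.
have -> : \sum_i pr nu (xi @^-1` [set i]) * - ln (r i) = ev nu (fun x => - ln (r (xi x))).
  by rewrite (ev_partition nu mxi (fun i => - ln (r i))); apply: eq_bigr => i _; rewrite mulrC.
by apply: ev_le => //; exact: (bm_partition mxi (fun i => - ln (r i))).
Qed.

Lemma partition_entropy_ge (I : finType) (xi : T -> I) (U : T -> R) :
  measurable_partition xi -> bm U ->
  (forall x, U x <= - ln (pr nu (xi @^-1` [set xi x]))) -> ev nu U <= partition_entropy nu xi.
Proof.
move=> mxi bU h; rewrite partition_entropy_ev//; apply: ev_le => //.
exact: (bm_partition mxi (fun i => - ln (pr nu (xi @^-1` [set i])))).
Qed.

End invariant_entropy.

(* [limn] of a divergent sequence is the default value 0. *)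
Lemma limn_le (R : realType) (u : nat -> R) (h : R) : 0 <= h ->
  (forall e, 0 < e -> exists C, forall n, (0 < n)%N -> n%:R * u n <= C + n%:R * (h + e)) ->
  limn u <= h.
Proof.
move=> h0 hu; case: (pselect (cvgn u)) => [cu|ncu]; last first.
  by rewrite dvgP.
apply/ler_addgt0Pr => e e0.
have e2 : 0 < e / 2 by rewrite divr_gt0.
have [C hC] := hu _ e2.
apply: (@ler_cvg_to nat \oo _ R u (fun=> h + e)) => //; first exact: cvg_cst.
exists (Num.bound (`|C| / (e / 2))).+1 => // n /= nb.
have n0 : (0 < n)%N := leq_ltn_trans (leq0n _) nb.
have n0' : (0 : R) < n%:R by rewrite ltr0n.
rewrite -(ler_pM2l n0') (le_trans (hC n n0))//.
have Ce : 0 <= `|C| / (e / 2) by rewrite divr_ge0// ltW.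
have h1 : `|C| <= n%:R * (e / 2).
  rewrite -ler_pdivrMr// (le_trans (ltW (archi_boundP Ce)))// ler_nat ltnW//.
have -> : n%:R * (h + e) = n%:R * (h + e / 2) + n%:R * (e / 2) by field.
by rewrite addrC lerD2l (le_trans (ler_norm C)).
Qed.

(** * Approximation of partitions by cylinders *)

Section cylinder_approximation.
Variables (R : realType) (alpha : R).
Hypothesis alpha_gt0 : 0 < alpha.
Local Notation X := (I01 R).
Local Notation f := (@intermittent R alpha).
Local Notation word := (@word R alpha).
Variable nu : probability X R.
Implicit Types (A B : set X) (D : pred (seq bool)).

Lemma measurable_word n D : measurable [set x | D (word n x)].
Proof.
elim: n D => [|n IH] D.
  rewrite (_ : [set _ | _] = if D [::] then setT else set0); first by case: (D _).
  by case: ifPn => h; apply/seteqP; split => // x /=; rewrite /word /= ?(negbTE h).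
pose A b := @digit R alpha @^-1` [set b] `&` f @^-1` [set x | D (b :: word n x)].
have mA b : measurable (A b).
  apply: measurableI.
    by rewrite -[X in measurable X]setTI; exact: measurable_digit.
  by rewrite -[X in measurable X]setTI; apply: measurable_intermittent => //; exact: IH (fun v => D (b :: v)).
rewrite (_ : [set _ | _] = A false `|` A true); first exact: measurableU.
apply/seteqP; split => x; rewrite /A /= wordS; last by case=> -[->].
by case: (digit alpha x) => h; [right|left].
Qed.

Lemma take_word m n x : (m <= n)%N -> take m (word n x) = word m x.
Proof. by move=> mn; rewrite /word -map_take take_iota (minn_idPl mn). Qed.

Definition mismatch A m D : set X := [set x | (x \in A) != D (word m x)].

Lemma measurable_mismatch A m D : measurable A -> measurable (mismatch A m D).
Proof.
move=> mA; have mD := measurable_word m D.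
rewrite (_ : mismatch _ _ _ = (A `\` [set x | D (word m x)]) `|` ([set x | D (word m x)] `\` A)).
  by apply: measurableU; exact: measurableD.
apply/seteqP; split => x; rewrite /mismatch /=.
  case: (boolP (x \in A)) => [|] /=; case: (boolP (D (word m x))) => //= h1; rewrite ?inE => h2 _.
    by left; split => //; exact/negP.
  by right; split => // Ax; move: h2; rewrite mem_set.
case=> -[h1 h2].
  by rewrite mem_set//; case: (D _) h2.
by rewrite memNset// h1.
Qed.

Definition approximable A := measurable A /\ forall e : R, 0 < e ->
  exists m D, pr nu (mismatch A m D) <= e.

Lemma mismatch_refine A m n D : (m <= n)%N ->
  mismatch A m D = mismatch A n (fun w => D (take m w)).
Proof. by move=> mn; apply/seteqP; split => x; rewrite /mismatch /= take_word. Qed.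

Lemma pr_setU A B : measurable A -> measurable B -> pr nu (A `|` B) <= pr nu A + pr nu B.
Proof.
move=> mA mB; rewrite -lee_fin EFinD !prE//; last exact: measurableU.
exact: measureU2.
Qed.

(** The union of the cylinders of order m that meet [0, t] decreases to [0, t], because cylinders
    shrink uniformly. *)
Lemma approximable_ray t : approximable [set x | pt x <= t].
Proof.
have mt := @measurable_rayC R t; split => // e e0.
pose D m w := `[< exists y : X, word m y = w /\ pt y <= t >].
pose B m := [set x | D m (word m x)].
have mB m : measurable (B m) by exact: measurable_word.
have subB m : [set x | pt x <= t] `<=` B m.
  by move=> x /= h; rewrite /B /=; apply/asboolP; exists x.
have niB : nonincreasing_seq B.
  move=> m n mn; apply/subsetPset => x /asboolP[y [yx yt]]; apply/asboolP; exists y; split => //.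
  by rewrite -(take_word y mn) yx take_word.
have capB : \bigcap_m B m = [set x | pt x <= t].
  apply/seteqP; split => x; last by move=> h m _; exact: subB.
  move=> h /=; apply/ler_addgt0Pl => d d0.
  have [m hm] := wbranch_diam alpha_gt0 d0.
  have /asboolP[y [yx yt]] := h m I.
  have := hm (word m x) (iter m f x) (iter m f y).
  rewrite size_word leqnn => /(_ isT).
  rewrite (wbranch_word alpha_gt0) -yx (wbranch_word alpha_gt0) ler_norml => /andP[_].
  by move=> h1; rewrite -lerBlDr; lra.
have cv : pr nu (B m) @[m --> \oo] --> pr nu [set x | pt x <= t].
  rewrite -capB; apply: fine_cvg; rewrite prE; last exact: bigcapT_measurable.
  apply: nonincreasing_cvg_mu => //; last exact: bigcapT_measurable.
  exact: le_lt_trans (probability_le1 nu (mB 0%N)) (ltry 1).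
have /cvgrPdist_le/(_ _ e0)[m _ /(_ m (leqnn m)) hm] := cv.
exists m, (D m).
rewrite (_ : mismatch _ _ _ = B m `\` [set x | pt x <= t]).
  have -> : pr nu (B m `\` [set x | pt x <= t]) = pr nu (B m) - pr nu [set x | pt x <= t].
    apply: EFin_inj; rewrite EFinB !prE//; last exact: measurableD.
    rewrite measureD ?setIidr//.
    exact: le_lt_trans (probability_le1 nu (mB m)) (ltry 1).
  by move: hm; rewrite distrC => /(le_trans (ler_norm _)).
apply/seteqP; split => x; rewrite /mismatch /=.
  case: (boolP (x \in _)) => [|] h.
    move: (h); rewrite inE /= => /subB; rewrite /B /= => ->; by [].
  move=> h'; split; first by rewrite /B /=; case: (D _ _) h'.
  by move=> h1; move: h; rewrite mem_set.
by case=> h1 h2; rewrite memNset// h1.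
Qed.

Lemma approximableC A : approximable A -> approximable (~` A).
Proof.
move=> [mA hA]; split; first exact: measurableC.
move=> e /hA[m [D hD]]; exists m, (predC D); apply: le_trans hD.
rewrite (_ : mismatch _ _ _ = mismatch A m D)//.
by apply/seteqP; split => x; rewrite /mismatch /= in_setC; case: (x \in A); case: (D _).
Qed.

Lemma approximable_bigU (F : nat -> set X) n : (forall k, approximable (F k)) ->
  approximable (\big[setU/set0]_(k < n) F k).
Proof.
move=> hF; elim: n => [|n [mU IH]].
  rewrite big_ord0; split => // e e0; exists 0%N, pred0.
  rewrite (_ : mismatch _ _ _ = set0) ?/pr ?measure0/= ?ltW//.
  by apply/seteqP; split => x; rewrite /mismatch /= in_set0.
rewrite big_ord_recr /=; have [mn hn] := hF n; split; first exact: measurableU.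
move=> e e0; have e2 : 0 < e / 2 by rewrite divr_gt0.
have [m1 [D1 h1]] := IH _ e2; have [m2 [D2 h2]] := hn _ e2.
exists (maxn m1 m2), (fun w => D1 (take m1 w) || D2 (take m2 w)).
rewrite (mismatch_refine _ _ (leq_maxl m1 m2)) in h1.
rewrite (mismatch_refine _ _ (leq_maxr m1 m2)) in h2.
set U := \big[_/_]_(k < n) _ in mU h1 *.
set D1' := (fun w => D1 _) in h1; set D2' := (fun w => D2 _) in h2.
have m1' := measurable_mismatch (maxn m1 m2) D1' mU.
have m2' := measurable_mismatch (maxn m1 m2) D2' mn.
have h := pr_setU m1' m2'.
rewrite (le_trans _ (le_trans h _))//; last by lra.
apply: pr_le; [exact/measurable_mismatch/measurableU|exact: measurableU|].
move=> x; rewrite /mismatch /= in_setU /D1' /D2'.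
case: (x \in U); case: (x \in F n); case: (D1 _); case: (D2 _) => //= _; by [left|right].
Qed.

Lemma approximable_bigcup (F : nat -> set X) : (forall k, approximable (F k)) ->
  approximable (\bigcup_k F k).
Proof.
move=> hF; have mF k : measurable (F k) by case: (hF k).
have mU : measurable (\bigcup_k F k) by exact: bigcupT_measurable.
split => // e e0; have e2 : 0 < e / 2 by rewrite divr_gt0.
pose U n := \big[setU/set0]_(k < n) F k.
have mUn n : measurable (U n) by case: (approximable_bigU n hF).
have subU n : U n `<=` \bigcup_k F k.
  by rewrite /U -bigcup_mkord; apply: bigcup_sub => k _; exact: bigcup_sup.
have capU : \bigcup_n U n = \bigcup_k F k.
  apply/seteqP; split; first by apply: bigcup_sub => n _.
  by move=> x [k _ Fkx]; exists k.+1 => //; rewrite /U big_ord_recr /=; right.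
have cv : pr nu (U n) @[n --> \oo] --> pr nu (\bigcup_k F k).
  rewrite -capU; apply: fine_cvg; rewrite prE; last by rewrite capU.
  apply: nondecreasing_cvg_mu => //; first by rewrite capU.
  by move=> m n mn; apply/subsetPset; exact: subset_bigsetU.
have /cvgrPdist_le/(_ _ e2)[n _ /(_ n (leqnn n)) hn] := cv.
have [_ hU] := approximable_bigU n hF; have [m [D hD]] := hU _ e2.
exists m, D; rewrite -/(U n) in hD.
have mD := measurable_mismatch m D (mUn n).
have mdiff : measurable (\bigcup_k F k `\` U n) by exact: measurableD.
have diff : pr nu (\bigcup_k F k `\` U n) <= e / 2.
  have -> : pr nu (\bigcup_k F k `\` U n) = pr nu (\bigcup_k F k) - pr nu (U n).
    apply: EFin_inj; rewrite EFinB !prE//.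
    rewrite measureD ?setIidr//.
    exact: le_lt_trans (probability_le1 nu mU) (ltry 1).
  exact: le_trans (ler_norm _) hn.
have h := pr_setU mD mdiff.
rewrite (le_trans _ (le_trans h _))//; last by lra.
apply: pr_le; [exact: measurable_mismatch|exact: measurableU|].
move=> x; rewrite /mismatch /= => h1.
case: (boolP (x \in U n)) => h2; last first.
  have [h3|h3] := boolP (x \in \bigcup_k F k).
    by right; split; [rewrite inE in h3|move=> h4; move: h2; rewrite mem_set].
  by left; move: h1; rewrite (negbTE h3).
by left; move: h1; rewrite mem_set//; apply: (subU n); rewrite inE in h2.
Qed.

Lemma approximable_measurable A : measurable A -> approximable A.
Proof.
move=> mA; apply: (dynkin_induction (G := @upper_rays R)) => //.
- exact: measurable_upper_rays.
- exact: upper_rays_setI.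
- rewrite -(setCK setT) setCT; apply: approximableC; split => // e e0.
  exists 0%N, pred0; rewrite (_ : mismatch _ _ _ = set0) ?/pr ?measure0/= ?ltW//.
  by apply/seteqP; split => x; rewrite /mismatch /= in_set0.
- move=> _ [t _ <-].
  have -> : [set x : X | t < pt x] = ~` [set x | pt x <= t].
    by apply/seteqP; split => x /=; rewrite ltNge => /negP.
  exact/approximableC/approximable_ray.
- by move=> B _; exact: approximableC.
- by move=> F _ _; exact: approximable_bigcup.
- by rewrite -measurable_upper_rays.
Qed.

(** Each class is approximated by a set of words of a common length m, and a word is labelled by
    some class that claims it. Wrong labels occur only on the union of the k mismatch sets, each of
    measure at most e / k. *)
Lemma partition_approximation k (xi : X -> 'I_k) (e : R) : measurable_partition xi -> 0 < e ->
  exists m (xi' : seq bool -> 'I_k),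
    measurable [set x | xi x != xi' (word m x)] /\ pr nu [set x | xi x != xi' (word m x)] <= e.
Proof.
move=> mxi e0; pose i0 := xi (I01_0 R).
have k0 : (0 < k)%N by apply: leq_ltn_trans (ltn_ord i0).
have ek : 0 < e / k%:R by rewrite divr_gt0// ltr0n.
have app i : exists mD : nat * pred (seq bool),
    pr nu (mismatch (xi @^-1` [set i]) mD.1 mD.2) <= e / k%:R.
  have [_ h] := approximable_measurable (mxi i).
  by have [m [D hD]] := h _ ek; exists (m, D).
have [mD hmD] := choice app.
pose m := \max_i (mD i).1.
have mle i : ((mD i).1 <= m)%N by exact: (leq_bigmax (F := fun i => (mD i).1)).
pose D i w := (mD i).2 (take (mD i).1 w).
exists m, (fun w => odflt i0 [pick i | D i w]).
set bad := [set x | _].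
have mbad : measurable bad.
  rewrite (_ : bad = \big[setU/set0]_(i : 'I_k) (xi @^-1` [set i] `&`
      [set x | (i != odflt i0 [pick i | D i (word m x)])])).
    apply: bigsetU_measurable => i _; apply: measurableI => //.
    exact: (measurable_word m (fun w => i != odflt i0 [pick i | D i w])).
  apply/seteqP; split => x.
    by rewrite /bad /= => h; rewrite -bigcup_seq; exists (xi x) => //=; rewrite mem_index_enum.
  by rewrite -bigcup_seq => -[i _ /= [<-]].
split => //.
pose U (s : seq 'I_k) := \big[setU/set0]_(i <- s) mismatch (xi @^-1` [set i]) m (D i).
have mU s : measurable (U s).
  by apply: bigsetU_measurable => i _; exact: measurable_mismatch.
have prU s : pr nu (U s) <= (size s)%:R * (e / k%:R).
  elim: s => [|i s IH]; first by rewrite /U big_nil /pr measure0 mul0r.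
  rewrite /U big_cons -/(U s) (le_trans (pr_setU _ _))//; first exact: measurable_mismatch.
  have := hmD i; rewrite (mismatch_refine _ _ (mle i)) -/(D i) => h.
  by rewrite -natr1 mulrDl mul1r addrC lerD.
apply: le_trans (_ : pr nu (U (index_enum 'I_k)) <= _).
  apply: pr_le => // x; rewrite /bad /= => h; rewrite /U -bigcup_seq.
  have D1 (i : 'I_k) : mismatch (xi @^-1` [set i]) m (D i) x \/ ((xi x == i) = D i (word m x)).
    rewrite /mismatch /=; have -> : (x \in xi @^-1` [set i]) = (xi x == i).
      by apply/idP/eqP; rewrite inE.
    by case: (xi x == i); case: (D i (word m x)); [right|left|left|right].
  have [h1|h1] := D1 (xi x); first by exists (xi x) => //=; rewrite mem_index_enum.
  rewrite eqxx in h1; move: h; case: pickP => [j hj|/(_ (xi x))] /=; last by rewrite -h1.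
  move=> hx; have [h2|h2] := D1 j; first by exists j => //=; rewrite mem_index_enum.
  by move: h2; rewrite hj (negbTE hx).
rewrite (le_trans (prU _))// -[index_enum _]enumT size_enum_ord mulrCA mulfV ?mulr1//.
by rewrite pnatr_eq0 -lt0n.
Qed.

End cylinder_approximation.

Lemma sum_ge_term (R : realDomainType) (I : eqType) (s : seq I) (F : I -> R) i :
  i \in s -> (forall j, 0 <= F j) -> F i <= \sum_(j <- s) F j.
Proof. by move=> si F0; rewrite (big_rem i si) /= lerDl sumr_ge0. Qed.

Lemma expR_bigsum (R : realType) (I : Type) (s : seq I) (F : I -> R) :
  expR (\sum_(i <- s) F i) = \prod_(i <- s) expR (F i).
Proof. by elim: s => [|i s IH]; rewrite ?big_nil ?expR0// !big_cons expRD IH. Qed.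

(** * Upper bound of entropy plus integral by ln rho *)

Section entropy_bound.
Variables (R : realType) (alpha : R).
Hypothesis alpha_gt0 : 0 < alpha.
Local Notation X := (I01 R).
Local Notation f := (@intermittent R alpha).
Local Notation word := (@word R alpha).
Local Notation transfer := (@transfer R alpha R).
Local Notation one := (fun _ : X => 1 : R).
Variable gamma : R.
Hypothesis gamma_gt0 : 0 < gamma.
Variables (phi : X -> R) (H B : R).
Hypothesis phiH : hol gamma H phi.
Hypothesis phiB : forall x, `|phi x| <= B.
Local Notation L := (transfer (ruelle alpha phi)).
Local Notation rho := (srad alpha phi).

Lemma iter_ruelle_ge n x : expR (- B) ^+ n <= iter n L one x.
Proof.
have Lp b y : 0 <= ruelle alpha phi b y by exact: ruelle_ge0.
have := @weight_le_iter R alpha (ruelle alpha phi) (nseq n false) one x Lp (fun=> ler01).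
rewrite mulr1 size_nseq; apply: le_trans.
by have := weight_ge alpha phiB (nseq n false) x; rewrite size_nseq.
Qed.

Lemma srad_ge : expR (- B) <= rho.
Proof.
apply: lb_le_inf; first by exists (2 * expR B); exact: growth_nonempty.
move=> s [s0 [C hC]]; rewrite leNgt; apply/negP => sB.
have C1 := growth_C_ge1 hC; have C0 : 0 < C := lt_le_trans ltr01 C1.
have q1 : s / expR (- B) < 1 by rewrite ltr_pdivrMr ?expR_gt0// mul1r.
have q0 : 0 <= s / expR (- B) by rewrite divr_ge0 ?expR_ge0 ?ltW.
have [n _ hn] := @exists_small_geom R C _ (1 / 2) (ltW C0) q0 q1 ltac:(lra).
have := le_trans (iter_ruelle_ge n (I01_0 R)) (hC n (I01_0 R)).
have e0 : 0 < expR (- B) ^+ n by rewrite exprn_gt0// expR_gt0.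
rewrite -[leLHS]mul1r -ler_pdivlMr// -mulrA -expr_div_n => h.
by have := le_trans h hn; lra.
Qed.

Lemma srad_gt0 : 0 < rho.
Proof. exact: lt_le_trans (expR_gt0 _) srad_ge. Qed.

Lemma drop_word m j n x : (j + m <= n)%N -> take m (drop j (word n x)) = word m (iter j f x).
Proof.
move=> jmn; rewrite /word -map_drop -map_take drop_iota add0n take_iota.
rewrite (minn_idPl _); last by rewrite leq_subRL// (leq_trans _ jmn)// leq_addr.
rewrite -[j in LHS]addn0 iotaDl -map_comp; apply: eq_map => i /=.
by rewrite addnC iterD.
Qed.

Variable nu : probability X R.
Hypothesis inv : invariant_measure f nu.

Let mf : measurable_fun setT f := measurable_intermittent alpha_gt0.
Let bphi : bm phi := hol_bm gamma_gt0 phiH.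

(* The Gibbs inequality is applied to the weights [rr]: a word w is drawn with its
   normalised Ruelle weight [r w], and an approximation xi' of xi by cylinders is
   read along w with errors of probability [del]. *)
Lemma partition_entropy_upper k (xi : X -> 'I_k) (e : R) : measurable_partition xi -> 0 < e ->
  exists C, forall n, partition_entropy nu (itinerary f xi n) <=
    C + n%:R * (ln rho - ev nu phi + e).
Proof.
move=> mxi e0; have e4 : 0 < e / 4 by rewrite divr_gt0.
have k0 : (0 < k)%N by apply: leq_ltn_trans (ltn_ord (xi (I01_0 R))).
have k0' : (0 : R) < k%:R by rewrite ltr0n.
(* The error e is spent in quarters: distortion, growth of L^N 1 beyond rho^N, correctly read
   letters at cost - ln (1 - del) = e / 4, and wrong letters at cost l2 with frequency at most
   eps. *)
pose del := 1 - expR (- (e / 4)).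
have del1 : 1 - del = expR (- (e / 4)) by rewrite /del opprB addrC subrK.
have del0 : 0 < del by rewrite subr_gt0 -[ltRHS]expR0 ltr_expR oppr_lt0.
have dellt : del < 1 by rewrite ltrBlDr ltrDl expR_gt0.
pose l2 := ln (k%:R / del).
have l20 : 0 < l2.
  by rewrite ln_gt0// ltr_pdivlMr// mul1r (lt_le_trans dellt)// ler1n.
have delk : del / k%:R = expR (- l2).
  by rewrite /l2 expRN lnK ?posrE ?divr_gt0// invf_div.
pose eps := e / 4 / l2.
have eps0 : 0 < eps by rewrite divr_gt0.
have [m [xi' [mbad hbad]]] := partition_approximation alpha_gt0 nu mxi eps0.
set bad := [set x | _] in mbad hbad.
have [C1 C10 dst] := distortion alpha_gt0 gamma_gt0 phiH e4.
have [s0 [C2 hC2]] : growth alpha phi (rho * expR (e / 4)).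
  by apply: (srad_growth phiB); rewrite ltr_pMr ?srad_gt0// -[ltLHS]expR0 ltr_expR.
set s := rho * _ in s0 hC2.
have C20 : 0 < C2 := lt_le_trans ltr01 (growth_C_ge1 hC2).
have lns : ln s = ln rho + e / 4 by rewrite lnM ?posrE ?expR_gt0 ?srad_gt0// expRK.
pose g (x : X) : R := e / 4 + l2 * \1_bad x.
have bg : bm g by apply: bmD; [exact: bm_cst|apply: bmZ; exact: bm_indic].
have evg : ev nu g <= e / 4 + e / 4.
  rewrite /g evD; [|exact: bm_cst|by apply: bmZ; exact: bm_indic].
  rewrite ev_cst evZ ?ev_indic//; last exact: bm_indic.
  rewrite lerD2l (le_trans (ler_wpM2l (ltW l20) hbad))// /eps mulrCA mulfV ?mulr1//.
  by rewrite gt_eqF.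
(* A noisy channel: the weight of reading b where the word predicts c. *)
pose kap (b c : 'I_k) : R := if b == c then 1 - del else del / k%:R.
have kap0 b c : 0 < kap b c.
  by rewrite /kap; case: ifP => _; rewrite ?divr_gt0// subr_gt0.
have kap1 c : \sum_b kap b c <= 1.
  have le b : kap b c <= (b == c)%:R * (1 - del) + del / k%:R.
    have dk : 0 <= del / k%:R by rewrite divr_ge0// ltW.
    by rewrite /kap; case: ifP => _; rewrite ?mul1r ?mul0r ?add0r// lerDl.
  rewrite (le_trans (ler_sum _ (fun b _ => le b)))// big_split /= sumr_const card_ord.
  rewrite -mulr_suml (bigD1 c)//= eqxx big1 => [|b /negbTE ->//].
  by rewrite addr0 mul1r -[(del / _) *+ _]mulr_natl mulrCA mulfV ?gt_eqF// mulr1 subrK.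
exists (ln C2 + C1 + m%:R * (ln s + e / 4 - ev nu phi)) => n.
(* The extra m letters let the window of length m at each position j < n fit in the word. *)
pose N := (n + m)%N; pose Z := iter N L one (I01_0 R).
have Z0 : 0 < Z by apply: lt_le_trans (iter_ruelle_ge _ _); rewrite exprn_gt0// expR_gt0.
have Zle : ln Z <= ln C2 + N%:R * ln s.
  rewrite mulr_natl -lnXn// -lnM ?posrE ?exprn_gt0//.
  by rewrite ler_ln ?posrE ?mulr_gt0 ?exprn_gt0//; exact: hC2.
pose r w := expR (bsum alpha phi w (I01_0 R)) / Z.
have r0 w : 0 < r w by rewrite divr_gt0// expR_gt0.
have r1 : \sum_(w <- words N) r w = 1.
  rewrite -mulr_suml -[RHS](mulfV (lt0r_neq0 Z0)); congr (_ / _).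
  by rewrite /Z iter_transferE; apply: eq_bigr => w _; rewrite mulr1 weight_ruelle.
pose pk (a : {ffun 'I_n -> 'I_k}) (w : seq bool) := \prod_(j < n) kap (a j) (xi' (take m (drop j w))).
have pk0 a w : 0 < pk a w by apply: prodr_gt0.
pose rr (a : {ffun 'I_n -> 'I_k}) := \sum_(w <- words N) r w * pk a w.
have rrge a w : size w = N -> r w * pk a w <= rr a.
  move=> sw; apply: (sum_ge_term (F := fun w => r w * pk a w)); first by rewrite mem_words sw.
  by move=> j; rewrite ltW// mulr_gt0.
have rr0 a : 0 < rr a.
  apply: lt_le_trans (rrge a (nseq N false) (size_nseq _ _)); exact: mulr_gt0.
have rr1 : \sum_a rr a <= 1.
  rewrite exchange_big /= -r1; apply: ler_sum => w _; rewrite -mulr_sumr; apply: ler_piMr; first exact: ltW.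
  rewrite -(bigA_distr_bigA (fun (j : 'I_n) b => kap b (xi' (take m (drop j w))))).
  by apply: prodr_ile1 => j _; rewrite kap1 andbT sumr_ge0// => b _; exact: ltW.
(* An upper bound for - ln of the weight of the itinerary of x, obtained by keeping in [rr] only the
   term of the word of x itself. *)
pose U (x : X) : R := ln C2 + N%:R * ln s + (C1 + e / 4 * N%:R)
   - \sum_(i < N) phi (iter i f x) + \sum_(j < n) g (iter j f x).
have bS u j : bm u -> bm (fun x => \sum_(i < j) u (iter i f x)).
  by move=> bu; apply: bm_sum => i; apply: (bm_comp (g := iter i f)) => //; exact: measurable_iter.
have bU1 : bm (fun x => ln C2 + N%:R * ln s + (C1 + e / 4 * N%:R)
   - \sum_(i < N) phi (iter i f x)) by apply: bmB; [exact: bm_cst|exact: bS].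
have bU : bm U by apply: bmD => //; exact: bS.
apply: (@le_trans _ _ (ev nu U)).
  apply: (partition_entropy_le nu _ rr0 rr1 bU) => [|x]; first exact: measurable_itinerary.
  set a := itinerary _ _ _ _; pose w := word N x.
  have sw : size w = N by rewrite size_word.
  have ka (j : 'I_n) : expR (- g (iter j f x)) <= kap (a j) (xi' (take m (drop j w))).
    rewrite /w drop_word; last by rewrite leq_add2r ltnW.
    rewrite /kap /a ffunE /g indicE; case: ifPn => h.
      by rewrite memNset ?mulr0 ?addr0 ?del1//; rewrite /bad /= h.
    rewrite mem_set// mulr1 delk ler_expR lerN2 lerDr; exact: ltW.
  have pkge : expR (- \sum_(j < n) g (iter j f x)) <= pk a w.
    rewrite -sumrN expR_bigsum; apply: ler_prod => j _; rewrite expR_ge0 /=; exact: ka.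
  have bw : \sum_(i < N) phi (iter i f x) - (C1 + e / 4 * N%:R) <= bsum alpha phi w (I01_0 R).
    have := dst w (iter N f x) (I01_0 R); rewrite sw /w (bsum_word alpha_gt0) ler_norml.
    by move=> /andP[_ h]; rewrite lerBlDr -lerBlDl.
  have rw : expR (\sum_(i < N) phi (iter i f x) - (C1 + e / 4 * N%:R) - ln Z) <= r w.
    have ZE : expR (ln Z) = Z by rewrite lnK ?posrE.
    by rewrite /r ler_pdivlMr// -[X in _ * X <= _]ZE -expRD ler_expR subrK.
  have := le_trans (ler_pM (expR_ge0 _) (expR_ge0 _) rw pkge) (rrge a w sw).
  rewrite -expRD => h; rewrite lerNl -ler_expR lnK ?posrE//.
  by apply: le_trans h; rewrite ler_expR /U; lra.
rewrite /U evD//; last exact: bS.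
rewrite evB; [|exact: bm_cst|exact: bS].
rewrite ev_cst !ev_birkhoff// /N natrD lns.
have : n%:R * ev nu g <= n%:R * (e / 4 + e / 4) by rewrite ler_wpM2l.
move: (ev nu g) (ev nu phi) (ln rho) (ln C2) (n%:R : R) (m%:R : R) => a b c d p q.
by lra.
Qed.

(** The trivial partition has entropy 0, so 0 <= C + n (ln rho - ev nu phi + e) for all n. This is
    the nonnegativity that [limn_le] asks for. *)
Lemma ev_phi_le : ev nu phi <= ln rho.
Proof.
apply/ler_addgt0Pr => e e0; have e2 : 0 < e / 2 by rewrite divr_gt0.
have mt : measurable_partition (fun _ : X => ord0 : 'I_1).
  by move=> i; rewrite (_ : _ @^-1` _ = setT)//; apply/seteqP; split => // x _ /=; rewrite [RHS]ord1.
have [C hC] := partition_entropy_upper mt e2.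
have H0 n : partition_entropy nu (itinerary f (fun _ : X => ord0 : 'I_1) n) = 0.
  rewrite partition_entropyE big1 ?oppr0// => a _.
  rewrite (_ : _ @^-1` _ = setT).
    by rewrite /pr (_ : fine _ = 1) ?ln1 ?mulr0//; exact: (congr1 fine (probability_setT nu)).
  by apply/seteqP; split => // x _ /=; apply/ffunP => i; rewrite ffunE ord1 [RHS]ord1.
rewrite leNgt; apply/negP => h.
have := archi_boundP (normr_ge0 (C / (e / 2))); set n := Num.bound _ => hn.
have := hC n; rewrite H0.
have h1 : n%:R * (ln rho - ev nu phi + e / 2) <= n%:R * - (e / 2) by rewrite ler_wpM2l//; lra.
have h2 : C < n%:R * (e / 2).
  by rewrite -ltr_pdivrMr//; apply: le_lt_trans hn; exact: ler_norm.
by rewrite mulrN in h1; lra.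
Qed.

Lemma entropy_rate_upper k (xi : X -> 'I_k) : measurable_partition xi ->
  entropy_rate f nu xi <= ln rho - ev nu phi.
Proof.
move=> mxi; apply: limn_le; first by rewrite subr_ge0 ev_phi_le.
move=> e e0; have [C hC] := partition_entropy_upper mxi e0; exists C => n n0.
by rewrite mulrCA mulfV ?mulr1// pnatr_eq0 -lt0n.
Qed.

Lemma measure_entropy_upper : (measure_entropy f nu <= (ln rho - ev nu phi)%:E)%E.
Proof.
apply: ge_ereal_sup => _ [k [xi [mxi ->]]]; rewrite lee_fin; exact: entropy_rate_upper.
Qed.

Lemma free_energy_upper : (free_energy alpha phi nu <= (ln rho)%:E)%E.
Proof.
rewrite /free_energy -evE// -(subrK (ev nu phi) (ln rho)) EFinD.
by rewrite leeD2r//; exact: measure_entropy_upper.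
Qed.

End entropy_bound.

Lemma cvg_rate (R : realType) (u : nat -> R) (h : R) :
  (forall e, 0 < e -> exists C, forall n, (0 < n)%N -> `|n%:R * u n - n%:R * h| <= C + n%:R * e) ->
  u n @[n --> \oo] --> h.
Proof.
move=> hu; apply/cvgrPdist_le => e e0.
have e2 : 0 < e / 2 by rewrite divr_gt0.
have [C hC] := hu _ e2.
exists (Num.bound (`|C| / (e / 2))).+1 => // n /= nb.
have n0 : (0 < n)%N := leq_ltn_trans (leq0n _) nb.
have n0' : (0 : R) < n%:R by rewrite ltr0n.
have Ce : 0 <= `|C| / (e / 2) by rewrite divr_ge0// ltW.
have h1 : `|C| <= n%:R * (e / 2).
  by rewrite -ler_pdivrMr// (le_trans (ltW (archi_boundP Ce)))// ler_nat ltnW.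
rewrite distrC -(ler_pM2l n0') -{1}[n%:R](ger0_norm (ltW n0')) -normrM mulrBr.
rewrite (le_trans (hC n n0))//.
have -> : n%:R * e = n%:R * (e / 2) + n%:R * (e / 2) by field.
by rewrite lerD2r (le_trans (ler_norm C)).
Qed.

(** * The Gibbs state when rho > exp (phi 0) *)

Section gibbs_measure.
Variables (R : realType) (alpha : R).
Hypothesis alpha_gt0 : 0 < alpha.
Local Notation X := (I01 R).
Local Notation f := (@intermittent R alpha).
Local Notation word := (@word R alpha).
Local Notation transfer := (@transfer R alpha R).
Variable gamma : R.
Hypothesis gamma_gt0 : 0 < gamma.
Hypothesis gamma_le1 : gamma <= 1.
Variables (phi : X -> R) (H B : R).
Hypothesis phiH : hol gamma H phi.
Hypothesis phiB : forall x, `|phi x| <= B.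
Local Notation rho := (srad alpha phi).

Let mf : measurable_fun setT f := measurable_intermittent alpha_gt0.
Let bphi : bm phi := hol_bm gamma_gt0 phiH.

Definition digit2 (x : X) : 'I_2 := if digit alpha x then ord_max else ord0.

Lemma measurable_digit2 : measurable_partition digit2.
Proof.
move=> i; pose b := i == ord_max.
rewrite (_ : _ @^-1` _ = @digit R alpha @^-1` [set b]).
  by rewrite -[X in measurable X]setTI; exact: measurable_digit.
apply/seteqP; split => x; rewrite /digit2 /b {b} /=.
  by case: (digit alpha x) => <-.
case: (digit alpha x); first by move=> /esym/eqP.
by case: i => -[|[|//]] hi // _; apply/val_inj.
Qed.

Lemma itinerary_digit2 n x y :
  itinerary f digit2 n x = itinerary f digit2 n y <-> word n x = word n y.
Proof.
have d2 z z' : digit2 z = digit2 z' <-> digit alpha z = digit alpha z'.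
  by rewrite /digit2; case: (digit alpha z); case: (digit alpha z').
split => [h|h].
  apply/eq_in_map => i; rewrite mem_iota add0n /= => hi.
  by move/ffunP/(_ (Ordinal hi)): h; rewrite !ffunE => /d2.
apply/ffunP => i; rewrite !ffunE; apply/d2.
by move/eq_in_map: h; apply; rewrite mem_iota /=.
Qed.

Hypothesis gap : expR (phi (I01_0 R)) < rho.

(** The partition by the first digit already attains the entropy: its cylinders have mass at most
    rho^-n exp (S_n phi) up to exp (C + e n), and [partition_entropy_upper] gives the converse
    bound. *)
Lemma gibbs_measure : exists nu : probability X R, [/\ invariant_measure f nu,
  exponentially_mixing alpha nu, measure_entropy f nu = (ln rho - ev nu phi)%:E &
  0 < ln rho - ev nu phi].
Proof.
have [h [c [K [c0 hr hK hL]]]] := eigenfunction alpha_gt0 gamma_gt0 phiH phiB gap.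
have rho0 := rho_gt0 gap.
pose p := normal alpha phi h.
pose c1 := rho^-1 * expR (- B) * c.
have c10 : 0 < c1 by rewrite !mulr_gt0 ?invr_gt0 ?expR_gt0.
have p_ge b x : c1 <= p b x := normal_ge phiB gap c0 hr b x.
have p_sum x : p false x + p true x = 1 := normal_sum gap c0 hr hL x.
have [Bp p_hol] := normal_hol alpha_gt0 gamma_gt0 phiH phiB c0 hr hK.
have [n0 n00 p_damp] := normal_damped alpha_gt0 gamma_gt0 phiH phiB gap c0 hr.
have [nu [nuM mix]] := equilibrium alpha_gt0 gamma_gt0 gamma_le1 c10 p_ge p_sum p_hol n00 p_damp.
have inv := stationary_invariant alpha_gt0 gamma_gt0 gamma_le1 c10 p_ge p_sum p_hol nuM.
have prc := pr_cylinder alpha_gt0 gamma_gt0 gamma_le1 c10 p_ge p_sum p_hol nuM.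
have bw w : bm (weight alpha p w).
  elim: w => [|b w IH] /=; first exact: bm_cst.
  apply: bmM => //; apply: (bm_comp (g := wbranch alpha w)); last exact: (bm_p gamma_gt0 p_hol).
  elim: w {IH} => [|b' w IH] /=; first exact: measurable_id.
  by apply: measurableT_comp => //; exact: measurable_branch.
have cell n x : pr nu (itinerary f digit2 n @^-1` [set itinerary f digit2 n x]) =
    ev nu (weight alpha p (word n x)).
  rewrite -prc size_word; congr (pr nu _).
  by apply/seteqP; split => y /= /itinerary_digit2.
have q0 n x : 0 < ev nu (weight alpha p (word n x)).
  apply: (@lt_le_trans _ _ (c1 ^+ n)); first exact: exprn_gt0.
  rewrite -[leLHS](ev_cst nu); apply: ev_le => //; first exact: bm_cst.
  by move=> y; have := p_weight_ge alpha c10 p_ge (word n x) y; rewrite size_word.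
have c1lt : c1 < 1 by have := p_sum (I01_0 R); have := p_ge true (I01_0 R); have := p_ge false (I01_0 R); lra.
pose hh := ln rho - ev nu phi.
have md n := measurable_itinerary mf (n := n) measurable_digit2.
have lower1 e : 0 < e -> exists C, forall n,
    n%:R * (hh - e) - C <= partition_entropy nu (itinerary f digit2 n).
  move=> e0; have [C1 C10 dst] := distortion alpha_gt0 gamma_gt0 phiH e0.
  exists (C1 - ln c) => n.
  pose U x : R := ln c + n%:R * ln rho - (C1 + e * n%:R) - \sum_(i < n) phi (iter i f x).
  have bU1 : bm (fun x => \sum_(i < n) phi (iter i f x)).
    apply: bm_sum => i; apply: (bm_comp (g := iter i f)) => //; exact: measurable_iter.
  have bU : bm U by apply: bmB => //; exact: bm_cst.
  have evU : ev nu U = n%:R * (hh - e) - (C1 - ln c).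
    by rewrite /U evB ?ev_cst ?ev_birkhoff//; [rewrite /hh; ring|exact: bm_cst].
  rewrite -evU; apply: (partition_entropy_ge (md n) bU) => x.
  rewrite cell lerNr -ler_expR lnK ?posrE//.
  rewrite -[leRHS](ev_cst nu); apply: ev_le => //; first exact: bm_cst.
  move=> y; have /andP[_] := normal_weight gap c0 hr (word n x) y.
  move=> /le_trans; apply; rewrite size_word.
  have -> : - U x = - ln c + (- (n%:R * ln rho) + (C1 + e * n%:R + \sum_(i < n) phi (iter i f x))).
    by rewrite /U; ring.
  rewrite !expRD expRN lnK ?posrE// ler_wpM2l ?invr_ge0 ?(ltW c0)//.
  have -> : expR (- (n%:R * ln rho)) = rho^-1 ^+ n.
    by rewrite expRN mulr_natl -lnXn// lnK ?posrE ?exprn_gt0// exprVn.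
  rewrite ler_wpM2l ?exprn_ge0 ?invr_ge0 ?(ltW rho0)// -!expRD ler_expR.
  have := dst (word n x) y (iter n f x); rewrite (bsum_word alpha_gt0) size_word ler_norml.
  by move=> /andP[_]; lra.
have upper1 e : 0 < e -> exists C, forall n,
    partition_entropy nu (itinerary f digit2 n) <= C + n%:R * (hh + e).
  exact: (partition_entropy_upper alpha_gt0 gamma_gt0 phiH phiB inv measurable_digit2).
have rate : partition_entropy nu (itinerary f digit2 n) / n%:R @[n --> \oo] --> hh.
  apply: cvg_rate => e e0; have [C1 h1] := lower1 e e0; have [C2 h2] := upper1 e e0.
  exists (`|C1| + `|C2|) => n n00'.
  rewrite mulrCA mulfV ?mulr1 ?pnatr_eq0 -?lt0n//.
  have := h1 n; have := h2 n; have := ler_norm C1; have := ler_norm C2.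
  have := normr_ge0 C1; have := normr_ge0 C2.
  by rewrite ler_norml mulrBr mulrDr => u1 u2 u3 u4 u5 u6; clear -u1 u2 u3 u4 u5 u6; apply/andP; split; lra.
(* Each transition probability is at most 1 - c1, so an n-cylinder has mass at most (1 - c1)^n; this
   makes the entropy strictly positive. *)
have lower2 n : n%:R * - ln (1 - c1) <= partition_entropy nu (itinerary f digit2 n).
  rewrite -[leLHS](ev_cst nu).
  apply: (partition_entropy_ge (md n) (bm_cst _ _)) => x.
  rewrite cell mulrN lerN2 mulr_natl -lnXn ?subr_gt0//.
  rewrite ler_ln ?posrE ?exprn_gt0 ?subr_gt0//.
  rewrite -[leRHS](ev_cst nu); apply: ev_le => //; first exact: bm_cst.
  move=> y; have := size_word alpha n x; move: (word n x) => w; elim: w n => [|b w IH] [|n]//=.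
  move=> [sw]; rewrite exprS; apply: ler_pM.
  - exact: le_trans (ltW c10) (p_ge _ _).
  - have := p_weight_ge alpha c10 p_ge w y; apply: le_trans; rewrite exprn_ge0// ltW//.
  - have := p_sum (wbranch alpha w y); have := p_ge true (wbranch alpha w y).
    by have := p_ge false (wbranch alpha w y); case: b; lra.
  - exact: IH.
have hh0 : 0 < hh.
  have l0 : 0 < - ln (1 - c1) by rewrite oppr_gt0 ln_lt0// subr_gt0 c1lt /= ltrBlDr ltrDl.
  apply: lt_le_trans l0 _; apply: (@ler_cvg_to nat \oo _ R (fun=> - ln (1 - c1)) _ _ _ _ rate).
    exact: cvg_cst.
  exists 1%N => // n /= n1; rewrite ler_pdivlMr ?ltr0n// mulrC; exact: lower2.
exists nu; split => //.
apply/eqP; rewrite eq_le; apply/andP; split.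
  exact: (measure_entropy_upper alpha_gt0 gamma_gt0 phiH phiB inv).
apply: ereal_sup_ubound; exists 2%N, digit2; split; first exact: measurable_digit2.
by congr EFin; apply/esym; apply: cvg_lim.
Qed.

End gibbs_measure.

(** * The Dirac mass and bounds on the pressure *)

Section pressure_bounds.
Variables (R : realType) (alpha : R).
Hypothesis alpha_gt0 : 0 < alpha.
Local Notation X := (I01 R).
Local Notation f := (@intermittent R alpha).
Implicit Types phi : X -> R.

Local Notation delta0 := (@dirac _ X (I01_0 R) R).

Lemma dirac0_invariant : invariant_measure f delta0.
Proof.
move=> A mA; have e S : delta0 S = (I01_0 R \in S)%:R%:E by exact: diracE.
transitivity (delta0 (f @^-1` A)) => //; transitivity (delta0 A) => //.
rewrite !e (_ : (_ \in _ @^-1` _) = (I01_0 R \in A))//.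
by apply/idP/idP; rewrite !inE /= intermittent0.
Qed.

Lemma entropy_ge0 (nu : probability X R) : (0 <= measure_entropy f nu)%E.
Proof.
apply: ereal_sup_ubound; exists 1%N, (fun=> ord0); split.
  by move=> i; rewrite (_ : _ @^-1` _ = setT)//; apply/seteqP; split => // x _ /=; rewrite [RHS]ord1.
congr EFin; apply/esym; rewrite /entropy_rate.
rewrite (_ : (fun n => _) = fun=> 0); first exact: lim_cst.
apply/funext => n; rewrite partition_entropyE big1 ?oppr0 ?mul0r// => a _.
rewrite (_ : _ @^-1` _ = setT).
  by rewrite /pr (_ : fine _ = 1) ?ln1 ?mulr0//; exact: (congr1 fine (probability_setT nu)).
by apply/seteqP; split => // x _ /=; apply/ffunP => i; rewrite ffunE ord1 [RHS]ord1.
Qed.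

Lemma entropy_dirac0 : measure_entropy f delta0 = 0%E.
Proof.
apply/eqP; rewrite eq_le entropy_ge0 andbT.
apply: ge_ereal_sup => _ [k [xi [mxi ->]]]; rewrite lee_fin /entropy_rate.
rewrite (_ : (fun n => _) = fun=> 0); first by rewrite lim_cst.
apply/funext => n; rewrite /partition_entropy big1 ?oppr0 ?mul0r// => a _.
rewrite /dirac /= indicE; case: (_ \in _); last by rewrite mul0r.
by rewrite ln1 mulr0.
Qed.

Lemma free_energy_dirac0 phi : bm phi -> free_energy alpha phi delta0 = (phi (I01_0 R))%:E.
Proof.
move=> [mphi _]; rewrite /free_energy entropy_dirac0 add0e integral_dirac//.
  by rewrite diracT mul1e.
exact/measurable_EFinP.
Qed.

Lemma pressure_ge phi : bm phi -> ((phi (I01_0 R))%:E <= pressure alpha phi)%E.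
Proof.
move=> bphi; rewrite -free_energy_dirac0//; apply: ereal_sup_ubound.
by exists delta0 => //; exact: dirac0_invariant.
Qed.

Variable gamma : R.
Hypothesis gamma_gt0 : 0 < gamma.
Hypothesis gamma_le1 : gamma <= 1.
Variables (phi : X -> R) (H B : R).
Hypothesis phiH : hol gamma H phi.
Hypothesis phiB : forall x, `|phi x| <= B.
Local Notation rho := (srad alpha phi).

Let bphi : bm phi := hol_bm gamma_gt0 phiH.

Lemma pressure_le : (pressure alpha phi <= (ln rho)%:E)%E.
Proof.
apply: ge_ereal_sup => _ [nu inv <-].
exact: (free_energy_upper alpha_gt0 gamma_gt0 phiH phiB inv).
Qed.

Lemma pressure_fin : (fine (pressure alpha phi))%:E = pressure alpha phi.
Proof.
rewrite fineK// fin_numE; apply/andP; split; apply/eqP => h.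
  by have := pressure_ge bphi; rewrite h.
by have := pressure_le; rewrite h.
Qed.

Hypothesis gap : expR (phi (I01_0 R)) < rho.

Lemma gibbs_gap : pressure alpha phi = (ln rho)%:E /\ exists nu : probability X R,
  [/\ gibbs_state alpha phi nu, exponentially_mixing alpha nu & (0 < measure_entropy f nu)%E].
Proof.
have [nu [inv mix ent pos]] := gibbs_measure alpha_gt0 gamma_gt0 gamma_le1 phiH phiB gap.
have fe : free_energy alpha phi nu = (ln rho)%:E.
  by rewrite /free_energy ent -evE// -EFinD subrK.
have pe : pressure alpha phi = (ln rho)%:E.
  apply/eqP; rewrite eq_le pressure_le /= -fe; apply: ereal_sup_ubound.
  by exists nu.
split => //; exists nu; split => //; first by split => //; rewrite fe pe.
by rewrite ent lte_fin.
Qed.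

End pressure_bounds.

(** * Pressure and the two phases *)

Section phases.
Variables (R : realType) (alpha : R).
Hypothesis alpha_gt0 : 0 < alpha.
Variable gamma : R.
Hypothesis gamma_gt0 : 0 < gamma.
Hypothesis gamma_le1 : gamma <= 1.
Local Notation X := (I01 R).
Local Notation f := (@intermittent R alpha).
Local Notation Hld := (holder (real_modulus R) gamma).
Local Notation P := (real_pressure alpha gamma).
Local Notation zero := (I01_0 R).
Implicit Types (phi psi : Hld) (nu : probability X R).

Lemma holder_hol phi : hol gamma (holder_seminorm (real_modulus R) gamma phi) phi.
Proof.
move=> x y; have [->|xy] := eqVneq x y; first by rewrite subrr normr0 distxx ?mulr0.
have xy' : 0 < `|pt x - pt y|.
  by rewrite normr_gt0 subr_eq0; apply: contra xy => /eqP/pt_inj ->.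
have := holder_seminorm_ub phi (p := (x, y)) xy.
by rewrite ler_pdivrMr ?powR_gt0.
Qed.

Lemma holder_normE phi : `|phi| = holder_norm (real_modulus R) gamma phi.
Proof. by []. Qed.

Lemma holder_sup_le phi x : `|phi x| <= `|phi|.
Proof.
rewrite holder_normE (le_trans (sup_norm_ub phi x))// lerDl; exact: holder_seminorm_ge0.
Qed.

Lemma holder_hol_norm phi : hol gamma `|phi| phi.
Proof.
apply: hol_le (holder_hol phi); rewrite holder_normE lerDr; exact: sup_norm_ge0.
Qed.

Lemma holder_bm phi : bm (phi : X -> R).
Proof. exact: (@hol_bm R gamma gamma_gt0 _ (phi : X -> R) (holder_hol phi)). Qed.

Lemma real_pressureE phi : (P phi)%:E = pressure alpha phi.
Proof. exact: (pressure_fin alpha_gt0 gamma_gt0 (holder_hol phi) (holder_sup_le phi)). Qed.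

Lemma free_energy_le phi nu : invariant_measure f nu -> (free_energy alpha phi nu <= (P phi)%:E)%E.
Proof. by move=> inv; rewrite real_pressureE; apply: ereal_sup_ubound; exists nu. Qed.

Lemma free_energyE phi nu :
  (free_energy alpha phi nu = measure_entropy f nu + (ev nu phi)%:E)%E.
Proof. by rewrite /free_energy evE//; exact: holder_bm. Qed.

Lemma real_pressure_ge phi : phi zero <= P phi.
Proof. by rewrite -lee_fin real_pressureE; apply: pressure_ge => //; exact: holder_bm. Qed.

Lemma real_pressure_mono phi psi (c : R) : (forall x, phi x <= psi x + c) -> P phi <= P psi + c.
Proof.
move=> h; rewrite -lee_fin [leLHS]real_pressureE; apply: ge_ereal_sup => _ [nu inv <-].
rewrite EFinD; apply: le_trans (_ : (free_energy alpha psi nu + c%:E <= _)%E); last first.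
  by rewrite leeD2r// free_energy_le.
rewrite !free_energyE -addeA -EFinD leeD2l// lee_fin -[c in leRHS](ev_cst nu) -evD.
- apply: ev_le => //; [exact: holder_bm|apply: bmD; [exact: holder_bm|exact: bm_cst]].
- exact: holder_bm.
- exact: bm_cst.
Qed.

Definition gap_set : set Hld := [set phi : Hld | phi zero < P phi].

Lemma gap_setC phi : ~ gap_set phi -> P phi = phi zero.
Proof.
move=> /negP; rewrite -leNgt => h; apply/eqP; rewrite eq_le h /=; exact: real_pressure_ge.
Qed.

(** One direction is P <= ln rho; in the other, [gibbs_gap] identifies P with ln rho. *)
Lemma gap_set_srad phi : gap_set phi <-> expR (phi zero) < srad alpha phi.
Proof.
have s0 : 0 < srad alpha phi := srad_gt0 alpha (holder_sup_le phi).
split => h.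
  rewrite -[ltRHS]lnK ?posrE// ltr_expR (lt_le_trans h)// -lee_fin real_pressureE.
  exact: (pressure_le alpha_gt0 gamma_gt0 (holder_hol phi) (holder_sup_le phi)).
have [e _] := gibbs_gap alpha_gt0 gamma_gt0 gamma_le1 (holder_hol phi) (holder_sup_le phi) h.
rewrite /gap_set /=; have -> : P phi = ln (srad alpha phi) by apply: EFin_inj; rewrite real_pressureE.
by rewrite -ltr_expR lnK ?posrE.
Qed.

Lemma gap_set_pressure phi : gap_set phi -> P phi = ln (srad alpha phi).
Proof.
move=> /gap_set_srad h; apply: EFin_inj; rewrite real_pressureE.
by have [] := gibbs_gap alpha_gt0 gamma_gt0 gamma_le1 (holder_hol phi) (holder_sup_le phi) h.
Qed.

Lemma gap_set_intermittent : gap_set `<=` intermittent_phase alpha gamma.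
Proof.
move=> phi /gap_set_srad h.
by have [_ [nu ?]] := gibbs_gap alpha_gt0 gamma_gt0 gamma_le1 (holder_hol phi) (holder_sup_le phi) h; exists nu.
Qed.

Lemma real_pressure_lip phi psi : `|P phi - P psi| <= `|phi - psi|.
Proof.
have key (u v : Hld) : P u <= P v + `|u - v|.
  apply: real_pressure_mono => x; rewrite -lerBlDl (le_trans (ler_norm _))//.
  exact: (holder_sup_le (u - v)).
rewrite ler_norml; have h1 := key phi psi; have h2 := key psi phi.
rewrite distrC in h2; apply/andP; split; lra.
Qed.

Lemma holder_open (A : set Hld) : open A <-> forall phi, A phi -> exists2 e : R, 0 < e &
  forall psi, `|psi - phi| < e -> A psi.
Proof.
rewrite openE; split=> h phi Aphi.
  have /nbhs_ballP[e /= e0 he] := h phi Aphi; exists e => // psi pe; apply: he.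
  by rewrite -ball_normE /= distrC.
have [e e0 he] := h phi Aphi; apply/nbhs_ballP; exists e => //= psi.
by rewrite -ball_normE /= distrC => /he.
Qed.

Lemma holder_interior (A : set Hld) phi : A^° phi <-> exists2 e : R, 0 < e &
  forall psi, `|psi - phi| < e -> A psi.
Proof.
split.
  move=> /nbhs_ballP[e /= e0 he]; exists e => // psi pe; apply: he.
  by rewrite -ball_normE /= distrC.
move=> [e e0 he]; apply/nbhs_ballP; exists e => //= psi.
by rewrite -ball_normE /= distrC => /he.
Qed.

Lemma gap_set_open : open gap_set.
Proof.
apply/holder_open => phi; rewrite /gap_set /= => h.
exists ((P phi - phi zero) / 2); first by rewrite divr_gt0// subr_gt0.
move=> psi hp.
have h1 := real_pressure_lip psi phi.
have h2 : `|psi zero - phi zero| <= `|psi - phi| by exact: (holder_sup_le (psi - phi)).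
move: h1 h2; rewrite !ler_norml => /andP[h1 _] /andP[_ h2]; lra.
Qed.

(** Subadditivity of t^gamma from t <= t^gamma on [0, 1], applied to b / a and 1 - b / a; it makes
    the cusp Hoelder with constant 1. *)
Lemma powR_sub (a b : R) : 0 <= b -> b <= a -> a `^ gamma <= b `^ gamma + (a - b) `^ gamma.
Proof.
move=> b0 ba; have a0 := le_trans b0 ba.
have [->|an] := eqVneq a 0; first by rewrite powR0 ?gt_eqF// addr_ge0// powR_ge0.
have ap : 0 < a by rewrite lt_neqAle eq_sym an.
have key t : 0 <= t -> t <= 1 -> t <= t `^ gamma.
  move=> t0 t1; have [->|tn] := eqVneq t 0; first exact: powR_ge0.
  by apply: ger1_powR => //; rewrite lt_neqAle eq_sym tn t0.
have q0 : 0 <= b / a by rewrite divr_ge0.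
have q1 : b / a <= 1 by rewrite ler_pdivrMr// mul1r.
have e2 : a - b = (1 - b / a) * a by rewrite mulrBl mul1r divfK.
have -> : b `^ gamma = (b / a) `^ gamma * a `^ gamma by rewrite -powRM// divfK.
have -> : (a - b) `^ gamma = (1 - b / a) `^ gamma * a `^ gamma by rewrite -powRM ?subr_ge0// -e2.
rewrite -mulrDl ler_peMl ?powR_ge0//.
have := key _ q0 q1; have := key (1 - b / a); rewrite subr_ge0 gerBl => /(_ q1 q0).
by move: ((b / a) `^ gamma) ((1 - b / a) `^ gamma) (b / a) => ? ? ?; lra.
Qed.

Definition cusp_fun (x : X) : R := dist gamma x zero.

Lemma cusp_hol : hol gamma 1 cusp_fun.
Proof.
have key x y : pt y <= pt x -> `|cusp_fun x - cusp_fun y| <= 1 * dist gamma x y.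
  move=> yx; rewrite mul1r /cusp_fun !dist0r /dist ger0_norm ?subr_ge0; last first.
    by apply: ge0_ler_powR; rewrite ?nnegrE ?I01_ge0// ltW.
  by rewrite ger0_norm ?subr_ge0// lerBlDl powR_sub ?I01_ge0.
move=> x y; have [/key|/ltW/key h] := leP (pt y) (pt x); first by [].
by rewrite distrC distC.
Qed.

Lemma cusp_subproof : (cusp_fun : X -> R^o) \in holder_pred (real_modulus R) gamma.
Proof.
apply/asboolP; exists 1; split=> [x|x y]; last exact: cusp_hol.
by rewrite [X in X <= _]ger0_norm ?dist_ge0 ?dist_le1.
Qed.

Definition cusp : Hld := Holder cusp_subproof.

Lemma cusp0 : cusp zero = 0.
Proof. exact: distxx. Qed.

Lemma cusp_ge0 x : 0 <= cusp x. Proof. exact: dist_ge0. Qed.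

Lemma cusp_le phi x : phi x - phi zero <= `|phi| * cusp x.
Proof. exact: le_trans (ler_norm _) (holder_hol_norm phi x zero). Qed.

(* The cone of potentials phi + C with a cusp at 0: lowering phi by a multiple
   of the cusp absorbs every small perturbation, because the pressure is
   monotone. *)
Lemma gap_setC_sub phi psi (e : R) : 0 < e -> ~ gap_set phi ->
  `|psi - (phi - e *: cusp)| < e -> ~ gap_set psi.
Proof.
move=> e0 nphi he; apply/negP; rewrite -leNgt.
have h x : psi x <= phi x + (psi zero - phi zero).
  have := cusp_le (psi - (phi - e *: cusp)) x.
  have -> : (psi - (phi - e *: cusp)) x = psi x - (phi x - e * cusp x) by [].
  have -> : (psi - (phi - e *: cusp)) zero = psi zero - (phi zero - e * cusp zero) by [].
  rewrite cusp0 mulr0 subr0 => h1.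
  have : `|psi - (phi - e *: cusp)| * cusp x <= e * cusp x by rewrite ler_wpM2r ?cusp_ge0// ltW.
  lra.
by rewrite (le_trans (real_pressure_mono h))// gap_setC// addrC subrK.
Qed.

Definition frozen : set Hld := (~` gap_set)^°.

Lemma gap_setC_frozen phi (e : R) : 0 < e -> ~ gap_set phi -> frozen (phi - e *: cusp).
Proof.
by move=> e0 h; apply/holder_interior; exists e => // psi; exact: gap_setC_sub.
Qed.

(** For small d, phi + d cusp is still off [gap_set] with the same value at 0, hence has the same
    pressure. The free energy of nu would exceed it if the cusp had a positive integral. *)
Lemma gibbs_frozen phi nu : frozen phi -> gibbs_state alpha phi nu -> ev nu cusp = 0.
Proof.
move=> /holder_interior[e e0 he] [inv gib].
have n0 : 0 < `|cusp| + 1 by rewrite ltr_wpDl.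
(* This makes the norm of d cusp less than e. *)
pose d := e / (`|cusp| + 1) / 2; have d0 : 0 < d by rewrite !divr_gt0.
have near : ~ gap_set (phi + d *: cusp).
  apply: he; rewrite addrAC subrr add0r normrZ gtr0_norm//.
  apply: (@le_lt_trans _ _ (d * (`|cusp| + 1))); first by rewrite ler_wpM2l ?(ltW d0)// lerDl.
  by rewrite /d mulrAC divfK ?gt_eqF// ltr_pdivrMr// ltr_pMr// ltr1n.
have nphi : ~ gap_set phi by apply: he; rewrite subrr normr0.
have bc := holder_bm cusp; have bp := holder_bm phi.
apply/eqP; rewrite eq_le ev_ge0 ?andbT; last exact: cusp_ge0.
have := free_energy_le (phi + d *: cusp) inv.
rewrite free_energyE (gap_setC near).
have -> : (phi + d *: cusp) zero = phi zero by rewrite -[LHS]/(phi zero + d * cusp zero) cusp0 mulr0 addr0.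
have -> : ev nu (phi + d *: cusp : Hld) = ev nu phi + d * ev nu cusp.
  by rewrite -evZ// -evD//; exact: bmZ.
rewrite EFinD addeA -free_energyE gib -real_pressureE (gap_setC nphi) -EFinD lee_fin.
by rewrite gerDl pmulr_rle0.
Qed.

(** |u - u 0| is at most c times the cusp, so a measure that annihilates the cusp integrates Hoelder
    functions like the Dirac mass at 0. *)
Lemma ev_cusp0 nu (u : X -> R) c : hol gamma c u -> ev nu cusp = 0 -> ev nu u = u zero.
Proof.
move=> hu ec; have bc := holder_bm cusp; have bu := hol_bm gamma_gt0 hu.
have key (v : X -> R) : bm v -> (forall x, v x <= u zero + c * cusp x) -> ev nu v <= u zero.
  move=> bv h; rewrite -[leRHS]addr0 -[X in _ + X](mulr0 c) -ec -evZ// -[u zero](ev_cst nu) -evD.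
  - by apply: ev_le => //; apply: bmD; [exact: bm_cst|exact: bmZ].
  - exact: bm_cst.
  - exact: bmZ.
have hx x : `|u x - u zero| <= c * cusp x := hu x zero.
apply/eqP; rewrite eq_le key//=; last first.
  by move=> x; have := le_trans (ler_norm _) (hx x); rewrite lerBlDl.
have e : ev nu u = 2 * u zero - ev nu (fun x => 2 * u zero + -1 * u x).
  rewrite evD; [|exact: bm_cst|exact: bmZ].
  by rewrite ev_cst evZ// mulN1r opprD opprK addrA subrr add0r.
rewrite e; have : ev nu (fun x => 2 * u zero + -1 * u x) <= u zero; last by lra.
apply: key; first by apply: bmD; [exact: bm_cst|exact: bmZ].
by move=> x; have := hx x; rewrite ler_norml => /andP[h _]; move: (u x) (u zero) (c * cusp x) h => a b d h; lra.
Qed.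

(** A Gibbs state annihilates the cusp, so its integral of phi is phi 0 = P phi, which leaves no
    room for positive entropy. *)
Lemma frozen_not_intermittent phi : frozen phi -> ~ intermittent_phase alpha gamma phi.
Proof.
move=> fr [nu [gib _ ent]]; have nphi : ~ gap_set phi := interior_subset fr.
have ec := gibbs_frozen fr gib; have [inv pr] := gib.
have := ev_cusp0 (holder_hol phi) ec => e.
move: pr; rewrite free_energyE -real_pressureE (gap_setC nphi) e.
move: ent; case: (measure_entropy f nu) => [h| |] //=.
rewrite lte_fin => h0 [] => he; have {}he : h = 0 by apply: (@addIr _ (phi zero : R)); rewrite add0r.
by rewrite he ltxx in h0.
Qed.

Lemma stationary_phaseE : stationary_phase alpha gamma = frozen.
Proof.
have bphi (phi : Hld) : bm (phi : X -> R) := holder_bm phi.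
rewrite /stationary_phase; set U := [set phi : Hld | _].
apply/seteqP; split.
  apply: interiorS => phi [[_ gib] _].
  rewrite free_energy_dirac0// -real_pressureE in gib; case: gib => e.
  by rewrite /gap_set /= -e ltxx.
rewrite -[X in X `<=` _](interior_id _).1; last exact: open_interior.
apply: interiorS => phi fr; have nphi : ~ gap_set phi := interior_subset fr.
split.
  split; first exact: dirac0_invariant.
  by rewrite free_energy_dirac0// -real_pressureE gap_setC.
move=> nu gib; apply: (probability_unique gamma_gt0 gamma_le1) => u [c hu].
rewrite (ev_cusp0 hu (gibbs_frozen fr gib)).
have := free_energy_dirac0 alpha (hol_bm gamma_gt0 hu).
rewrite /free_energy entropy_dirac0// add0e -(evE _ (hol_bm gamma_gt0 hu)).
by case.
Qed.

Lemma closure_frozen : closure frozen = ~` gap_set.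
Proof.
apply/seteqP; split.
  rewrite [X in _ `<=` X](closure_id _).1; last exact: open_closedC gap_set_open.
  by apply: closure_subset; exact: interior_subset.
move=> phi nphi B /nbhs_ballP[e /= e0 he].
have n0 : 0 < `|cusp| + 1 by rewrite ltr_wpDl.
pose d := e / (`|cusp| + 1) / 2; have d0 : 0 < d by rewrite !divr_gt0.
exists (phi - d *: cusp); split; first exact: gap_setC_frozen.
apply: he; rewrite -ball_normE /= opprB addrC subrK normrZ gtr0_norm//.
apply: (@le_lt_trans _ _ (d * (`|cusp| + 1))); first by rewrite ler_wpM2l ?(ltW d0)// lerDl.
by rewrite /d mulrAC divfK ?gt_eqF// ltr_pdivrMr// ltr_pMr// ltr1n.
Qed.

Lemma boundary_stationary : boundary (stationary_phase alpha gamma) = ~` gap_set `\` frozen.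
Proof.
rewrite /boundary stationary_phaseE closure_frozen (interior_id _).1//.
exact: open_interior.
Qed.

(** The interior of the intermittent phase is [gap_set]: from an interior point off it, a small
    multiple of the cusp would lead to a potential that is both frozen and intermittent. *)
Lemma boundary_intermittent : boundary (intermittent_phase alpha gamma) = ~` gap_set `\` frozen.
Proof.
have intI : (intermittent_phase alpha gamma)^° = gap_set.
  apply/seteqP; split; last first.
    rewrite -[X in X `<=` _](interior_id _).1; last exact: gap_set_open.
    exact/interiorS/gap_set_intermittent.
  move=> phi /holder_interior[e e0 he]; apply: contrapT => nphi.
  have n0 : 0 < `|cusp| + 1 by rewrite ltr_wpDl.
  pose d := e / (`|cusp| + 1) / 2; have d0 : 0 < d by rewrite !divr_gt0.
  apply: (frozen_not_intermittent (gap_setC_frozen d0 nphi)); apply: he.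
  rewrite addrAC subrr add0r normrN normrZ gtr0_norm//.
  apply: (@le_lt_trans _ _ (d * (`|cusp| + 1))); first by rewrite ler_wpM2l ?(ltW d0)// lerDl.
  by rewrite /d mulrAC divfK ?gt_eqF// ltr_pdivrMr// ltr_pMr// ltr1n.
rewrite /boundary intI; apply/seteqP; split => phi [].
  move=> cl ng; split => // fr.
  have [psi [ps1 ps2]] := cl _ (open_nbhs_nbhs (conj (@open_interior _ (~` gap_set)) fr)).
  exact: frozen_not_intermittent ps2 ps1.
move=> ng nfr; split => // B /nbhs_ballP[e /= e0 he].
apply: contrapT => h; apply: nfr; apply/holder_interior; exists e => // psi pe gp.
apply: h; exists psi; split; first exact: gap_set_intermittent.
by apply: he; rewrite -ball_normE /= distrC.
Qed.

End phases.

(** * Analyticity of the pressure *)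

(** s is the supremum of the times up to which A is avoided. As A is open, s itself is not in A; by
    maximality A is met just after s. *)
Lemma last_exit (R : realType) (A : set R) (d0 : R) : 0 < d0 ->
  (forall t, 0 <= t < d0 -> ~ A t) -> A 1 ->
  (forall t, A t -> exists2 d, 0 < d & forall s, `|s - t| < d -> A s) ->
  exists2 s, 0 < s < 1 & (forall t, 0 <= t <= s -> ~ A t) /\
    (forall d, 0 < d -> exists t, [/\ s <= t < s + d, t <= 1 & A t]).
Proof.
move=> d00 hd0 A1 oA.
pose S := [set t : R | 0 <= t <= 1 /\ forall s, 0 <= s <= t -> ~ A s].
have half (d : R) : 0 < d -> d / 2 < d by move=> ?; rewrite ltr_pdivrMr// ltr_pMr// ltr1n.
have hS : has_sup S.
  split; last by exists 1 => t [/andP[]].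
  exists 0; split => [|s /andP[s0 s1]]; first by rewrite lexx ler01.
  by apply: hd0; rewrite s0 (le_lt_trans s1).
pose s := sup S.
have s_gt0 : 0 < s.
  pose t := Num.min 1 (d0 / 2).
  have t0 : 0 < t by rewrite lt_min ltr01 divr_gt0.
  apply: (lt_le_trans t0); apply: ub_le_sup; first exact: hS.2.
  split; first by rewrite (ltW t0) ge_min lexx.
  move=> u /andP[u0 ut]; apply: hd0; rewrite u0 (le_lt_trans ut)//.
  by rewrite gt_min half ?orbT.
have s_le1 : s <= 1 by apply: ge_sup; [exact: hS.1|move=> t [/andP[]]].
have below t : 0 <= t -> t < s -> ~ A t.
  move=> t0 ts; have [u Su tu] := sup_gt hS.1 ts.
  by apply: Su.2; rewrite t0 ltW.
have at_s : ~ A s.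
  move=> /oA[d dd0 hd]; pose t := Num.max 0 (s - d / 2).
  have ts : t < s by rewrite gt_max s_gt0 ltrBlDr ltrDl divr_gt0.
  apply: (below t _ ts); first by rewrite le_max lexx.
  apply: hd; rewrite ltr0_norm ?subr_lt0// opprB ltrBlDr -ltrBlDl.
  by rewrite lt_max ltrD2l ltrN2 half ?orbT.
have s_lt1 : s < 1.
  by rewrite lt_neqAle s_le1 andbT; apply/eqP => s1; apply: at_s; rewrite s1.
exists s; first by rewrite s_gt0.
have upto t : 0 <= t <= s -> ~ A t.
  by move=> /andP[t0]; rewrite le_eqVlt => /orP[/eqP ->|]; [|exact: below].
split=> // d dd0; apply: contrapT => hn.
pose t := Num.min (d / 2) (1 - s).
have t0 : 0 < t by rewrite lt_min divr_gt0//= subr_gt0.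
have st1 : s + t <= 1 by rewrite -lerBrDl ge_min lexx orbT.
have : s + t <= s; last by rewrite gerDl leNgt t0.
apply: ub_le_sup; first exact: hS.2.
split; first by rewrite st1 andbT addr_ge0// ltW.
move=> u /andP[u0 ut]; have [us|us] := leP u s; first by apply: upto; rewrite u0.
move=> Au; apply: hn; exists u; split => //; last exact: le_trans st1.
by rewrite ltW//= (le_lt_trans ut)// ltrD2l gt_min half.
Qed.

Lemma complex_pos (R : realType) (e : R[i]) : 0 < e -> exists2 r : R, 0 < r & e = r%:C%C.
Proof.
by case: e => a b; rewrite ltcE /= => /andP[/eqP -> a0]; exists a.
Qed.

(** * Translation between real-valued norms and norms with values in R[i] *)

Section complex_bridge.
Variables (R : realType) (V : normedModType R[i]) (N : V -> R).
Local Notation C := R[i].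
Hypothesis NE : forall v, `|v| = (N v)%:C%C.

Lemma complex_nbhs v (A : set V) :
  nbhs v A <-> exists2 r, 0 < r & forall w, N (w - v) < r -> A w.
Proof.
split.
  move=> /nbhs_ballP[e /= /complex_pos[r r0 ->] he]; exists r => // w wr; apply: he.
  by rewrite -ball_normE /= distrC NE ltcR.
move=> [r r0 he]; apply/nbhs_ballP; exists r%:C%C; first by rewrite /= ltcR.
by move=> w; rewrite -ball_normE /= distrC NE ltcR => /he.
Qed.

Lemma complex_open (A : set V) :
  open A <-> forall v, A v -> exists2 r, 0 < r & forall w, N (w - v) < r -> A w.
Proof. by rewrite openE; split=> h v /h /complex_nbhs. Qed.

End complex_bridge.

Section derivative_bridge.
Variables (R : realType) (V : normedModType R[i]) (N : V -> R).
Local Notation C := R[i].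
Hypothesis NE : forall v, `|v| = (N v)%:C%C.

Lemma normc_abs (z : C^o) : `|z| = (normc z)%:C%C.
Proof. by rewrite [LHS]normc_def; case: z. Qed.

Lemma complex_derivable (H : C^o -> V) z : derivable H z 1 <->
  exists l, forall e : R, 0 < e -> exists2 d : R, 0 < d & forall w : C, w != z ->
    normc (w - z) < d -> N ((w - z)^-1 *: (H w - H z) - l) <= e.
Proof.
have shift (k : C^o) : k *: (1 : C^o) + z = k + z by rewrite [k *: 1]mulr1.
split.
  move=> /cvg_ex[l /cvgrPdist_le hl]; exists l => e e0.
  have /hl : 0 < e%:C%C :> C by rewrite ltcR.
  rewrite near_withinE => /(complex_nbhs normc_abs)[d d0 hd]; exists d => // w wz wd.
  have := hd (w - z); rewrite subr0 subr_eq0 => /(_ wd wz).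
  by rewrite /= shift subrK distrC NE lecR.
move=> [l hl]; apply/cvg_ex; exists l; apply/cvgrPdist_le => e /complex_pos[r r0 ->].
rewrite near_withinE; apply/(complex_nbhs normc_abs).
have [d d0 hd] := hl r r0; exists d => // k; rewrite subr0 => kd k0.
have := hd (k + z); rewrite addrK -subr_eq0 addrK => /(_ k0 kd).
by rewrite /= shift distrC NE lecR.
Qed.

End derivative_bridge.

Section scalar_bridge.
Variable R : realType.
Local Notation C := R[i].

Lemma cdiff_quotient (F : C -> C) z : cdiff F z <->
  exists l, forall e : R, 0 < e -> exists2 d : R, 0 < d & forall w : C, w != z ->
    normc (w - z) < d -> normc ((w - z)^-1 * (F w - F z) - l) <= e.
Proof.
split.
  move=> [phi [phic [r r0 Fr]]]; exists (phi z) => e e0.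
  have [d d0 hd] := phic e e0; exists (Num.min d r) => [|w wz]; first by rewrite lt_min d0.
  rewrite lt_min => /andP[wd wr]; rewrite Fr// addrAC subrr add0r mulrC mulfK ?subr_eq0//.
  exact: hd.
move=> [l hl]; pose phi w := if w == z then l else (w - z)^-1 * (F w - F z).
exists phi; split; last first.
  exists 1 => // w _; rewrite /phi; case: eqVneq => [->|wz]; first by rewrite subrr mulr0 addr0.
  by rewrite mulrAC mulVf ?subr_eq0// mul1r addrC subrK.
move=> e e0; have [d d0 hd] := hl e e0; exists d => // w wd; rewrite /phi eqxx.
by case: eqVneq => [_|wz]; [rewrite subrr normc0 ltW|exact: hd].
Qed.

Lemma cdiff_derivable (F : C^o -> C^o) (z : C^o) : cdiff F z <-> derivable F z 1.
Proof.
split.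
  by move/cdiff_quotient => h; apply/(complex_derivable (@normc_abs R)).
by move/(complex_derivable (@normc_abs R)) => h; apply/cdiff_quotient.
Qed.

End scalar_bridge.

Section holder_bridge.
Variables (R : realType) (gamma : R).
Hypothesis gamma_gt0 : 0 < gamma.
Local Notation C := R[i].
Local Notation X := (I01 R).
Local Notation HC := (holder (complex_modulus R) gamma).
Local Notation Hld := (holder (real_modulus R) gamma).
Local Notation N := (@holder_norm R C (complex_modulus R) gamma).

Lemma holder_complex_normE (u : HC) : `|u| = (N u)%:C%C.
Proof. by []. Qed.

Lemma holder_cnb (u : HC) (r : R) : N u <= r -> cnb gamma r u.
Proof.
move=> ur; have s0 := holder_seminorm_ge0 u; have n0 := sup_norm_ge0 u.
split=> [x|x y].
  apply: le_trans ur; rewrite -complex_modulusE; apply: le_trans (sup_norm_ub u x) _.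
  by rewrite lerDl.
have [->|xy] := eqVneq x y.
  by rewrite subrr normc0 mulr_ge0 ?powR_ge0// (le_trans _ ur)// addr_ge0.
have xy' : 0 < `|pt x - pt y|.
  by rewrite normr_gt0 subr_eq0; apply: contra xy => /eqP/pt_inj ->.
have := holder_seminorm_ub u (p := (x, y)) xy.
rewrite ler_pdivrMr ?powR_gt0// complex_modulusE => /le_trans; apply.
by rewrite ler_wpM2r ?powR_ge0// (le_trans _ ur)// lerDr.
Qed.

Lemma holder_eval_cdiff (H : C^o -> HC) z x : derivable H z 1 ->
  cdiff (fun w => H w x) z.
Proof.
move=> /(complex_derivable holder_complex_normE)[l hl]; apply/cdiff_quotient.
exists (l x) => e /hl[d d0 hd]; exists d => // w wz wd.
exact: (holder_cnb (hd w wz wd)).1.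
Qed.

Lemma complexifyB (u v : Hld) : complexify u - complexify v = complexify (u - v).
Proof. by apply/val_inj/funext => x; rewrite /= -[RHS]/((u x - v x)%:C%C) rmorphB. Qed.

Lemma complexify_affine (u v : Hld) (t : R) :
  complexify u + t%:C%C *: complexify v = complexify (u + t *: v).
Proof.
by apply/val_inj/funext => x; rewrite /= -[RHS]/((u x + t * v x)%:C%C) rmorphD rmorphM.
Qed.

Lemma complexify_norm (u : Hld) : N (complexify u) = `|u|.
Proof.
have E (a : R) : complex_modulus R a%:C%C = `|a| by rewrite complex_modulusE normc_real.
rewrite [RHS]holder_normE /holder_norm /sup_norm /holder_seminorm; congr (sup _ + sup _).
  by apply: eq_imagel => x _; exact: E.
by apply: eq_imagel => p _; rewrite -rmorphB E.
Qed.

End holder_bridge.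

(** * Analyticity and its failure *)

Section locus.
Variables (R : realType) (alpha : R).
Hypothesis alpha_gt0 : 0 < alpha.
Variable gamma : R.
Hypothesis gamma_gt0 : 0 < gamma.
Hypothesis gamma_le1 : gamma <= 1.
Local Notation X := (I01 R).
Local Notation C := R[i].
Local Notation Hld := (holder (real_modulus R) gamma).
Local Notation HC := (holder (complex_modulus R) gamma).
Local Notation N := (@holder_norm R C (complex_modulus R) gamma).
Local Notation P := (real_pressure alpha gamma).
Local Notation zero := (I01_0 R).
Local Notation gap := (@gap_set R alpha gamma).
Local Notation frozen := (@frozen R alpha gamma).
Implicit Types (phi psi : Hld).

Lemma analytic_gap phi : gap phi -> real_analytic_at P phi.
Proof.
move=> g; have /(gap_set_srad alpha_gt0 gamma_gt0 gamma_le1) g' := g.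
have [r r0 [h [hP hH]]] :=
  local_pressure alpha_gt0 gamma_gt0 (holder_hol gamma_gt0 phi) (holder_sup_le phi) g'.
(* The extension computes ln of the spectral radius, which is known to be the pressure on [gap]
   only. *)
exists ([set psi | `|psi - phi| < r] `&` gap); split.
- apply: (openI _ (gap_set_open alpha_gt0 gamma_gt0)).
  apply/holder_open => psi /= hpsi; exists (r - `|psi - phi|); first by rewrite subr_gt0.
  move=> u; rewrite ltrBrDr; apply: le_lt_trans.
  by have := ler_normD (u - psi) (psi - phi); rewrite addrA subrK.
- by split => //=; rewrite subrr normr0.
exists [set u : HC | N (u - complexify phi) < r], (fun u => h (u : X -> C)); split.
- apply/(complex_open (@holder_complex_normE R gamma)) => u /= hu.
  exists (r - N (u - complexify phi)); first by rewrite subr_gt0.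
  move=> v; rewrite ltrBrDr; apply: le_lt_trans.
  by have := holder_normD (v - u) (u - complexify phi); rewrite addrA subrK.
- move=> D H /(complex_open (@normc_abs R)) oD HD dH z Dz.
  have [q q0 qD] := oD z Dz; apply/cdiff_derivable.
  apply: (hH (fun z x => H z x) z q) => // [w wq|w x wq].
    exact: (holder_cnb (ltW (HD w (qD w wq)))).
  by apply: holder_eval_cdiff; apply: dH; exact: qD.
move=> psi [/= hpsi gpsi]; have hc : N (complexify psi - complexify phi) < r.
  by rewrite complexifyB complexify_norm.
split => //; rewrite (gap_set_pressure alpha_gt0 gamma_gt0 gamma_le1 gpsi).
apply: (hP psi _ _ (holder_hol gamma_gt0 psi) (holder_sup_le psi)).
  exact/(gap_set_srad alpha_gt0 gamma_gt0 gamma_le1).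
exact: (holder_cnb (ltW hc)).
Qed.

Lemma analytic_frozen phi : frozen phi -> real_analytic_at P phi.
Proof.
move=> fr; exists frozen; split => //; first exact: open_interior.
exists setT, (fun u => u zero); split => //; first exact: openT.
  by move=> D H oD _ dH z Dz; apply/cdiff_derivable; apply: holder_eval_cdiff; exact: dH.
by move=> psi fpsi; split => //; rewrite gap_setC//; exact: interior_subset fpsi.
Qed.

Lemma affine_derivable (u v : HC) z : derivable (fun w : C^o => u + w *: v) z 1.
Proof.
apply/(complex_derivable (@holder_complex_normE R gamma)); exists v => e e0.
exists 1 => // w wz _; rewrite opprD addrACA subrr add0r -scalerBl scalerA mulVf ?subr_eq0//.
by rewrite scale1r subrr -[0 in leLHS](scale0r (0 : HC)) holder_normZ modulus0 mul0r ltW.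
Qed.

(* On the segment from a frozen potential to one in [gap_set], P - phi 0 vanishes
   up to a last time s and is positive at times arbitrarily close to s, which
   [cdiff_vanish] forbids if P is analytic at s. *)
Lemma not_analytic phi : ~ gap phi -> ~ frozen phi -> ~ real_analytic_at P phi.
Proof.
move=> ng nf [U [oU Uphi [W [h [oW hW hU]]]]].
have [e e0 eU] := (holder_open U).1 oU phi Uphi.
have [psi0 [fr0 b0]] : exists psi, frozen psi /\ `|psi - phi| < e.
  have := ng; rewrite -[~ _]/((~` gap) phi) -(closure_frozen alpha_gt0 gamma_gt0 gamma_le1).
  move=> /(_ [set psi | `|psi - phi| < e])[|psi [? ?]]; last by exists psi.
  by apply/nbhs_ballP; exists e => //= psi; rewrite -ball_normE /= distrC.
have [psi1 [g1 b1]] : exists psi, gap psi /\ `|psi - phi| < e.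
  apply: contrapT => hn; apply: nf; apply/holder_interior; exists e => // psi pe gp.
  by apply: hn; exists psi.
pose v := psi1 - psi0; pose line (t : R) := psi0 + t *: v.
have line_lip s t : `|line s - line t| <= `|s - t| * (`|v| + 1).
  have -> : line s - line t = (s - t) *: v by rewrite /line opprD addrACA subrr add0r scalerBl.
  by rewrite normrZ ler_wpM2l// lerDl.
have v0 : 0 < `|v| + 1 by rewrite ltr_wpDl.
have lineU t : 0 <= t -> t <= 1 -> U (line t).
  move=> t0 t1; apply: eU.
  have -> : line t - phi = (1 - t) *: (psi0 - phi) + t *: (psi1 - phi).
    apply/val_inj/funext => x /=; rewrite -[LHS]/(psi0 x + t * (psi1 x - psi0 x) - phi x : R).
    by rewrite -[RHS]/((1 - t) * (psi0 x - phi x) + t * (psi1 x - phi x) : R); ring.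
  rewrite (le_lt_trans (ler_normD _ _))// !normrZ !ger0_norm ?subr_ge0//.
  have [->|tn] := eqVneq t 1; first by rewrite subrr mul0r add0r mul1r.
  have t1' : t < 1 by rewrite lt_neqAle tn.
  have := ltr_pM2l (_ : 0 < 1 - t); have := ler_wpM2l t0 (ltW b1); rewrite subr_gt0 => h1 /(_ t1' `|psi0 - phi| e).
  rewrite b0 => h2.
  by have -> : e = (1 - t) * e + t * e; [ring|exact: ltr_leD].
pose H (z : C^o) := complexify psi0 + z *: complexify v.
pose D := [set z : C^o | W (H z)].
have HR (t : R) : H t%:C%C = complexify (line t) by exact: complexify_affine.
have oD : open D.
  apply/(complex_open (@normc_abs R)) => z Dz.
  have [r r0 rW] := (complex_open (@holder_complex_normE R gamma) W).1 oW _ Dz.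
  exists (r / (`|v| + 1)); first by rewrite divr_gt0.
  move=> w; rewrite ltr_pdivlMr// => wr; apply: rW.
  have -> : H w - H z = (w - z) *: complexify v by rewrite /H opprD addrACA subrr add0r scalerBl.
  rewrite holder_normZ complexify_norm complex_modulusE (le_lt_trans _ wr)//.
  by rewrite ler_wpM2l ?normc_ge0// lerDl.
have Fd z : D z -> cdiff (fun w => h (H w) - H w zero) z.
  move=> Dz; apply: cdiffB.
    by apply/cdiff_derivable; apply: (hW D H) => // w _; exact: affine_derivable.
  by apply: holder_eval_cdiff; exact: affine_derivable.
have FE t : 0 <= t -> t <= 1 -> h (H t%:C%C) - H t%:C%C zero = (P (line t) - line t zero)%:C%C.
  by move=> t0 t1; rewrite HR (hU _ (lineU t t0 t1)).2 rmorphB.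
have DR t : 0 <= t -> t <= 1 -> D t%:C%C.
  by move=> t0 t1; rewrite /D /= HR; exact: (hU _ (lineU t t0 t1)).1.
have line_open (A : set Hld) t : open A -> A (line t) ->
    exists2 d, 0 < d & forall s, `|s - t| < d -> A (line s).
  move=> /holder_open oA /oA[d d0 hd]; exists (d / (`|v| + 1)); first by rewrite divr_gt0.
  move=> s sd; apply: hd; rewrite (le_lt_trans (line_lip _ _))//.
  by rewrite -ltr_pdivlMr.
have line0 : line 0 = psi0 by rewrite /line scale0r addr0.
have line1 : line 1 = psi1 by rewrite /line scale1r /v addrC subrK.
have [d0 d00 hd0] : exists2 d, 0 < d & forall s, `|s - 0| < d -> frozen (line s).
  by apply: line_open; [exact: open_interior|rewrite line0].
have [s /andP[s_gt0 s_lt1] [below above]] : exists2 s : R, 0 < s < 1 &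
    (forall t, 0 <= t <= s -> ~ gap (line t)) /\
    (forall d, 0 < d -> exists t, [/\ s <= t < s + d, t <= 1 & gap (line t)]).
  apply: (last_exit (A := fun t => gap (line t)) d00) => [t /andP[t0 td]||t gt].
  - suff /interior_subset : frozen (line t) by [].
    by apply: hd0; rewrite subr0 ger0_norm.
  - by rewrite line1.
  - exact: line_open (gap_set_open alpha_gt0 gamma_gt0) gt.
have [q q0 qD] := (complex_open (@normc_abs R) D).1 oD _ (DR s (ltW s_gt0) (ltW s_lt1)).
(* The bound by s keeps s + x nonnegative for - r < x, hence on the segment; the bound by q keeps
   the disc in D. *)
pose r := Num.min q s; have r0 : 0 < r by rewrite lt_min q0.
have [||d dd0 hd] := @cdiff_vanish R (fun z => h (H (s%:C%C + z)) - H (s%:C%C + z) zero) r r0.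
- move=> z zr; apply: (@cdiff_comp _ (fun w => h (H w) - H w zero) (fun z => s%:C%C + z)).
    by apply: cdiffD; [exact: cdiff_cst|exact: cdiff_id].
  apply: Fd; apply: qD; rewrite addrAC subrr add0r (lt_le_trans zr)// ge_min lexx //.
- move=> x /andP[xr x0]; rewrite -rmorphD.
  have sx : 0 <= s + x.
    by rewrite -lerBlDl sub0r ltW// (le_lt_trans _ xr)// lerN2 ge_min lexx orbT.
  have sx1 : s + x <= s by rewrite gerDl.
  have ngap : ~ gap (line (s + x)) by apply: below; rewrite sx.
  by rewrite (FE _ sx (le_trans sx1 (ltW s_lt1))) (gap_setC alpha_gt0 gamma_gt0 ngap) subrr.
have [t [/andP[st td] t1 gt]] := above d dd0.
have := hd (t - s); rewrite subr_ge0 st ltrBlDl => /(_ td).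
have -> : s%:C%C + (t - s)%:C%C = t%:C%C :> C by rewrite -rmorphD addrC subrK.
rewrite (FE t (le_trans (ltW s_gt0) st) t1) => -[/eqP].
by rewrite subr_eq0 => /eqP h0; move: gt; rewrite /gap_set /= h0 ltxx.
Qed.

End locus.

Theorem theoremA (R : realType) (alpha : R) (halpha : 0 < alpha)
    (gamma : R) (hgamma : 0 < gamma <= 1) :
  boundary (intermittent_phase alpha gamma) =
    boundary (stationary_phase alpha gamma) /\
  phase_transition_locus alpha gamma =
    [set phi : holder (real_modulus R) gamma |
      ~ real_analytic_at (real_pressure alpha gamma) phi].
Proof.
have /andP[gamma_gt0 gamma_le1] := hgamma.
have bI := boundary_intermittent halpha gamma_gt0 gamma_le1.
split; first by rewrite bI boundary_stationary.
rewrite /phase_transition_locus bI; apply/seteqP; split => phi.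
  by move=> [ng nf]; exact: not_analytic.
move=> na; split.
  by move=> g; apply: na; exact: analytic_gap.
by move=> fr; apply: na; exact: analytic_frozen.
Qed.
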